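(* Let $\alpha\in(0,1)$. If $f\in BV^\alpha(\mathbb{R}^n)$, then $$D^\beta f\rightharpoonup D^\alpha f\quad\text{and}\quad|D^\beta f|\rightharpoonup|D^\alpha f|\quad\text{as }\beta\to\alpha^-.$$ Moreover, $$\lim_{\beta\to\alpha^-}|D^\beta f|(\mathbb{R}^n)=|D^\alpha f|(\mathbb{R}^n).$$
   Context: Here $n\in\mathbb{N}$, $n\ge1$. For $\alpha\in(0,1)$ let $\mu_{n,\alpha}:=2^\alpha\pi^{-n/2}\,\Gamma\big(\tfrac{n+\alpha+1}{2}\big)/\Gamma\big(\tfrac{1-\alpha}{2}\big)$, and for $\varphi\in C^\infty_c(\mathbb{R}^n;\mathbb{R}^n)$ let $$\mathrm{div}^\alpha\varphi(x):=\mu_{n,\alpha}\int_{\mathbb{R}^n}\frac{(y-x)\cdot(\varphi(y)-\varphi(x))}{|y-x|^{n+\alpha+1}}\,dy,\qquad x\in\mathbb{R}^n,$$ which belongs to $L^1(\mathbb{R}^n)\cap L^\infty(\mathbb{R}^n)$. $BV^\alpha(\mathbb{R}^n)$ is the space of $f\in L^1(\mathbb{R}^n)$ such that $$\sup\Big\{\int_{\mathbb{R}^n} f\,\mathrm{div}^\alpha\varphi\,dx:\ \varphi\in C^\infty_c(\mathbb{R}^n;\mathbb{R}^n),\ \|\varphi\|_{L^\infty}\le1\Big\}<+\infty;$$ equivalently, there is a (unique) finite $\mathbb{R}^n$-valued Radon measure $D^\alpha f$ on $\mathbb{R}^n$ with $\int f\,\mathrm{div}^\alpha\varphi\,dx=-\int\varphi\cdot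 dD^\alpha f$ for all $\varphi\in C^\infty_c(\mathbb{R}^n;\mathbb{R}^n)$. $|D^\alpha f|$ is its total variation measure, and $|D^\alpha f|(\mathbb{R}^n)$ equals the supremum above. If $f\in BV^\alpha(\mathbb{R}^n)$ then $f\in BV^\beta(\mathbb{R}^n)$ for every $\beta\in(0,\alpha)$. The symbol $\rightharpoonup$ denotes weak*-convergence of Radon measures, i.e. convergence of integrals against every continuous compactly supported (vector-valued, resp. scalar) test function. *)

(* Defs.v *)
From HB Require Import structures.
From mathcomp Require Import all_boot all_order all_algebra.
From mathcomp Require Import all_classical all_reals all_analysis.
From mathcomp Require Import measurable_realfun ring.

Set Implicit Arguments.
Unset Strict Implicit.
Unset Printing Implicit Defensive.

Import Order.TTheory GRing.Theory Num.Theory.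
Import numFieldNormedType.Exports.

Local Open Scope classical_set_scope.
Local Open Scope ring_scope.

Section borel_rV.
Variables (R : realType) (n : nat).

Definition borel_rV : set (set 'rV[R]_n) := <<s @open 'rV[R]_n >>.

Let borel_rV0 : borel_rV set0.
Proof. exact: sigma_algebra0. Qed.

Let borel_rVC A : borel_rV A -> borel_rV (~` A).
Proof. exact: sigma_algebraC. Qed.

Let borel_rV_bigcup (F : (set 'rV[R]_n)^nat) :
  (forall i, borel_rV (F i)) -> borel_rV (\bigcup_i F i).
Proof. exact: sigma_algebra_bigcup. Qed.

HB.instance Definition _ := @isMeasurable.Build default_measure_display
  'rV[R]_n borel_rV borel_rV0 borel_rVC borel_rV_bigcup.

End borel_rV.

Section measurable_rV.
Context {R : realType}.

Lemma open_measurable_rV n (U : set 'rV[R]_n) : open U -> measurable U.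
Proof. by move=> oU; exact: sub_sigma_algebra. Qed.

Lemma open_rV_bigcup n (U : set 'rV[R]_n) : open U ->
  U = \bigcup_(p in [set p : 'rV[rat]_n * nat |
        ball (map_mx ratr p.1 : 'rV[R]_n) (p.2.+1%:R^-1) `<=` U])
      ball (map_mx ratr p.1 : 'rV[R]_n) (p.2.+1%:R^-1).
Proof.
move=> oU; apply/seteqP; split => [x Ux|x [p pU /pU//]].
have /nbhs_ballP[e /= e0 xeU] : nbhs x U by exact: open_nbhs_nbhs.
have [k ke] : exists k : nat, k.+1%:R^-1 < e / 2.
  exists (Num.truncn (e / 2)^-1).
  rewrite invf_plt ?posrE ?divr_gt0//.
  by rewrite truncnS_gt.
have k0 : 0 < k.+1%:R^-1 :> R by rewrite invr_gt0.
have /choice[q qx] (i : 'I_n) : exists q : rat,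
    `|x 0 i - ratr q| < k.+1%:R^-1.
  have /rat_in_itvoo[q] : x 0 i - k.+1%:R^-1 < x 0 i + k.+1%:R^-1.
    by rewrite ltrBlDr -addrA ltrDl addr_gt0.
  rewrite in_itv/= => /andP[q1 q2]; exists q.
  by rewrite ltr_norml; apply/andP; split;
    [rewrite ltrBrDr addrC ltrBlDr // addrC|rewrite ltrBlDr -ltrBlDl].
have qball : ball (map_mx ratr (\row_i q i) : 'rV[R]_n) (k.+1%:R^-1) x.
  split => // i j; rewrite !mxE ord1 /ball/= distrC; exact: qx.
exists (\row_i q i, k) => //= y qy; apply: xeU.
apply: (@le_ball _ _ x (k.+1%:R^-1 + k.+1%:R^-1)).
  by rewrite [leRHS](splitr e) lerD// ltW.
by apply: ball_triangle qy; exact/ball_sym.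
Qed.

Lemma measurable_fun_rV d (T : measurableType d) n (f : T -> 'rV[R]_n) :
  (forall i, measurable_fun setT (fun t => f t 0 i)) -> measurable_fun setT f.
Proof.
move=> mf; apply: (@measurability _ _ _ _ _ _ (@open 'rV[R]_n)) => //.
move=> _ [U oU <-]; rewrite setTI (open_rV_bigcup oU) preimage_bigcup.
rewrite bigcup_mkcond; apply: countable_bigcupT_measurable => [|[q k]].
  exact: countableP.
case: ifPn => _ //=.
have -> : f @^-1` ball (map_mx ratr q : 'rV[R]_n) (k.+1%:R^-1) =
    \big[setI/setT]_(i < n) ((fun t => f t 0 i) @^-1`
       ball (ratr (q 0 i) : R) (k.+1%:R^-1)).
  rewrite -bigcap_seq; apply/seteqP; split => [t [_ tq] i _ /=|t tq /=].
    by have := tq 0 i; rewrite mxE.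
  split => [|i j]; first by rewrite invr_gt0.
  by rewrite ord1 mxE; apply: tq; rewrite /= mem_index_enum.
apply: bigsetI_measurable => i _; rewrite -[X in measurable X]setTI.
by apply: mf => //; exact: measurable_ball.
Qed.

End measurable_rV.

Section lebesgue_rV.
Context {R : realType}.

Definition rV_cons n (p : R * 'rV[R]_n) : 'rV[R]_n.+1 :=
  \row_i if unlift ord0 i is Some j then p.2 0 j else p.1.

Lemma rV_consE0 n (p : R * 'rV[R]_n) : rV_cons p 0 ord0 = p.1.
Proof. by rewrite mxE unlift_none. Qed.

Lemma rV_consES n (p : R * 'rV[R]_n) i : rV_cons p 0 (lift ord0 i) = p.2 0 i.
Proof. by rewrite mxE liftK. Qed.

Lemma measurable_coord_rV n (i : 'I_n) :
  measurable_fun setT (fun x : 'rV[R]_n => x 0 i).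
Proof.
have cx : continuous (fun x : 'rV[R]_n => x 0 i) by exact: coord_continuous.
apply: (measurability _ (RGenOpens.measurableE R)).
move=> _ [_ [a [b ->] <-]]; rewrite setTI; apply: open_measurable_rV.
by apply: open_comp => // x _; exact: cx.
Qed.

Lemma measurable_rV_cons n : measurable_fun setT (@rV_cons n).
Proof.
apply: measurable_fun_rV => i.
have [->|[j ->]] : i = ord0 \/ exists j, i = lift ord0 j.
  by case: (unliftP ord0 i) => [j ->|->]; [right; exists j|left].
  by under eq_fun do rewrite rV_consE0; exact: measurable_fst.
under eq_fun do rewrite rV_consES.
exact: measurableT_comp (measurable_coord_rV j) measurable_snd.
Qed.

Section lebesgue_rVS.
Variables (n : nat) (m : {sigma_finite_measure set 'rV[R]_n -> \bar R}).

Let mS : set 'rV[R]_n.+1 -> \bar R :=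
  pushforward (lebesgue_measure \x m)%E (@rV_cons n).

Let pm : {measure set 'rV[R]_n.+1 -> \bar R} :=
  measure_function_pushforward__canonical__measure_function_Measure
    (lebesgue_measure \x m)%E (@measurable_rV_cons n).

Let mS0 : mS set0 = 0%E. Proof. exact: (measure0 pm). Qed.

Let mS_ge0 A : (0 <= mS A)%E. Proof. exact: (measure_ge0 pm). Qed.

Let mS_sigma_additive : semi_sigma_additive mS.
Proof. exact: (@measure_semi_sigma_additive _ _ _ pm). Qed.

HB.instance Definition _ := isMeasure.Build _ _ _ mS
  mS0 mS_ge0 mS_sigma_additive.

Let mS_sigma_finite : sigma_finite setT mS.
Proof.
have /sigma_finiteP[F [FT ndF Foo]] := sigma_finiteT (@lebesgue_measure R).
have /sigma_finiteP[G [GT ndG Goo]] := sigma_finiteT m.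
pose tail (x : 'rV[R]_n.+1) : 'rV[R]_n := \row_i x 0 (lift ord0 i).
have mtail : measurable_fun setT tail.
  apply: measurable_fun_rV => i; under eq_fun do rewrite mxE.
  exact: measurable_coord_rV.
have mhead : measurable_fun setT (fun x : 'rV[R]_n.+1 => x 0 ord0).
  exact: measurable_coord_rV.
exists (fun k => (fun x : 'rV[R]_n.+1 => x 0 ord0) @^-1` F k
                 `&` tail @^-1` G k).
  apply/seteqP; split => // x _.
  have [i _ Fi] : (\bigcup_i F i) (x 0 ord0) by rewrite -FT.
  have [j _ Gj] : (\bigcup_i G i) (tail x) by rewrite -GT.
  exists (maxn i j) => //; split.
    by move/subsetPset : (ndF _ _ (leq_maxl i j)); exact.
  by move/subsetPset : (ndG _ _ (leq_maxr i j)); exact.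
move=> k; have [mF Fk] := Foo k; have [mG Gk] := Goo k; split.
  by apply: measurableI; rewrite -[X in measurable X]setTI;
    [exact: mhead|exact: mtail].
rewrite /mS /pushforward.
rewrite (_ : _ @^-1` _ = F k `*` G k).
  by rewrite product_measure1E// lte_mul_pinfty// ge0_fin_numE.
apply/seteqP; split => -[x y] /=; rewrite rV_consE0/=;
  (have -> : tail (rV_cons (x, y)) = y by
    apply/rowP => i; rewrite mxE rV_consES); by [].
Qed.

HB.instance Definition _ := Measure_isSigmaFinite.Build _ _ _ mS
  mS_sigma_finite.

Definition lebesgue_rVS : {sigma_finite_measure set 'rV[R]_n.+1 -> \bar R} :=
  mS.

End lebesgue_rVS.

(* The n-fold product of the Lebesgue measure on R, as a Borel measure. *)
Fixpoint lebesgue_rV n : {sigma_finite_measure set 'rV[R]_n -> \bar R} :=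
  match n with
  | 0 => \d_(0 : 'rV[R]_0)
  | m.+1 => lebesgue_rVS (lebesgue_rV m)
  end.

Lemma lebesgue_rV_box n (A : 'I_n -> set R) : (forall i, measurable (A i)) ->
  lebesgue_rV n [set x : 'rV[R]_n | forall i, A i (x 0 i)] =
  (\prod_(i < n) lebesgue_measure (A i))%E.
Proof.
elim: n A => [|n ih] A mA.
  rewrite big_ord0.
  have -> : [set x : 'rV[R]_0 | forall i : 'I_0, A i (x 0 i)] = setT.
    by apply/seteqP; split => // x _ [].
  by rewrite /= diracT.
pose B (i : 'I_n) : set R := A (lift ord0 i).
have mB : measurable [set x : 'rV[R]_n | forall i, B i (x 0 i)].
  have -> : [set x : 'rV[R]_n | forall i, B i (x 0 i)] =
      \big[setI/setT]_(i < n) ((fun x : 'rV[R]_n => x 0 i) @^-1` B i).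
    rewrite -bigcap_seq; apply/seteqP; split => [x xA i _|x xA i].
      exact: xA.
    by apply: xA; rewrite /= mem_index_enum.
  apply: bigsetI_measurable => i _; rewrite -[X in measurable X]setTI.
  by apply: measurable_coord_rV => //; exact: mA.
rewrite big_ord_recl /= /pushforward.
rewrite (_ : _ @^-1` _ = A ord0 `*` [set x : 'rV[R]_n | forall i, B i (x 0 i)]).
  have mA0 := mA ord0; rewrite product_measure1E//.
  by congr (_ * _)%E; apply: ih => i; exact: mA.
apply/seteqP; split => [[x y] /= xyA|[x y] /= [xA yA] i].
  split; first by have := xyA ord0; rewrite rV_consE0.
  by move=> i; have := xyA (lift ord0 i); rewrite rV_consES.
case: (unliftP ord0 i) => [j ->|->]; last by rewrite rV_consE0.
by rewrite rV_consES; exact: yA.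
Qed.

End lebesgue_rV.


Section euclidean.
Context {R : realType} {n : nat}.
Implicit Types x y : 'rV[R]_n.

Definition dotrv x y : R := \sum_i x 0 i * y 0 i.

(* The library's norm on 'rV[R]_n is the sup norm. *)
Definition enorm x : R := Num.sqrt (dotrv x x).

Lemma dotrv_ge0 x : 0 <= dotrv x x.
Proof. by apply: sumr_ge0 => i _; rewrite -expr2 sqr_ge0. Qed.

Lemma enorm_ge0 x : 0 <= enorm x. Proof. exact: sqrtr_ge0. Qed.

Lemma enorm0 : enorm 0 = 0.
Proof.
by rewrite /enorm /dotrv big1 ?sqrtr0// => i _; rewrite mxE mul0r.
Qed.

Lemma dotrv_le x y : dotrv x y <= enorm x * enorm y.
Proof.
rewrite -sqrtrM ?dotrv_ge0//; apply: (le_trans (ler_norm _)).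
rewrite -sqrtr_sqr ler_wsqrtr// -subr_ge0.
have -> : dotrv x x * dotrv y y - dotrv x y ^+ 2 =
    2^-1 * \sum_i \sum_j (x 0 i * y 0 j - x 0 j * y 0 i) ^+ 2.
  have -> : \sum_i \sum_j (x 0 i * y 0 j - x 0 j * y 0 i) ^+ 2 =
      \sum_i \sum_j ((x 0 i * x 0 i) * (y 0 j * y 0 j))
      + \sum_i \sum_j ((y 0 i * y 0 i) * (x 0 j * x 0 j))
      - 2 * \sum_i \sum_j ((x 0 i * y 0 i) * (x 0 j * y 0 j)).
    rewrite mulr_sumr -big_split -sumrB; apply: eq_bigr => i _ /=.
    rewrite mulr_sumr -big_split -sumrB; apply: eq_bigr => j _ /=.
    by ring.
  rewrite -!big_distrlr/= -/(dotrv x x) -/(dotrv y y) -/(dotrv x y).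
  by field.
by rewrite mulr_ge0 ?invr_ge0//; apply: sumr_ge0 => i _; apply: sumr_ge0 => j _;
  rewrite sqr_ge0.
Qed.

Lemma enormD x y : enorm (x + y) <= enorm x + enorm y.
Proof.
rewrite -(@ler_pXn2r _ 2)// ?nnegrE ?addr_ge0 ?enorm_ge0//.
rewrite sqr_sqrtr ?dotrv_ge0// sqrrD !sqr_sqrtr ?dotrv_ge0//.
have -> : dotrv (x + y) (x + y) = dotrv x x + dotrv x y *+ 2 + dotrv y y.
  rewrite /dotrv -sumrMnl -!big_split/=; apply: eq_bigr => i _.
  by rewrite !mxE; ring.
by rewrite lerD2r lerD2l ler_pMn2r// dotrv_le.
Qed.

End euclidean.

Section vector_charge.
Context d (T : measurableType d) {R : realType} {n : nat}.

(* A finite R^n-valued measure, given by its components. On R^n with its Borel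
   sets every such measure is Radon. *)
Definition vcharge := 'I_n -> {charge set T -> \bar R}.

Implicit Types (nu : vcharge) (A : set T).

Definition vcharge_val nu A : 'rV[R]_n := \row_i fine (nu i A).

(* On measurable A this is the supremum over countable measurable partitions
   of A, the remainder A `\` \bigcup_k F k being one more piece. *)
Definition vtotal_variation nu A : \bar R :=
  ereal_sup [set (\sum_(k <oo) (enorm (vcharge_val nu (F k)))%:E)%E | F in
    [set F : (set T)^nat | [/\ forall k, measurable (F k),
       trivIset setT F & \bigcup_k F k `<=` A]]].

Variable nu : vcharge.
Local Notation tv := (vtotal_variation nu).

Lemma vcharge_val0 : vcharge_val nu set0 = 0.
Proof. by apply/rowP => i; rewrite !mxE charge0. Qed.

Let nnu A := (enorm (vcharge_val nu A))%:E.

Let nnu_ge0 A : (0 <= nnu A)%E. Proof. by rewrite lee_fin enorm_ge0. Qed.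

Let tv_ub (F : (set T)^nat) A : (forall k, measurable (F k)) ->
  trivIset setT F -> \bigcup_k F k `<=` A ->
  (\sum_(k <oo) nnu (F k) <= tv A)%E.
Proof. by move=> mF tF FA; apply: ereal_sup_ubound; exists F. Qed.

Lemma vtotal_variation_ge0 A : (0 <= tv A)%E.
Proof.
apply: (@le_trans _ _ (\sum_(k <oo) nnu ((fun=> set0) k))%E).
  by apply: nneseries_ge0 => k _ _; exact: nnu_ge0.
by apply: tv_ub => //; [exact: trivIset_set0|rewrite bigcup0].
Qed.

Let le_tv A B : A `<=` B -> (tv A <= tv B)%E.
Proof.
move=> AB; apply: le_ereal_sup => _ [F [mF tF FA] <-]; exists F => //.
by split => //; exact: subset_trans FA AB.
Qed.

Let tv0 : tv set0 = 0%E.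
Proof.
apply/eqP; rewrite eq_le vtotal_variation_ge0 andbT.
apply: ge_ereal_sup => _ [F [mF tF F0] <-].
rewrite eseries0// => k _ _.
have -> : F k = set0 by apply/seteqP; split => // x Fx; apply: F0; exists k.
by rewrite vcharge_val0 enorm0.
Qed.

Let nnu_sigma_subadditive (F : (set T)^nat) : (forall k, measurable (F k)) ->
  trivIset setT F -> (nnu (\bigcup_k F k) <= \sum_(k <oo) nnu (F k))%E.
Proof.
move=> mF tF; set S := (\sum_(k <oo) _)%E.
have S0 : (0 <= S)%E by apply: nneseries_ge0 => k _ _; exact: nnu_ge0.
have [Soo|Sfin] := eqVneq S +oo%E; first by rewrite Soo leey.
have Sfn : S \is a fin_num by rewrite ge0_fin_numE// lt_neqAle Sfin leey.
rewrite -(fineK Sfn) lee_fin.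
pose v (k : nat) : 'rV[R]_n := \sum_(j < k) vcharge_val nu (F j).
have vS k : enorm (v k) <= fine S.
  rewrite -lee_fin fineK//; apply: le_trans (nneseries_lim_ge k _) => //.
  rewrite big_mkord /nnu sumEFin lee_fin /v.
  apply: (big_ind2 (fun (x : 'rV[R]_n) (y : R) => enorm x <= y)) => //.
    by rewrite enorm0.
  by move=> x1 y1 x2 y2 h1 h2; apply: le_trans (enormD _ _) _; exact: lerD.
have mUF : measurable (\bigcup_k F k) by exact: bigcupT_measurable.
have vi i : (v k) 0 i @[k --> \oo] --> vcharge_val nu (\bigcup_k F k) 0 i.
  have := @charge_semi_sigma_additive _ _ _ (nu i) F mF tF mUF.
  rewrite -[X in _ --> X -> _]fineK ?fin_num_measure// => /fine_cvgP[_].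
  rewrite mxE; apply: cvg_trans; apply: near_eq_cvg; near=> k.
  rewrite /= /v summxE big_mkord -sum_fine => [|j _].
    by apply: eq_bigr => j _; rewrite mxE.
  by rewrite fin_num_measure.
have cvgsum (r : seq 'I_n) : \sum_(i <- r) (v k 0 i * v k 0 i) @[k --> \oo] -->
    \sum_(i <- r) (vcharge_val nu (\bigcup_k F k) 0 i
                   * vcharge_val nu (\bigcup_k F k) 0 i).
  elim: r => [|i r ih].
    by rewrite big_nil; under eq_fun do rewrite big_nil; exact: cvg_cst.
  rewrite big_cons; under eq_fun do rewrite big_cons.
  by apply: cvgD => //; apply: cvgM; exact: vi.
have cv : enorm (v k) @[k --> \oo] --> enorm (vcharge_val nu (\bigcup_k F k)).
  apply: (@cvg_comp _ _ _ (fun k => dotrv (v k) (v k)) Num.sqrt); last first.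
    exact: sqrt_continuous.
  exact: cvgsum.
rewrite -(cvg_lim _ cv)//; apply: limr_le; first by apply/cvg_ex; eexists; exact: cv.
by apply: nearW => k; exact: vS.
Unshelve. all: by end_near. Qed.

Let tvD A B : A `&` B = set0 -> (tv A + tv B <= tv (A `|` B))%E.
Proof.
move=> AB0.
have tvAUB (F G : (set T)^nat) : (forall k, measurable (F k)) ->
    trivIset setT F -> \bigcup_k F k `<=` A -> (forall k, measurable (G k)) ->
    trivIset setT G -> \bigcup_k G k `<=` B ->
    (\sum_(k <oo) nnu (F k) + \sum_(k <oo) nnu (G k) <= tv (A `|` B))%E.
  move=> mF tF FA mG tG GB.
  pose H k := if odd k then G k./2 else F k./2.
  have HAB : (\sum_(k <oo) nnu (H k) <= tv (A `|` B))%E.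
    apply: tv_ub.
    - by move=> k; rewrite /H; case: ifP.
    - apply/trivIsetP => i j _ _ ij; rewrite /H.
      have FG0 k l : F k `&` G l = set0.
        apply/seteqP; split => // t [Ft Gt].
        by rewrite -AB0; split; [apply: FA; exists k|apply: GB; exists l].
      have h2 : odd i = odd j -> i./2 != j./2.
        move=> oij; apply: contra ij => /eqP ij2; apply/eqP.
        by rewrite -(odd_double_half i) -(odd_double_half j) oij ij2.
      case: ifPn => oi; case: ifPn => oj.
      + by move/trivIsetP : tG; apply => //; apply: h2; rewrite oi oj.
      + by rewrite setIC FG0.
      + by rewrite FG0.
      + move/trivIsetP : tF; apply => //; apply: h2.
        by rewrite (negbTE oi) (negbTE oj).
    - move=> t [k _]; rewrite /H; case: ifP => _ tk.
        by right; apply: GB; exists k./2.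
      by left; apply: FA; exists k./2.
  apply: le_trans HAB.
  rewrite -nneseriesD => [|k _ _|k _ _]; [|exact: nnu_ge0..].
  apply: lime_le; first by apply: is_cvg_nneseries => k _ _; exact: adde_ge0.
  apply: nearW => m; apply: le_trans (nneseries_lim_ge m.*2 _) => //.
  rewrite le_eqVlt; apply/orP; left; apply/eqP.
  elim: m => [|m ih]; first by rewrite !big_nil.
  rewrite big_nat_recr//= ih doubleS !big_nat_recr//= -addeA; congr (_ + _)%E.
  by rewrite /H /= odd_double/= uphalf_double doubleK.
have [ABoo|ABoo] := eqVneq (tv (A `|` B)) +oo%E; first by rewrite ABoo leey.
have fin_le x : (0 <= x)%E -> (x <= tv (A `|` B))%E -> x \is a fin_num.
  move=> x0 xAB; rewrite ge0_fin_numE//; apply: le_lt_trans xAB _.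
  by rewrite lt_neqAle ABoo leey.
have fB : tv B \is a fin_num.
  by apply: fin_le; [exact: vtotal_variation_ge0|exact/le_tv/subsetUr].
rewrite -leeBrDr//; apply: ge_ereal_sup => _ [F [mF tF FA] <-].
have sF0 : (0 <= \sum_(k <oo) nnu (F k))%E.
  by apply: nneseries_ge0 => k _ _; exact: nnu_ge0.
have fF : (\sum_(k <oo) nnu (F k))%E \is a fin_num.
  by apply: fin_le => //; apply: tv_ub => //; exact: subset_trans FA (@subsetUl _ _ _).
rewrite leeBrDr// -leeBrDl//; apply: ge_ereal_sup => _ [G [mG tG GB] <-].
by rewrite leeBrDl//; exact: tvAUB.
Qed.

Let tv_sigma_additive : semi_sigma_additive tv.
Proof.
move=> F mF tF mUF.
suff <- : (\sum_(k <oo) tv (F k))%E = tv (\bigcup_k F k).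
  by apply: is_cvg_nneseries => k _ _; exact: vtotal_variation_ge0.
apply/eqP; rewrite eq_le; apply/andP; split.
  apply: lime_le.
    by apply: is_cvg_nneseries => k _ _; exact: vtotal_variation_ge0.
  apply: nearW => m.
  apply: (@le_trans _ _ (tv (\big[setU/set0]_(i < m) F i))); last first.
    by apply: le_tv; exact: bigsetU_bigcup.
  elim: m => [|m ih]; first by rewrite big_nil vtotal_variation_ge0.
  rewrite big_nat_recr//= big_ord_recr/=.
  apply: le_trans (tvD _); first by rewrite leeD2r.
  apply: (@trivIset_bigsetUI _ predT) => //.
  exact: sub_trivIset tF.
apply: ge_ereal_sup => _ [G [mG tG GF] <-].
apply: (@le_trans _ _ (\sum_(k <oo) \sum_(j <oo) nnu (G k `&` F j))%E).
  apply: lee_nneseries => [k _ _|k _]; first exact: nnu_ge0.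
  rewrite -/(nnu (G k)).
  have {1}-> : G k = \bigcup_j (G k `&` F j).
    rewrite -setI_bigcupr; apply/esym/setIidPl => t Gt; apply: GF; by exists k.
  apply: nnu_sigma_subadditive => [j|]; first exact: measurableI.
  by apply: trivIset_setIl.
rewrite nneseries_interchange//; apply: lee_nneseries => [j _ _|j _].
  by apply: nneseries_ge0 => k _ _; exact: nnu_ge0.
apply: tv_ub => [k||]; first exact: measurableI.
  by apply: trivIset_setIr.
by move=> t [k _ []].
Qed.

HB.instance Definition _ := isMeasure.Build _ _ _ tv
  tv0 vtotal_variation_ge0 tv_sigma_additive.

End vector_charge.
Arguments vcharge {d} T R n.

Section charge_integral.
Context d (T : measurableType d) {R : realType}.

Let hahn (nu : {charge set T -> \bar R}) :
  {PN : set T * set T | hahn_decomposition nu PN.1 PN.2}.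
Proof. by apply: cid; have [P [N h]] := Hahn_decomposition nu; exists (P, N). Qed.

(* The value does not depend on the Hahn decomposition that is picked. *)
Definition charge_integral (nu : {charge set T -> \bar R}) (g : T -> R) : R :=
  \int[jordan_pos (svalP (hahn nu))]_x g x
  - \int[jordan_neg (svalP (hahn nu))]_x g x.

Definition vcharge_integral n (nu : vcharge T R n) (phi : T -> 'rV[R]_n) : R :=
  \sum_i charge_integral (nu i) (fun x => phi x 0 i).

End charge_integral.

Section test_functions.
Context {R : realType} {n : nat}.

Definition compactly_supported (W : zmodType) (g : 'rV[R]_n -> W) :=
  compact (closure [set x | g x <> 0]).

Definition iter_partial (W : normedModType R) (s : seq 'I_n)
    (g : 'rV[R]_n -> W) : 'rV[R]_n -> W :=
  foldr (fun i h x => 'D_(delta_mx 0 i) h x) g s.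

(* C^oo: the partial derivatives of all orders exist and are continuous. *)
Definition smooth (W : normedModType R) (g : 'rV[R]_n -> W) :=
  forall s : seq 'I_n, continuous (iter_partial s g) /\
    forall i x, derivable (iter_partial s g) x (delta_mx 0 i).

Definition Cc_infty (W : normedModType R) : set ('rV[R]_n -> W) :=
  [set g | smooth g /\ compactly_supported g].

Definition Cc (W : normedModType R) : set ('rV[R]_n -> W) :=
  [set g | continuous g /\ compactly_supported g].

End test_functions.

Section fractional_variation.
Context {R : realType} {n : nat}.
Local Notation Rn := 'rV[R]_n.
Local Notation leb := (@lebesgue_rV R n).

Definition Gamma (s : R) : R :=
  \int[lebesgue_measure]_(t in `]0, +oo[) (t `^ (s - 1) * expR (- t)).

Definition frac_mu (alpha : R) : R :=
  2 `^ alpha * pi `^ (- (n%:R / 2)) *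
  Gamma ((n%:R + alpha + 1) / 2) / Gamma ((1 - alpha) / 2).

(* The integrand is 0 at y = x, where the numerator is 0. *)
Definition frac_div (alpha : R) (phi : Rn -> Rn) (x : Rn) : R :=
  frac_mu alpha * \int[leb]_y
    (dotrv (y - x) (phi y - phi x) / enorm (y - x) `^ (n%:R + alpha + 1)).

Definition frac_variation (alpha : R) (f : Rn -> R) : \bar R :=
  ereal_sup [set (\int[leb]_x (f x * frac_div alpha phi x))%:E | phi in
    [set phi : Rn -> Rn | Cc_infty phi /\
      (Lnorm leb +oo (fun x => (enorm (phi x))%:E) <= 1)%E]].

(* Elements of L^1 are given by Borel representatives. *)
Definition BV (alpha : R) : set (Rn -> R) :=
  [set f : Rn -> R | leb.-integrable setT (EFin \o f) /\
           (frac_variation alpha f < +oo)%E].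

Definition represents_frac_grad (alpha : R) (f : Rn -> R) (nu : vcharge Rn R n) :=
  forall phi : Rn -> Rn, Cc_infty phi ->
    \int[leb]_x (f x * frac_div alpha phi x) = - vcharge_integral nu phi.

(* D^alpha f. A representing measure exists when BV alpha f holds with
   0 < alpha < 1, and it is then unique on Borel sets; otherwise the value is a
   representing measure if there is one, and 0 if there is none. *)
Definition frac_grad (alpha : R) (f : Rn -> R) : vcharge Rn R n :=
  if pselect (exists nu, represents_frac_grad alpha f nu) is left h
  then sval (cid h) else fun=> czero.

End fractional_variation.

Section weak_star.
Context {R : realType} {n : nat} {I : Type}.

Definition weak_star_cvg (F : set_system I)
    (mu : I -> {measure set 'rV[R]_n -> \bar R})
    (mu0 : {measure set 'rV[R]_n -> \bar R}) :=
  forall psi : 'rV[R]_n -> R, Cc psi ->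
    \int[mu i]_x psi x @[i --> F] --> \int[mu0]_x psi x.

Definition vweak_star_cvg (F : set_system I)
    (nu : I -> vcharge 'rV[R]_n R n) (nu0 : vcharge 'rV[R]_n R n) :=
  forall phi : 'rV[R]_n -> 'rV[R]_n, Cc phi ->
    vcharge_integral (nu i) phi @[i --> F] --> vcharge_integral nu0 phi.

End weak_star.

(* Main.v *)
(* The fractional divergence is an average of heat regularizations: with p_t the
   heat kernel, div^a phi is K_a times the integral over t > 0 of
   t^(-(a+1)/2) W_t phi, where W_t phi(x) = \int p_t(h) h . phi(x + h) / t dh.
   The semigroup property p_s * W_t = W_(t+s) and a Beta integral express
   div^b phi, for b < a, as an average over s of p_s * div^a phi. Testing with f,
   the small s contribute at most the a-variation of f, and the large s
   contribute O(a - b) times the L^1 norm of f. Hence |D^b f|(R^n) is at most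
   |D^a f|(R^n) + o(1) as b -> a-. The representing measures exist by the Riesz
   theorem, proved by Daniell's method. Dominated convergence gives the
   convergence of the pairings with smooth phi; with the bound on the masses it
   gives weak* convergence, lower semicontinuity of the mass, and so the
   convergence of the masses. Splitting the mass along h and 1 - h then yields
   the weak* convergence of the total variations. *)
From HB Require Import structures.
Require Import Defs.
From mathcomp Require Import all_boot all_order all_algebra.
From mathcomp Require Import all_classical all_reals all_analysis.
From mathcomp Require Import measurable_realfun ess_sup_inf ring lra.
Set Implicit Arguments.
Unset Strict Implicit.
Unset Printing Implicit Defensive.
Import Order.TTheory GRing.Theory Num.Theory.
Import numFieldNormedType.Exports.
Local Open Scope classical_set_scope.
Local Open Scope ring_scope.

(** * Integration on the line and on R^n, Gaussians *)

(** Testing against fixed fields only bounds the limit masses from below, so everything rests on an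
    upper bound for |D^b f|(R^n) whose leading constant tends to 1; an embedding estimate with any
    other constant would give weak limits but not the limit of the masses. The Beta average yields
    such a bound. With g = (a - b) / 2 the weight s^(g-1) has mass of order 1 / (a - b) near s = 0,
    whereas at infinity the decay s^(-a/2) of p_s * div^a phi leaves a contribution O(1). After
    normalization the average therefore concentrates at small s. There p_s has mass one, and
    convolution with it amounts to testing with translates of phi, which are admissible for the
    a-variation: the small s cost at most that variation. The constants enter only through K_b /
    K_a, which tends to 1 because Gamma-type integrals depend continuously on their exponent. Orders
    are taken along sequences, because the limits rest on dominated convergence. *)

Section real_integrals.
Context {R : realType}.

(** The change of variables behind both the affine maps of the line and the coordinates [rV_cons]:
    [nu] is a multiple of a push-forward of [mu]. *)
Lemma integral_mp d1 d2 (X : measurableType d1) (Y : measurableType d2)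
    (mu : {measure set X -> \bar R}) (nu : {measure set Y -> \bar R}) (c : {nonneg R})
    (phi : X -> Y) : measurable_fun setT phi ->
  (forall A, measurable A -> nu A = (c%:num%:E * mu (phi @^-1` A))%E) ->
  forall g : Y -> \bar R, measurable_fun setT g -> (forall y, 0 <= g y)%E ->
  (\int[nu]_y g y = c%:num%:E * \int[mu]_x g (phi x))%E.
Proof.
move=> mphi H g mg g0.
pose pm : {measure set Y -> \bar R} :=
  measure_function_pushforward__canonical__measure_function_Measure mu mphi.
rewrite (@eq_measure_integral _ _ _ _ (mscale c pm)); last first.
  by move=> A mA _; rewrite H.
rewrite ge0_integral_mscale//; congr (_ * _)%E.
by rewrite /pm /= ge0_integral_pushforward// preimage_setT.
Qed.

(** [Rintegral] is [fine] of an extended integral, so the identity survives divergent parts: in the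
    final cases with an infinite part both sides are 0. *)
Lemma Rintegral_ge0_transfer d1 d2 (X : measurableType d1) (Y : measurableType d2)
    (mu : {measure set X -> \bar R}) (nu : {measure set Y -> \bar R}) (c : R)
    (phi : X -> Y) : 0 <= c ->
  (forall g : Y -> \bar R, measurable_fun setT g -> (forall y, 0 <= g y)%E ->
     (\int[nu]_y g y = c%:E * \int[mu]_x g (phi x))%E) ->
  forall g : Y -> R, measurable_fun setT g ->
  \int[nu]_y g y = c * \int[mu]_x g (phi x).
Proof.
move=> c0 H g mg; rewrite /Rintegral [in LHS]integralE [in RHS]integralE.
have mg' : measurable_fun setT (EFin \o g) by exact/measurable_EFinP.
rewrite (H ((EFin \o g)^\+)%E)//; last exact: measurable_funepos.
rewrite (H ((EFin \o g)^\-)%E)//; last exact: measurable_funeneg.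
have -> : (\int[mu]_x ((EFin \o g)^\+)%E (phi x) = \int[mu]_x (fun x => (g (phi x))%:E)^\+ x)%E.
  by apply: eq_integral => x _; rewrite (funepos_comp (EFin \o g) phi).
have -> : (\int[mu]_x ((EFin \o g)^\-)%E (phi x) = \int[mu]_x (fun x => (g (phi x))%:E)^\- x)%E.
  by apply: eq_integral => x _; rewrite (funeneg_comp (EFin \o g) phi).
set a := (\int[mu]_x (fun x => (g (phi x))%:E)^\+ x)%E.
set b := (\int[mu]_x (fun x => (g (phi x))%:E)^\- x)%E.
have a0 : (0 <= a)%E by apply: integral_ge0 => x _; exact: funepos_ge0.
have b0 : (0 <= b)%E by apply: integral_ge0 => x _; exact: funeneg_ge0.
move: a0 b0; case: (ltgtP c 0) c0 => // [c0 _|-> _ _ _]; last by rewrite !mul0e mul0r subee.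
case: a => [a||]//; case: b => [b||]//= a0 b0.
- by rewrite mulrBr.
- by rewrite gt0_muley ?lte_fin//= mulr0.
- by rewrite gt0_muley ?lte_fin//= mulr0.
- by rewrite gt0_muley ?lte_fin//= mulr0.
Qed.

(** By Tonelli the integrals of the positive and the negative part are measurable in the parameter;
    so is their extended-real difference, and so is its [fine]. *)
Lemma measurable_Rintegral d1 d2 (X : measurableType d1) (Y : measurableType d2)
    (m2 : {sigma_finite_measure set Y -> \bar R}) (f : X * Y -> R) :
  measurable_fun setT f -> measurable_fun setT (fun x => \int[m2]_y f (x, y)).
Proof.
move=> mf; rewrite /Rintegral.
under eq_fun do rewrite integralE.
have mf' : measurable_fun setT (EFin \o f) by exact/measurable_EFinP.
apply: (@measurableT_comp _ _ _ _ _ _ (fine)) => //.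
apply: emeasurable_funB.
  under eq_fun do under eq_integral do rewrite (funepos_comp (EFin \o f)).
  by apply: (@measurable_fun_fubini_tonelli_F _ _ _ _ _ m2 ((EFin \o f)^\+)%E) => //; exact: measurable_funepos.
under eq_fun do under eq_integral do rewrite (funeneg_comp (EFin \o f)).
by apply: (@measurable_fun_fubini_tonelli_F _ _ _ _ _ m2 ((EFin \o f)^\-)%E) => //; exact: measurable_funeneg.
Qed.

(** An integrable function is finite almost everywhere. This links the extended-real Fubini theorem
    to iterated [Rintegral]s, whose inner integral is a [fine]. *)
Lemma integral_fine d (X : measurableType d) (mu : {measure set X -> \bar R}) (g : X -> \bar R) :
  mu.-integrable setT g -> (\int[mu]_x (fine (g x))%:E = \int[mu]_x g x)%E.
Proof.
move=> ig; have mg := measurable_int _ ig.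
apply: ae_eq_integral => //.
  by apply/measurable_EFinP; exact: measurableT_comp.
have := integrable_ae measurableT ig; apply: filterS => x /(_ I) gx _.
by rewrite fineK.
Qed.

Lemma Rintegral_fubini d1 d2 (X : measurableType d1) (Y : measurableType d2)
    (m1 : {sigma_finite_measure set X -> \bar R}) (m2 : {sigma_finite_measure set Y -> \bar R})
    (f : X * Y -> R) :
  measurable_fun setT f ->
  (\int[m1]_x \int[m2]_y `|f (x, y)|%:E < +oo)%E ->
  \int[m1]_x \int[m2]_y f (x, y) = \int[m2]_y \int[m1]_x f (x, y).
Proof.
move=> mf foo.
have mf' : measurable_fun setT (EFin \o f) by exact/measurable_EFinP.
have If : (m1 \x m2)%E.-integrable setT (EFin \o f) by apply/integrable12ltyP.
rewrite /Rintegral; congr fine.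
have /= -> := integral_fine (integrable_fubini_F If).
have mG := measurable_fubini_G If.
have iG : m2.-integrable setT (fubini_G m1 (EFin \o f)).
  apply/integrableP; split => //.
  have /(integrable21ltyP m1 m2 mf') := If; apply: le_lt_trans.
  have mabs : measurable_fun setT (abse \o (EFin \o f)) by exact: measurableT_comp.
  apply: ge0_le_integral => //.
  - by apply: measurableT_comp.
  - exact: (@measurable_fun_fubini_tonelli_G _ _ _ _ _ m1 (abse \o (EFin \o f)) mabs (fun=> abse_ge0 _)).
  - move=> y _; apply: le_abse_integral => //.
    exact: (measurableT_comp mf' (measurable_pair2 y)).
have /= -> := integral_fine iG.
by rewrite (integral12_prod_meas1 If) -(integral21_prod_meas1 If).
Qed.

End real_integrals.

Section lebesgue_affine.
Context {R : realType}.
Local Notation mu := (@lebesgue_measure R).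

(** Lebesgue measure is determined by its values on half-open intervals, and there the scaled
    push-forward has the right length. *)
Lemma lebesgue_affine (c d : R) (A : set R) : c != 0 -> measurable A ->
  mu A = (`|c|%:E * mu ((fun x => c * x + d)%R @^-1` A))%E.
Proof.
move=> c0 mA.
have mphi : measurable_fun [set: R] (fun x : R => c * x + d).
  by apply: measurable_funD => //; exact: measurable_funM.
pose T := measurableTypeR R; pose phi : T -> T := fun x => c * x + d.
have mphi' : measurable_fun [set: T] phi := mphi.
pose pm : {measure set T -> \bar R} :=
  measure_function_pushforward__canonical__measure_function_Measure mu mphi'.
pose nc : {nonneg R} := NngNum (normr_ge0 c).
pose sm : {measure set T -> \bar R} := mscale nc pm.
rewrite (lebesgue_measure_unique (mu := sm))//.
move=> X /ocitvP[->|[[a b]/= ab ->]]; first by rewrite !measure0.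
rewrite lebesgue_measure_itv/= lte_fin ab.
rewrite /sm /= /mscale/= /pushforward/= /phi.
case: (ltgtP c 0) c0 => // [cn|cp] _.
  (* A negative slope exchanges the open and the closed end, which leaves the length unchanged. *)
  have -> : (fun x => c * x + d) @^-1` `]a, b] = `[(b - d) / c, (a - d) / c[%classic.
    apply/seteqP; split => x /=; rewrite !in_itv/= ler_ndivrMr// ltr_ndivlMr// ltrBlDr lerBrDr ![_ * c]mulrC => /andP[-> ->]//.
  rewrite lebesgue_measure_itv/= lte_fin ltr_ndivrMr// divfK ?lt_eqF// ltrD2r ab ltr0_norm// -!EFinD -EFinM.
  by congr EFin; field; rewrite lt_eqF.
have -> : (fun x => c * x + d) @^-1` `]a, b] = `](a - d) / c, (b - d) / c]%classic.
  apply/seteqP; split => x /=; rewrite !in_itv/= ltr_pdivrMr// ler_pdivlMr// ltrBlDr lerBrDr ![_ * c]mulrC => /andP[-> ->]//.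
rewrite lebesgue_measure_itv/= lte_fin ltr_pdivrMr// divfK ?gt_eqF// ltrD2r ab gtr0_norm// -!EFinD -EFinM.
by congr EFin; field; rewrite gt_eqF.
Qed.

Lemma ge0_integral_affine (c d : R) (g : R -> \bar R) : c != 0 ->
  measurable_fun setT g -> (forall y, 0 <= g y)%E ->
  (\int[mu]_y g y = `|c|%:E * \int[mu]_x g (c * x + d)%R)%E.
Proof.
move=> c0 mg g0.
have mphi : measurable_fun [set: R] (fun x : R => c * x + d).
  by apply: measurable_funD => //; exact: measurable_funM.
pose T := measurableTypeR R; pose phi : T -> T := fun x => c * x + d.
have mphi' : measurable_fun [set: T] phi := mphi.
apply: (@integral_mp _ _ _ T T mu mu (NngNum (normr_ge0 c)) phi) => //.
by move=> A mA; exact: lebesgue_affine.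
Qed.

End lebesgue_affine.

Section lebesgue_rV_integral.
Context {R : realType}.
Local Notation mu := (@lebesgue_measure R).

Lemma ge0_integral_rVS n (g : 'rV[R]_n.+1 -> \bar R) :
  measurable_fun setT g -> (forall y, 0 <= g y)%E ->
  (\int[lebesgue_rV n.+1]_y g y = \int[mu]_a \int[lebesgue_rV n]_v g (rV_cons (a, v)))%E.
Proof.
move=> mg g0.
rewrite (@integral_mp _ _ _ _ _ (mu \x lebesgue_rV n)%E (lebesgue_rV n.+1) (NngNum ler01) (@rV_cons R n))//.
- rewrite mul1e fubini_tonelli1//.
  exact: (measurableT_comp mg (@measurable_rV_cons R n)).
- exact: measurable_rV_cons.
- by move=> A mA; rewrite mul1e.
Qed.

Lemma measurable_rVD n (h : 'rV[R]_n) : measurable_fun setT (fun x : 'rV[R]_n => x + h).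
Proof.
apply: measurable_fun_rV => i; under eq_fun do rewrite mxE.
by apply: measurable_funD => //; exact: measurable_coord_rV.
Qed.

Lemma measurable_rVN n : measurable_fun setT (fun x : 'rV[R]_n => - x).
Proof.
apply: measurable_fun_rV => i; under eq_fun do rewrite mxE.
by apply: measurableT_comp => //; exact: measurable_coord_rV.
Qed.

(** With |c| = 1 no power of a Jacobian appears, so a single induction on the dimension covers
    translations and the reflection. *)
Lemma ge0_integral_rV_affine n (c : R) (h : 'rV[R]_n) (g : 'rV[R]_n -> \bar R) : `|c| = 1 ->
  measurable_fun setT g -> (forall y, 0 <= g y)%E ->
  (\int[lebesgue_rV n]_x g (c *: x + h)%R = \int[lebesgue_rV n]_x g x)%E.
Proof.
move=> c1; have c0 : c != 0 by rewrite -normr_gt0 c1.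
elim: n h g => [|n ih] h g mg g0.
  by apply: eq_integral => x _; congr g; apply/rowP => -[].
have ma : measurable_fun setT (fun x : 'rV[R]_n.+1 => c *: x + h).
  apply: measurable_fun_rV => i; under eq_fun do rewrite !mxE.
  by apply: measurable_funD => //; apply: measurable_funM => //; exact: measurable_coord_rV.
rewrite (ge0_integral_rVS (g := fun x => g (c *: x + h)) (measurableT_comp mg ma) (fun=> g0 _)).
rewrite (ge0_integral_rVS mg g0).
have mG : measurable_fun setT (fun z : R * 'rV[R]_n => g (rV_cons z)).
  exact: (measurableT_comp mg (@measurable_rV_cons R n)).
rewrite [RHS](@ge0_integral_affine _ c (h 0 ord0))//; first last.
- by move=> y; exact: integral_ge0.
- exact: (measurable_fun_fubini_tonelli_F (fun z : R * 'rV[R]_n => g (rV_cons z))).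
rewrite c1 mul1e; apply: eq_integral => a _.
rewrite -(ih (\row_j h 0 (lift ord0 j)) (fun v => g (rV_cons (c * a + h 0 ord0, v))))//; last first.
  exact: (measurableT_comp mG (measurable_pair1 (c * a + h 0 ord0))).
apply: eq_integral => v _; congr g; apply/rowP => i; rewrite !mxE.
by case: (unliftP ord0 i) => [j ->|->]; rewrite ?liftK ?unlift_none/= ?mxE.
Qed.

Lemma ge0_integral_rV_shift n (h : 'rV[R]_n) (g : 'rV[R]_n -> \bar R) :
  measurable_fun setT g -> (forall y, 0 <= g y)%E ->
  (\int[lebesgue_rV n]_x g (x + h)%R = \int[lebesgue_rV n]_x g x)%E.
Proof.
move=> mg g0; rewrite -(ge0_integral_rV_affine h (normr1 R) mg g0).
by apply: eq_integral => x _; rewrite scale1r.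
Qed.

Lemma Rintegral_rV_shift n (h : 'rV[R]_n) (g : 'rV[R]_n -> R) :
  measurable_fun setT g ->
  \int[lebesgue_rV n]_x g (x + h) = \int[lebesgue_rV n]_x g x.
Proof.
move=> mg.
rewrite (@Rintegral_ge0_transfer _ _ _ _ _ (lebesgue_rV n) (lebesgue_rV n) 1 (fun x => x + h) _ _ g)// ?mul1r//.
by move=> k mk k0; rewrite mul1e ge0_integral_rV_shift.
Qed.

Lemma Rintegral_rV_opp n (g : 'rV[R]_n -> R) :
  measurable_fun setT g ->
  \int[lebesgue_rV n]_x g (- x) = \int[lebesgue_rV n]_x g x.
Proof.
move=> mg.
rewrite (@Rintegral_ge0_transfer _ _ _ _ _ (lebesgue_rV n) (lebesgue_rV n) 1 (fun x => - x) _ _ g)// ?mul1r//.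
move=> k mk k0; rewrite mul1e.
have N1 : `|-1 : R| = 1 by rewrite normrN1.
rewrite -(ge0_integral_rV_affine 0 N1 mk k0).
by apply: eq_integral => x _; rewrite scaleN1r addr0.
Qed.

(** The time scale is exp(-|h|^2 / t) instead of exp(-|h|^2 / (4t)): times still add under
    convolution, and the mass is the power of sqrt(pi t) below. *)
Definition gauss n (t : R) (h : 'rV[R]_n) : R := expR (- (dotrv h h / t)).

Lemma integral_gauss1 (t : R) : 0 < t ->
  (\int[mu]_x (expR (- (x * x / t)))%:E = (Num.sqrt (pi * t))%:E)%E.
Proof.
move=> t0; have st : 0 < Num.sqrt t by rewrite sqrtr_gt0.
rewrite (@ge0_integral_affine _ (Num.sqrt t) 0) ?gt_eqF//; first last.
- apply/measurable_EFinP; apply: measurableT_comp => //; apply: measurableT_comp => //.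
  by apply: measurable_funM => //; exact: measurable_funM.
rewrite gtr0_norm// sqrtrM ?pi_ge0// [in RHS]mulrC EFinM -integralT_gauss; congr (_ * _)%E.
apply: eq_integral => x _; rewrite /gauss_fun; do 3 congr (_ _).
have tt : Num.sqrt t * Num.sqrt t = t by rewrite -expr2 sqr_sqrtr// ltW.
by rewrite addr0 mulrACA tt mulrC mulKf ?gt_eqF.
Qed.

Lemma dotrv_cons n (a : R) (v : 'rV[R]_n) :
  dotrv (rV_cons (a, v)) (rV_cons (a, v)) = a * a + dotrv v v.
Proof.
rewrite /dotrv big_ord_recl rV_consE0/=; congr (_ + _).
by apply: eq_bigr => i _; rewrite rV_consES.
Qed.

Lemma measurable_dotrv d (T : measurableType d) n (f g : T -> 'rV[R]_n) :
  measurable_fun setT f -> measurable_fun setT g ->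
  measurable_fun setT (fun x => dotrv (f x) (g x)).
Proof.
move=> mf mg; apply: measurable_sum => i; apply: measurable_funM.
  exact: (measurableT_comp (measurable_coord_rV i) mf).
exact: (measurableT_comp (measurable_coord_rV i) mg).
Qed.

Lemma measurable_gauss n t : measurable_fun setT (@gauss n t).
Proof.
apply: measurableT_comp => //; apply: measurableT_comp => //.
by apply: measurable_funM => //; exact: measurable_dotrv.
Qed.

(** The Gaussian factors over the coordinates, so Tonelli reduces the claim to the line; in
    dimension 0 the measure is a Dirac mass. *)
Lemma integral_gauss n (t : R) : 0 < t ->
  (\int[lebesgue_rV n]_x (gauss t x)%:E = (Num.sqrt (pi * t) ^+ n)%:E)%E.
Proof.
move=> t0; elim: n => [|n ih].
  rewrite integral_dirac//; last by apply/measurable_EFinP; exact: measurable_gauss.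
  rewrite diracT mul1e.
  by rewrite /gauss /dotrv big_ord0 mul0r oppr0 expR0.
rewrite ge0_integral_rVS; first last.
- by move=> y; rewrite lee_fin expR_ge0.
- by apply/measurable_EFinP; exact: measurable_gauss.
rewrite exprS EFinM -integral_gauss1//.
rewrite -ge0_integralZr//; first last.
- apply/measurable_EFinP; apply: measurableT_comp => //; apply: measurableT_comp => //.
  by apply: measurable_funM => //; exact: measurable_funM.
apply: eq_integral => a _; rewrite -ih -ge0_integralZl//; first last.
- by move=> x _; rewrite lee_fin expR_ge0.
- by apply/measurable_EFinP; exact: measurable_gauss.
apply: eq_integral => v _; rewrite /gauss dotrv_cons mulrDl opprD expRD.
by rewrite EFinM.
Qed.

End lebesgue_rV_integral.

(** * Power weights *)

Lemma Rintegral_dominated {R : realType} d (T : measurableType d)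
    (mu : {measure set T -> \bar R}) (f_ : nat -> T -> R) (f g : T -> R) :
  (forall k, measurable_fun setT (f_ k)) -> measurable_fun setT f ->
  (forall x, f_ k x @[k --> \oo] --> f x) ->
  mu.-integrable setT (EFin \o g) -> (forall k x, `|f_ k x| <= g x) ->
  \int[mu]_x f_ k x @[k --> \oo] --> \int[mu]_x f x.
Proof.
move=> mf_ mf cf ig fg.
have [] := @dominated_convergence _ _ _ mu setT measurableT (fun k => EFin \o f_ k) (EFin \o f) (EFin \o g).
- by move=> k; exact/measurable_EFinP.
- exact/measurable_EFinP.
- by apply: nearW => x _; apply: cvg_EFin; [exact: nearW|exact: cf].
- exact: ig.
- by apply: nearW => x k _; rewrite lee_fin.
move=> i_f _; rewrite -[X in _ --> X -> _]fineK; last exact: integrable_fin_num.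
by move/fine_cvgP => [].
Qed.

Lemma integrable_le {R : realType} d (T : measurableType d)
    (mu : {measure set T -> \bar R}) (f g : T -> R) : measurable_fun setT f ->
  (\int[mu]_x (g x)%:E < +oo)%E -> measurable_fun setT g -> (forall x, `|f x| <= g x) ->
  mu.-integrable setT (EFin \o f).
Proof.
move=> mf goo mg fg; apply/integrableP; split; first exact/measurable_EFinP.
apply: le_lt_trans goo; apply: ge0_le_integral => //.
- by apply/measurable_EFinP; exact: measurableT_comp.
- exact/measurable_EFinP.
- by move=> x _ /=; rewrite lee_fin.
Qed.

Section power_integrals.
Context {R : realType}.
Local Notation mu := (@lebesgue_measure R).

(** Extending the power by 0 turns integrals over the positive half-line into integrals over R,
    where affine substitutions and convolutions are available. *)
Definition pw (p t : R) : R := if 0 < t then t `^ p else 0.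

Lemma pw_ge0 p t : 0 <= pw p t.
Proof. by rewrite /pw; case: ifP => // _; exact: powR_ge0. Qed.

Lemma pw_pos p t : 0 < t -> pw p t = t `^ p.
Proof. by rewrite /pw => ->. Qed.

Lemma pw_neg p t : t <= 0 -> pw p t = 0.
Proof. by rewrite /pw ltNge => ->. Qed.

Lemma measurable_pw p : measurable_fun setT (pw p).
Proof.
by rewrite /pw; apply: measurable_fun_ifT => //=; exact: measurable_fun_ltr.
Qed.

Lemma pwM p q t : pw p t * pw q t = pw (p + q) t.
Proof.
rewrite /pw; case: ifP => t0; last by rewrite mul0r.
by rewrite powRD//; apply/implyP => _; rewrite gt_eqF.
Qed.

Lemma pw_mulr p s t : 0 < s -> pw p (s * t) = pw p s * pw p t.
Proof.
move=> s0; rewrite /pw s0 pmulr_rgt0//; case: ifP => t0; last by rewrite mulr0.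
by rewrite powRM// ltW.
Qed.

Lemma ge0_le_pw p q t : p <= q -> 1 <= t -> pw p t <= pw q t.
Proof. by move=> pq t1; rewrite !pw_pos ?(lt_le_trans ltr01)// ler_powR. Qed.

Lemma le1_le_pw p q t : p <= q -> t <= 1 -> pw q t <= pw p t.
Proof.
move=> pq t1; have [t0|t0] := leP t 0; first by rewrite !pw_neg.
rewrite !pw_pos// /powR gt_eqF// ler_expR.
by apply: ler_wnM2r => //; exact: ln_le0.
Qed.

Lemma integral_powR_itv (a b p : R) : 0 < a -> a < b -> p + 1 != 0 ->
  (\int[mu]_(t in `[a, b]) (t `^ p)%:E = ((b `^ (p + 1) - a `^ (p + 1)) / (p + 1))%:E)%E.
Proof.
move=> a0 ab p0.
pose F (t : R) : R := (p + 1)^-1 * t `^ (p + 1).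
have dF (t : R) : 0 < t -> is_derive t 1 F (t `^ p).
  move=> t0; have := is_derive1_powR (p + 1) t0; rewrite addrK => d.
  have -> : t `^ p = (p + 1)^-1 *: ((p + 1) * t `^ p) by rewrite /GRing.scale/= mulrA mulVf// mul1r.
  exact: is_deriveZ.
have cF (t : R) : 0 < t -> {for t, continuous F}.
  by move=> t0; apply/differentiable_continuous/derivable1_diffP; have [] := dF _ t0.
rewrite (@continuous_FTC2 _ _ F)//.
- by rewrite -EFinB /F mulrBl ![(p + 1)^-1 * _]mulrC.
- apply: derivable_within_continuous => t; rewrite in_itv/= => /andP[at_ _].
  by have [] := is_derive1_powR p (lt_le_trans a0 at_).
- split.
  + move=> t; rewrite in_itv/= => /andP[at_ _].
    by have [] := dF _ (lt_trans a0 at_).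
  + by apply: cvg_at_right_filter; exact: cF.
  + by apply: cvg_at_left_filter; apply: cF; exact: lt_trans a0 ab.
- move=> t; rewrite in_itv/= => /andP[at_ _].
  by rewrite derive1E; have [_ ->] := dF _ (lt_trans a0 at_).
Qed.

Lemma integral_powR01_le (p : R) : -1 < p ->
  (\int[mu]_(t in `]0%R, 1%R]) (t `^ p)%:E <= ((p + 1)^-1)%:E)%E.
Proof.
move=> p1; have p0 : 0 < p + 1 by rewrite -ltrBlDr sub0r.
(* The shift by 2 keeps the left end strictly below 1, as the closed formula on [[a, b]] asks for
   [a < b]. *)
pose F (i : nat) : set R := `[i.+2%:R^-1, 1]%classic.
have -> : `]0, 1]%classic = \bigcup_i F i.
  apply/seteqP; split => t /=; last first.
    move=> [i _]; rewrite /F/= !in_itv/= => /andP[h ->]; rewrite andbT.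
    by apply: lt_le_trans h; rewrite invr_gt0.
  rewrite in_itv/= => /andP[t0 t1]; exists (Num.truncn t^-1) => //.
  rewrite /F/= in_itv/= t1 andbT invf_ple ?posrE//.
  apply: le_trans (ltW (truncnS_gt _)) _.
  by rewrite ler_nat.
have := @ge0_nondecreasing_set_cvg_integral _ (measurableTypeR R) _ F (fun t => (t `^ p)%:E) mu.
move=> /(_ _ _ _ _)/cvg_lim <-//; last 4 first.
- move=> i j ij; apply/subsetPset => t; rewrite /F/= !in_itv/= => /andP[h ->]; rewrite andbT.
  by apply: le_trans h; rewrite lef_pV2 ?posrE// ler_nat.
- by move=> i; exact: measurable_itv.
- by move=> i; apply/measurable_EFinP; apply: measurable_funTS; exact: (@measurable_powR R p).
- by move=> i t _; rewrite lee_fin powR_ge0.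
apply: lime_le.
  by apply: ereal_nondecreasing_is_cvgn => i j ij; apply: ge0_subset_integral => //;
   [exact: measurable_itv|exact: measurable_itv
   |by apply/measurable_EFinP; apply: measurable_funTS; exact: measurable_powR
   |by move=> t _; rewrite lee_fin powR_ge0
   |move=> t; rewrite /F/= !in_itv/= => /andP[h ->]; rewrite andbT; apply: le_trans h; rewrite lef_pV2 ?posrE// ler_nat].
apply: nearW => i; rewrite /F integral_powR_itv ?invr_gt0 ?gt_eqF//; last first.
  by rewrite invf_lt1// ltr1n.
rewrite lee_fin powR1 -[leRHS]mul1r ler_pM2r ?invr_gt0// lerBlDr lerDl powR_ge0//.
Qed.

Lemma integral_powR01_ge (p : R) : -1 < p ->
  (((p + 1) *+ 2)^-1%:E <= \int[mu]_(t in `]0%R, 1%R]) (t `^ p)%:E)%E.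
Proof.
move=> p1; have p0 : 0 < p + 1 by rewrite -ltrBlDr sub0r.
(* Chosen so that x^(p+1) = 1/2: the part of the integral over [x, 1] is then half of 1 / (p +
   1). *)
pose x : R := 2^-1 `^ (p + 1)^-1.
have x0 : 0 < x by exact: powR_gt0.
have x1 : x < 1.
  rewrite /x /powR gt_eqF// -[ltRHS]expR0 ltr_expR.
  rewrite pmulr_rlt0 ?invr_gt0// ln_lt0//.
  by rewrite invr_gt0 ltr0n/= invf_lt1// ltr1n.
apply: (@le_trans _ _ (\int[mu]_(t in `[x, 1%R]) (t `^ p)%:E)%E).
  rewrite integral_powR_itv// ?gt_eqF// lee_fin powR1 -powRrM mulVf ?gt_eqF// powRr1//.
  by rewrite le_eqVlt; apply/orP; left; apply/eqP; rewrite -mulr_natl; field; rewrite gt_eqF.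
apply: ge0_subset_integral => //.
- by apply/measurable_EFinP; apply: measurable_funTS; exact: (@measurable_powR R p).
- by move=> t _; rewrite lee_fin powR_ge0.
- move=> t /=; rewrite !in_itv/= => /andP[h ->]; rewrite andbT.
  exact: lt_le_trans h.
Qed.

Lemma integral_powR1y_le (p : R) : p < -1 ->
  (\int[mu]_(t in `[1%R, +oo[) (t `^ p)%:E <= (- (p + 1)^-1)%:E)%E.
Proof.
move=> p1; have p0 : p + 1 < 0 by rewrite -ltrBrDr sub0r.
pose F (i : nat) : set R := `[1, i.+2%:R]%classic.
have -> : `[1, +oo[%classic = \bigcup_i F i.
  apply/seteqP; split => t /=; last first.
    by move=> [i _]; rewrite /F/= !in_itv/= => /andP[->].
  rewrite in_itv/= => /andP[t1 _]; exists (Num.truncn t) => //.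
  rewrite /F/= in_itv/= t1/=.
  by apply: le_trans (ltW (truncnS_gt _)) _; rewrite ler_nat.
have sF i j : (i <= j)%N -> F i `<=` F j.
  by move=> ij t; rewrite /F/= !in_itv/= => /andP[->/= h]; apply: le_trans h _; rewrite ler_nat.
have mp (D : set R) : measurable_fun D (fun t => (t `^ p)%:E).
  by apply/measurable_EFinP; apply: measurable_funTS; exact: (@measurable_powR R p).
have := @ge0_nondecreasing_set_cvg_integral _ (measurableTypeR R) _ F (fun t => (t `^ p)%:E) mu.
move=> /(_ _ _ _ _)/cvg_lim <-//; last 4 first.
- by move=> i j ij; apply/subsetPset; exact: sF.
- by move=> i; exact: measurable_itv.
- by move=> i; exact: mp.
- by move=> i t _; rewrite lee_fin powR_ge0.
apply: lime_le.
  apply: ereal_nondecreasing_is_cvgn => i j ij; apply: ge0_subset_integral => //.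
  - exact: measurable_itv.
  - exact: measurable_itv.
  - exact: mp.
  - by move=> t _; rewrite lee_fin powR_ge0.
  - exact: sF.
apply: nearW => i; rewrite /F integral_powR_itv ?lt_eqF// ?ltr1n//.
rewrite lee_fin powR1 -[leRHS]mul1r mulrN -mulNr ler_nM2r ?invr_lt0// -opprB lerN2 lerBlDr lerDl powR_ge0//.
Qed.

(** The common majorant of the time integrals: it is integrable when the exponent at 0 exceeds -1
    and the one at infinity is below -1. *)
Definition pw2 (p q t : R) : R := if t <= 1 then pw p t else pw q t.

Lemma pw2_ge0 p q t : 0 <= pw2 p q t.
Proof. by rewrite /pw2; case: ifP => _; exact: pw_ge0. Qed.

Lemma measurable_pw2 p q : measurable_fun setT (pw2 p q).
Proof.
apply: measurable_fun_ifT => //; [|exact: measurable_pw|exact: measurable_pw].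
exact: measurable_fun_ler.
Qed.

Lemma integral_pw2_le (p q : R) : -1 < p -> q < -1 ->
  (\int[mu]_t (pw2 p q t)%:E <= ((p + 1)^-1 - (q + 1)^-1)%:E)%E.
Proof.
move=> p1 q1; rewrite EFinB.
have mp2 (D : set R) : measurable_fun D (fun t => (pw2 p q t)%:E).
  by apply/measurable_EFinP; apply: measurable_funTS; exact: measurable_pw2.
rewrite -(setUv (`]-oo, 1]%classic : set R)) ge0_integral_setU//; last 4 first.
- exact: (@measurableC _ (measurableTypeR R)).
- by rewrite setUv; exact: mp2.
- by move=> t _; rewrite lee_fin pw2_ge0.
- exact/disj_setPCl.
apply: leeD.
  apply: le_trans (integral_powR01_le p1).
  rewrite integral_mkcond [leRHS]integral_mkcond.
  apply: ge0_le_integral => //.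
  - by move=> t _; rewrite patchE; case: ifP => // _; rewrite lee_fin pw2_ge0.
  - by apply: (measurable_restrictT _ _).1 => //; exact: mp2.
  - apply: (measurable_restrictT _ _).1 => //.
    by apply/measurable_EFinP; apply: measurable_funTS; exact: (@measurable_powR R p).
  move=> t _; rewrite !patchE !mem_setE !in_itv/=.
  case: ifP => [t1|_]; last by case: ifP => // _; rewrite lee_fin powR_ge0.
  by rewrite /pw2 t1 /pw andbT; case: ifP.
apply: le_trans (integral_powR1y_le q1).
rewrite integral_mkcond [leRHS]integral_mkcond.
apply: ge0_le_integral => //.
- by move=> t _; rewrite patchE; case: ifP => // _; rewrite lee_fin pw2_ge0.
- by apply: (measurable_restrictT _ _).1; [exact: (@measurableC _ (measurableTypeR R))|exact: mp2].
- apply: (measurable_restrictT _ _).1 => //.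
  by apply/measurable_EFinP; apply: measurable_funTS; exact: (@measurable_powR R q).
move=> t _; rewrite !patchE in_setC !mem_setE !in_itv/= andbT -ltNge.
case: ifP => [t1|_]; last by case: ifP => // _; rewrite lee_fin powR_ge0.
by rewrite (ltW t1) /pw2 (leNgt t 1) t1/= /pw (lt_trans ltr01 t1).
Qed.

Lemma integral_pw2_lty (p q : R) : -1 < p -> q < -1 -> (\int[mu]_t (pw2 p q t)%:E < +oo)%E.
Proof. by move=> p1 q1; apply: le_lt_trans (integral_pw2_le p1 q1) _; rewrite ltry. Qed.

Lemma integrable_pw2 (p q : R) : -1 < p -> q < -1 -> mu.-integrable setT (EFin \o pw2 p q).
Proof.
move=> p1 q1; apply: (@integrable_le R _ (measurableTypeR R) mu _ (pw2 p q)).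
- exact: measurable_pw2.
- exact: integral_pw2_lty.
- exact: measurable_pw2.
- by move=> x; rewrite ger0_norm// pw2_ge0.
Qed.

(** A single term of the exponential series bounds [expR y] from below. *)
Lemma pow_expR_bound (m : nat) (y : R) : 0 <= y -> y ^+ m * expR (- y) <= m`!%:R.
Proof.
move=> y0; rewrite expRN ler_pdivrMr ?expR_gt0//.
case: m => [|m]; first by rewrite expr0 fact0 mul1r -expR0 ler_expR.
have m0 : 0 < m.+1`!%:R :> R by rewrite ltr0n fact_gt0.
rewrite mulrC -ler_pdivrMr//.
by apply: le_trans (expR_ge1Dxn m y0); rewrite lerDr.
Qed.

(** For y <= 1 both factors are at most 1, which accounts for the summand 1; for y > 1 the exponent
    is rounded up to an integer. *)
Lemma powR_expR_bound (k y : R) : 0 <= k -> 0 < y ->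
  y `^ k * expR (- y) <= 1 + (Num.truncn k).+1`!%:R.
Proof.
move=> k0 y0; have [y1|y1] := leP y 1.
  rewrite -[leLHS]addr0 lerD// -[leRHS]mulr1 ler_pM ?powR_ge0 ?expR_ge0//.
    by have := le1_le_pw k0 y1; rewrite !pw_pos// powRr0.
  by rewrite -[leRHS]expR0 ler_expR oppr_le0 ltW.
rewrite -[leLHS]add0r lerD//; apply: le_trans (pow_expR_bound _ (ltW y0)).
rewrite ler_wpM2r ?expR_ge0//.
rewrite -powR_mulrn ?(ltW y0)// ler_powR ?(ltW y1)// ltW//.
exact: truncnS_gt.
Qed.

(* [Gamma (p + 1)] for [w t = expR (- t)]; the weight [expR (- t^-1)] serves
   the subordination of the powers of [|h|] to Gaussians. *)
Definition wint (w : R -> R) (p : R) : R := \int[mu]_t (pw p t * w t).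

Definition egam (t : R) : R := expR (- t).
Definition einv (t : R) : R := expR (- t^-1).

Lemma measurable_egam : measurable_fun setT egam.
Proof. by apply: measurableT_comp => //; exact: measurable_oppr. Qed.

Lemma measurable_invr : measurable_fun setT (fun x : R => x^-1).
Proof.
(* Inversion is not continuous at 0; as a real power of the nonnegative number [x * x] it inherits
   the measurability of [powR]. *)
have -> : (fun x : R => x^-1) = (fun x => x * (x * x) `^ (-1)).
  apply/funext => x; rewrite powR_inv1 -?expr2 ?sqr_ge0//.
  by have [->|x0] := eqVneq x 0; [rewrite invr0 mul0r|rewrite expr2 invfM mulVKf].
apply: measurable_funM => //.
apply: (@measurableT_comp _ _ _ _ _ _ (@powR R ^~ (-1))); first exact: measurable_powR.
exact: measurable_funM.
Qed.

Lemma measurable_einv : measurable_fun setT einv.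
Proof.
by apply: measurableT_comp => //; apply: measurableT_comp => //; exact: measurable_invr.
Qed.

Lemma egam_dom (p : R) : exists C, 0 <= C /\ forall t, pw p t * egam t <= C * pw2 p (-2) t.
Proof.
(* At infinity the exponential absorbs t^(p+2), which leaves t^(-2); the maximum with 0 keeps the
   exponent in the range of [powR_expR_bound]. *)
pose k := Num.max 0 (p + 2).
exists (1 + (1 + (Num.truncn k).+1`!%:R)); split => [|t].
  by rewrite !addr_ge0.
have [t0|t0] := leP t 0; first by rewrite pw_neg// mul0r mulr_ge0 ?pw2_ge0 ?addr_ge0.
rewrite /pw2; have [t1|t1] := leP t 1.
  rewrite [leRHS]mulrC ler_pM ?pw_ge0 ?expR_ge0// -[leLHS]addr0 lerD//.
  by rewrite -[leRHS]expR0 ler_expR oppr_le0 ltW.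
have k0 : 0 <= k by rewrite le_max lexx.
have := powR_expR_bound k0 t0; rewrite -/(egam t) => h.
have -> : pw p t = pw (p + 2) t * pw (-2) t by rewrite pwM addrK.
rewrite mulrAC ler_wpM2r ?pw_ge0//; apply: le_trans (le_trans h _); last by rewrite lerDr.
by rewrite ler_wpM2r ?expR_ge0// pw_pos// ler_powR ?(ltW t1)// le_max lexx orbT.
Qed.

(** The mirror image of [egam_dom] under t -> 1/t: exp(-1/t) absorbs negative powers at 0 and is at
    most 1 at infinity. *)
Lemma einv_dom (p : R) : exists C, 0 <= C /\ forall t, pw p t * einv t <= C * pw2 0 p t.
Proof.
pose k := Num.max 0 (- p).
exists (1 + (1 + (Num.truncn k).+1`!%:R)); split => [|t].
  by rewrite !addr_ge0.
have [t0|t0] := leP t 0; first by rewrite pw_neg// mul0r mulr_ge0 ?pw2_ge0 ?addr_ge0.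
rewrite /pw2; have [t1|t1] := leP t 1; last first.
  rewrite [leRHS]mulrC ler_pM ?pw_ge0 ?expR_ge0// -[leLHS]addr0 lerD//.
  by rewrite -[leRHS]expR0 ler_expR oppr_le0 invr_ge0 ltW.
have k0 : 0 <= k by rewrite le_max lexx.
have ti0 : 0 < t^-1 by rewrite invr_gt0.
have := powR_expR_bound k0 ti0; rewrite -/(einv t) => h.
rewrite (pw_pos 0)// powRr0 mulr1; apply: le_trans (le_trans h _); last by rewrite lerDr.
rewrite ler_wpM2r ?expR_ge0// pw_pos//.
have -> : t `^ p = t^-1 `^ (- p) by rewrite -powR_inv1 ?(ltW t0)// -powRrM mulN1r opprK.
by rewrite ler_powR ?invf_ge1// le_max lexx orbT.
Qed.

Lemma integrable_dom (f : R -> R) (p q C : R) : measurable_fun setT f -> -1 < p -> q < -1 ->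
  (forall t, `|f t| <= C * pw2 p q t) -> mu.-integrable setT (EFin \o f).
Proof.
move=> mf p1 q1 fC.
apply: (@le_integrable _ (measurableTypeR R) _ mu setT measurableT _ (EFin \o (fun t => C * pw2 p q t))).
- exact/measurable_EFinP.
- by move=> t _ /=; rewrite lee_fin; apply: le_trans (ler_norm _); exact: fC.
- rewrite (_ : _ \o _ = (fun t => C%:E * (EFin \o pw2 p q) t)%E)//.
  by apply: (@integrableZl _ (measurableTypeR R)) => //; exact: integrable_pw2.
Qed.

(** Packages what positivity and continuity of the moments rely on, for [egam] (exponents above -1)
    and [einv] (exponents below -1) at once. *)
Definition admissible (w : R -> R) (P : set R) := [/\ measurable_fun setT w, (forall t, 0 < w t) &
  forall p, P p -> mu.-integrable setT (EFin \o (fun t => pw p t * w t))].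

Lemma measurable_pww w p : measurable_fun setT w -> measurable_fun setT (fun t => pw p t * w t).
Proof. by move=> mw; apply: measurable_funM => //; exact: measurable_pw. Qed.

Lemma admissible_egam : admissible egam [set p | -1 < p].
Proof.
split; [exact: measurable_egam|by move=> t; exact: expR_gt0|move=> p /= p1].
have [C [C0 HC]] := egam_dom p.
apply: (@integrable_dom _ p (-2) C) => //.
- by apply: measurable_pww; exact: measurable_egam.
- by rewrite ltrN2 ltr1n.
- by move=> t; rewrite ger0_norm// mulr_ge0 ?pw_ge0 ?expR_ge0.
Qed.

Lemma admissible_einv : admissible einv [set p | p < -1].
Proof.
split; [exact: measurable_einv|by move=> t; exact: expR_gt0|move=> p /= p1].
have [C [C0 HC]] := einv_dom p.
apply: (@integrable_dom _ 0 p C) => //.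
- by apply: measurable_pww; exact: measurable_einv.
- by move=> t; rewrite ger0_norm// mulr_ge0 ?pw_ge0 ?expR_ge0.
Qed.

(** A vanishing moment would force the integrand to vanish almost everywhere, but it is positive on
    ]0, 1], a set of measure 1. *)
Lemma wint_gt0 w P p : admissible w P -> P p -> 0 < wint w p.
Proof.
move=> [mw w0 iw] Pp; have ip := iw _ Pp.
have f0 t : 0 <= pw p t * w t by rewrite mulr_ge0 ?pw_ge0// ltW.
rewrite lt_neqAle Rintegral_ge0 ?andbT; last by move=> t _; exact: f0.
apply/eqP => /esym wi0.
have : (\int[mu]_t `|(EFin \o (fun t => pw p t * w t)%R) t| = 0)%E.
  transitivity ((wint w p)%:E); last by rewrite wi0.
  rewrite /wint /Rintegral fineK; last exact: integrable_fin_num.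
  by apply: eq_integral => t _ /=; rewrite ger0_norm.
move/(ae_eq_integral_abs _ _ _).1 => /(_ measurableT) [].
  exact: measurable_int ip.
move=> N [mN N0 sN].
have : (mu (`]0%R, 1%R]) <= mu N)%E.
  apply: le_measure; rewrite ?inE//.
  move=> t /=; rewrite in_itv/= => /andP[t0 _]; apply: sN => /= /(_ I) /eqP.
  rewrite eqe mulf_eq0 (gt_eqF (w0 t)) orbF pw_pos// gt_eqF//.
  exact: powR_gt0.
by rewrite N0 lebesgue_measure_itv/= lte_fin ltr01 oppr0 adde0 lee_fin ler10.
Qed.

Lemma cvg_pw (p_ : nat -> R) p t : p_ k @[k --> \oo] --> p -> pw (p_ k) t @[k --> \oo] --> pw p t.
Proof.
move=> cp; rewrite /pw; case: ifP => t0; last exact: cvg_cst.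
rewrite /powR gt_eqF//.
apply: (@cvg_comp _ _ _ (fun k => p_ k * ln t) expR); last exact: continuous_expR.
by apply: cvgMl.
Qed.

(** Dominates all exponents of a compact interval by its two ends; this is the source of every
    domination in the order of the derivative. *)
Lemma pw_between p1 p p2 t : p1 <= p -> p <= p2 -> pw p t <= pw p1 t + pw p2 t.
Proof.
move=> h1 h2; have [t1|t1] := leP t 1.
  by rewrite -[leLHS]addr0 lerD ?pw_ge0// le1_le_pw.
by rewrite -[leLHS]add0r lerD ?pw_ge0// ge0_le_pw// ltW.
Qed.

Lemma cvg_wint w P (p_ : nat -> R) p p1 p2 : admissible w P -> P p1 -> P p2 ->
  (forall k, p1 <= p_ k <= p2) -> p_ k @[k --> \oo] --> p ->
  wint w (p_ k) @[k --> \oo] --> wint w p.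
Proof.
move=> [mw w0 iw] P1 P2 pk cp.
apply: (@Rintegral_dominated _ _ (measurableTypeR R) mu _ _ (fun t => pw p1 t * w t + pw p2 t * w t)).
- by move=> k; exact: measurable_pww.
- exact: measurable_pww.
- by move=> t; apply: cvgM; [exact: cvg_pw|exact: cvg_cst].
- have -> : EFin \o (fun t => pw p1 t * w t + pw p2 t * w t) =
    (fun t => (EFin \o (fun t => pw p1 t * w t)%R) t + (EFin \o (fun t => pw p2 t * w t)%R) t)%E by [].
  by apply: (@integrableD _ (measurableTypeR R)) => //; exact: iw.
move=> k t; rewrite ger0_norm ?mulr_ge0 ?pw_ge0 ?(ltW (w0 _))//.
rewrite -mulrDl ler_wpM2r ?(ltW (w0 _))//.
by have /andP[] := pk k; exact: pw_between.
Qed.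

Lemma GammaE (s : R) : Gamma s = wint egam (s - 1).
Proof.
rewrite /Gamma Rintegral_mkcond /wint; apply: eq_Rintegral => t _.
rewrite patchE mem_setE in_itv/= andbT /pw; case: ifP => //.
by rewrite mul0r.
Qed.

Lemma measurable_expRinv (r : R) : measurable_fun setT (fun t : R => expR (- (r / t))).
Proof.
apply: measurableT_comp => //; apply: measurableT_comp => //; apply: measurable_funM => //.
exact: measurable_invr.
Qed.

(** The subordination formula, by the substitution t -> r t. With r = |h|^2 and q = (n + a + 1) / 2
    it writes |h|^-(n+a+1) as a mixture of Gaussians in h. *)
Lemma wint_einv_scale (q r c : R) : 0 < r -> 0 < q ->
  \int[mu]_t (pw (- q - 1) t * expR (- (r / t)) * c) = r `^ (- q) * wint einv (- q - 1) * c.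
Proof.
move=> r0 q0.
pose T := measurableTypeR R.
have mT : measurable_fun [set: R] (fun t : R => pw (- q - 1) t * expR (- (r / t)) * c).
  apply: measurable_funM => //.
  by apply: measurable_funM; [exact: measurable_pw|exact: measurable_expRinv].
have tr g : measurable_fun setT g -> (forall y, (0 <= g y)%E) ->
    (\int[mu]_y g y = r%:E * \int[mu]_x g (r * x + 0)%R)%E.
  by move=> mg g0; have := @ge0_integral_affine _ r 0 g (lt0r_neq0 r0) mg g0; rewrite gtr0_norm.
have -> := @Rintegral_ge0_transfer R _ _ T T mu mu r (fun x => r * x + 0) (ltW r0) tr _ mT.
have -> : r `^ (- q) = r * pw (- q - 1) r.
  rewrite pw_pos// -[X in X * _]powRr1 ?(ltW r0)// -powRD; last by apply/implyP => _; rewrite gt_eqF.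
  by congr (_ `^ _); ring.
rewrite -!mulrA; congr (r * _).
have -> : pw (- q - 1) r * (wint einv (- q - 1) * c) = pw (- q - 1) r * c * wint einv (- q - 1) by ring.
rewrite /wint -RintegralZl//; last first.
  by have [_ _] := admissible_einv; apply => /=; rewrite ltrBlDr addrC subrr oppr_lt0.
apply: eq_Rintegral => t _; rewrite addr0 pw_mulr//.
have -> : expR (- (r / (r * t))) = einv t.
  by rewrite /einv; congr (expR (- _)); rewrite invfM mulrA divff ?mul1r// gt_eqF.
by ring.
Qed.

(** Euler's Beta integral B(a, b): the two factors vanish outside ]0, 1[. *)
Definition beta2 (a b : R) : \bar R := (\int[mu]_s (pw (a - 1) s * pw (b - 1) (1 - s))%:E)%E.

Lemma measurable_pwconv (p q t : R) : measurable_fun setT (fun s => pw p s * pw q (t - s)).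
Proof.
apply: measurable_funM; first exact: measurable_pw.
apply: (@measurableT_comp _ _ _ _ _ _ (pw q)); first exact: measurable_pw.
exact: measurable_funB.
Qed.

(** For b <= 1 the second factor is at least 1 on ]0, 1[. The resulting blow-up as a -> 0 is what
    makes the averages over s concentrate at 0. *)
Lemma beta2_ge (a b : R) : 0 < a -> b <= 1 -> ((a *+ 2)^-1%:E <= beta2 a b)%E.
Proof.
move=> a0 b1; have a1 : -1 < a - 1 by rewrite ltrBrDl subrr.
have := integral_powR01_ge a1; rewrite subrK => h; apply: le_trans h _.
have mp (D : set R) : measurable_fun D (fun t => (t `^ (a - 1))%:E).
  by apply/measurable_EFinP; apply: measurable_funTS; exact: (@measurable_powR R (a - 1)).
(* The end point 1 is dropped because there the second factor [pw] is 0 by convention. *)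
rewrite -integral_itv_bndo_bndc//.
rewrite integral_mkcond; apply: ge0_le_integral => //.
- by move=> t _; rewrite patchE; case: ifP => // _; rewrite lee_fin powR_ge0.
- by apply: (measurable_restrictT _ _).1 => //; exact: mp.
- by apply/measurable_EFinP; exact: measurable_pwconv.
move=> t _; rewrite patchE mem_setE in_itv/=; case: ifP => [/andP[t0 t1]|_]; last first.
  by rewrite lee_fin mulr_ge0 ?pw_ge0.
rewrite lee_fin pw_pos// -[leLHS]mulr1 ler_wpM2l ?powR_ge0//.
have b0 : b - 1 <= 0 by rewrite subr_le0.
have t1' : 1 - t <= 1 by rewrite lerBlDr lerDl ltW.
by have := le1_le_pw b0 t1'; rewrite !pw_pos ?subr_gt0// powRr0.
Qed.

(** On each half of ]0, 1[ only one factor can be singular, and the other is at most 2 there. The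
    reflection s -> 1 - s treats the second half like the first. *)
Lemma beta2_lty (a b : R) : 0 < a -> 0 < b -> b <= 1 -> a <= 1 -> (beta2 a b < +oo)%E.
Proof.
move=> a0 b0 b1 a1.
have a2 : -1 < a - 1 by rewrite ltrBrDl subrr.
have b2 : -1 < b - 1 by rewrite ltrBrDl subrr.
have m2 : -2 < -1 :> R by rewrite ltrN2 ltr1n.
have mr : measurable_fun setT (fun s : R => (pw2 (b - 1) (-2) (-1 * s + 1))%:E).
  apply/measurable_EFinP; apply: (@measurableT_comp _ _ _ _ _ _ (pw2 (b - 1) (-2))).
    exact: measurable_pw2.
  by apply: measurable_funD => //; exact: measurable_funM.
have mp (p q : R) : measurable_fun setT (fun s : R => (pw2 p q s)%:E).
  by apply/measurable_EFinP; exact: measurable_pw2.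
have half c s : 0 < c -> c <= 1 -> 2^-1 <= s -> pw (c - 1) s <= 2.
  move=> c0 c1 s2; have s0 : 0 < s by apply: lt_le_trans s2.
  have [s1|/ltW s1] := leP s 1.
    have h : pw (c - 1) s <= pw (-1) s by rewrite le1_le_pw// lerBrDl subrr ltW.
    by apply: (le_trans h); rewrite pw_pos// powR_inv1 ?(ltW s0)// invf_ple ?posrE.
  have h : pw (c - 1) s <= pw 0 s by rewrite ge0_le_pw// subr_le0.
  by apply: (le_trans h); rewrite pw_pos// powRr0 ler1n.
apply: (@le_lt_trans _ _ (\int[mu]_s (2%:E * (pw2 (a - 1) (-2) s)%:E + 2%:E * (pw2 (b - 1) (-2) (-1 * s + 1))%:E))%E).
  apply: ge0_le_integral => //.
  - by move=> s _; rewrite lee_fin mulr_ge0 ?pw_ge0.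
  - by apply/measurable_EFinP; exact: measurable_pwconv.
  - by apply: emeasurable_funD; apply: measurable_funeM => //; exact: mp.
  move=> s _; rewrite -!EFinM -EFinD lee_fin.
  have -> : -1 * s + 1 = 1 - s by ring.
  have [s0|s0] := leP s 0.
    by rewrite pw_neg// mul0r addr_ge0 ?mulr_ge0 ?pw2_ge0.
  have [s1|s1] := leP 1 s.
    by rewrite [X in _ * X]pw_neg ?subr_le0// mulr0 addr_ge0 ?mulr_ge0 ?pw2_ge0.
  rewrite /pw2 (ltW s1) lerBlDr lerDl (ltW s0).
  have [sh|/ltW sh] := leP s 2^-1.
    rewrite -[leLHS]addr0 lerD ?mulr_ge0 ?pw_ge0// mulrC ler_wpM2r ?pw_ge0// half//.
    by rewrite lerBrDl -lerBrDr; apply: le_trans sh _; rewrite le_eqVlt; apply/orP; left; apply/eqP; field.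
  by rewrite -[leLHS]add0r lerD ?mulr_ge0 ?pw_ge0// ler_wpM2r ?pw_ge0// half.
rewrite ge0_integralD//; first last.
- exact: measurable_funeM.
- by move=> s _; rewrite mule_ge0// lee_fin pw2_ge0.
- by apply: measurable_funeM; exact: mp.
- by move=> s _; rewrite mule_ge0// lee_fin pw2_ge0.
rewrite !ge0_integralZl//; first last.
- by move=> s _; rewrite lee_fin pw2_ge0.
- exact: mp.
- by move=> s _; rewrite lee_fin pw2_ge0.
have pg (s : R) : (0 <= (pw2 (b - 1) (-2) s)%:E)%E by rewrite lee_fin pw2_ge0.
have n1 : -1 != 0 :> R by rewrite oppr_eq0 oner_eq0.
have := @ge0_integral_affine _ (-1) 1 _ n1 (mp (b - 1) (-2)) pg.
rewrite normrN1 mul1e => <-.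
by apply: lte_add_pinfty; apply: lte_mul_pinfty => //; exact: integral_pw2_lty.
Qed.

(** Scaling s by t: the convolution of two powers is again a power, the semigroup law of the
    Riemann-Liouville kernels before normalization. *)
Lemma integral_pwconv (a b t : R) : 0 < a -> 0 < b -> 
  (\int[mu]_s (pw (a - 1) s * pw (b - 1) (t - s))%:E = (pw (a + b - 1) t)%:E * beta2 a b)%E.
Proof.
move=> a0 b0; have [t0|t0] := leP t 0.
  rewrite pw_neg// mul0e integral0_eq// => s _; have [s0|s0] := leP s 0.
    by rewrite pw_neg// mul0r.
  by rewrite [X in _ * X]pw_neg ?mulr0// lerBlDr add0r (le_trans t0)// ltW.
have mc : measurable_fun setT (fun s => (pw (a - 1) s * pw (b - 1) (t - s))%:E).
  by apply/measurable_EFinP; exact: measurable_pwconv.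
have c0 s : (0 <= (pw (a - 1) s * pw (b - 1) (t - s))%:E)%E by rewrite lee_fin mulr_ge0 ?pw_ge0.
have -> := @ge0_integral_affine _ t 0 _ (lt0r_neq0 t0) mc c0.
rewrite (gtr0_norm t0).
have -> : pw (a + b - 1) t = t * (pw (a - 1) t * pw (b - 1) t).
  transitivity (pw 1 t * (pw (a - 1) t * pw (b - 1) t)); first by rewrite !pwM; congr (pw _ _); ring.
  by rewrite (pw_pos 1)// powRr1// ltW.
rewrite EFinM -muleA; congr (_ * _)%E; rewrite /beta2 -ge0_integralZl//; last 3 first.
- by apply/measurable_EFinP; exact: measurable_pwconv.
- by move=> s _; rewrite lee_fin mulr_ge0 ?pw_ge0.
- by rewrite lee_fin mulr_ge0 ?pw_ge0.
apply: eq_integral => s _; rewrite -EFinM; congr EFin.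
have -> : t - (t * s + 0) = t * (1 - s) by ring.
by rewrite addr0 !pw_mulr//; ring.
Qed.

End power_integrals.

Section ge0_real_integrals.
Context {R : realType} d (T : measurableType d) (mu : {measure set T -> \bar R}).
Implicit Types f g : T -> R.

Lemma ge0_integralZ_EFin (c : R) f : 0 <= c -> measurable_fun setT f -> (forall x, 0 <= f x) ->
  (\int[mu]_x (c * f x)%:E = c%:E * \int[mu]_x (f x)%:E)%E.
Proof.
move=> c0 mf f0; under eq_integral do rewrite EFinM.
apply: ge0_integralZl => //; first exact/measurable_EFinP.
by move=> x _; rewrite lee_fin.
Qed.

Lemma ge0_integralZ_EFin_le (c K : R) f : 0 <= c -> measurable_fun setT f -> (forall x, 0 <= f x) ->
  (\int[mu]_x (f x)%:E <= K%:E)%E -> (\int[mu]_x (c * f x)%:E <= (c * K)%:E)%E.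
Proof.
move=> c0 mf f0 fK; rewrite ge0_integralZ_EFin// EFinM.
by apply: lee_wpmul2l => //; rewrite lee_fin.
Qed.

Lemma ge0_integralD_EFin f g : measurable_fun setT f -> measurable_fun setT g ->
  (forall x, 0 <= f x) -> (forall x, 0 <= g x) ->
  (\int[mu]_x (f x + g x)%:E = \int[mu]_x (f x)%:E + \int[mu]_x (g x)%:E)%E.
Proof.
move=> mf mg f0 g0; under eq_integral do rewrite EFinD.
apply: ge0_integralD => //; try exact/measurable_EFinP.
- by move=> x _; rewrite lee_fin.
- by move=> x _; rewrite lee_fin.
Qed.

Lemma ge0_le_integral_EFin f g : measurable_fun setT f -> measurable_fun setT g ->
  (forall x, 0 <= f x) -> (forall x, f x <= g x) ->
  (\int[mu]_x (f x)%:E <= \int[mu]_x (g x)%:E)%E.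
Proof.
move=> mf mg f0 fg; apply: ge0_le_integral => //; try exact/measurable_EFinP.
- by move=> x _; rewrite lee_fin.
- by move=> x _; rewrite lee_fin.
Qed.

Lemma normr_Rintegral_le f g (c : R) : measurable_fun setT f -> measurable_fun setT g ->
  (forall x, `|f x| <= g x) -> (\int[mu]_x (g x)%:E <= c%:E)%E ->
  `|\int[mu]_x f x| <= c.
Proof.
move=> mf mg fg gc.
have ig : mu.-integrable setT (EFin \o f).
  by apply: (integrable_le mf _ mg fg); apply: le_lt_trans gc _; rewrite ltry.
apply: le_trans (le_normr_Rintegral _ ig) _ => //.
have f0 : (0 <= \int[mu]_x `|f x|%:E)%E by apply: integral_ge0 => x _; rewrite lee_fin.
rewrite -lee_fin /Rintegral fineK; last first.
  rewrite ge0_fin_numE//; apply: le_lt_trans (ltry c); apply: le_trans gc.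
  by apply: ge0_le_integral_EFin => //; exact: measurableT_comp.
by apply: le_trans gc; apply: ge0_le_integral_EFin => //; exact: measurableT_comp.
Qed.

Lemma integrable_EFin_le f g (c : R) : measurable_fun setT f -> measurable_fun setT g ->
  (forall x, `|f x| <= g x) -> (\int[mu]_x (g x)%:E <= c%:E)%E ->
  mu.-integrable setT (EFin \o f).
Proof.
move=> mf mg fg gc.
by apply: (integrable_le mf _ mg fg); apply: le_lt_trans gc _; rewrite ltry.
Qed.

Lemma EFin_Rintegral f : mu.-integrable setT (EFin \o f) ->
  ((\int[mu]_x f x)%:E = \int[mu]_x (f x)%:E)%E.
Proof. by move=> i_f; rewrite /Rintegral fineK//; exact: integrable_fin_num. Qed.

End ge0_real_integrals.

(** * Heat representation of the fractional divergence *)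

Section heat.
Context {R : realType} {n : nat}.
Local Notation Rn := 'rV[R]_n.
Local Notation leb := (@lebesgue_rV R n).
Local Notation mu := (@lebesgue_measure R).
Local Notation RT := (measurableTypeR R).
Implicit Types (t s : R) (h : Rn) (phi : Rn -> Rn).

Definition heat t h : R := gauss t h / Num.sqrt (pi * t) ^+ n.

Lemma heat_ge0 t h : 0 <= heat t h.
Proof. by rewrite divr_ge0 ?expR_ge0// exprn_ge0// sqrtr_ge0. Qed.

Lemma sqrt_pit_gt0 t : 0 < t -> 0 < Num.sqrt (pi * t) ^+ n.
Proof. by move=> t0; rewrite exprn_gt0// sqrtr_gt0 mulr_gt0// pi_gt0. Qed.

Lemma measurable_heat d (T : measurableType d) (u : T -> R) (v : T -> Rn) :
  measurable_fun setT u -> measurable_fun setT v -> measurable_fun setT (fun x => heat (u x) (v x)).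
Proof.
move=> mu_ mv; apply: measurable_funM.
  apply: measurableT_comp => //; apply: measurableT_comp => //; apply: measurable_funM.
    exact: measurable_dotrv.
  by apply: measurableT_comp => //; exact: measurable_invr.
apply: (@measurableT_comp _ _ _ _ _ _ (fun x : R => x^-1)); first exact: measurable_invr.
apply: (@measurable_funX _ _ _ _ (fun x => Num.sqrt (pi * u x))).
apply: (@measurableT_comp _ _ _ _ _ _ (@Num.sqrt R)).
  by apply: continuous_measurable_fun; exact: sqrt_continuous.
exact: measurable_funM.
Qed.

Lemma measurable_heat1 t : measurable_fun setT (heat t).
Proof. exact: measurable_heat. Qed.

Lemma integral_heat t : 0 < t -> (\int[leb]_h (heat t h)%:E = 1)%E.
Proof.
move=> t0; under eq_integral do rewrite /heat mulrC.
rewrite ge0_integralZ_EFin.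
- by rewrite integral_gauss// -EFinM mulVf// gt_eqF// sqrt_pit_gt0.
- by rewrite invr_ge0 ltW// sqrt_pit_gt0.
- exact: measurable_gauss.
- by move=> h; exact: expR_ge0.
Qed.

(** One constant for the first and the second moment of the heat kernel: 2 sqrt(2)^n comes from
    comparing the times t and 2t, and the 1 from the region |h| <= sqrt t. *)
Definition cheat : R := 1 + 2 * Num.sqrt 2 ^+ n.

Lemma cheat_ge0 : 0 <= cheat.
Proof. by rewrite addr_ge0// mulr_ge0// exprn_ge0// sqrtr_ge0. Qed.

(** Half of the Gaussian exponent absorbs |h|^2 / (2t) through y exp(-y) <= 1; the other half is the
    Gaussian of time 2t, and sqrt(2)^n corrects its normalization. *)
Lemma heat_dotrv_le t h : 0 < t ->
  heat t h * dotrv h h <= 2 * Num.sqrt 2 ^+ n * t * heat (2 * t) h.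
Proof.
move=> t0; have p0 := sqrt_pit_gt0 t0.
have s2 : Num.sqrt (2 : R) ^+ n != 0 by rewrite expf_neq0// gt_eqF// sqrtr_gt0.
have E : Num.sqrt 2 ^+ n * heat (2 * t) h = gauss (2 * t) h / Num.sqrt (pi * t) ^+ n.
  rewrite /heat (mulrCA pi) [in LHS]sqrtrM// exprMn invfM.
  by rewrite mulrCA; congr (_ * _); rewrite mulVKf.
have -> : 2 * Num.sqrt 2 ^+ n * t * heat (2 * t) h = 2 * t * (Num.sqrt 2 ^+ n * heat (2 * t) h) by ring.
rewrite E /heat mulrAC mulrA ler_wpM2r ?invr_ge0 ?(ltW p0)//.
have t2 : 0 < 2 * t by rewrite mulr_gt0.
pose r := dotrv h h / (2 * t).
have r0 : 0 <= r by rewrite divr_ge0 ?dotrv_ge0// ltW.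
have -> : gauss t h = expR (- r) * expR (- r).
  rewrite -expRD /gauss /r; congr expR; field; by rewrite gt_eqF.
have -> : dotrv h h = 2 * t * r by rewrite /r mulrC divfK// gt_eqF.
rewrite [gauss _ _]/(expR (- r)) mulrCA ler_wpM2l ?(ltW t2)//.
rewrite mulrC mulrA -[leRHS]mul1r ler_wpM2r ?expR_ge0//.
by have := pow_expR_bound 1 r0; rewrite expr1.
Qed.

Lemma integral_heat_dotrv t : 0 < t -> (\int[leb]_h (heat t h * dotrv h h)%:E <= (cheat * t)%:E)%E.
Proof.
move=> t0; have t2 : 0 < 2 * t by rewrite mulr_gt0.
have c0 : 0 <= 2 * Num.sqrt 2 ^+ n * t by rewrite !mulr_ge0 ?exprn_ge0 ?sqrtr_ge0// ltW.
apply: (@le_trans _ _ (\int[leb]_h (2 * Num.sqrt 2 ^+ n * t * heat (2 * t) h)%:E)%E).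
  apply: ge0_le_integral_EFin.
  - by apply: measurable_funM; [exact: measurable_heat1|exact: measurable_dotrv].
  - by apply: measurable_funM => //; exact: measurable_heat1.
  - by move=> h; rewrite mulr_ge0 ?heat_ge0 ?dotrv_ge0.
  - by move=> h; exact: heat_dotrv_le.
rewrite ge0_integralZ_EFin ?integral_heat ?mule1//; first last.
- by move=> h; exact: heat_ge0.
- exact: measurable_heat1.
by rewrite lee_fin ler_wpM2r ?(ltW t0)// lerDr.
Qed.

Lemma integral_heat_enorm t : 0 < t -> (\int[leb]_h (heat t h * enorm h)%:E <= (cheat * Num.sqrt t)%:E)%E.
Proof.
move=> t0; have st0 : 0 < Num.sqrt t by rewrite sqrtr_gt0.
have t2 : 0 < 2 * t by rewrite mulr_gt0.
have c0 : 0 <= 2 * Num.sqrt (2 : R) ^+ n by rewrite !mulr_ge0 ?exprn_ge0 ?sqrtr_ge0.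
have c1 : 0 <= 2 * Num.sqrt (2 : R) ^+ n * Num.sqrt t by rewrite mulr_ge0 ?sqrtr_ge0.
have me : measurable_fun setT (fun h : Rn => enorm h).
  apply: (@measurableT_comp _ _ _ _ _ _ (@Num.sqrt R)); last exact: measurable_dotrv.
  by apply: continuous_measurable_fun; exact: sqrt_continuous.
apply: (@le_trans _ _ (\int[leb]_h (Num.sqrt t * heat t h + 2 * Num.sqrt 2 ^+ n * Num.sqrt t * heat (2 * t) h)%:E)%E).
  apply: ge0_le_integral_EFin.
  - by apply: measurable_funM; [exact: measurable_heat1|].
  - apply: measurable_funD; apply: measurable_funM => //; exact: measurable_heat1.
  - by move=> h; rewrite mulr_ge0 ?heat_ge0 ?enorm_ge0.
  move=> h; have := heat_dotrv_le h t0 => H.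
  (* Either |h| <= sqrt t or |h| <= |h|^2 / sqrt t, so the first moment follows from the mass and
     the second moment. *)
  have e1 : enorm h <= Num.sqrt t + dotrv h h / Num.sqrt t.
    have -> : dotrv h h = enorm h * enorm h by rewrite -expr2 sqr_sqrtr ?dotrv_ge0.
    have [et|te] := leP (enorm h) (Num.sqrt t).
      by rewrite -[leLHS]addr0 lerD// divr_ge0 ?(ltW st0)// mulr_ge0 ?enorm_ge0.
    rewrite -[leLHS]add0r lerD ?(ltW st0)// ler_pdivlMr// ler_wpM2l ?enorm_ge0//.
    exact: ltW.
  apply: le_trans (ler_wpM2l (heat_ge0 t h) e1) _.
  rewrite mulrDr [heat t h * Num.sqrt t]mulrC lerD2l mulrA ler_pdivrMr//.
  apply: le_trans H _; rewrite le_eqVlt; apply/orP; left; apply/eqP.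
  have tt : t = Num.sqrt t * Num.sqrt t by rewrite -expr2 sqr_sqrtr// ltW.
  by rewrite {1}tt; ring.
rewrite ge0_integralD_EFin; first last.
- by move=> h; rewrite mulr_ge0 ?heat_ge0.
- by move=> h; rewrite mulr_ge0 ?heat_ge0// ltW.
- by apply: measurable_funM => //; exact: measurable_heat1.
- by apply: measurable_funM => //; exact: measurable_heat1.
have Z c s : 0 <= c -> 0 < s -> (\int[leb]_x (c * heat s x)%:E = c%:E)%E.
  move=> c0' s0; rewrite ge0_integralZ_EFin ?integral_heat ?mule1//; first exact: measurable_heat1.
  by move=> h; exact: heat_ge0.
rewrite (Z _ _ (ltW st0) t0) (Z _ _ c1 t2) -EFinD lee_fin /cheat le_eqVlt; apply/orP; left; apply/eqP.
by ring.
Qed.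

Lemma measurable_enorm d (T : measurableType d) (f : T -> Rn) : measurable_fun setT f ->
  measurable_fun setT (fun x => enorm (f x)).
Proof.
move=> mf; apply: (@measurableT_comp _ _ _ _ _ _ (@Num.sqrt R)); last exact: measurable_dotrv.
by apply: continuous_measurable_fun; exact: sqrt_continuous.
Qed.

Lemma dotrvN (x y : Rn) : dotrv (- x) y = - dotrv x y.
Proof. by rewrite /dotrv -sumrN; apply: eq_bigr => i _; rewrite mxE mulNr. Qed.

Lemma dotrvDr (x y z : Rn) : dotrv x (y + z) = dotrv x y + dotrv x z.
Proof. by rewrite /dotrv -big_split; apply: eq_bigr => i _; rewrite mxE mulrDr. Qed.

Lemma dotrvDl (x y z : Rn) : dotrv (x + y) z = dotrv x z + dotrv y z.
Proof. by rewrite /dotrv -big_split; apply: eq_bigr => i _; rewrite mxE mulrDl. Qed.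

Lemma dotrvZl c (x y : Rn) : dotrv (c *: x) y = c * dotrv x y.
Proof. by rewrite /dotrv mulr_sumr; apply: eq_bigr => i _; rewrite mxE mulrA. Qed.

Lemma dotrvC (x y : Rn) : dotrv x y = dotrv y x.
Proof. by apply: eq_bigr => i _; rewrite mulrC. Qed.

Lemma normr_dotrv_le (x y : Rn) : `|dotrv x y| <= enorm x * enorm y.
Proof.
rewrite ler_norml dotrv_le andbT lerNl -dotrvN.
apply: le_trans (dotrv_le _ _) _; rewrite /enorm.
by rewrite [dotrv (- x) (- x)]dotrvN dotrvC dotrvN opprK.
Qed.

Lemma integrable_heat_dotrv t (v : Rn) : 0 < t -> 
  leb.-integrable setT (EFin \o (fun h => heat t h * dotrv h v)).
Proof.
move=> t0; apply: (@integrable_EFin_le _ _ _ _ _ (fun h => enorm v * (heat t h * enorm h)) (enorm v * (cheat * Num.sqrt t))).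
- by apply: measurable_funM; [exact: measurable_heat1|exact: measurable_dotrv].
- by apply: measurable_funM => //; apply: measurable_funM; [exact: measurable_heat1|exact: measurable_enorm].
- move=> h; rewrite normrM (ger0_norm (heat_ge0 _ _)) mulrCA ler_wpM2l ?heat_ge0// mulrC.
  exact: normr_dotrv_le.
- rewrite ge0_integralZ_EFin ?enorm_ge0//; first by rewrite EFinM lee_wpmul2l ?lee_fin ?enorm_ge0 ?integral_heat_enorm.
  + by apply: measurable_funM; [exact: measurable_heat1|exact: measurable_enorm].
  + by move=> h; rewrite mulr_ge0 ?heat_ge0 ?enorm_ge0.
Qed.

(** The integrand is odd. This cancellation allows [phi x] to be subtracted inside [heatdiv]. *)
Lemma Rintegral_heat_dotrv t (v : Rn) : 0 < t -> \int[leb]_h (heat t h * dotrv h v) = 0.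
Proof.
move=> t0; have mf : measurable_fun setT (fun h => heat t h * dotrv h v).
  by apply: measurable_funM; [exact: measurable_heat1|exact: measurable_dotrv].
have := Rintegral_rV_opp mf.
have -> : \int[leb]_x (heat t (- x) * dotrv (- x) v) = \int[leb]_x (-1 * (heat t x * dotrv x v)).
  apply: eq_Rintegral => x _; rewrite dotrvN mulN1r mulrN /heat /gauss.
  by rewrite [dotrv (- x) (- x)]dotrvN dotrvC dotrvN opprK.
rewrite RintegralZl//; last exact: integrable_heat_dotrv.
by rewrite mulN1r => /eqP; rewrite eq_sym -subr_eq0 opprK -mulr2n mulrn_eq0/= => /eqP.
Qed.

(** The estimates on the fractional divergence use a test field only through these two constants,
    which are unchanged by translation. *)
Definition bndlip (M L : R) phi := [/\ measurable_fun setT phi, (forall x, enorm (phi x) <= M) &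
  forall x y, enorm (phi x - phi y) <= L * enorm (x - y)].

Lemma bndlip_shift M L phi h : bndlip M L phi -> bndlip M L (fun x => phi (x + h)).
Proof.
move=> [mp bp lp]; split => [||x y]; last by rewrite (le_trans (lp _ _))// opprD addrACA subrr addr0.
  exact: (measurableT_comp mp (measurable_rVD h)).
by move=> x.
Qed.

Lemma bndlip_ge0 M L phi : bndlip M L phi -> 0 <= M.
Proof. by move=> [_ bp _]; exact: le_trans (enorm_ge0 _) (bp 0). Qed.

(** For smooth [phi] this is half the divergence of the heat regularization of [phi], with the
    derivative moved onto the kernel. *)
Definition heatdiv t phi (x : Rn) : R := \int[leb]_h (heat t h * dotrv h (phi (x + h)) / t).

Lemma measurable_rV_add d (T : measurableType d) (f g : T -> Rn) :
  measurable_fun setT f -> measurable_fun setT g -> measurable_fun setT (fun x => f x + g x).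
Proof.
move=> mf mg; apply: measurable_fun_rV => i; under eq_fun do rewrite mxE.
by apply: measurable_funD; [exact: (measurableT_comp (measurable_coord_rV i) mf)
  |exact: (measurableT_comp (measurable_coord_rV i) mg)].
Qed.

Lemma measurable_rV_opp d (T : measurableType d) (f : T -> Rn) :
  measurable_fun setT f -> measurable_fun setT (fun x => - f x).
Proof. by move=> mf; exact: (measurableT_comp (@measurable_rVN R n) mf). Qed.

Lemma measurable_heat_dotrv d (T : measurableType d) (u : T -> R) (v w : T -> Rn) phi :
  measurable_fun setT phi -> measurable_fun setT u -> measurable_fun setT v -> measurable_fun setT w ->
  measurable_fun setT (fun x => heat (u x) (v x) * dotrv (v x) (phi (w x)) / u x).
Proof.
move=> mp mu_ mv mw; apply: measurable_funM.
  apply: measurable_funM; first exact: measurable_heat.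
  by apply: measurable_dotrv => //; exact: (measurableT_comp mp mw).
by apply: measurableT_comp => //; exact: measurable_invr.
Qed.

Lemma measurable_heatdiv d (T : measurableType d) (u : T -> R) (v : T -> Rn) phi :
  measurable_fun setT phi -> measurable_fun setT u -> measurable_fun setT v ->
  measurable_fun setT (fun x => heatdiv (u x) phi (v x)).
Proof.
move=> mp mu_ mv.
apply: (@measurable_Rintegral _ _ _ T _ leb (fun z => heat (u z.1) z.2 * dotrv z.2 (phi (v z.1 + z.2)) / u z.1)).
have m1 := @measurable_fst _ _ T (Rn : measurableType _).
have m2 := @measurable_snd _ _ T (Rn : measurableType _).
apply: measurable_heat_dotrv => //.
- exact: (measurableT_comp mu_ m1).
- by apply: measurable_rV_add => //; exact: (measurableT_comp mv m1).
Qed.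

Lemma heatdiv_integrable t M L phi (x : Rn) : bndlip M L phi -> 0 < t ->
  leb.-integrable setT (EFin \o (fun h => heat t h * dotrv h (phi (x + h)) / t)).
Proof.
move=> bl t0; have M0 := bndlip_ge0 bl; have [mp bp lp] := bl.
apply: (@integrable_EFin_le _ _ _ _ _ (fun h => M / t * (heat t h * enorm h)) (M / t * (cheat * Num.sqrt t))).
- by apply: measurable_heat_dotrv => //; exact: measurable_rV_add.
- by apply: measurable_funM => //; apply: measurable_funM; [exact: measurable_heat1|exact: measurable_enorm].
- move=> h; rewrite (normrM (heat t h * _)) (normrM (heat t h)) (ger0_norm (heat_ge0 _ _)).
  rewrite (@ger0_norm _ t^-1) ?invr_ge0 ?(ltW t0)//.
  have -> : M / t * (heat t h * enorm h) = heat t h * (enorm h * M) / t by ring.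
  rewrite ler_wpM2r ?invr_ge0 ?(ltW t0)//.
  rewrite ler_wpM2l ?heat_ge0//; apply: le_trans (normr_dotrv_le _ _) _.
  by rewrite ler_wpM2l ?enorm_ge0.
- apply: ge0_integralZ_EFin_le; last exact: integral_heat_enorm.
  + by rewrite divr_ge0 ?(ltW t0).
  + by apply: measurable_funM; [exact: measurable_heat1|exact: measurable_enorm].
  + by move=> h; rewrite mulr_ge0 ?heat_ge0 ?enorm_ge0.
Qed.

Lemma heatdiv_diffE t M L phi (x : Rn) : bndlip M L phi -> 0 < t ->
  heatdiv t phi x = \int[leb]_h (heat t h * dotrv h (phi (x + h) - phi x) / t).
Proof.
move=> bl t0; have i1 := heatdiv_integrable x bl t0.
have i2 := integrable_heat_dotrv (- phi x) t0.
transitivity (\int[leb]_h (heat t h * dotrv h (phi (x + h)) / t + (heat t h * dotrv h (- phi x)) * t^-1)); last first.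
  by apply: eq_Rintegral => h _; rewrite dotrvDr mulrDr mulrDl.
have i3 : leb.-integrable setT (EFin \o (fun h => (heat t h * dotrv h (- phi x)) * t^-1)).
  rewrite (_ : _ \o _ = (fun h => (EFin \o (fun h => heat t h * dotrv h (- phi x))%R) h * (t^-1)%:E)%E)//.
  exact: integrableZr.
rewrite (RintegralD _ i1 i3)// (RintegralZr _ _ i2)//.
by rewrite Rintegral_heat_dotrv// mul0r addr0.
Qed.

(** The bound for large times: the first moment of the heat kernel is O(sqrt t), and it is divided
    by t. *)
Lemma heatdiv_le t M L phi (x : Rn) : bndlip M L phi -> 0 < t ->
  `|heatdiv t phi x| <= cheat * M * t `^ (- 2^-1).
Proof.
move=> bl t0; have M0 := bndlip_ge0 bl; have [mp bp lp] := bl.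
apply: (@normr_Rintegral_le _ _ _ _ _ (fun h => M / t * (heat t h * enorm h))).
- by apply: measurable_heat_dotrv => //; exact: measurable_rV_add.
- by apply: measurable_funM => //; apply: measurable_funM; [exact: measurable_heat1|exact: measurable_enorm].
- move=> h; rewrite (normrM (heat t h * _)) (normrM (heat t h)) (ger0_norm (heat_ge0 _ _)).
  rewrite (@ger0_norm _ t^-1) ?invr_ge0 ?(ltW t0)//.
  have -> : M / t * (heat t h * enorm h) = heat t h * (enorm h * M) / t by ring.
  rewrite ler_wpM2r ?invr_ge0 ?(ltW t0)//.
  rewrite ler_wpM2l ?heat_ge0//; apply: le_trans (normr_dotrv_le _ _) _.
  by rewrite ler_wpM2l ?enorm_ge0.
rewrite ge0_integralZ_EFin ?divr_ge0 ?(ltW t0)//.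
- apply: le_trans (lee_wpmul2l _ (integral_heat_enorm t0)) _; first by rewrite lee_fin divr_ge0 ?(ltW t0).
  rewrite -EFinM lee_fin le_eqVlt; apply/orP; left; apply/eqP.
  have st0 : Num.sqrt t != 0 by rewrite gt_eqF// sqrtr_gt0.
  rewrite powRN powR12_sqrt ?(ltW t0)// -{1}(@sqr_sqrtr _ t) ?(ltW t0)//.
  by field.
- by apply: measurable_funM; [exact: measurable_heat1|exact: measurable_enorm].
- by move=> h; rewrite mulr_ge0 ?heat_ge0 ?enorm_ge0.
Qed.

Lemma normr_dotrv_lip M L phi (x h : Rn) : bndlip M L phi -> 
  `|dotrv h (phi (x + h) - phi x)| <= L * dotrv h h.
Proof.
move=> [_ _ lp]; apply: le_trans (normr_dotrv_le _ _) _.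
have := lp (x + h) x; rewrite addrAC subrr add0r => H.
apply: le_trans (ler_wpM2l (enorm_ge0 _) H) _.
by rewrite mulrCA -expr2 sqr_sqrtr ?dotrv_ge0.
Qed.

(** The bound for small times: once [phi x] is subtracted, the Lipschitz constant meets the second
    moment O(t), which cancels 1/t. *)
Lemma heatdiv_le_lip t M L phi (x : Rn) : 0 <= L -> bndlip M L phi -> 0 < t ->
  `|heatdiv t phi x| <= cheat * L.
Proof.
move=> L0 bl t0; rewrite (heatdiv_diffE _ bl)//; have [mp bp lp] := bl.
apply: (@normr_Rintegral_le _ _ _ _ _ (fun h => L / t * (heat t h * dotrv h h))).
- apply: measurable_funM => //; apply: measurable_funM; first exact: measurable_heat1.
  apply: measurable_dotrv => //; apply: measurable_rV_add => //.
  by apply: (measurableT_comp mp); exact: measurable_rV_add.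
- by apply: measurable_funM => //; apply: measurable_funM; [exact: measurable_heat1|exact: measurable_dotrv].
- move=> h; rewrite (normrM (heat t h * _)) (normrM (heat t h)) (ger0_norm (heat_ge0 _ _)).
  rewrite (@ger0_norm _ t^-1) ?invr_ge0 ?(ltW t0)//.
  have -> : L / t * (heat t h * dotrv h h) = heat t h * (L * dotrv h h) / t by ring.
  rewrite ler_wpM2r ?invr_ge0 ?(ltW t0)//.
  by rewrite ler_wpM2l ?heat_ge0//; exact: normr_dotrv_lip bl.
rewrite ge0_integralZ_EFin ?divr_ge0 ?(ltW t0)//.
- apply: le_trans (lee_wpmul2l _ (integral_heat_dotrv t0)) _; first by rewrite lee_fin divr_ge0 ?(ltW t0).
  rewrite -EFinM lee_fin le_eqVlt; apply/orP; left; apply/eqP.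
  by field; rewrite gt_eqF.
- by apply: measurable_funM; [exact: measurable_heat1|exact: measurable_dotrv].
- by move=> h; rewrite mulr_ge0 ?heat_ge0 ?dotrv_ge0.
Qed.

(* Up to the factor [Ka a] below, the fractional divergence of order [a]. *)
Definition fdiv (a : R) phi (x : Rn) : R :=
  \int[mu]_t (pw (- ((a + 1) / 2)) t * heatdiv t phi x).

(** The Lipschitz bound is used for t <= 1 and the sup bound, with its factor t^(-1/2), for t > 1.
    The two exponents are on the integrable sides of -1 when a < 1 and a > 0 respectively. *)
Lemma fdiv_integrand_le a M L phi (x : Rn) t : 0 <= L -> bndlip M L phi ->
  `|pw (- ((a + 1) / 2)) t * heatdiv t phi x| <=
    cheat * (M + L) * pw2 (- ((a + 1) / 2)) (- (a / 2) - 1) t.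
Proof.
move=> L0 bl; have M0 := bndlip_ge0 bl.
rewrite normrM (ger0_norm (pw_ge0 _ _)) /pw2.
have [t0|t0] := leP t 0.
  rewrite (pw_neg _ t0) mul0r; apply: mulr_ge0; first by rewrite mulr_ge0 ?cheat_ge0 ?addr_ge0.
  by case: (t <= 1) => //; exact: pw_ge0.
have [t1|t1] := leP t 1.
  rewrite mulrC ler_wpM2r ?pw_ge0//; apply: le_trans (heatdiv_le_lip x L0 bl t0) _.
  by rewrite ler_wpM2l ?cheat_ge0// lerDr.
have -> : pw (- (a / 2) - 1) t = pw (- ((a + 1) / 2)) t * t `^ (- 2^-1).
  by rewrite -(pw_pos (- 2^-1))// pwM; congr (pw _ _); field.
rewrite mulrCA ler_wpM2l ?pw_ge0//; apply: le_trans (heatdiv_le x bl t0) _.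
by rewrite ler_wpM2r ?powR_ge0// ler_wpM2l ?cheat_ge0// lerDl.
Qed.

Lemma measurable_fdiv_integrand d (T : measurableType d) (p : R) (u : T -> R) (v : T -> Rn) phi :
  measurable_fun setT phi -> measurable_fun setT u -> measurable_fun setT v ->
  measurable_fun setT (fun x => pw p (u x) * heatdiv (u x) phi (v x)).
Proof.
move=> mp mu_ mv; apply: measurable_funM; last exact: measurable_heatdiv.
by apply: (measurableT_comp (@measurable_pw R p)).
Qed.

(** The two terms come from times below and above 1; they blow up as a -> 1 and as a -> 0
    respectively. *)
Definition cfdiv (a : R) : R := (1 - (a + 1) / 2)^-1 + (a / 2)^-1.

Lemma integral_fdiv_dom a : 0 < a -> a < 1 ->
  (\int[mu]_t (pw2 (- ((a + 1) / 2)) (- (a / 2) - 1) t)%:E <= (cfdiv a)%:E)%E.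
Proof.
move=> a0 a1; apply: le_trans (integral_pw2_le _ _) _; last 1 first.
- by rewrite lee_fin addrNK /cfdiv addrC [_ + 1]addrC -invrN opprK addrC.
- by rewrite ltrN2 ltr_pdivrMr// mul1r; lra.
- by rewrite ltrBlDl subrr oppr_lt0 divr_gt0.
Qed.

Lemma cfdiv_ge0 a : 0 < a -> a < 1 -> 0 <= cfdiv a.
Proof. by move=> a0 a1; rewrite /cfdiv addr_ge0// invr_ge0 ?divr_ge0//; lra. Qed.

Lemma fdiv_le a M L phi (x : Rn) : 0 < a -> a < 1 -> 0 <= L -> bndlip M L phi ->
  `|fdiv a phi x| <= cheat * (M + L) * cfdiv a.
Proof.
move=> a0 a1 L0 bl; have M0 := bndlip_ge0 bl; have [mp bp lp] := bl.
have c0 : 0 <= cheat * (M + L) by rewrite mulr_ge0 ?cheat_ge0 ?addr_ge0.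
apply: (@normr_Rintegral_le _ _ RT mu _ (fun t => cheat * (M + L) * pw2 (- ((a + 1) / 2)) (- (a / 2) - 1) t)).
- exact: measurable_fdiv_integrand.
- by apply: measurable_funM => //; exact: measurable_pw2.
- by move=> t; exact: fdiv_integrand_le.
apply: (@ge0_integralZ_EFin_le _ _ RT mu) => //.
- exact: measurable_pw2.
- by move=> t; exact: pw2_ge0.
- exact: integral_fdiv_dom.
Qed.

Lemma fdiv_integrable a M L phi (x : Rn) : 0 < a -> a < 1 -> 0 <= L -> bndlip M L phi ->
  mu.-integrable setT (EFin \o (fun t => pw (- ((a + 1) / 2)) t * heatdiv t phi x)).
Proof.
move=> a0 a1 L0 bl; have [mp bp lp] := bl.
apply: (@integrable_dom R _ (- ((a + 1) / 2)) (- (a / 2) - 1) (cheat * (M + L))).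
- exact: measurable_fdiv_integrand.
- by rewrite ltrN2 ltr_pdivrMr// mul1r; lra.
- by rewrite ltrBlDl subrr oppr_lt0 divr_gt0.
- by move=> t; exact: fdiv_integrand_le.
Qed.

Lemma measurable_fdiv a phi : measurable_fun setT phi -> measurable_fun setT (fdiv a phi).
Proof.
move=> mp; apply: (@measurable_Rintegral _ _ _ (Rn : measurableType _) RT mu (fun z => pw (- ((a + 1) / 2)) z.2 * heatdiv z.2 phi z.1)).
exact: measurable_fdiv_integrand.
Qed.

Lemma heatdiv_shift t phi (x h : Rn) : heatdiv t phi (x + h) = heatdiv t (fun y => phi (y + h)) x.
Proof. by apply: eq_Rintegral => z _; rewrite addrAC. Qed.

Lemma fdiv_shift a phi (x h : Rn) : fdiv a phi (x + h) = fdiv a (fun y => phi (y + h)) x.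
Proof. by apply: eq_Rintegral => t _; rewrite heatdiv_shift. Qed.

(* Completing the square. *)
Lemma heat_mul s t (z w : Rn) : 0 < s -> 0 < t ->
  heat s z * heat t (w - z) = heat (t + s) w * heat (s * t / (t + s)) (z - (s / (t + s)) *: w).
Proof.
move=> s0 t0; have ts0 : 0 < t + s by rewrite addr_gt0.
have ts1 : t + s != 0 by rewrite gt_eqF.
have s1 : s != 0 by rewrite gt_eqF. have t1 : t != 0 by rewrite gt_eqF.
rewrite /heat mulrACA [RHS]mulrACA; congr (_ * _).
  rewrite /gauss -!expRD; congr expR.
  have dN (x y : Rn) : dotrv x (- y) = - dotrv x y by rewrite dotrvC dotrvN dotrvC.
  have dZr c (x y : Rn) : dotrv x (c *: y) = c * dotrv x y by rewrite dotrvC dotrvZl dotrvC.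
  rewrite !(dotrvDl, dotrvDr, dotrvN, dN, dotrvZl, dZr) (dotrvC w z).
  field; by rewrite ?s1 ?t1 ?ts1.
rewrite -!invfM -!exprMn; congr (_ ^- _).
have p0 : 0 <= pi :> R by exact: pi_ge0.
rewrite -!sqrtrM ?mulr_ge0 ?(ltW s0) ?(ltW ts0)//.
by congr Num.sqrt; field.
Qed.

Definition hconv s (u : Rn -> R) (x : Rn) : R := \int[leb]_z (heat s z * u (x + z)).

Lemma Rintegral_heat t (v : R) : 0 < t -> \int[leb]_h (heat t h * v) = v.
Proof.
move=> t0; rewrite RintegralZr//; last first.
  apply: (@integrable_EFin_le _ _ _ _ _ (heat t) 1); try exact: measurable_heat1.
  - by move=> h; rewrite ger0_norm// heat_ge0.
  - by rewrite integral_heat.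
by rewrite /Rintegral integral_heat//= mul1r.
Qed.

(** After Fubini and [heat_mul] the inner integral is a Gaussian mean in z: the variable w - z has
    mean (t / (t + s)) w, its centred part integrates to 0, and the factor t cancels the 1/t of
    [heatdiv t]. *)
Lemma heatdiv_semigroup s t M L phi (x : Rn) : bndlip M L phi -> 0 < s -> 0 < t ->
  hconv s (heatdiv t phi) x = heatdiv (t + s) phi x.
Proof.
move=> bl s0 t0; have [mp bp lp] := bl; have M0 := bndlip_ge0 bl.
have ts0 : 0 < t + s by rewrite addr_gt0.
pose F (z : Rn * Rn) := heat s z.1 * (heat t (z.2 - z.1) * dotrv (z.2 - z.1) (phi (x + z.2)) / t).
have m1 := @measurable_fst _ _ (Rn : measurableType _) (Rn : measurableType _).
have m2 := @measurable_snd _ _ (Rn : measurableType _) (Rn : measurableType _).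
have m21 : measurable_fun setT (fun z : Rn * Rn => z.2 - z.1).
  by apply: measurable_rV_add => //; exact: measurable_rV_opp.
have mF : measurable_fun setT F.
  apply: measurable_funM; first exact: measurable_heat.
  by apply: measurable_heat_dotrv => //; exact: measurable_rV_add.
transitivity (\int[leb]_z \int[leb]_w F (z, w)).
  apply: eq_Rintegral => z _; rewrite /F/=.
  rewrite /heatdiv -RintegralZl//; last exact: heatdiv_integrable bl t0.
  pose G h := heat s z * (heat t h * dotrv h (phi (x + z + h)) / t).
  have mG : measurable_fun setT G.
    by apply: measurable_funM => //; apply: measurable_heat_dotrv => //; exact: measurable_rV_add.
  rewrite -[LHS]/(\int[leb]_h G h) -(Rintegral_rV_shift (- z) mG).
  by apply: eq_Rintegral => w _; rewrite /G; congr (_ * (_ * dotrv _ (phi _) / _)); rewrite addrACA subrr addr0.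
rewrite Rintegral_fubini//; last first.
  have B0 : 0 <= M / t * (cheat * Num.sqrt t).
    by rewrite !mulr_ge0 ?cheat_ge0 ?sqrtr_ge0 ?invr_ge0 ?(ltW t0).
  apply: (@le_lt_trans _ _ (\int[leb]_z (M / t * (cheat * Num.sqrt t) * heat s z)%:E)%E); last first.
    rewrite ge0_integralZ_EFin ?integral_heat ?mule1 ?ltry//; first exact: measurable_heat1.
    by move=> z; exact: heat_ge0.
  have mFa : measurable_fun setT (fun z => `|F z|%:E).
    by apply/measurable_EFinP; exact: measurableT_comp.
  apply: ge0_le_integral => //.
  - by move=> z _; exact: integral_ge0.
  - exact: (@measurable_fun_fubini_tonelli_F _ _ _ _ _ leb _ mFa).
  - by apply/measurable_EFinP; apply: measurable_funM => //; exact: measurable_heat1.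
  move=> z _.
  have mH : measurable_fun setT (fun w : Rn => (heat s z * (M / t) * (heat t (w - z) * enorm (w - z)))).
    apply: measurable_funM => //; apply: measurable_funM.
      by apply: measurable_heat => //; exact: measurable_rV_add.
    by apply: measurable_enorm; exact: measurable_rV_add.
  apply: (@le_trans _ _ (\int[leb]_w (heat s z * (M / t) * (heat t (w - z) * enorm (w - z)))%:E)%E).
    apply: ge0_le_integral_EFin => //.
    + exact: (measurableT_comp (measurableT_comp (@normr_measurable R setT) mF) (measurable_pair1 z)).
    move=> w; rewrite /F/= (normrM (heat s z)) (normrM (heat t _ * _)) (normrM (heat t _)) !(ger0_norm (heat_ge0 _ _)).
    rewrite (@ger0_norm _ t^-1) ?invr_ge0 ?(ltW t0)//.
    have -> : heat s z * (M / t) * (heat t (w - z) * enorm (w - z)) = heat s z * (heat t (w - z) * (enorm (w - z) * M) / t) by ring.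
    rewrite ler_wpM2l ?heat_ge0// ler_wpM2r ?invr_ge0 ?(ltW t0)// ler_wpM2l ?heat_ge0//.
    by apply: le_trans (normr_dotrv_le _ _) _; rewrite ler_wpM2l ?enorm_ge0.
  have mK : measurable_fun setT (fun w : Rn => (heat s z * (M / t) * (heat t w * enorm w))%:E).
    apply/measurable_EFinP; apply: measurable_funM => //.
    by apply: measurable_funM; [exact: measurable_heat1|exact: measurable_enorm].
  have K0 (w : Rn) : (0 <= (heat s z * (M / t) * (heat t w * enorm w))%:E)%E.
    by rewrite lee_fin; exact: mulr_ge0 (mulr_ge0 (heat_ge0 _ _) (divr_ge0 M0 (ltW t0))) (mulr_ge0 (heat_ge0 _ _) (enorm_ge0 _)).
  have -> := ge0_integral_rV_shift (- z) mK K0.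
  have -> : M / t * (cheat * Num.sqrt t) * heat s z = heat s z * (M / t) * (cheat * Num.sqrt t) by ring.
  apply: ge0_integralZ_EFin_le.
  - exact: mulr_ge0 (heat_ge0 _ _) (divr_ge0 M0 (ltW t0)).
  - by apply: measurable_funM; [exact: measurable_heat1|exact: measurable_enorm].
  - by move=> w; rewrite mulr_ge0 ?heat_ge0 ?enorm_ge0.
  - exact: integral_heat_enorm.
apply: eq_Rintegral => w _; rewrite /F/=.
set v := phi (x + w).
have sig0 : 0 < s * t / (t + s) by rewrite divr_gt0// mulr_gt0.
pose G z := heat (t + s) w * heat (s * t / (t + s)) (z - (s / (t + s)) *: w) * dotrv (w - z) v / t.
transitivity (\int[leb]_z G z).
  by apply: eq_Rintegral => z _; rewrite /G -(heat_mul z w s0 t0) !mulrA.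
have mG : measurable_fun setT G.
  apply: measurable_funM => //; apply: measurable_funM; last first.
    by apply: measurable_dotrv => //; apply: measurable_rV_add => //; exact: measurable_rV_opp.
  by apply: measurable_funM => //; apply: measurable_heat => //; exact: measurable_rV_add.
rewrite -(Rintegral_rV_shift ((s / (t + s)) *: w) mG).
set sg := s * t / (t + s).
have ig := integrable_heat_dotrv v sig0.
have ih : leb.-integrable setT (EFin \o (fun z => heat sg z * (t / (t + s) * dotrv w v))).
  apply: (@integrable_EFin_le _ _ _ _ _ (fun z => `|t / (t + s) * dotrv w v| * heat sg z) (`|t / (t + s) * dotrv w v| * 1)).
  - by apply: measurable_funM => //; exact: measurable_heat1.
  - by apply: measurable_funM => //; exact: measurable_heat1.
  - by move=> z; rewrite normrM (ger0_norm (heat_ge0 _ _)) mulrC.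
  - apply: ge0_integralZ_EFin_le => //; first exact: measurable_heat1.
    + by move=> z; exact: heat_ge0.
    + by rewrite integral_heat.
transitivity (\int[leb]_z (heat (t + s) w / t * (heat sg z * (t / (t + s) * dotrv w v) - heat sg z * dotrv z v))).
  apply: eq_Rintegral => z _; rewrite /G addrK -/sg.
  have -> : w - (z + (s / (t + s)) *: w) = (t / (t + s)) *: w - z.
    rewrite opprD addrCA addrC -scaleNr -{1}(scale1r w) -scalerDl; congr (_ *: _ - _).
    by field; rewrite gt_eqF.
  rewrite dotrvDl dotrvN dotrvZl.
  by move: (heat _ _) (heat _ _) (dotrv _ _) (dotrv _ _) => A B C D; ring.
rewrite RintegralZl//; last first.
  rewrite (_ : _ \o _ = (fun z => (EFin \o (fun z => heat sg z * (t / (t + s) * dotrv w v))%R) z - (EFin \o (fun h => heat sg h * dotrv h v)%R) z)%E)//.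
  exact: integrableB.
rewrite (RintegralB _ ih ig)// Rintegral_heat// Rintegral_heat_dotrv// subr0.
by field; rewrite !gt_eqF.
Qed.

End heat.

Lemma Rintegral_fubini' {R : realType} d1 d2 (X : measurableType d1) (Y : measurableType d2)
    (m1 : {sigma_finite_measure set X -> \bar R}) (m2 : {sigma_finite_measure set Y -> \bar R})
    (f : X * Y -> R) :
  measurable_fun setT f ->
  (\int[m2]_y \int[m1]_x `|f (x, y)|%:E < +oo)%E ->
  \int[m1]_x \int[m2]_y f (x, y) = \int[m2]_y \int[m1]_x f (x, y).
Proof.
move=> mf foo; apply: Rintegral_fubini => //.
rewrite (fubini_tonelli (fun z => `|f z|%:E))//.
by apply/measurable_EFinP; exact: measurableT_comp.
Qed.

Lemma iterated_integral_lty {R : realType} d1 d2 (X : measurableType d1) (Y : measurableType d2)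
    (m1 : {measure set X -> \bar R}) (m2 : {sigma_finite_measure set Y -> \bar R})
    (f : X * Y -> R) (g : X -> R) :
  measurable_fun setT f -> measurable_fun setT g ->
  (forall x, \int[m2]_y `|f (x, y)|%:E <= (g x)%:E)%E -> (\int[m1]_x (g x)%:E < +oo)%E ->
  (\int[m1]_x \int[m2]_y `|f (x, y)|%:E < +oo)%E.
Proof.
move=> mf mg fg; apply: le_lt_trans.
have mFa : measurable_fun setT (fun z => `|f z|%:E).
  by apply/measurable_EFinP; exact: measurableT_comp.
apply: ge0_le_integral => //.
- by move=> x _; exact: integral_ge0.
- exact: (@measurable_fun_fubini_tonelli_F _ _ _ _ _ m2 _ mFa).
- exact/measurable_EFinP.
Qed.

Lemma iterated_integral_lty2 {R : realType} d1 d2 (X : measurableType d1) (Y : measurableType d2)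
    (m1 : {sigma_finite_measure set X -> \bar R}) (m2 : {measure set Y -> \bar R})
    (f : X * Y -> R) (g : Y -> R) :
  measurable_fun setT f -> measurable_fun setT g ->
  (forall y, \int[m1]_x `|f (x, y)|%:E <= (g y)%:E)%E -> (\int[m2]_x (g x)%:E < +oo)%E ->
  (\int[m2]_y \int[m1]_x `|f (x, y)|%:E < +oo)%E.
Proof.
move=> mf mg fg; apply: le_lt_trans.
have mFa : measurable_fun setT (fun z => `|f z|%:E).
  by apply/measurable_EFinP; exact: measurableT_comp.
apply: ge0_le_integral => //.
- by move=> x _; exact: integral_ge0.
- exact: (@measurable_fun_fubini_tonelli_G _ _ _ _ _ m1 _ mFa).
- exact/measurable_EFinP.
Qed.

Lemma Rintegral_shift1 {R : realType} (s : R) (g : R -> R) : measurable_fun setT g ->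
  \int[lebesgue_measure]_t g t = \int[lebesgue_measure]_t g (t - s).
Proof.
move=> mg; pose T := measurableTypeR R.
have tr k : measurable_fun setT k -> (forall y, (0 <= k y)%E) ->
    (\int[lebesgue_measure]_y k y = 1%:E * \int[lebesgue_measure]_x k (1 * x - s)%R)%E.
  by move=> mk k0; have := @ge0_integral_affine R 1 (- s) k (oner_neq0 _) mk k0; rewrite normr1.
have -> := @Rintegral_ge0_transfer R _ _ T T lebesgue_measure lebesgue_measure 1 (fun x => 1 * x - s) ler01 tr _ mg.
by rewrite mul1r; apply: eq_Rintegral => t _; rewrite mul1r.
Qed.

(** * Subordination of the fractional kernel to Gaussians *)

Section subordination.
Context {R : realType} {n : nat}.
Local Notation Rn := 'rV[R]_n.
Local Notation leb := (@lebesgue_rV R n).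
Local Notation mu := (@lebesgue_measure R).
Local Notation RT := (measurableTypeR R).
Local Notation ch := (@cheat R n).
Implicit Types (t s : R) (phi : Rn -> Rn).

(** The exponent of the singular kernel as a power of |h|^2. *)
Definition qexp (a : R) : R := (n%:R + a + 1) / 2.

(* The factor [Gamma (qexp a)] of [frac_mu a] need not be related to the
   integral in the denominator: only continuity in [a] matters. *)
Definition Ka (a : R) : R :=
  @frac_mu R n a * Num.sqrt pi ^+ n / wint einv (- qexp a - 1).

Lemma sqrt_pit t : 0 < t -> Num.sqrt (pi * t) ^+ n = Num.sqrt pi ^+ n * t `^ (n%:R / 2).
Proof.
move=> t0; rewrite sqrtrM ?pi_ge0// exprMn; congr (_ * _).
by rewrite -powR12_sqrt ?(ltW t0)// -powR_mulrn ?powR_ge0// -powRrM mulrC.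
Qed.

Lemma dotrv_eq0 (h : Rn) : dotrv h h = 0 -> h = 0.
Proof.
move=> h0; apply/rowP => i; rewrite mxE; apply/eqP.
have : `|h 0 i| ^+ 2 <= 0.
  rewrite -h0 /dotrv (bigD1 i)//= real_normK ?num_real// expr2 lerDl.
  by apply: sumr_ge0 => j _; rewrite -expr2 sqr_ge0.
by rewrite real_normK ?num_real// => H; rewrite -sqrf_eq0 eq_le H sqr_ge0.
Qed.

Lemma integral_heat_enorm_le t (u : Rn -> R) K : 0 < t -> 0 <= K -> measurable_fun setT u ->
  (forall h, `|u h| <= K * enorm h) ->
  (\int[leb]_h `|heat t h * u h / t|%:E <= (ch * K * t `^ (- 2^-1))%:E)%E.
Proof.
move=> t0 K0 mu_ uK.
have mh := @measurable_heat1 R n t.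
apply: (@le_trans _ _ (\int[leb]_h (K / t * (heat t h * enorm h))%:E)%E).
  apply: ge0_le_integral_EFin => //.
  - by apply: measurableT_comp => //; apply: measurable_funM => //; exact: measurable_funM.
  - by apply: measurable_funM => //; apply: measurable_funM => //; exact: measurable_enorm.
  move=> h; rewrite (normrM (heat t h * _)) (normrM (heat t h)) (ger0_norm (heat_ge0 _ _)).
  rewrite (@ger0_norm _ t^-1) ?invr_ge0 ?(ltW t0)//.
  have -> : K / t * (heat t h * enorm h) = heat t h * (K * enorm h) / t.
    by move: (heat _ _) (enorm _) => A B; ring.
  by rewrite ler_wpM2r ?invr_ge0 ?(ltW t0)// ler_wpM2l ?heat_ge0.
have -> : ch * K * t `^ (- 2^-1) = K / t * (ch * Num.sqrt t).
  have st0 : Num.sqrt t != 0 by rewrite gt_eqF// sqrtr_gt0.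
  have -> : K / t = K / (Num.sqrt t ^+ 2) by rewrite sqr_sqrtr ?(ltW t0).
  rewrite powRN powR12_sqrt ?(ltW t0)//.
  by field.
apply: ge0_integralZ_EFin_le; last exact: integral_heat_enorm.
- by rewrite divr_ge0 ?(ltW t0).
- by apply: measurable_funM => //; exact: measurable_enorm.
- by move=> h; exact: mulr_ge0 (heat_ge0 _ _) (enorm_ge0 _).
Qed.

Lemma integral_heat_dotrv_le t (u : Rn -> R) K : 0 < t -> 0 <= K -> measurable_fun setT u ->
  (forall h, `|u h| <= K * dotrv h h) ->
  (\int[leb]_h `|heat t h * u h / t|%:E <= (ch * K)%:E)%E.
Proof.
move=> t0 K0 mu_ uK.
have mh := @measurable_heat1 R n t.
apply: (@le_trans _ _ (\int[leb]_h (K / t * (heat t h * dotrv h h))%:E)%E).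
  apply: ge0_le_integral_EFin => //.
  - by apply: measurableT_comp => //; apply: measurable_funM => //; exact: measurable_funM.
  - by apply: measurable_funM => //; apply: measurable_funM => //; exact: measurable_dotrv.
  move=> h; rewrite (normrM (heat t h * _)) (normrM (heat t h)) (ger0_norm (heat_ge0 _ _)).
  rewrite (@ger0_norm _ t^-1) ?invr_ge0 ?(ltW t0)//.
  have -> : K / t * (heat t h * dotrv h h) = heat t h * (K * dotrv h h) / t.
    by move: (heat _ _) (dotrv _ _) => A B; ring.
  by rewrite ler_wpM2r ?invr_ge0 ?(ltW t0)// ler_wpM2l ?heat_ge0.
have -> : ch * K = K / t * (ch * t) by field; rewrite gt_eqF.
apply: ge0_integralZ_EFin_le; last exact: integral_heat_dotrv.
- by rewrite divr_ge0 ?(ltW t0).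
- by apply: measurable_funM => //; exact: measurable_dotrv.
- by move=> h; exact: mulr_ge0 (heat_ge0 _ _) (dotrv_ge0 _).
Qed.

(** The kernel is replaced by its Gaussian mixture and the integrals are exchanged. The weight
    t^(-q-1), the Gaussian mass of order t^(n/2) and the factor t that compensates the 1/t of
    [heatdiv] combine to t^(-(a+1)/2). *)
Lemma frac_divE (a : R) M L phi x : 0 < a -> a < 1 -> 0 <= L -> bndlip M L phi ->
  frac_div a phi x = Ka a * fdiv a phi x.
Proof.
move=> a0 a1 L0 bl; have [mp bp lp] := bl; have M0 := bndlip_ge0 bl.
have n0 : 0 <= n%:R :> R by [].
have q0 : 0 < qexp a by rewrite /qexp; lra.
set q := qexp a in q0 *.
have I0 : 0 < wint einv (- q - 1).
  by apply: (wint_gt0 (P := [set p | p < -1])); [exact: admissible_einv|rewrite /=; lra].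
pose v h := dotrv h (phi (x + h) - phi x).
have mv : measurable_fun setT v.
  apply: measurable_dotrv => //; apply: measurable_rV_add => //.
  by apply: (measurableT_comp mp); exact: measurable_rV_add.
pose G (y : Rn) := dotrv (y - x) (phi y - phi x) / enorm (y - x) `^ (n%:R + a + 1).
have mG : measurable_fun setT G.
  have ms : measurable_fun setT (fun y : Rn => y - x) by exact: measurable_rV_add.
  apply: measurable_funM.
    by apply: measurable_dotrv => //; exact: measurable_rV_add.
  apply: (@measurableT_comp _ _ _ _ _ _ (fun x : R => x^-1)); first exact: measurable_invr.
  apply: (@measurableT_comp _ _ _ _ _ _ (@powR R ^~ (n%:R + a + 1))); first exact: measurable_powR.
  exact: measurable_enorm.
set I := wint einv (- q - 1) in I0 *.
(* Dividing by I makes the time integral of F reproduce the singular kernel exactly. *)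
pose F (z : Rn * R) := pw (- q - 1) z.2 * expR (- (dotrv z.1 z.1 / z.2)) * (v z.1 / I).
have m1 := @measurable_fst _ _ (Rn : measurableType _) RT.
have m2 := @measurable_snd _ _ (Rn : measurableType _) RT.
have mF : measurable_fun setT F.
  apply: measurable_funM; last by apply: measurable_funM => //; exact: (measurableT_comp mv m1).
  apply: measurable_funM; first exact: (measurableT_comp (measurable_pw _) m2).
  apply: measurableT_comp => //; apply: measurableT_comp => //; apply: measurable_funM.
    exact: measurable_dotrv.
  exact: (measurableT_comp (@measurable_invr R) m2).
have FE t h : 0 < t -> F (h, t) = Num.sqrt pi ^+ n / I * (pw (- ((a + 1) / 2)) t * (heat t h * v h / t)).
  move=> t0; rewrite /F/=.
  have -> : expR (- (dotrv h h / t)) = Num.sqrt (pi * t) ^+ n * heat t h.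
    by rewrite /heat mulrCA mulfV ?mulr1// gt_eqF// sqrt_pit_gt0.
  rewrite sqrt_pit// -(pw_pos (n%:R / 2))//.
  have -> : pw (- ((a + 1) / 2)) t = pw (- q - 1) t * pw (n%:R / 2) t * t.
    transitivity (pw (- q - 1) t * pw (n%:R / 2) t * pw 1 t); last by rewrite (pw_pos 1)// powRr1// ltW.
    by rewrite !pwM; congr (pw _ _); rewrite /q /qexp; field.
  move: (pw _ _) (pw _ _) (heat _ _) (v _) => A B C D /=.
  by field; rewrite !gt_eqF.
have Ft0 t h : t <= 0 -> F (h, t) = 0 by move=> t0; rewrite /F/= pw_neg// !mul0r.
have step1 : \int[leb]_y G y = \int[leb]_h \int[mu]_t F (h, t).
  rewrite -(Rintegral_rV_shift x mG); apply: eq_Rintegral => h _.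
  rewrite /G /F/= addrK [h + x]addrC -/(v h).
  (* At h = 0 the increment [v h] vanishes and both sides are 0; the subordination formula is
     applied for |h|^2 > 0. *)
  have [r0|r0] := eqVneq (dotrv h h) 0.
    have v0 : v h = 0 by rewrite /v (dotrv_eq0 r0) /dotrv big1// => i _; rewrite mxE mul0r.
    rewrite v0 !mul0r; under eq_Rintegral do rewrite mulr0.
    by rewrite Rintegral_cst// mul0r.
  have rp : 0 < dotrv h h by rewrite lt_neqAle eq_sym r0 dotrv_ge0.
  rewrite wint_einv_scale// -/I.
  have -> : enorm h `^ (n%:R + a + 1) = dotrv h h `^ q.
    by rewrite /enorm -powR12_sqrt ?dotrv_ge0// -powRrM; congr (_ `^ _); rewrite /q /qexp mulrC.
  rewrite powRN; field.
  by rewrite (gt_eqF I0)/= gt_eqF// powR_gt0.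
have Iv0 : 0 <= Num.sqrt pi ^+ n / I :> R by rewrite divr_ge0 ?(ltW I0)// exprn_ge0// sqrtr_ge0.
have vL h : `|v h| <= L * dotrv h h by exact: normr_dotrv_lip bl.
have vM h : `|v h| <= (2 * M) * enorm h.
  apply: le_trans (normr_dotrv_le _ _) _; rewrite mulrC ler_wpM2r ?enorm_ge0//.
  apply: le_trans (enormD _ _) _; rewrite mulr2n mulrDl mul1r lerD//.
  by rewrite /enorm dotrvN dotrvC dotrvN opprK; exact: bp.
(* The integrability behind Fubini: the Lipschitz bound on the increment for t <= 1, and the bound
   2M on it for t > 1. *)
have absF t : 0 < t -> (\int[leb]_h `|F (h, t)|%:E <=
    (Num.sqrt pi ^+ n / I * (ch * (2 * M + L)) * pw2 (- ((a + 1) / 2)) (- (a / 2) - 1) t)%:E)%E.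
  move=> t0.
  have mu1 : measurable_fun setT (fun h => heat t h * v h / t).
    by apply: measurable_funM => //; apply: measurable_funM => //; exact: measurable_heat1.
  have -> : (\int[leb]_h `|F (h, t)|%:E = \int[leb]_h ((Num.sqrt pi ^+ n / I * pw (- ((a + 1) / 2)) t) * `|heat t h * v h / t|)%:E)%E.
    apply: eq_integral => h _; congr EFin; rewrite FE//; set X := heat t h * v h / t.
    by rewrite (normrM (_ / I)) (normrM (pw _ _)) ger0_norm// (ger0_norm (pw_ge0 _ _)) mulrA.
  have c0 : 0 <= Num.sqrt pi ^+ n / I * pw (- ((a + 1) / 2)) t by rewrite mulr_ge0 ?pw_ge0.
  rewrite /pw2; have [t1|t1] := leP t 1.
    apply: (@le_trans _ _ ((Num.sqrt pi ^+ n / I * pw (- ((a + 1) / 2)) t) * (ch * L))%:E).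
      apply: ge0_integralZ_EFin_le => //; first exact: measurableT_comp.
      exact: integral_heat_dotrv_le.
    rewrite lee_fin -!mulrA ler_wpM2l ?exprn_ge0 ?sqrtr_ge0// ler_wpM2l ?invr_ge0 ?(ltW I0)//.
    rewrite mulrC -!mulrA ler_wpM2l ?cheat_ge0// ler_wpM2r ?pw_ge0// lerDr.
    by rewrite mulr_ge0.
  apply: (@le_trans _ _ ((Num.sqrt pi ^+ n / I * pw (- ((a + 1) / 2)) t) * (ch * (2 * M) * t `^ (- 2^-1)))%:E).
    apply: ge0_integralZ_EFin_le => //; first exact: measurableT_comp.
    by apply: integral_heat_enorm_le => //; rewrite mulr_ge0.
  have -> : pw (- (a / 2) - 1) t = pw (- ((a + 1) / 2)) t * t `^ (- 2^-1).
    by rewrite -(pw_pos (- 2^-1))// pwM; congr (pw _ _); field.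
  have e1 : Num.sqrt pi ^+ n / I * pw (- ((a + 1) / 2)) t * (ch * (2 * M) * t `^ (- 2^-1)) =
    Num.sqrt pi ^+ n / I * (ch * (2 * M)) * (pw (- ((a + 1) / 2)) t * t `^ (- 2^-1)) by ring.
  rewrite lee_fin e1 ler_wpM2r ?mulr_ge0 ?pw_ge0 ?powR_ge0//.
  by rewrite ler_wpM2l// ler_wpM2l ?cheat_ge0// lerDl.
have C0 : 0 <= Num.sqrt pi ^+ n / I * (ch * (2 * M + L)).
  by apply: mulr_ge0 => //; apply: mulr_ge0; [exact: cheat_ge0|rewrite addr_ge0// mulr_ge0].
have step2 : \int[leb]_h \int[mu]_t F (h, t) = Num.sqrt pi ^+ n / I * fdiv a phi x.
  rewrite (@Rintegral_fubini' _ _ _ Rn RT leb mu)//; last first.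
    apply: (@iterated_integral_lty2 _ _ _ Rn RT leb mu _ (fun t => Num.sqrt pi ^+ n / I * (ch * (2 * M + L)) * pw2 (- ((a + 1) / 2)) (- (a / 2) - 1) t)) => //.
    - by apply: measurable_funM => //; exact: measurable_pw2.
    - move=> t; have [t0|t0] := leP t 0; last exact: absF.
      rewrite integral0_eq; last by move=> h _; rewrite Ft0// normr0.
      by rewrite lee_fin mulr_ge0 ?pw2_ge0.
    - apply: le_lt_trans (ltry (Num.sqrt pi ^+ n / I * (ch * (2 * M + L)) * cfdiv a)).
      apply: (@ge0_integralZ_EFin_le _ _ RT mu) => //.
      + exact: measurable_pw2.
      + by move=> t; exact: pw2_ge0.
      + exact: integral_fdiv_dom.
  rewrite /fdiv -RintegralZl//; last exact: fdiv_integrable bl.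
  apply: eq_Rintegral => t _; have [t0|t0] := leP t 0.
    rewrite pw_neg// mul0r mulr0; under eq_Rintegral do rewrite Ft0//.
    by rewrite Rintegral_cst// mul0r.
  rewrite (heatdiv_diffE _ bl t0) mulrA -RintegralZl//; last first.
    apply: (@integrable_EFin_le _ _ _ _ _ (fun h => `|heat t h * v h / t|) (ch * L)) => //.
    + by apply: measurable_funM => //; apply: measurable_funM => //; exact: measurable_heat1.
    + apply: measurableT_comp => //.
      by apply: measurable_funM => //; apply: measurable_funM => //; exact: measurable_heat1.
    + exact: integral_heat_dotrv_le.
  by apply: eq_Rintegral => h _; rewrite FE//; exact: mulrA.
rewrite /frac_div -[X in _ * X = _]/(\int[leb]_y G y) step1 step2 /Ka -/q -/I.
by ring.
Qed.

End subordination.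

(** * Interpolation between fractional orders *)

Section interpolation.
Context {R : realType} {n : nat}.
Local Notation Rn := 'rV[R]_n.
Local Notation leb := (@lebesgue_rV R n).
Local Notation mu := (@lebesgue_measure R).
Local Notation RT := (measurableTypeR R).
Local Notation ch := (@cheat R n).
Implicit Types (t s : R) (phi : Rn -> Rn).

Lemma measurable_hconv d (T : measurableType d) (u : T -> R) (v : T -> Rn) (w : Rn -> R) :
  measurable_fun setT w -> measurable_fun setT u -> measurable_fun setT v ->
  measurable_fun setT (fun x => hconv (u x) w (v x)).
Proof.
move=> mw mu_ mv.
apply: (@measurable_Rintegral _ _ _ T _ leb (fun z => heat (u z.1) z.2 * w (v z.1 + z.2))).
have m1 := @measurable_fst _ _ T (Rn : measurableType _).
have m2 := @measurable_snd _ _ T (Rn : measurableType _).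
apply: measurable_funM.
  by apply: measurable_heat => //; exact: (measurableT_comp mu_ m1).
apply: (measurableT_comp mw); apply: measurable_rV_add => //.
exact: (measurableT_comp mv m1).
Qed.

Section fixed_test.
Variables (a M L : R) (phi : Rn -> Rn).
Hypotheses (a0 : 0 < a) (a1 : a < 1) (L0 : 0 <= L) (bl : bndlip M L phi).

Let mp : measurable_fun setT phi. Proof. by case: bl. Qed.
Let M0 : 0 <= M. Proof. exact: bndlip_ge0 bl. Qed.
Let D : R := ch * (M + L) * cfdiv a.
Let D0 : 0 <= D.
Proof. by rewrite /D mulr_ge0 ?cfdiv_ge0// mulr_ge0 ?cheat_ge0 ?addr_ge0. Qed.

Local Notation Q s x := (hconv s (fdiv a phi) x).

Lemma hconv_fdiv_le s x : 0 < s -> `|Q s x| <= D.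
Proof.
move=> s0; rewrite -[D]mulr1.
apply: (@normr_Rintegral_le _ _ _ leb _ (fun z => D * heat s z)).
- apply: measurable_funM; first exact: measurable_heat1.
  by apply: (measurableT_comp (measurable_fdiv a mp)); exact: measurable_rV_add.
- by apply: measurable_funM => //; exact: measurable_heat1.
- move=> z; rewrite normrM (ger0_norm (heat_ge0 _ _)) mulrC ler_wpM2r ?heat_ge0//.
  exact: fdiv_le.
- apply: ge0_integralZ_EFin_le => //; first exact: measurable_heat1.
  + by move=> z; exact: heat_ge0.
  + by rewrite integral_heat.
Qed.

(** The semigroup law moves the regularization by s into the time of [heatdiv], while the weight
    keeps the unshifted time. *)
Lemma hconv_fdivE s x : 0 < s ->
  Q s x = \int[mu]_t (pw (- ((a + 1) / 2)) t * heatdiv (t + s) phi x).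
Proof.
move=> s0.
have m1 := @measurable_fst _ _ (Rn : measurableType _) RT.
have m2 := @measurable_snd _ _ (Rn : measurableType _) RT.
pose F (z : Rn * R) := heat s z.1 * (pw (- ((a + 1) / 2)) z.2 * heatdiv z.2 phi (x + z.1)).
have mF : measurable_fun setT F.
  apply: measurable_funM; first exact: measurable_heat.
  apply: measurable_fdiv_integrand => //.
  exact: measurable_rV_add.
transitivity (\int[leb]_z \int[mu]_t F (z, t)).
  apply: eq_Rintegral => z _; rewrite /F/= /fdiv -RintegralZl//.
  exact: fdiv_integrable bl.
rewrite (@Rintegral_fubini _ _ _ Rn RT leb mu)//; last first.
  apply: (@iterated_integral_lty _ _ _ Rn RT leb mu _ (fun z => D * heat s z)) => //.
  - by apply: measurable_funM => //; exact: measurable_heat1.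
  - move=> z; rewrite /F/= (mulrC D).
    have -> : (\int[mu]_y `|heat s z * (pw (- ((a + 1) / 2)) y * heatdiv y phi (x + z))|%:E =
       \int[mu]_y (heat s z * `|pw (- ((a + 1) / 2)) y * heatdiv y phi (x + z)|)%:E)%E.
      by apply: eq_integral => y _; rewrite normrM (ger0_norm (heat_ge0 _ _)).
    apply: (@ge0_integralZ_EFin_le _ _ RT mu) => //; first exact: heat_ge0.
    + apply: measurableT_comp => //; exact: measurable_fdiv_integrand.
    apply: (@le_trans _ _ (\int[mu]_t (ch * (M + L) * pw2 (- ((a + 1) / 2)) (- (a / 2) - 1) t)%:E)%E).
      apply: (@ge0_le_integral_EFin _ _ RT mu) => //.
      * apply: measurableT_comp => //; exact: measurable_fdiv_integrand.
      * by apply: measurable_funM => //; exact: measurable_pw2.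
      * by move=> t; exact: fdiv_integrand_le bl.
    apply: (@ge0_integralZ_EFin_le _ _ RT mu) => //.
    + by rewrite mulr_ge0 ?cheat_ge0 ?addr_ge0.
    + exact: measurable_pw2.
    + by move=> t; exact: pw2_ge0.
    + exact: integral_fdiv_dom.
  - rewrite ge0_integralZ_EFin//; last 2 first.
    + exact: measurable_heat1.
    + by move=> z; exact: heat_ge0.
    by rewrite integral_heat// mule1 ltry.
apply: eq_Rintegral => t _; rewrite /F/=; have [t0|t0] := leP t 0.
  rewrite pw_neg// mul0r; under eq_Rintegral do rewrite mul0r mulr0.
  by rewrite Rintegral_cst// mul0r.
rewrite -(heatdiv_semigroup x bl s0 t0) /hconv -RintegralZl//.
  by apply: eq_Rintegral => z _; rewrite mulrCA.
apply: (@integrable_EFin_le _ _ _ leb _ (fun z => ch * L * heat s z) (ch * L * 1)).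
- apply: measurable_funM; first exact: measurable_heat1.
  by apply: measurable_heatdiv => //; exact: measurable_rV_add.
- by apply: measurable_funM => //; exact: measurable_heat1.
- move=> z; rewrite normrM (ger0_norm (heat_ge0 _ _)) mulrC ler_wpM2r ?heat_ge0//.
  exact: heatdiv_le_lip bl _.
- apply: ge0_integralZ_EFin_le => //; first by rewrite mulr_ge0 ?cheat_ge0.
  + exact: measurable_heat1.
  + by move=> z; exact: heat_ge0.
  + by rewrite integral_heat.
Qed.

(** The sup bound at time t + s gives an integral homogeneous in s, of degree 1 - (a+1)/2 - 1/2 =
    -a/2. The constant involves M but not L. *)
Lemma hconv_fdiv_far s x : 0 < s -> `|Q s x| <= ch * M * cfdiv a * pw (- (a / 2)) s.
Proof.
move=> s0; rewrite hconv_fdivE//.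
pose p := - ((a + 1) / 2).
have cM : 0 <= ch * M by rewrite mulr_ge0 ?cheat_ge0.
have mg : measurable_fun setT (fun t => pw p t * pw (- 2^-1) (t + s)).
  apply: measurable_funM; first exact: measurable_pw.
  apply: (@measurableT_comp _ _ _ _ _ _ (pw (- 2^-1))); first exact: measurable_pw.
  exact: measurable_funD.
have g0 t : 0 <= pw p t * pw (- 2^-1) (t + s) by rewrite mulr_ge0 ?pw_ge0.
apply: (@normr_Rintegral_le _ _ RT mu _ (fun t => ch * M * (pw p t * pw (- 2^-1) (t + s)))).
- apply: measurable_funM; first exact: measurable_pw.
  by apply: measurable_heatdiv => //; exact: measurable_funD.
- exact: measurable_funM.
- move=> t; rewrite normrM (ger0_norm (pw_ge0 _ _)); have [t0|t0] := leP t 0.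
    by rewrite pw_neg// !mul0r mulr0.
  rewrite mulrCA ler_wpM2l ?pw_ge0//.
  have ts0 : 0 < t + s by rewrite addr_gt0.
  by rewrite (pw_pos _ ts0); exact: (heatdiv_le x bl ts0).
rewrite -[X in (_ <= X%:E)%E]mulrA; apply: (@ge0_integralZ_EFin_le _ _ RT mu) => //.
have mg' : measurable_fun setT (fun t => (pw p t * pw (- 2^-1) (t + s))%:E) by exact/measurable_EFinP.
have g0' t : (0 <= (pw p t * pw (- 2^-1) (t + s))%:E)%E by rewrite lee_fin.
have -> := @ge0_integral_affine _ s 0 _ (lt0r_neq0 s0) mg' g0'.
rewrite (gtr0_norm s0).
have mh : measurable_fun setT (fun t => pw p t * pw (- 2^-1) (t + 1)).
  apply: measurable_funM; first exact: measurable_pw.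
  apply: (@measurableT_comp _ _ _ _ _ _ (pw (- 2^-1))); first exact: measurable_pw.
  exact: measurable_funD.
have -> : (\int[mu]_t (pw p (s * t + 0) * pw (- 2^-1) (s * t + 0 + s))%:E =
   (pw p s * pw (- 2^-1) s)%:E * \int[mu]_t (pw p t * pw (- 2^-1) (t + 1))%:E)%E.
  rewrite -(@ge0_integralZ_EFin _ _ RT mu)//; last 2 first.
  - by rewrite mulr_ge0 ?pw_ge0.
  - by move=> t; rewrite mulr_ge0 ?pw_ge0.
  apply: eq_integral => t _; rewrite addr0.
  have -> : s * t + s = s * (t + 1) by ring.
  by rewrite !pw_mulr//; congr EFin; ring.
rewrite muleA -EFinM.
have -> : s * (pw p s * pw (- 2^-1) s) = pw (- (a / 2)) s.
  transitivity (pw 1 s * (pw p s * pw (- 2^-1) s)); first by rewrite (pw_pos 1)// powRr1// ltW.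
  by rewrite !pwM; congr (pw _ _); rewrite /p; field.
rewrite [X in (_ <= X%:E)%E]mulrC EFinM; apply: lee_wpmul2l; first by rewrite lee_fin pw_ge0.
apply: le_trans (integral_fdiv_dom a0 a1).
apply: (@ge0_le_integral_EFin _ _ RT mu) => //.
- exact: measurable_pw2.
- by move=> t; rewrite mulr_ge0 ?pw_ge0.
move=> t; have [t0|t0] := leP t 0; first by rewrite pw_neg// mul0r pw2_ge0.
have t1 : 1 <= t + 1 by rewrite lerDr ltW.
have t10 : 0 < t + 1 by apply: lt_le_trans t1.
have n2 : - 2^-1 <= 0 :> R by rewrite oppr_le0 invr_ge0.
rewrite /pw2; have [t1'|t1'] := leP t 1.
  rewrite -/p -[leRHS]mulr1 ler_wpM2l ?pw_ge0//.
  by have := ge0_le_pw n2 t1; rewrite [leRHS]pw_pos// powRr0.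
have -> : pw (- (a / 2) - 1) t = pw p t * pw (- 2^-1) t.
  by rewrite pwM; congr (pw _ _); rewrite /p; field.
rewrite ler_wpM2l ?pw_ge0// !pw_pos// !powRN lef_pV2 ?posrE ?powR_gt0//.
by apply: ge0_ler_powR; rewrite ?nnegrE ?invr_ge0 ?(ltW t0) ?(ltW t10)// lerDl.
Qed.

(** Both bounds on [heatdiv] are nonincreasing in time, so adding s keeps the majorant of
    [fdiv_integrand_le]. *)
Lemma fdiv_shift_integrand_le s t x : 0 <= s ->
  `|pw (- ((a + 1) / 2)) t * heatdiv (t + s) phi x| <=
    ch * (M + L) * pw2 (- ((a + 1) / 2)) (- (a / 2) - 1) t.
Proof.
move=> s0; rewrite normrM (ger0_norm (pw_ge0 _ _)) /pw2.
have [t0|t0] := leP t 0.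
  rewrite (pw_neg _ t0) mul0r; apply: mulr_ge0; first by rewrite mulr_ge0 ?cheat_ge0 ?addr_ge0.
  by case: (t <= 1) => //; exact: pw_ge0.
have ts0 : 0 < t + s by rewrite ltr_wpDr.
have [t1|t1] := leP t 1.
  rewrite mulrC ler_wpM2r ?pw_ge0//; apply: le_trans (heatdiv_le_lip x L0 bl ts0) _.
  by rewrite ler_wpM2l ?cheat_ge0// lerDr.
have -> : pw (- (a / 2) - 1) t = pw (- ((a + 1) / 2)) t * t `^ (- 2^-1).
  by rewrite -(pw_pos (- 2^-1))// pwM; congr (pw _ _); field.
rewrite mulrCA ler_wpM2l ?pw_ge0//; apply: le_trans (heatdiv_le x bl ts0) _.
rewrite ler_pM ?mulr_ge0 ?cheat_ge0 ?powR_ge0//.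
  by rewrite ler_wpM2l ?cheat_ge0// lerDl.
rewrite !powRN lef_pV2 ?posrE ?powR_gt0//.
by apply: ge0_ler_powR; rewrite ?nnegrE ?invr_ge0 ?(ltW t0) ?(ltW ts0)// lerDl.
Qed.

(** With g = (a - b)/2 and c = (1 - a)/2 the weight of order a is t^(c-1); convolving it with
    s^(g-1) gives t^(g+c-1), and g + c - 1 = -(b+1)/2 is the exponent of order b. *)
Lemma integral_hconv_fdiv (b : R) x : 0 < b -> b < a ->
  \int[mu]_s (pw ((a - b) / 2 - 1) s * Q s x) =
  fine (beta2 ((a - b) / 2) ((1 - a) / 2)) * fdiv b phi x.
Proof.
move=> b0 ba; pose g : R := (a - b) / 2; have g0 : 0 < g by rewrite divr_gt0// subr_gt0.
pose c : R := (1 - a) / 2; have c0 : 0 < c by rewrite divr_gt0// subr_gt0.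
rewrite -/g -/c.
have B1 : (beta2 g c < +oo)%E by move: a0 a1 => h0 h1; apply: beta2_lty => //; rewrite /g /c; lra.
have B0 : (0 <= beta2 g c)%E by apply: integral_ge0 => s _; rewrite lee_fin mulr_ge0 ?pw_ge0.
have Bf : beta2 g c \is a fin_num by rewrite ge0_fin_numE.
have pE : - ((a + 1) / 2) = c - 1 by rewrite /c; field.
have b1 : b < 1 by exact: lt_trans a1.
have gcE : g + c - 1 = - ((b + 1) / 2) by rewrite /g /c; field.
have int_conv t : (\int[mu]_s (pw (g - 1) s * pw (c - 1) (t - s))%:E =
    (pw (- ((b + 1) / 2)) t * fine (beta2 g c))%:E)%E.
  by rewrite integral_pwconv// EFinM fineK// gcE.
have i_conv t : mu.-integrable setT (EFin \o (fun s => pw (g - 1) s * pw (c - 1) (t - s))).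
  apply: (@integrable_EFin_le _ _ RT mu _ (fun s => pw (g - 1) s * pw (c - 1) (t - s)) (pw (- ((b + 1) / 2)) t * fine (beta2 g c))).
  - exact: measurable_pwconv.
  - exact: measurable_pwconv.
  - by move=> s; rewrite ger0_norm// mulr_ge0 ?pw_ge0.
  - by rewrite int_conv.
pose F (z : R * R) := pw (g - 1) z.1 * (pw (c - 1) (z.2 - z.1) * heatdiv z.2 phi x).
have m1 := @measurable_fst _ _ RT RT.
have m2 := @measurable_snd _ _ RT RT.
have mF : measurable_fun setT F.
  apply: measurable_funM; first exact: (measurableT_comp (measurable_pw _) m1).
  apply: measurable_funM; last exact: measurable_heatdiv.
  apply: (@measurableT_comp _ _ _ _ _ _ (pw (c - 1))); first exact: measurable_pw.
  exact: measurable_funB.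
transitivity (\int[mu]_s \int[mu]_t F (s, t)).
  apply: eq_Rintegral => s _; have [s0|s0] := leP s 0.
    rewrite /F/= pw_neg// mul0r; under eq_Rintegral do rewrite mul0r.
    by rewrite Rintegral_cst// mul0r.
  rewrite (hconv_fdivE _ s0) -(RintegralZl (mu := mu))//; last first.
    apply: (@integrable_dom R _ (- ((a + 1) / 2)) (- (a / 2) - 1) (ch * (M + L))).
    - apply: measurable_funM; first exact: measurable_pw.
      by apply: measurable_heatdiv => //; exact: measurable_funD.
    - by move: a0 a1 => h0 h1; rewrite ltrN2 ltr_pdivrMr// mul1r; lra.
    - by rewrite ltrBlDl subrr oppr_lt0 divr_gt0.
    - by move=> t; apply: fdiv_shift_integrand_le; exact: ltW.
  have mG : measurable_fun setT (fun t => pw (g - 1) s * (pw (- ((a + 1) / 2)) t * heatdiv (t + s) phi x)).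
    apply: measurable_funM => //; apply: measurable_funM; first exact: measurable_pw.
    by apply: measurable_heatdiv => //; exact: measurable_funD.
  (* Replacing t by t - s frees the heat time from s, so that after Fubini s occurs only in the two
     powers. *)
  rewrite (Rintegral_shift1 s mG).
  by apply: eq_Rintegral => t _; rewrite subrK pE.
have mb : measurable_fun setT (fun t => pw (- ((b + 1) / 2)) t * heatdiv t phi x).
  exact: measurable_fdiv_integrand.
rewrite (@Rintegral_fubini' _ _ _ RT RT mu mu)//; last first.
  apply: (@iterated_integral_lty2 _ _ _ RT RT mu mu _ (fun t => fine (beta2 g c) * `|pw (- ((b + 1) / 2)) t * heatdiv t phi x|)) => //.
  - by apply: measurable_funM => //; exact: measurableT_comp.
  - move=> t; have -> : (\int[mu]_s `|F (s, t)|%:E = \int[mu]_s (`|heatdiv t phi x| * (pw (g - 1) s * pw (c - 1) (t - s)))%:E)%E.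
      apply: eq_integral => s _; congr EFin; rewrite /F/= !normrM !(ger0_norm (pw_ge0 _ _)).
      by rewrite mulrA mulrC.
    rewrite (@ge0_integralZ_EFin _ _ RT mu)//; last 2 first.
    + exact: measurable_pwconv.
    + by move=> s; rewrite mulr_ge0 ?pw_ge0.
    rewrite int_conv -EFinM lee_fin normrM (ger0_norm (pw_ge0 _ _)).
    by rewrite le_eqVlt; apply/orP; left; apply/eqP; ring.
  - have fB : 0 <= fine (beta2 g c) by exact: fine_ge0.
    apply: le_lt_trans (ltry (fine (beta2 g c) * (ch * (M + L) * cfdiv b))).
    apply: (@ge0_integralZ_EFin_le _ _ RT mu) => //; first exact: measurableT_comp.
    apply: (@le_trans _ _ (\int[mu]_t (ch * (M + L) * pw2 (- ((b + 1) / 2)) (- (b / 2) - 1) t)%:E)%E).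
      apply: (@ge0_le_integral_EFin _ _ RT mu) => //.
      + exact: measurableT_comp.
      + by apply: measurable_funM => //; exact: measurable_pw2.
      + by move=> t; exact: fdiv_integrand_le bl.
    apply: (@ge0_integralZ_EFin_le _ _ RT mu) => //.
    + by rewrite mulr_ge0 ?cheat_ge0 ?addr_ge0.
    + exact: measurable_pw2.
    + by move=> t; exact: pw2_ge0.
    + exact: integral_fdiv_dom.
rewrite /fdiv -RintegralZl//; last by apply: fdiv_integrable bl.
apply: eq_Rintegral => t _; rewrite /F/=.
transitivity (\int[mu]_s (pw (g - 1) s * pw (c - 1) (t - s) * heatdiv t phi x)).
  by apply: eq_Rintegral => s _; rewrite mulrA.
rewrite RintegralZr//.
have -> : \int[mu]_s (pw (g - 1) s * pw (c - 1) (t - s)) = pw (- ((b + 1) / 2)) t * fine (beta2 g c).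
  by rewrite /Rintegral int_conv.
by ring.
Qed.

End fixed_test.

Section pairing.
Variables (f : Rn -> R) (N : R).
Hypotheses (mf : measurable_fun setT f) (fN : (\int[leb]_x `|f x|%:E <= N%:E)%E).

Definition fpair (a : R) phi : R := \int[leb]_x (f x * fdiv a phi x).

Let N0 : 0 <= N.
Proof. by rewrite -lee_fin; apply: le_trans fN; apply: integral_ge0 => x _; rewrite lee_fin. Qed.

Lemma integrable_pair (u : Rn -> R) (C : R) : 0 <= C -> measurable_fun setT u -> (forall x, `|u x| <= C) ->
  leb.-integrable setT (EFin \o (fun x => f x * u x)).
Proof.
move=> C0 mu_ uC; apply: (@integrable_EFin_le _ _ _ leb _ (fun x => C * `|f x|) (C * N)).
- exact: measurable_funM.
- by apply: measurable_funM => //; exact: measurableT_comp.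
- by move=> x; rewrite normrM mulrC ler_wpM2r.
- by apply: ge0_integralZ_EFin_le => //; exact: measurableT_comp.
Qed.

Lemma pair_le (u : Rn -> R) (C : R) : 0 <= C -> measurable_fun setT u -> (forall x, `|u x| <= C) ->
  `|\int[leb]_x (f x * u x)| <= C * N.
Proof.
move=> C0 mu_ uC; apply: (@normr_Rintegral_le _ _ _ leb _ (fun x => C * `|f x|)).
- exact: measurable_funM.
- by apply: measurable_funM => //; exact: measurableT_comp.
- by move=> x; rewrite normrM mulrC ler_wpM2r.
- by apply: ge0_integralZ_EFin_le => //; exact: measurableT_comp.
Qed.

Variables (a M L : R) (phi : Rn -> Rn).
Hypotheses (a0 : 0 < a) (a1 : a < 1) (L0 : 0 <= L) (bl : bndlip M L phi).

Let mp : measurable_fun setT phi. Proof. by case: bl. Qed.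
Let M0 : 0 <= M. Proof. exact: bndlip_ge0 bl. Qed.
Let D : R := ch * (M + L) * cfdiv a.
Let D0 : 0 <= D.
Proof. by rewrite /D mulr_ge0 ?cfdiv_ge0// mulr_ge0 ?cheat_ge0 ?addr_ge0. Qed.
Local Notation Q s x := (hconv s (fdiv a phi) x).

(** Regularizing the fractional divergence is averaging over translates of the test field, weighted
    by the heat kernel. *)
Lemma pair_hconv s : 0 < s ->
  \int[leb]_x (f x * Q s x) = \int[leb]_z (heat s z * fpair a (fun y => phi (y + z))).
Proof.
move=> s0.
have m1 := @measurable_fst _ _ (Rn : measurableType _) (Rn : measurableType _).
have m2 := @measurable_snd _ _ (Rn : measurableType _) (Rn : measurableType _).
pose F (w : Rn * Rn) := f w.1 * (heat s w.2 * fdiv a phi (w.1 + w.2)).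
have mF : measurable_fun setT F.
  apply: measurable_funM; first exact: (measurableT_comp mf m1).
  apply: measurable_funM; first exact: measurable_heat.
  by apply: (measurableT_comp (measurable_fdiv a mp)); exact: measurable_rV_add.
have mh := @measurable_heat1 R n s.
have mfd (x : Rn) : measurable_fun setT (fun z => heat s z * fdiv a phi (x + z)).
  apply: measurable_funM => //.
  by apply: (measurableT_comp (measurable_fdiv a mp)); exact: measurable_rV_add.
have dom (x z : Rn) : `|heat s z * fdiv a phi (x + z)| <= D * heat s z.
  by rewrite normrM (ger0_norm (heat_ge0 _ _)) mulrC ler_wpM2r ?heat_ge0//; exact: fdiv_le.
have iD : (\int[leb]_z (D * heat s z)%:E <= (D * 1)%:E)%E.
  apply: ge0_integralZ_EFin_le => //; first by move=> z; exact: heat_ge0.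
  by rewrite integral_heat.
transitivity (\int[leb]_x \int[leb]_z F (x, z)).
  apply: eq_Rintegral => x _; rewrite /F/= /hconv -RintegralZl//.
  apply: (@integrable_EFin_le _ _ _ leb _ (fun z => D * heat s z) (D * 1)) => //.
  exact: measurable_funM.
rewrite (@Rintegral_fubini _ _ _ Rn Rn leb leb)//; last first.
  apply: (@iterated_integral_lty _ _ _ Rn Rn leb leb _ (fun x => `|f x| * (D * 1))) => //.
  - by apply: measurable_funM => //; exact: measurableT_comp.
  - move=> x.
    have -> : (\int[leb]_z `|F (x, z)|%:E = \int[leb]_z (`|f x| * `|heat s z * fdiv a phi (x + z)|)%:E)%E.
      by apply: eq_integral => z _; rewrite /F normrM.
    apply: ge0_integralZ_EFin_le => //; first exact: measurableT_comp.
    apply: le_trans iD; apply: ge0_le_integral_EFin => //; first exact: measurableT_comp.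
    exact: measurable_funM.
  - under eq_integral do rewrite mulrC.
    apply: le_lt_trans (ltry (D * 1 * N)); apply: ge0_integralZ_EFin_le => //; first by rewrite mulr1.
    exact: measurableT_comp.
apply: eq_Rintegral => z _; rewrite /F/=.
transitivity (\int[leb]_x (heat s z * (f x * fdiv a (fun y => phi (y + z)) x))).
  by apply: eq_Rintegral => x _; rewrite mulrCA fdiv_shift.
have blz := bndlip_shift z bl; have [mpz _ _] := blz.
rewrite RintegralZl//; apply: (@integrable_pair _ D) => //; first exact: measurable_fdiv.
by move=> x; exact: fdiv_le blz.
Qed.

(** The translates share the bound m and the heat kernel has mass one, so regularization costs no
    constant. *)
Lemma pair_hconv_near (m s : R) : 0 < s -> 0 <= m -> (forall z, `|fpair a (fun y => phi (y + z))| <= m) ->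
  `|\int[leb]_x (f x * Q s x)| <= m.
Proof.
move=> s0 m0 fm; rewrite pair_hconv// -[m]mulr1.
have mh := @measurable_heat1 R n s.
have mfp : measurable_fun setT (fun z => fpair a (fun y => phi (y + z))).
  have m1 := @measurable_fst _ _ (Rn : measurableType _) (Rn : measurableType _).
  have m2 := @measurable_snd _ _ (Rn : measurableType _) (Rn : measurableType _).
  have -> : (fun z => fpair a (fun y => phi (y + z))) = (fun z => \int[leb]_x (f x * fdiv a phi (x + z))).
    by apply/funext => z; apply: eq_Rintegral => x _; rewrite fdiv_shift.
  apply: (@measurable_Rintegral _ _ _ (Rn : measurableType _) _ leb (fun w => f w.2 * fdiv a phi (w.2 + w.1))).
  apply: measurable_funM; first exact: (measurableT_comp mf m2).
  by apply: (measurableT_comp (measurable_fdiv a mp)); exact: measurable_rV_add.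
apply: (@normr_Rintegral_le _ _ _ leb _ (fun z => m * heat s z)).
- exact: measurable_funM.
- exact: measurable_funM.
- by move=> z; rewrite normrM (ger0_norm (heat_ge0 _ _)) mulrC ler_wpM2r ?heat_ge0.
- apply: ge0_integralZ_EFin_le => //; first by move=> z; exact: heat_ge0.
  by rewrite integral_heat.
Qed.

(* [fdiv b] is a Beta-weighted average of the heat regularizations of [fdiv a]
   (semigroup property): times s < 1 cost at most [m], and times s > 1 cost
   O(1) against a normalization of size 1 / (a - b). *)
Lemma fpair_interpolation (m b : R) : 0 < b -> b < a -> 0 <= m ->
  (forall z, `|fpair a (fun y => phi (y + z))| <= m) ->
  `|fpair b phi| <= m + ch * M * cfdiv a * N * (1 + 2 / b) * (a - b).
Proof.
move=> b0 ba m0 fm; pose g : R := (a - b) / 2; have g0 : 0 < g by rewrite divr_gt0// subr_gt0.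
pose c : R := (1 - a) / 2; have c0 : 0 < c by rewrite divr_gt0// subr_gt0.
have B1 : (beta2 g c < +oo)%E by move: a0 a1 => h0 h1; apply: beta2_lty => //; rewrite /g /c; lra.
have B0 : (0 <= beta2 g c)%E by apply: integral_ge0 => s _; rewrite lee_fin mulr_ge0 ?pw_ge0.
have Bf : beta2 g c \is a fin_num by rewrite ge0_fin_numE.
have c1 : c <= 1 by move: a0 a1 => h0 h1; rewrite /c; lra.
(* The lower bound 1 / (2g) of the Beta integral, with 2g = a - b. *)
have Bge : (a - b)^-1 <= fine (beta2 g c).
  have := beta2_ge g0 c1; rewrite -(fineK Bf) lee_fin.
  by have -> : g *+ 2 = a - b by rewrite /g; field.
set B := fine (beta2 g c) in Bge *.
have ab0 : 0 < a - b by rewrite subr_gt0.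
have Bp : 0 < B by apply: lt_le_trans Bge; rewrite invr_gt0.
have m1 := @measurable_fst _ _ (Rn : measurableType _) RT.
have m2 := @measurable_snd _ _ (Rn : measurableType _) RT.
have C0 : 0 <= ch * M * cfdiv a by rewrite mulr_ge0 ?cfdiv_ge0// mulr_ge0 ?cheat_ge0.
pose C := D + ch * M * cfdiv a.
have CC : 0 <= C by exact: addr_ge0.
have g1 : -1 < g - 1 by rewrite ltrBrDl subrr.
have g2 : g - 1 - a / 2 < -1 by rewrite /g; lra.
have Qle (s : R) x : 0 < s -> `|Q s x| <= D by move=> s0; exact: (hconv_fdiv_le a0 a1 L0 bl x s0).
have Qfar (s : R) x : 0 < s -> `|Q s x| <= ch * M * cfdiv a * pw (- (a / 2)) s by move=> s0; exact: (hconv_fdiv_far a0 a1 L0 bl x s0).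
have mQ d (T : measurableType d) (u : T -> R) (v : T -> Rn) : measurable_fun setT u -> measurable_fun setT v ->
    measurable_fun setT (fun i => Q (u i) (v i)).
  by move=> ? ?; apply: measurable_hconv => //; exact: measurable_fdiv.
pose F (w : Rn * R) := f w.1 * (pw (g - 1) w.2 * Q w.2 w.1).
have mF : measurable_fun setT F.
  apply: measurable_funM; first exact: (measurableT_comp mf m1).
  apply: measurable_funM; first exact: (measurableT_comp (measurable_pw _) m2).
  exact: mQ.
have pQ s x : `|pw (g - 1) s * Q s x| <= C * pw2 (g - 1) (g - 1 - a / 2) s.
  rewrite normrM (ger0_norm (pw_ge0 _ _)) /pw2; have [s0|s0] := leP s 0.
    rewrite (pw_neg _ s0) mul0r; apply: mulr_ge0 => //.
    by case: (s <= 1) => //; exact: pw_ge0.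
  have [s1|s1] := leP s 1.
    rewrite mulrC ler_wpM2r ?pw_ge0//; apply: le_trans (hconv_fdiv_le a0 a1 L0 bl x s0) _ => //.
    by rewrite lerDl.
  have -> : pw (g - 1 - a / 2) s = pw (g - 1) s * pw (- (a / 2)) s by rewrite pwM.
  rewrite mulrCA ler_wpM2l ?pw_ge0//; apply: le_trans (hconv_fdiv_far a0 a1 L0 bl x s0) _ => //.
  by rewrite ler_wpM2r ?pw_ge0// lerDr.
have BE : B * fpair b phi = \int[mu]_s (pw (g - 1) s * \int[leb]_x (f x * Q s x)).
  have b1 : b < 1 by exact: lt_trans a1.
  have iQ x : mu.-integrable setT (EFin \o (fun s => pw (g - 1) s * Q s x)).
    apply: (@integrable_dom R _ (g - 1) (g - 1 - a / 2) C) => //.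
    by apply: measurable_funM; [exact: measurable_pw|exact: mQ].
  rewrite /fpair -RintegralZl//; last first.
    apply: (@integrable_pair _ (ch * (M + L) * cfdiv b)).
    - by rewrite mulr_ge0 ?cfdiv_ge0// mulr_ge0 ?cheat_ge0 ?addr_ge0.
    - exact: measurable_fdiv.
    - by move=> x; exact: fdiv_le bl.
  transitivity (\int[leb]_x \int[mu]_s F (x, s)).
    apply: eq_Rintegral => x _; rewrite /F/= RintegralZl//.
    by rewrite (integral_hconv_fdiv a0 a1 L0 bl x b0 ba) -/g -/c -/B mulrCA.
  rewrite (@Rintegral_fubini _ _ _ Rn RT leb mu)//; last first.
    pose K := C * ((g - 1 + 1)^-1 - (g - 1 - a / 2 + 1)^-1).
    apply: (@iterated_integral_lty _ _ _ Rn RT leb mu _ (fun x => `|f x| * K)) => //.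
    - by apply: measurable_funM => //; exact: measurableT_comp.
    - move=> x.
      have mq : measurable_fun setT (fun s => pw (g - 1) s * Q s x).
        by apply: measurable_funM; [exact: measurable_pw|exact: mQ].
      have -> : (\int[mu]_s `|F (x, s)|%:E = \int[mu]_s (`|f x| * `|pw (g - 1) s * Q s x|)%:E)%E.
        by apply: eq_integral => s _; rewrite /F normrM.
      apply: (@ge0_integralZ_EFin_le _ _ RT mu) => //; first exact: measurableT_comp.
      apply: (@le_trans _ _ (\int[mu]_s (C * pw2 (g - 1) (g - 1 - a / 2) s)%:E)%E).
        apply: (@ge0_le_integral_EFin _ _ RT mu) => //; first exact: measurableT_comp.
        by apply: measurable_funM => //; exact: measurable_pw2.
      apply: (@ge0_integralZ_EFin_le _ _ RT mu) => //; first exact: measurable_pw2.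
      + by move=> s; exact: pw2_ge0.
      + exact: integral_pw2_le.
    - have K0 : 0 <= K.
        rewrite /K subrK mulr_ge0// subr_ge0 (@le_trans _ _ 0)// ?invr_ge0 ?(ltW g0)//.
        by rewrite invr_le0; apply: ltW; rewrite -ltrBrDr sub0r.
      under eq_integral do rewrite mulrC.
      apply: le_lt_trans (ltry (K * N)); apply: ge0_integralZ_EFin_le => //.
      exact: measurableT_comp.
  apply: eq_Rintegral => s _; rewrite /F/=; have [s0|s0] := leP s 0.
    rewrite pw_neg// mul0r; under eq_Rintegral do rewrite mul0r mulr0.
    by rewrite Rintegral_cst// mul0r.
  rewrite -RintegralZl//; first by apply: eq_Rintegral => x _; rewrite mulrCA.
  apply: (@integrable_pair _ D) => //; first exact: mQ.
  by move=> x; exact: Qle.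
have K0 : 0 <= ch * M * cfdiv a * N by rewrite mulr_ge0.
(* On ]0, 1[ the other Beta factor (1 - s)^(c-1) is at least 1, so this part of the weight has mass
   at most B, with constant exactly 1. *)
pose near s := if s < 1 then pw (g - 1) s else 0.
have mnear : measurable_fun setT near.
  by apply: measurable_fun_ifT => //; [exact: measurable_fun_ltr|exact: measurable_pw].
have near0 s : 0 <= near s by rewrite /near; case: ifP => // _; exact: pw_ge0.
have nearB : (\int[mu]_s (near s)%:E <= B%:E)%E.
  rewrite /B fineK//; apply: (@ge0_le_integral_EFin _ _ RT mu) => //.
  - exact: measurable_pwconv.
  move=> s; rewrite /near; case: ifPn => [s1|_]; last by rewrite mulr_ge0 ?pw_ge0.
  have [s0|s0] := leP s 0; first by rewrite pw_neg// mul0r.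
  rewrite -[leLHS]mulr1 ler_wpM2l ?pw_ge0//.
  have c2 : c - 1 <= 0 by rewrite subr_le0.
  have s2 : 1 - s <= 1 by rewrite lerBlDr lerDl ltW.
  have := le1_le_pw c2 s2; rewrite [X in X <= _]pw_pos ?subr_gt0// powRr0.
  by [].
have J : `|\int[mu]_s (pw (g - 1) s * \int[leb]_x (f x * Q s x))| <=
    m * B + ch * M * cfdiv a * N * (1 + 2 / b).
  have mg1 : measurable_fun setT (fun s => m * near s) by exact: measurable_funM.
  have mg2 : measurable_fun setT (fun s => ch * M * cfdiv a * N * pw2 0 (g - 1 - a / 2) s).
    by apply: measurable_funM => //; exact: measurable_pw2.
  apply: (@normr_Rintegral_le _ _ RT mu _ (fun s => m * near s + ch * M * cfdiv a * N * pw2 0 (g - 1 - a / 2) s)).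
  - apply: measurable_funM; first exact: measurable_pw.
    apply: (@measurable_Rintegral _ _ _ RT _ leb (fun w => f w.2 * Q w.1 w.2)).
    apply: measurable_funM; last exact: mQ.
    exact: (measurableT_comp mf).
  - exact: measurable_funD.
  - move=> s; rewrite normrM (ger0_norm (pw_ge0 _ _)); have [s0|s0] := leP s 0.
      rewrite (pw_neg _ s0) mul0r; apply: addr_ge0; first exact: mulr_ge0.
      by apply: mulr_ge0 => //; exact: pw2_ge0.
    have [s1|s1] := ltP s 1.
      rewrite /near s1 -[leLHS]addr0; apply: lerD; last by apply: mulr_ge0 => //; exact: pw2_ge0.
      rewrite mulrC ler_wpM2r ?pw_ge0//; exact: pair_hconv_near.
    rewrite -[leLHS]add0r; apply: lerD; first exact: mulr_ge0.
    have -> : pw2 0 (g - 1 - a / 2) s = pw (g - 1 - a / 2) s.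
      rewrite /pw2; case: ifPn => // s1'; have -> : s = 1 by apply/le_anti; rewrite s1 s1'.
      by rewrite !pw_pos// !powR1.
    have -> : pw (g - 1 - a / 2) s = pw (g - 1) s * pw (- (a / 2)) s by rewrite pwM.
    have -> : ch * M * cfdiv a * N * (pw (g - 1) s * pw (- (a / 2)) s) =
        pw (g - 1) s * (ch * M * cfdiv a * pw (- (a / 2)) s * N) by ring.
    rewrite ler_wpM2l ?pw_ge0//.
    apply: pair_le; first by rewrite mulr_ge0 ?pw_ge0.
      exact: mQ.
    by move=> x; exact: Qfar.
  rewrite (@ge0_integralD_EFin _ _ RT mu)//; last 2 first.
  - by move=> s; exact: mulr_ge0.
  - by move=> s; apply: mulr_ge0 => //; exact: pw2_ge0.
  rewrite EFinD; apply: leeD; first exact: (@ge0_integralZ_EFin_le _ _ RT mu).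
  apply: (@ge0_integralZ_EFin_le _ _ RT mu) => //; first exact: measurable_pw2.
    by move=> s; exact: pw2_ge0.
  have h01 : -1 < 0 :> R by rewrite ltrN10.
  apply: le_trans (integral_pw2_le h01 g2) _.
  rewrite lee_fin add0r invr1 lerD2l.
  (* The tail of exponent -b/2 - 1 contributes 2/b; the unit interval, with exponent 0, contributes
     the 1. *)
  have -> : g - 1 - a / 2 + 1 = - (b / 2) by rewrite /g; field.
  by rewrite invrN opprK invfM invrK mulrC.
rewrite -BE normrM (gtr0_norm Bp) in J.
have X : 0 <= ch * M * cfdiv a * N * (1 + 2 / b).
  by rewrite mulr_ge0// addr_ge0// divr_ge0// ltW.
(* Division by B returns m for the small s and gains the factor a - b for the large s. *)
have Bab : 1 <= B * (a - b) by rewrite -ler_pdivrMr ?mul1r// subr_gt0.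
rewrite -(ler_pM2l Bp); apply: (le_trans J).
have -> : B * (m + ch * M * cfdiv a * N * (1 + 2 / b) * (a - b)) =
  m * B + (ch * M * cfdiv a * N * (1 + 2 / b)) * (B * (a - b)) by ring.
by rewrite lerD2l ler_peMr.
Qed.

End pairing.
End interpolation.

(** * Smooth test functions *)

Section smooth_step.
Context {R : realType}.
Implicit Types (x y : R) (f g : R -> R).

(** The whole sequence of derivatives is the witness, so smoothness is proved by exhibiting
    formulas. *)
Definition smooth1 f := exists2 F : nat -> R -> R, F 0%N = f &
  forall k x, is_derive x (1 : R) (F k) (F k.+1 x).

Lemma is_derive_mull (c : R) f x (l : R) : is_derive x (1 : R) f l -> is_derive x (1 : R) (fun y => c * f y) (c * l).
Proof. by move=> d; exact: is_deriveZ. Qed.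

Lemma smooth1_derive f : smooth1 f -> exists2 g, smooth1 g & forall x, is_derive x (1 : R) f (g x).
Proof.
move=> [F <- dF]; exists (F 1%N); last exact: dF.
by exists (fun k => F k.+1) => // k x; exact: dF.
Qed.

Lemma smooth1_prim f g : smooth1 g -> (forall x, is_derive x (1 : R) f (g x)) -> smooth1 f.
Proof.
by move=> [F F0 dF] fg; exists (fun k => if k is k'.+1 then F k' else f) => // -[|k] x //=; rewrite F0.
Qed.

(** A linear combination is a list of coefficients and indices, and [D'] differentiates such a list
    formally; iterating it produces the sequence of derivatives. *)
Lemma smooth1_span (I : Type) (h : I -> R -> R) (D : I -> seq (R * I)) :
  (forall i x, is_derive x (1 : R) (h i) (\sum_(p <- D i) p.1 * h p.2 x)) ->
  forall l : seq (R * I), smooth1 (fun x => \sum_(p <- l) p.1 * h p.2 x).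
Proof.
move=> dh l.
pose D' (l : seq (R * I)) := flatten [seq [seq (p.1 * q.1, q.2) | q <- D p.2] | p <- l].
exists (fun k x => \sum_(p <- iter k D' l) p.1 * h p.2 x) => // k x.
rewrite [iter k.+1 _ _]/=; elim: (iter k D' l) => [|p m ih].
  rewrite /D'/= big_nil; under eq_fun do rewrite big_nil.
  exact: is_derive_cst.
under eq_fun do rewrite big_cons.
rewrite /D'/= big_cat/=; apply: is_deriveD => //.
rewrite big_map; under eq_bigr do rewrite -mulrA.
by rewrite -mulr_sumr; exact: is_derive_mull.
Qed.

(** The classical function exp(-1/x), with the negative powers that make the family closed under
    differentiation. *)
Definition flat (m : nat) (x : R) : R := if 0 < x then x^-1 ^+ m * expR (- x^-1) else 0.

(** The bound y^(m+2) exp(-y) <= (m+2)! at y = 1/x; vanishing to second order gives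
    differentiability at 0. *)
Lemma flat_le m x : `|flat m x| <= (m.+2)`!%:R * x ^+ 2.
Proof.
rewrite /flat; case: ifPn => x0; last by rewrite normr0 mulr_ge0 ?sqr_ge0.
have xi : 0 <= x^-1 by rewrite invr_ge0 ltW.
have h := pow_expR_bound m.+2 xi.
rewrite ger0_norm ?mulr_ge0 ?exprn_ge0 ?expR_ge0//.
have -> : x^-1 ^+ m * expR (- x^-1) = x^-1 ^+ m.+2 * expR (- x^-1) * x ^+ 2.
  by rewrite !exprS expr0; field; rewrite gt_eqF.
by rewrite ler_wpM2r ?sqr_ge0.
Qed.

Lemma is_derive_flat m x : is_derive x (1 : R) (flat m) (- m%:R * flat m.+1 x + flat m.+2 x).
Proof.
have [x0|x0|->] := ltgtP x 0.
- have -> : - m%:R * flat m.+1 x + flat m.+2 x = 0.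
    by rewrite /flat !ltNge (ltW x0)/= mulr0 addr0.
  have E : \near x, cst 0 x = flat m x.
    near=> y; have y0 : y < 0 by near: y; exact: lt_nbhsl.
    by rewrite /flat ltNge (ltW y0).
  by apply: near_eq_is_derive E _; exact: is_derive_cst.
- have E : \near x, ((fun y => y^-1) ^+ m * (expR \o (fun y => - y^-1))) x = flat m x.
    near=> y; have y0 : 0 < y by near: y; exact: lt_nbhsr.
    by rewrite /flat y0 !fctE.
  apply: near_eq_is_derive E _.
  have x1 : x != 0 by rewrite gt_eqF.
  have d1 : is_derive x (1 : R) (fun y => y^-1) (- x ^- 2 *: 1).
    exact: (@is_deriveV _ id x 1 1).
  have d2 := is_deriveX m d1.
  have d3 : is_derive x (1 : R) (fun y => - y^-1) (- (- x ^- 2 *: 1)) by exact: is_deriveN.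
  have d4 := @is_derive1_comp _ expR (fun y => - y^-1) x _ _ (is_derive_expR (- x^-1)) d3.
  have := is_deriveM d2 d4.
  rewrite /flat x0 /GRing.scale/= !fctE => d; apply: (@is_derive_eq _ _ _ _ _ _ _ _ d).
  rewrite !exprS; case: m {d2 d} => [|m]; first by rewrite !expr0; field.
  by rewrite /= !exprS; field.
- have -> : - m%:R * flat m.+1 0 + flat m.+2 0 = 0 :> R.
    by rewrite /flat ltxx mulr0 addr0.
  (* By [flat_le] the difference quotient at 0 is at most (m+2)! |h|. *)
  have cv : h^-1 *: (flat m (h *: 1 + 0) - flat m 0) @[h --> 0^'] --> (0 : R).
    apply/cvgrPdist_le => e e0.
    have m0 : 0 < (m.+2)`!%:R :> R by rewrite ltr0n fact_gt0.
    near=> h.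
    have h0 : h != 0 by near: h; exact: nbhs_dnbhs_neq.
    rewrite sub0r normrN /flat ltxx -/(flat m _) subr0 addr0 /GRing.scale/= mulr1 normrM normfV.
    rewrite mulrC ler_pdivrMr ?normr_gt0//; apply: le_trans (flat_le m h) _.
    rewrite -real_normK ?num_real// expr2 mulrA ler_wpM2r//.
    rewrite -ler_pdivlMl// mulrC.
    near: h; apply: dnbhs0_le; first by rewrite divr_gt0.
  split; first by apply/cvg_ex; exists 0.
  exact/cvg_lim.
Unshelve. all: by end_near. Qed.

Lemma smooth1_flat m : smooth1 (flat m).
Proof.
have -> : flat m = (fun x => \sum_(p <- [:: (1, m)]) p.1 * flat p.2 x).
  by apply/funext => x; rewrite big_seq1 mul1r.
apply: (@smooth1_span nat flat (fun m => [:: (- m%:R, m.+1); (1, m.+2)])) => i x.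
rewrite !big_cons big_nil/= mul1r addr0.
exact: is_derive_flat.
Qed.

(** By Leibniz the products of a derivative of f and a derivative of g form a family closed under
    differentiation. *)
Lemma smooth1M f g : smooth1 f -> smooth1 g -> smooth1 (f * g).
Proof.
move=> [F F0 dF] [G G0 dG].
have -> : f * g = (fun x => \sum_(p <- [:: (1 : R, (0%N, 0%N))]) p.1 * (F p.2.1 x * G p.2.2 x)).
  by apply/funext => x; rewrite big_seq1 mul1r/= F0 G0.
apply: (@smooth1_span (nat * nat) (fun ij x => F ij.1 x * G ij.2 x)
  (fun ij => [:: (1, (ij.1.+1, ij.2)); (1, (ij.1, ij.2.+1))])) => -[i j] x.
rewrite !big_cons big_nil/= !mul1r addr0.
have := is_deriveM (dF i x) (dG j x); rewrite /GRing.scale/= => d.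
by apply: (@is_derive_eq _ _ _ _ _ _ _ _ d); rewrite addrC [G j x * _]mulrC.
Qed.

Lemma smooth1D f g : smooth1 f -> smooth1 g -> smooth1 (f + g).
Proof.
by move=> [F F0 dF] [G G0 dG]; exists (fun k => F k + G k) => [|k x]; [rewrite F0 G0|exact: is_deriveD].
Qed.

Lemma smooth1Z (c : R) f : smooth1 f -> smooth1 (fun x => c * f x).
Proof.
move=> [F F0 dF]; exists (fun k x => c * F k x) => [|k x]; first by rewrite F0.
exact: is_derive_mull.
Qed.

Lemma smooth1_affine (c d : R) f : smooth1 f -> smooth1 (fun x => f (c * x + d)).
Proof.
move=> [F F0 dF]; exists (fun k x => c ^+ k * F k (c * x + d)) => [|k x].
  by apply/funext => x; rewrite expr0 mul1r F0.
have d1 : is_derive x (1 : R) (fun x => c * x + d) (c * 1 + 0).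
  by apply: is_deriveD; exact: is_derive_mull.
have := is_derive_mull (c ^+ k) (@is_derive1_comp _ (F k) (fun x => c * x + d) x _ _ (dF k (c * x + d)) d1).
move=> d'; apply: (@is_derive_eq _ _ _ _ _ _ _ _ d').
by rewrite exprS; ring.
Qed.

Lemma is_derive_continuous f x (l : R) : is_derive x (1 : R) f l -> {for x, continuous f}.
Proof. by move=> [d _]; apply: differentiable_continuous; exact/derivable1_diffP. Qed.

Lemma smooth1_continuous f : smooth1 f -> continuous f.
Proof. by move=> [F <- dF] x; exact: is_derive_continuous (dF 0%N x). Qed.

Definition bump1 (x : R) : R := flat 0 x * flat 0 (1 - x).

Lemma smooth1_bump1 : smooth1 bump1.
Proof.
have -> : bump1 = flat 0 * (fun x => flat 0 (-1 * x + 1)).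
  by apply/funext => x; rewrite /bump1 fctE; congr (_ * flat 0 _); ring.
by apply: smooth1M; [exact: smooth1_flat|apply: smooth1_affine; exact: smooth1_flat].
Qed.

Lemma bump1_ge0 x : 0 <= bump1 x.
Proof.
have h y : 0 <= flat 0 y by rewrite /flat; case: ifP => // _; rewrite expr0 mul1r expR_ge0.
exact: mulr_ge0.
Qed.

Lemma bump1_le0 x : x <= 0 -> bump1 x = 0.
Proof. by move=> x0; rewrite /bump1 /flat ltNge x0/= mul0r. Qed.

Lemma bump1_ge1 x : 1 <= x -> bump1 x = 0.
Proof. by move=> x0; rewrite /bump1 {2}/flat ltNge subr_le0 x0/= mulr0. Qed.

Lemma bump1_gt0 x : 0 < x -> x < 1 -> 0 < bump1 x.
Proof.
move=> x0 x1; rewrite /bump1 /flat x0 subr_gt0 x1 !expr0 !mul1r.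
by rewrite mulr_gt0// expR_gt0.
Qed.

Lemma bump1_le1 x : bump1 x <= 1.
Proof.
have h y : 0 <= flat 0 y <= 1.
  rewrite /flat; case: ifPn => [y0|_]; last by rewrite lexx ler01.
  by rewrite expr0 mul1r expR_ge0/= -[leRHS]expR0 ler_expR oppr_le0 invr_ge0 ltW.
have /andP[a b] := h x; have /andP[c d] := h (1 - x).
by rewrite /bump1 -[leRHS]mulr1 ler_pM.
Qed.

Local Notation mu := (@lebesgue_measure R).

Lemma integrable_bump1 (A : set R) : measurable A -> mu.-integrable A (EFin \o bump1).
Proof.
move=> mA; apply: (@integrableS _ (measurableTypeR R) _ mu setT) => //.
have cb := smooth1_continuous smooth1_bump1.
have mb : measurable_fun setT bump1 by exact: continuous_measurable_fun.
have mi : measurable_fun setT (\1_(`[0, 1]%classic) : R -> R) by exact: measurable_indic.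
apply: (@integrable_EFin_le _ _ (measurableTypeR R) mu _ (\1_(`[0, 1]%classic)) 1) => //.
- move=> x; rewrite ger0_norm ?bump1_ge0// indicE mem_setE in_itv/=.
  have [x0|x0] := leP 0 x; have [x1|x1] := leP x 1 => /=.
  + exact: bump1_le1.
  + by rewrite bump1_ge1// ltW.
  + by rewrite bump1_le0// ltW.
  + by rewrite bump1_le0// ltW.
- rewrite integral_indic// setIT /= lebesgue_measure_itv/= lte_fin ltr01.
  by rewrite oppr0 adde0.
Qed.

Let S0 (x : R) : R := \int[mu]_(t in `]-oo, x]) bump1 t.

Let dS0 x : is_derive x (1 : R) S0 (bump1 x).
Proof.
have x1 : x < x + 1 by rewrite ltrDl.
have i1 : mu.-integrable `]-oo, (x + 1)] (EFin \o bump1) by exact: integrable_bump1.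
have [||d1 d2] := @continuous_FTC1 R bump1 -oo%O x (x + 1) x1 i1.
- by rewrite ltNyr.
- exact: smooth1_continuous smooth1_bump1 x.
by split; [exact: d1|rewrite -derive1E; exact: d2].
Qed.

Let S0_homo : {homo S0 : x y / x <= y}.
Proof.
move=> x y xy; rewrite le_eqVlt in xy; case/predU1P : xy => [->//|xy].
have [||c _ E] := @MVT _ S0 bump1 x y xy.
- by move=> z _; exact: dS0.
- by apply: continuous_subspaceT => z; exact: is_derive_continuous (dS0 z).
by rewrite -subr_ge0 E mulr_ge0 ?bump1_ge0// subr_ge0 ltW.
Qed.

Let S0_le0 x : x <= 0 -> S0 x = 0.
Proof.
move=> x0; rewrite /S0 -[RHS](@Rintegral_set0 _ _ _ mu bump1) /Rintegral; congr fine.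
rewrite integral_set0; apply: integral0_eq => t /=; rewrite in_itv/= => tx.
by rewrite bump1_le0// (le_trans tx).
Qed.

Let S0_ge1 x : 1 <= x -> S0 x = S0 1.
Proof.
rewrite le_eqVlt => /predU1P[<-//|x1].
have [||c c1 E] := @MVT _ S0 bump1 1 x x1.
- by move=> z _; exact: dS0.
- by apply: continuous_subspaceT => z; exact: is_derive_continuous (dS0 z).
apply/eqP; rewrite -subr_eq0 E bump1_ge1 ?mul0r//.
by move: c1; rewrite in_itv/= => /andP[/ltW].
Qed.

Let S0_gt0 : 0 < S0 1.
Proof.
have [||c c1 E] := @MVT _ S0 bump1 0 1 ltr01.
- by move=> z _; exact: dS0.
- by apply: continuous_subspaceT => z; exact: is_derive_continuous (dS0 z).
have E0 := S0_le0 (lexx 0); rewrite E0 !subr0 mulr1 in E; rewrite E.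
by move: c1; rewrite in_itv/= => /andP[a b]; exact: bump1_gt0.
Qed.

(** S is the primitive of the bump supported in [0, 1], divided by the total integral; monotonicity
    and constancy outside [0, 1] come from the mean value theorem and the support of the bump. *)
Lemma smooth_step : exists S : R -> R, [/\ smooth1 S, {homo S : x y / x <= y},
  forall x, x <= 0 -> S x = 0 & forall x, 1 <= x -> S x = 1].
Proof.
exists (fun x => (S0 1)^-1 * S0 x); split.
- by apply: smooth1Z; exact: smooth1_prim smooth1_bump1 dS0.
- by move=> x y xy; rewrite ler_wpM2l ?invr_ge0 ?(ltW S0_gt0)//; exact: S0_homo.
- by move=> x x0; rewrite (S0_le0 x0) mulr0.
- by move=> x x1; rewrite (S0_ge1 x1) mulVf// gt_eqF// S0_gt0.
Qed.

End smooth_step.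

Lemma cont_comp (X Y Z : topologicalType) (f : X -> Y) (g : Y -> Z) :
  continuous f -> continuous g -> continuous (fun x => g (f x)).
Proof. by move=> cf cg x; apply: (@continuous_comp _ _ _ f g); [exact: cf|exact: cg]. Qed.

Lemma cont_cst (X Y : topologicalType) (y : Y) : continuous (fun _ : X => y).
Proof. by move=> x; exact: cst_continuous. Qed.

Section rV_norm.
Context {R : realType}.

Lemma normr_coord_le m (x : 'rV[R]_m) i : `|x 0 i| <= `|x|.
Proof.
rewrite [`|x|]/Num.norm/= mx_normrE.
exact: (le_bigmax_cond 0 (fun ij : 'I_1 * 'I_m => `|x ij.1 ij.2|) (j := (0, i))).
Qed.

Lemma normr_le_coord m (x : 'rV[R]_m) (r : R) : 0 <= r -> (forall i, `|x 0 i| <= r) -> `|x| <= r.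
Proof.
move=> r0 H; rewrite [`|x|]/Num.norm/= mx_normrE; apply: bigmax_le => // -[i j] _.
by rewrite ord1.
Qed.

Lemma normr_lt_coord m (x : 'rV[R]_m) (r : R) : 0 < r -> (forall i, `|x 0 i| < r) -> `|x| < r.
Proof.
move=> r0 H; rewrite [`|x|]/Num.norm/= mx_normrE; apply: bigmax_lt => // -[i j] _.
by rewrite ord1.
Qed.

Lemma cvg_rV m (I : Type) (F : set_system I) {FF : Filter F} (M : I -> 'rV[R]_m) (l : 'rV[R]_m) :
  (forall j, M x 0 j @[x --> F] --> l 0 j) -> M x @[x --> F] --> l.
Proof.
move=> H; apply/cvgrPdist_lt => e e0.
have : \forall x \near F, forall j, `|l 0 j - M x 0 j| < e.
  by apply: filter_forall => j; have /cvgrPdist_lt := H j; exact.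
apply: filterS => x Hx; apply: normr_lt_coord => // j.
by rewrite !mxE; exact: Hx.
Qed.

Lemma cont_rV (X : topologicalType) m (f : X -> 'rV[R]_m) : (forall i, continuous (fun x => f x 0 i : R)) -> continuous f.
Proof. by move=> H x; apply: cvg_rV => j; exact: H. Qed.

End rV_norm.

Section continuity.
Context {R : realType} {X : topologicalType} {W : normedModType R}.

Lemma cont_coord0 m i : continuous (fun x : 'rV[R]_m => x 0 i : R).
Proof. exact: coord_continuous. Qed.

Lemma cont_id : continuous (fun x : X => x).
Proof. by move=> x; exact: cvg_id. Qed.

Lemma contD (f g : X -> W) : continuous f -> continuous g -> continuous (fun x => f x + g x).
Proof. by move=> cf cg x; apply: (@continuousD _ _ _ f g); [exact: cf|exact: cg]. Qed.

Lemma contN (f : X -> W) : continuous f -> continuous (fun x => - f x).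
Proof. by move=> cf x; apply: (@continuousN _ _ _ f); exact: cf. Qed.

Lemma contB (f g : X -> W) : continuous f -> continuous g -> continuous (fun x => f x - g x).
Proof. by move=> cf cg x; apply: (@continuousB _ _ _ f g); [exact: cf|exact: cg]. Qed.

Lemma contZ (c : R) (f : X -> W) : continuous f -> continuous (fun x => c *: f x).
Proof. by move=> cf x; apply: cvgZr; exact: cf. Qed.

Lemma contM (f g : X -> R) : continuous f -> continuous g -> continuous (fun x => f x * g x).
Proof. by move=> cf cg x; apply: (@continuousM _ _ f g); [exact: cf|exact: cg]. Qed.

Lemma cont_norm (f : X -> W) : continuous f -> continuous (fun x => `|f x|).
Proof. by move=> cf; apply: (cont_comp cf); exact: norm_continuous. Qed.

Lemma cont_coord m (f : X -> 'rV[R]_m) i : continuous f -> continuous (fun x => f x 0 i : R).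
Proof. by move=> cf; apply: (cont_comp cf (g := fun v : 'rV[R]_m => v 0 i)); exact: coord_continuous. Qed.

Lemma cont_prod (I : Type) (r : seq I) (f : I -> X -> R) : (forall i, continuous (f i)) ->
  continuous (fun x => \prod_(i <- r) f i x).
Proof.
move=> cf; elim: r => [|i r ih].
  by under eq_fun do rewrite big_nil; exact: cont_cst.
by under eq_fun do rewrite big_cons; exact: contM.
Qed.

Lemma cont_sum (I : Type) (r : seq I) (f : I -> X -> W) : (forall i, continuous (f i)) ->
  continuous (fun x => \sum_(i <- r) f i x).
Proof.
move=> cf; elim: r => [|i r ih].
  by under eq_fun do rewrite big_nil; exact: cont_cst.
by under eq_fun do rewrite big_cons; exact: contD.
Qed.

End continuity.

(** * Smooth functions of several variables *)

Section smooth_rV.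
Context {R : realType} {n : nat}.
Local Notation Rn := 'rV[R]_n.
Implicit Types (W : normedModType R) (x y v : Rn).

(** The two difference quotients are the same function of h, so directional derivatives reduce to
    one variable. *)
Lemma is_derive_line W (f : Rn -> W) x v (t : R) (l : W) :
  is_derive (t *: v + x) v f l <-> is_derive t (1 : R) (fun s => f (s *: v + x)) l.
Proof.
have E : (fun h : R => h^-1 *: (f (h *: v + (t *: v + x)) - f (t *: v + x))) =
    (fun h : R => h^-1 *: (f ((h *: (1 : R) + t) *: v + x) - f (t *: v + x))).
  apply/funext => h; have -> : h *: (1 : R) = h by rewrite /GRing.scale/= mulr1.
  by rewrite scalerDl addrA.
split=> -[d <-]; split.
- by rewrite /derivable -E.
- by rewrite /derive -E.
- by rewrite /derivable E.
- by rewrite /derive E.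
Qed.

Lemma is_derive_line0 W (f : Rn -> W) x v (l : W) :
  is_derive x v f l <-> is_derive (0 : R) (1 : R) (fun s => f (s *: v + x)) l.
Proof. by rewrite -is_derive_line scale0r add0r. Qed.

Definition ei (i : 'I_n) : Rn := delta_mx 0 i.

(** A coinduction principle: each stability property of [smooth] below only has to exhibit a class
    closed under partial derivatives. *)
Lemma smooth_family W (S : set (Rn -> W)) :
  (forall g, S g -> continuous g /\ forall i, exists2 g', S g' & forall x, is_derive x (ei i) g (g' x)) ->
  forall g, S g -> smooth g.
Proof.
move=> HS g Sg.
have Si s : S (iter_partial s g).
  elim: s => [//|i s ih] /=; have [_ /(_ i)[g' Sg' dg]] := HS _ ih.
  suff -> : (fun x => 'D_(delta_mx 0 i) (iter_partial s g) x) = g' by [].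
  by apply/funext => x; exact: derive_val.
move=> s; have [cg dg] := HS _ (Si s); split => // i x.
by have [g' _ /(_ x)[]] := dg i.
Qed.

Lemma smooth_continuous W (g : Rn -> W) : smooth g -> continuous g.
Proof. by move=> /(_ [::])[]. Qed.

Lemma smooth_derive W (g : Rn -> W) i : smooth g ->
  exists2 g', smooth g' & forall x, is_derive x (ei i) g (g' x).
Proof.
move=> sg; exists (fun x => 'D_(delta_mx 0 i) g x) => [s|x].
  have := sg (rcons s i); rewrite -cats1 /iter_partial foldr_cat/=.
  by [].
by have [_ /(_ i x) d] := sg [::]; split.
Qed.

Lemma smoothD W (f g : Rn -> W) : smooth f -> smooth g -> smooth (fun x => f x + g x).
Proof.
move=> sf sg.
apply: (@smooth_family _ [set h | exists f g, [/\ smooth f, smooth g & h = (fun x => f x + g x)]]); last by exists f, g.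
move=> _ [f' [g' [sf' sg' ->]]]; split=> [|i].
  by apply: contD; exact: smooth_continuous.
have [f1 sf1 df1] := smooth_derive i sf'; have [g1 sg1 dg1] := smooth_derive i sg'.
exists (fun x => f1 x + g1 x); first by exists f1, g1.
by move=> x; exact: is_deriveD.
Qed.

Lemma smoothZ W (c : R) (f : Rn -> W) : smooth f -> smooth (fun x => c *: f x).
Proof.
move=> sf.
apply: (@smooth_family _ [set h | exists2 f, smooth f & h = (fun x => c *: f x)]); last by exists f.
move=> _ [f' sf' ->]; split=> [|i].
  by apply: contZ; exact: smooth_continuous.
have [f1 sf1 df1] := smooth_derive i sf'.
exists (fun x => c *: f1 x); first by exists f1.
by move=> x; exact: is_deriveZ.
Qed.

Lemma smooth0 W : smooth (fun _ : Rn => 0 : W).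
Proof.
apply: (@smooth_family _ [set h | h = (fun=> 0)]) => // _ ->; split=> [x|i]; first exact: cont_cst.
by exists (fun=> 0) => // x; exact: is_derive_cst.
Qed.

Lemma smooth_sum W (I : Type) (r : seq I) (f : I -> Rn -> W) : (forall i, smooth (f i)) ->
  smooth (fun x => \sum_(i <- r) f i x).
Proof.
move=> sf; elim: r => [|i r ih].
  by under eq_fun do rewrite big_nil; exact: smooth0.
by under eq_fun do rewrite big_cons; exact: smoothD.
Qed.

Lemma smooth_shift W (h : Rn) (f : Rn -> W) : smooth f -> smooth (fun x => f (x + h)).
Proof.
move=> sf.
apply: (@smooth_family _ [set g | exists2 f, smooth f & g = (fun x => f (x + h))]); last by exists f.
move=> _ [f' sf' ->]; split=> [|i].
  apply: (@cont_comp _ _ _ (fun x => x + h) f'); last exact: smooth_continuous.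
  by apply: contD; [exact: cont_id|exact: cont_cst].
have [f1 sf1 df1] := smooth_derive i sf'.
exists (fun x => f1 (x + h)); first by exists f1.
move=> x; have /is_derive_line0 := df1 (x + h) => d; apply/is_derive_line0.
by under eq_fun do rewrite -addrA.
Qed.

Lemma is_derive_mx m (M : Rn -> 'rV[R]_m) x v (l : 'rV[R]_m) :
  is_derive x v M l <-> forall j, is_derive x v (fun x => M x 0 j) (l 0 j).
Proof.
split=> [[d <-] j|H].
  have dj := (derivable_mxP M x v).1 d; split; first exact: dj.
  by rewrite derive_mx// mxE.
have d : derivable M x v by apply/derivable_mxP => i j; rewrite ord1; have [] := H j.
split => //; rewrite derive_mx//; apply/rowP => j; rewrite mxE.
exact: derive_val.
Qed.

Lemma smooth_scale_cst m (f : Rn -> R) (w : 'rV[R]_m) : smooth f -> smooth (fun x => f x *: w).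
Proof.
move=> sf.
apply: (@smooth_family _ [set g | exists2 f : Rn -> R, smooth f & g = (fun x => f x *: w)]); last by exists f.
move=> _ [f' sf' ->]; split=> [|i].
  apply: (@cont_rV R) => j; under eq_fun do rewrite mxE.
  by apply: contM; [exact: smooth_continuous|exact: cont_cst].
have [f1 sf1 df1] := smooth_derive i sf'.
exists (fun x => f1 x *: w); first by exists f1.
move=> x; apply/is_derive_mx => j; rewrite mxE.
have -> : (fun x => (f' x *: w) 0 j) = (fun x => w 0 j *: f' x).
  by apply/funext => y; rewrite mxE mulrC.
by rewrite [_ * w 0 j]mulrC; exact: is_deriveZ.
Qed.

Lemma smooth_coord m (phi : Rn -> 'rV[R]_m) j : smooth phi -> smooth (fun x => phi x 0 j : R).
Proof.
move=> sf.
apply: (@smooth_family _ [set g | exists2 f : Rn -> 'rV[R]_m, smooth f & g = (fun x => f x 0 j)]); last by exists phi.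
move=> _ [f' sf' ->]; split=> [|i].
  by apply: cont_coord; exact: smooth_continuous.
have [f1 sf1 df1] := smooth_derive i sf'.
exists (fun x => f1 x 0 j); first by exists f1.
by move=> x; have /is_derive_mx := df1 x.
Qed.

(** Differentiating in direction i replaces the i-th factor by its derivative, so tensor products of
    smooth factors form a closed class. *)
Lemma smooth_prod (h : 'I_n -> R -> R) : (forall i, smooth1 (h i)) ->
  smooth (fun x : Rn => \prod_i h i (x 0 i)).
Proof.
move=> sh.
apply: (@smooth_family _ [set g | exists2 h, (forall i, smooth1 (h i)) & g = (fun x : Rn => \prod_i h i (x 0 i))]); last by exists h.
move=> _ [k sk ->]; split=> [|i].
  apply: cont_prod => j; apply: (@cont_comp _ _ _ (fun x : Rn => x 0 j) (k j)).
    exact: cont_coord0.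
  exact: smooth1_continuous.
have [k' sk' dk'] := smooth1_derive (sk i).
pose K j := if j == i then k' else k j.
exists (fun x : Rn => \prod_j K j (x 0 j)).
  by exists K => // j; rewrite /K; case: ifP.
move=> x; apply/is_derive_line0.
pose c := \prod_(j | j != i) k j (x 0 j).
have -> : (fun s : R => \prod_j k j ((s *: ei i + x) 0 j)) = (fun s => c * k i (1 * s + x 0 i)).
  apply/funext => s; rewrite (bigD1 i)//= mulrC; congr (_ * _).
    by apply: eq_bigr => j ji; rewrite !mxE (negbTE ji) andbF mulr0 add0r.
  by rewrite !mxE !eqxx mulr1 mul1r.
have -> : \prod_j K j (x 0 j) = c * k' (x 0 i).
  rewrite (bigD1 i)//= {1}/K eqxx mulrC; congr (_ * _).
  by apply: eq_bigr => j ji; rewrite /K (negbTE ji).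
apply: is_derive_mull.
have d1 : is_derive (0 : R) (1 : R) (fun s => 1 * s + x 0 i) (1 * 1 + 0).
  by apply: is_deriveD; exact: is_derive_mull.
have dk : is_derive (1 * 0 + x 0 i) (1 : R) (k i) (k' (x 0 i)) by rewrite mulr0 add0r; exact: dk'.
have := @is_derive1_comp _ (k i) (fun s => 1 * s + x 0 i) 0 _ _ dk d1.
by rewrite addr0 mul1r mulr1.
Qed.

Lemma compactly_supportedP (W : normedModType R) (g : Rn -> W) :
  compactly_supported g <-> exists r : R, forall x, r < `|x| -> g x = 0.
Proof.
split=> [/compact_bounded|[r gr]].
  move=> /ex_strict_bound_gt0[r r0 H]; exists r => x rx; apply: contrapT => gx.
  by have := H x (subset_closure gx); rewrite /= ltNge (ltW rx).
apply: bounded_closed_compact; last exact: closed_closure.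
exists r; split; first exact: num_real.
move=> s rs x; have cl : closed [set y : Rn | `|y| <= s].
  apply: (@closed_comp _ _ (fun y : Rn => `|y|) [set t | t <= s]).
    by move=> y _; exact: norm_continuous.
  exact: closed_le.
move/closure_id : cl => -> /=; apply: closureS => y /= gy.
rewrite leNgt; apply/negP => sy; apply: gy; apply: gr; exact: lt_trans sy.
Qed.

Lemma Cc_bounded W (g : Rn -> W) : Cc g -> exists2 M : R, 0 <= M & forall x, `|g x| <= M.
Proof.
move=> [cg /compactly_supportedP[r gr]].
have K : compact [set x : Rn | `|x| <= r].
  apply: bounded_closed_compact.
    by exists r; split; [exact: num_real|move=> s rs x /= xr; rewrite (le_trans xr)// ltW].
  apply: (@closed_comp _ _ (fun y : Rn => `|y|) [set t | t <= r]).
    by move=> y _; exact: norm_continuous.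
  exact: closed_le.
have /compact_bounded/ex_strict_bound_gt0[M M0 HM] : compact (g @` [set x : Rn | `|x| <= r]).
  by apply: continuous_compact => //; exact: continuous_subspaceT.
exists M => [|x]; first exact: ltW.
have [xr|xr] := leP `|x| r; first by apply: ltW; apply: HM; exists x.
by rewrite gr// normr0 ltW.
Qed.

Lemma Cc_unif W (g : Rn -> W) : Cc g -> forall e : R, 0 < e ->
  exists2 d : R, 0 < d & forall x y, `|x - y| < d -> `|g x - g y| < e.
Proof.
move=> [cg /compactly_supportedP[r gr]] e e0.
have K : compact [set x : Rn | `|x| <= r + 1].
  apply: bounded_closed_compact.
    by exists (r + 1); split; [exact: num_real|move=> s rs x /= xr; rewrite (le_trans xr)// ltW].
  apply: (@closed_comp _ _ (fun y : Rn => `|y|) [set t | t <= r + 1]).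
    by move=> y _; exact: norm_continuous.
  exact: closed_le.
have near0 : \forall h \near (0 : Rn), [set x : Rn | `|x| <= r + 1] `<=` [set x | `|g (x + h) - g x| < e].
  move/compact_near_coveringP : K => /(_ Rn (nbhs (0 : Rn)) (fun h x => `|g (x + h) - g x| < e) _); apply => x _.
  have cF : continuous (fun z : Rn * Rn => g (z.1 + z.2) - g z.1).
    have c1 : continuous (fun z : Rn * Rn => z.1) by move=> z; exact: cvg_fst.
    have c2 : continuous (fun z : Rn * Rn => z.2) by move=> z; exact: cvg_snd.
    by apply: contB; apply: (fun h => cont_comp h cg) => //; exact: contD.
  have /cvgrPdist_lt/(_ _ e0) := cF (x : Rn, 0 : Rn).
  apply: filterS => -[y h] /=; rewrite addr0 subrr sub0r normrN; exact.
have /nbhs_ballP[d d0 Hd] := near0.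
(* With a distance below 1, a point y outside the ball of radius r + 1 forces x outside the support
   as well. *)
exists (Num.min d 1); first by rewrite lt_min d0 ltr01.
move=> x y; rewrite lt_min => /andP[xyd xy1].
have [yr|yr] := leP `|y| (r + 1).
  have {1}-> : x = y + (x - y) by rewrite addrC subrK.
  apply: (Hd (x - y)) => //.
  by rewrite -ball_normE /ball_/= sub0r normrN.
have xr : r < `|x|.
  have : `|y| <= `|y - x| + `|x| by rewrite -{1}(subrK x y) ler_normD.
  by rewrite distrC => h; lra.
by rewrite !gr ?subrr ?normr0//; lra.
Qed.

End smooth_rV.

Section enorm_facts.
Context {R : realType} {n : nat}.
Local Notation Rn := 'rV[R]_n.
Implicit Types (x y v : Rn).

Lemma normr_coord_le_enorm x i : `|x 0 i| <= enorm x.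
Proof.
rewrite -sqrtr_sqr /enorm ler_wsqrtr// /dotrv (bigD1 i)//= expr2 lerDl.
by apply: sumr_ge0 => j _; rewrite -expr2 sqr_ge0.
Qed.

Lemma enorm_sum (I : Type) (r : seq I) (P : pred I) (f : I -> Rn) :
  enorm (\sum_(i <- r | P i) f i) <= \sum_(i <- r | P i) enorm (f i).
Proof.
apply: (big_ind2 (fun x (y : R) => enorm x <= y)) => //; first by rewrite enorm0.
by move=> x1 y1 x2 y2 h1 h2; apply: le_trans (enormD _ _) _; exact: lerD.
Qed.

Lemma enormZ (c : R) x : enorm (c *: x) = `|c| * enorm x.
Proof.
rewrite /enorm -sqrtr_sqr -sqrtrM ?sqr_ge0//; congr Num.sqrt.
by rewrite /dotrv mulr_sumr; apply: eq_bigr => i _; rewrite !mxE; ring.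
Qed.

Lemma enormN x : enorm (- x) = enorm x.
Proof. by rewrite -scaleN1r enormZ normrN1 mul1r. Qed.

Lemma enorm_ei i : enorm (ei i : Rn) = 1.
Proof.
rewrite /enorm /dotrv (bigD1 i)//= big1 => [|j ji]; last by rewrite !mxE (negbTE ji) andbF mulr0.
by rewrite !mxE !eqxx mulr1 addr0 sqrtr1.
Qed.

Lemma rV_sum_ei x : x = \sum_i x 0 i *: (ei i : Rn).
Proof. exact: row_sum_delta. Qed.

Lemma enorm_le_sum x : enorm x <= \sum_i `|x 0 i|.
Proof.
rewrite {1}(rV_sum_ei x); apply: le_trans (enorm_sum _ _ _) _.
by apply: ler_sum => i _; rewrite enormZ enorm_ei mulr1.
Qed.

Lemma enorm_le_normr x : enorm x <= n%:R * `|x|.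
Proof.
apply: le_trans (enorm_le_sum x) _; rewrite -[n in n%:R]card_ord mulr_natl -sumr_const.
by apply: ler_sum => i _; exact: normr_coord_le.
Qed.

Lemma normr_le_enorm x : `|x| <= enorm x.
Proof. by apply: normr_le_coord => [|i]; [exact: enorm_ge0|exact: normr_coord_le_enorm]. Qed.

Lemma enorm_continuous : continuous (@enorm R n).
Proof.
apply: (@cont_comp _ _ _ (fun x => dotrv x x) Num.sqrt); last exact: sqrt_continuous.
by apply: cont_sum => i; apply: contM; exact: cont_coord0.
Qed.

End enorm_facts.

Lemma measurable_continuous_rV {R : realType} {n : nat} (f : 'rV[R]_n -> R) :
  continuous f -> measurable_fun setT f.
Proof.
move=> cf; apply: (measurability _ (RGenOpens.measurableE R)).
move=> _ [_ [a [b ->] <-]]; rewrite setTI; apply: open_measurable_rV.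
by apply: open_comp => // x _; exact: cf.
Qed.

(** * Smooth partitions of unity with small supports *)

Section partition_of_unity.
Context {R : realType} {n : nat}.
Local Notation Rn := 'rV[R]_n.

(** A product of one-dimensional partitions, each made of differences of a smooth step at
    consecutive grid points, whose sum telescopes. *)
Lemma smooth_partition (rho d : R) : 0 < d ->
  exists (J : finType) (w : J -> Rn -> R) (p : J -> Rn),
  [/\ forall j, Cc_infty (w j), forall j x, 0 <= w j x,
      forall x, \sum_j w j x <= 1, forall x, `|x| <= rho -> \sum_j w j x = 1 &
      forall j x, w j x != 0 -> `|x - p j| < d].
Proof.
move=> d0; have [S [sS ndS S0 S1]] := @smooth_step R.
(* Each difference of steps is supported where 0 < k t - l < 2 for a grid point l, an interval of
   length 2 / k = d. *)
pose k := 2 / d; have k0 : 0 < k by rewrite divr_gt0.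
(* The telescoped sum S(k t + N) - S(k t - N) equals 1 - 0 as soon as |k t| <= k |rho| < N - 1. *)
pose N := (Num.truncn (k * `|rho| + 1)).+1.
have NB : k * `|rho| + 1 < N%:R by rewrite truncnS_gt.
pose g (t : R) (l : 'I_(N + N)) : R := S (k * t - (l%:R - N%:R)) - S (k * t - (l%:R - N%:R) - 1).
have gs t : \sum_l g t l = S (k * t + N%:R) - S (k * t - N%:R).
  rewrite -(big_mkord predT (fun l : nat => S (k * t - (l%:R - N%:R)) - S (k * t - (l%:R - N%:R) - 1))).
  rewrite (eq_bigr (fun l => - (S (k * t + N%:R - l.+1%:R) - S (k * t + N%:R - l%:R)))); last first.
    move=> l _; rewrite [RHS]opprB -natr1.
    have -> : k * t - (l%:R - N%:R) = k * t + N%:R - l%:R by ring.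
    by have -> : k * t + N%:R - l%:R - 1 = k * t + N%:R - (l%:R + 1) by ring.
  rewrite sumrN (telescope_sumr (fun l : nat => S (k * t + N%:R - l%:R)))// opprB subr0 natrD; congr (_ - S _); ring.
have g0 t l : 0 <= g t l by rewrite subr_ge0; apply: ndS; lra.
have S01 t : 0 <= S t <= 1.
  have [t0|t0] := leP t 0; first by rewrite S0// lexx ler01.
  have [t1|t1] := leP 1 t; first by rewrite S1// lexx ler01.
  by rewrite -{1}(S0 0)// -(S1 1)// !ndS// ltW.
pose w (j : {ffun 'I_n -> 'I_(N + N)}) (x : Rn) := \prod_i g (x 0 i) (j i).
pose p (j : {ffun 'I_n -> 'I_(N + N)}) : Rn := \row_i (((j i)%:R - N%:R) / k).
(* The distributive law: the sum over all multi-indices of the products is the product of the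
   one-dimensional sums. *)
have ws x : \sum_j w j x = \prod_i (S (k * x 0 i + N%:R) - S (k * x 0 i - N%:R)).
  by rewrite /w -(bigA_distr_bigA (fun i l => g (x 0 i) l)); apply: eq_bigr => i _; rewrite gs.
have wp j x : w j x != 0 -> `|x - p j| < d.
  move=> wjx; apply: normr_lt_coord => // i; rewrite !mxE.
  have : g (x 0 i) (j i) != 0.
    by apply: contra wjx => /eqP gi; rewrite /w (bigD1 i)//= gi mul0r.
  rewrite /g; set a := (j i)%:R - N%:R => ga.
  have [h1|h1] := leP (k * x 0 i - a) 0.
    by move: ga; rewrite !S0 ?subrr ?eqxx//; lra.
  have [h2|h2] := leP 2 (k * x 0 i - a).
    by move: ga; rewrite !S1 ?subrr ?eqxx//; lra.
  have -> : x 0 i - a / k = (k * x 0 i - a) / k by field; rewrite gt_eqF.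
  rewrite gtr0_norm ?divr_gt0// ltr_pdivrMr//.
  by have -> : d * k = 2 by rewrite /k mulrC divfK// gt_eqF.
exists _, w, p; split => //.
- move=> j; split.
    apply: (@smooth_prod _ _ (fun i t => g t (j i))) => i.
    have -> : (fun t => g t (j i)) = (fun t => S (k * t + (N%:R - (j i)%:R))) +
      (fun t => -1 * S (k * t + (N%:R - (j i)%:R - 1))).
      by apply/funext => t; rewrite /g fctE mulN1r; congr (S _ - S _); ring.
    by apply: smooth1D; [exact: smooth1_affine|apply: smooth1Z; exact: smooth1_affine].
  apply/compactly_supportedP; exists (`|p j| + d) => x px; apply/eqP/negPn/negP => /wp wj.
  have := ler_normD (p j) (x - p j); rewrite addrC subrK => h; lra.
- by move=> j x; apply: prodr_ge0.
- move=> x; rewrite ws; apply: prodr_ile1 => i _.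
  have /andP[a0 a1] := S01 (k * x 0 i + N%:R); have /andP[b0 b1] := S01 (k * x 0 i - N%:R).
  apply/andP; split; last lra.
  by rewrite subr_ge0; apply: ndS; rewrite lerD2l; have := ler0n R N; lra.
- move=> x xr; rewrite ws big1// => i _.
  have xi : `|k * x 0 i| <= k * `|rho|.
    rewrite normrM (gtr0_norm k0) ler_pM2l//.
    by apply: le_trans (normr_coord_le _ _) _; apply: le_trans xr _; exact: ler_norm.
  move: xi; rewrite ler_norml => /andP[x1 x2].
  by rewrite S1 ?S0 ?subr0//; lra.
Qed.

End partition_of_unity.

(** * Approximation by smooth compactly supported fields *)

Section density.
Context {R : realType} {n : nat}.
Local Notation Rn := 'rV[R]_n.

Lemma compactly_supported_sum (W : normedModType R) (I : Type) (r : seq I) (f : I -> Rn -> W) :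
  (forall i, compactly_supported (f i)) -> compactly_supported (fun x => \sum_(i <- r) f i x).
Proof.
move=> cf; apply/compactly_supportedP; elim: r => [|i r [c ih]].
  by exists 0 => x _; rewrite big_nil.
have /compactly_supportedP[c' h] := cf i.
exists (Num.max c c') => x; rewrite gt_max => /andP[x1 x2].
by rewrite big_cons h// ih// addr0.
Qed.

Lemma Cc_infty_scale m (f : Rn -> R) (v : 'rV[R]_m) : Cc_infty f -> Cc_infty (fun x => f x *: v).
Proof.
move=> [sf /compactly_supportedP[r fr]]; split; first exact: smooth_scale_cst.
by apply/compactly_supportedP; exists r => x xr; rewrite fr// scale0r.
Qed.

Lemma Cc_infty_sum (W : normedModType R) (I : Type) (r : seq I) (f : I -> Rn -> W) :
  (forall i, Cc_infty (f i)) -> Cc_infty (fun x => \sum_(i <- r) f i x).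
Proof.
move=> Cf; split; first by apply: smooth_sum => i; have [] := Cf i.
by apply: compactly_supported_sum => i; have [] := Cf i.
Qed.

(** The approximation averages values of phi at nearby points with weights of sum at most 1, so it
    keeps the Euclidean bound c without loss, as duality with the total variation demands. *)
Lemma Cc_infty_dense_rV m (phi : Rn -> 'rV[R]_m) (e c : R) : Cc phi -> 0 < e -> (forall x, enorm (phi x) <= c) ->
  exists psi, [/\ Cc_infty psi, forall x, enorm (psi x) <= c & forall x, enorm (phi x - psi x) <= e].
Proof.
move=> Cphi e0 bphi; have [cphi /compactly_supportedP[r phir]] := Cphi.
have m0 : 0 < (m%:R + 1) :> R by rewrite ltr_wpDl.
have [d d0 ud] := Cc_unif Cphi (divr_gt0 e0 m0).
have [J [w [p [Cw w0 w1 wr wp]]]] := smooth_partition (n := n) (r + d) d0.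
have c0 : 0 <= c by apply: le_trans (bphi 0); exact: enorm_ge0.
exists (fun x => \sum_j w j x *: phi (p j)); split.
- by apply: Cc_infty_sum => j; exact: Cc_infty_scale.
- move=> x; apply: le_trans (enorm_sum _ _ _) _.
  apply: (@le_trans _ _ (\sum_j w j x * c)); last by rewrite -mulr_suml ler_piMl.
  by apply: ler_sum => j _; rewrite enormZ ger0_norm// ler_wpM2l.
- move=> x.
  have -> : phi x - \sum_j w j x *: phi (p j) = \sum_j w j x *: (phi x - phi (p j)).
    have wsum : phi x = \sum_j w j x *: phi x.
      rewrite -scaler_suml; have [xr|xr] := leP `|x| (r + d); first by rewrite wr// scale1r.
      by rewrite phir ?scaler0//; lra.
    by rewrite {1}wsum -sumrB; apply: eq_bigr => j _; rewrite scalerBr.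
  apply: le_trans (enorm_sum _ _ _) _.
  apply: (@le_trans _ _ (\sum_j w j x * e)); last by rewrite -mulr_suml ler_piMl// ltW.
  apply: ler_sum => j _; rewrite enormZ ger0_norm//.
  have [->|wj] := eqVneq (w j x) 0; first by rewrite !mul0r.
  rewrite ler_wpM2l//; apply: le_trans (enorm_le_normr _) _.
  have /ltW h := ud _ _ (wp _ _ wj).
  apply: (@le_trans _ _ (m%:R * (e / (m%:R + 1)))); first by rewrite ler_wpM2l.
  by rewrite mulrA ler_pdivrMr// mulrC ler_pM2l// lerDl.
Qed.

Lemma Cc_infty_Cc (W : normedModType R) (g : Rn -> W) : Cc_infty g -> Cc g.
Proof. by move=> [sg cg]; split => //; exact: smooth_continuous. Qed.

Lemma Cc_infty_shift (W : normedModType R) (g : Rn -> W) h : Cc_infty g -> Cc_infty (fun x => g (x + h)).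
Proof.
move=> [sg /compactly_supportedP[r gr]]; split; first exact: smooth_shift.
apply/compactly_supportedP; exists (r + `|h|) => x xr; apply: gr.
have := ler_normB (x + h) h; rewrite addrK; lra.
Qed.

Lemma Cc_infty_coord m (phi : Rn -> 'rV[R]_m) j : Cc_infty phi -> Cc_infty (fun x => phi x 0 j : R).
Proof.
move=> [sg /compactly_supportedP[r gr]]; split; first exact: smooth_coord.
by apply/compactly_supportedP; exists r => x xr; rewrite gr// mxE.
Qed.

Lemma Cc_coord m (phi : Rn -> 'rV[R]_m) j : Cc phi -> Cc (fun x => phi x 0 j : R).
Proof.
move=> [sg /compactly_supportedP[r gr]]; split; first exact: cont_coord.
by apply/compactly_supportedP; exists r => x xr; rewrite gr// mxE.
Qed.

Lemma Cc_scale m (f : Rn -> R) (v : 'rV[R]_m) : Cc f -> Cc (fun x => f x *: v).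
Proof.
move=> [sf /compactly_supportedP[r fr]]; split.
  apply: (@cont_rV R) => j; under eq_fun do rewrite mxE.
  by apply: contM => //; exact: cont_cst.
by apply/compactly_supportedP; exists r => x xr; rewrite fr// scale0r.
Qed.

Lemma Cc_infty_dense (f : Rn -> R) (e c : R) : Cc f -> 0 < e -> (forall x, `|f x| <= c) ->
  exists g, [/\ Cc_infty g, forall x, `|g x| <= c & forall x, `|f x - g x| <= e].
Proof.
move=> Cf e0 fc; pose v : 'rV[R]_1 := const_mx 1.
have Cv := Cc_scale v Cf.
have E (y : 'rV[R]_1) : enorm y = `|y 0 0|.
  by rewrite /enorm /dotrv big_ord1 -expr2 sqrtr_sqr.
have [|psi [Cpsi h1 h2]] := Cc_infty_dense_rV (c := c) Cv e0.
  by move=> x; rewrite E !mxE mulr1.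
exists (fun x => psi x 0 0); split; first exact: Cc_infty_coord.
  by move=> x; rewrite -E.
by move=> x; have := h2 x; rewrite E !mxE mulr1.
Qed.

Lemma Cc_infty_derive (g : Rn -> R) i : Cc_infty g ->
  exists2 g', Cc_infty g' & forall x, is_derive x (ei i) g (g' x).
Proof.
move=> [sg /compactly_supportedP[r gr]]; have [g' sg' dg'] := smooth_derive i sg.
exists g' => //; split => //; apply/compactly_supportedP; exists r => x xr.
have : is_derive x (ei i) (fun=> 0 : R) (g' x).
  apply: near_eq_is_derive (dg' x) => //.
  by apply: filterS (cvgr_gt _ (@norm_continuous _ _ x) _ xr) => y; exact: gr.
by move=> d0; rewrite -(@derive_val _ _ _ _ _ _ _ d0) derive_cst.
Qed.

(** Partial derivatives are bounded, so the mean value theorem applies in each coordinate direction;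
    a general increment is a chain of n such moves. *)
Lemma Cc_infty_lip (g : Rn -> R) : Cc_infty g ->
  exists2 L : R, 0 <= L & forall x y, `|g x - g y| <= L * `|x - y|.
Proof.
move=> Cg.
have /choice[K HK] i : exists K : R, 0 <= K /\ forall x (t : R), `|g (t *: ei i + x) - g x| <= K * `|t|.
  have [g' Cg' dg'] := Cc_infty_derive i Cg.
  have [K K0 HK] := Cc_bounded (Cc_infty_Cc Cg').
  exists K; split => // x t.
  have D (s : R) : is_derive s (1 : R) (fun s => g (s *: ei i + x)) (g' (s *: ei i + x)).
    by apply/is_derive_line.
  have cont : continuous (fun s : R => g (s *: ei i + x)).
    by move=> s; exact: is_derive_continuous (D s).
  have M (a b : R) : a < b -> `|g (b *: ei i + x) - g (a *: ei i + x)| <= K * (b - a).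
    move=> ab; have [//|c _ ->] := @MVT _ (fun s => g (s *: ei i + x)) _ _ _ ab (fun s _ => D s).
      exact: continuous_subspaceT.
    rewrite normrM (@gtr0_norm _ (b - a)) ?subr_gt0//.
    by rewrite ler_wpM2r// subr_ge0 ltW.
  have [t0|t0|->] := ltgtP t 0.
  - by rewrite (ltr0_norm t0); have := M _ _ t0; rewrite scale0r add0r distrC sub0r.
  - by rewrite (gtr0_norm t0); have := M _ _ t0; rewrite scale0r add0r subr0.
  - by rewrite scale0r add0r subrr !normr0 mulr0.
have K0 i : 0 <= K i by have [] := HK i.
exists (\sum_i K i); first exact: sumr_ge0.
(* The path from y to x that changes one coordinate at a time. *)
move=> x y; pose z (k : nat) : Rn := \row_i (if (i < k)%N then x 0 i else y 0 i).
have z0 : z 0%N = y by apply/rowP => i; rewrite mxE.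
have zn : z n = x by apply/rowP => i; rewrite mxE ltn_ord.
have zS (k : 'I_n) : z k.+1 = (x 0 k - y 0 k) *: ei k + z k.
  apply/rowP => i; rewrite !mxE ltnS; case: (ltngtP i k) => ik.
  - by rewrite eqxx/= (_ : (i == k) = false) ?mulr0 ?add0r//; apply/eqP => ik'; rewrite ik' ltnn in ik.
  - by rewrite eqxx/= (_ : (i == k) = false) ?mulr0 ?add0r//; apply/eqP => ik'; rewrite ik' ltnn in ik.
  - have -> : i = k by exact/val_inj.
    by rewrite !eqxx mulr1 subrK.
have -> : g x - g y = \sum_(k < n) (g (z k.+1) - g (z k)).
  by rewrite -(big_mkord predT (fun k => g (z k.+1) - g (z k))) telescope_sumr// z0 zn.
apply: le_trans (ler_norm_sum _ _ _) _; rewrite mulr_suml.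
apply: ler_sum => k _; rewrite zS; have [_ h] := HK k; apply: le_trans (h _ _) _.
by rewrite ler_wpM2l//; have := normr_coord_le (x - y) k; rewrite !mxE.
Qed.

Lemma Cc_infty_bndlip (phi : Rn -> Rn) (M : R) : Cc_infty phi -> (forall x, enorm (phi x) <= M) ->
  exists2 L : R, 0 <= L & bndlip M L phi.
Proof.
move=> Cphi bphi.
have /choice[K HK] i : exists K : R, 0 <= K /\ forall x y, `|phi x 0 i - phi y 0 i| <= K * `|x - y|.
  by have [K K0 HK] := Cc_infty_lip (Cc_infty_coord i Cphi); exists K.
have K0 i : 0 <= K i by have [] := HK i.
exists (\sum_i K i); first exact: sumr_ge0.
split => //.
  apply: measurable_fun_rV => i; apply: measurable_continuous_rV.
  exact: (smooth_continuous (Cc_infty_coord i Cphi).1).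
move=> x y; apply: le_trans (enorm_le_sum _) _; rewrite mulr_suml.
apply: ler_sum => i _; rewrite !mxE; have [_ h] := HK i; apply: le_trans (h _ _) _.
by rewrite ler_wpM2l//; exact: normr_le_enorm.
Qed.

End density.

Lemma Cc_infty_bound {R : realType} {n : nat} (phi : 'rV[R]_n -> 'rV[R]_n) : Cc_infty phi ->
  exists M, forall x, enorm (phi x) <= M.
Proof.
move=> /Cc_infty_Cc Cphi; have [M _ HM] := Cc_bounded Cphi; exists (n%:R * M) => x.
by apply: le_trans (enorm_le_normr _) _; rewrite ler_wpM2l.
Qed.

(** * Continuity in the order *)

Section pairing_linear.
Context {R : realType} {n : nat}.
Local Notation Rn := 'rV[R]_n.
Local Notation leb := (@lebesgue_rV R n).
Local Notation mu := (@lebesgue_measure R).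
Local Notation RT := (measurableTypeR R).
Implicit Types (phi psi : Rn -> Rn).

Lemma bndlipD M L M' L' phi psi : bndlip M L phi -> bndlip M' L' psi ->
  bndlip (M + M') (L + L') (fun x => phi x + psi x).
Proof.
move=> [m1 b1 l1] [m2 b2 l2]; split.
- exact: measurable_rV_add.
- by move=> x; apply: le_trans (enormD _ _) _; exact: lerD.
- move=> x y; rewrite opprD addrACA mulrDl; apply: le_trans (enormD _ _) _; exact: lerD.
Qed.

Lemma bndlipZ M L (c : R) phi : bndlip M L phi ->
  bndlip (`|c| * M) (`|c| * L) (fun x => c *: phi x).
Proof.
move=> [m1 b1 l1]; split.
- apply: measurable_fun_rV => i; under eq_fun do rewrite mxE.
  apply: measurable_funM; first exact: measurable_cst.
  exact: (measurableT_comp (measurable_coord_rV i) m1).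
- by move=> x; rewrite enormZ ler_wpM2l.
- by move=> x y; rewrite -scalerBr enormZ -mulrA ler_wpM2l.
Qed.

Lemma heatdivD M L M' L' phi psi t x : bndlip M L phi -> bndlip M' L' psi -> 0 < t ->
  heatdiv t (fun x => phi x + psi x) x = heatdiv t phi x + heatdiv t psi x.
Proof.
move=> b1 b2 t0; rewrite /heatdiv -RintegralD//; [|exact: heatdiv_integrable b1 t0|exact: heatdiv_integrable b2 t0].
by apply: eq_Rintegral => h _; rewrite dotrvDr mulrDr mulrDl.
Qed.

Lemma dotrvZr (c : R) (x y : Rn) : dotrv x (c *: y) = c * dotrv x y.
Proof. by rewrite dotrvC dotrvZl dotrvC. Qed.

Lemma heatdivZ M L c phi t x : bndlip M L phi -> 0 < t ->
  heatdiv t (fun x => c *: phi x) x = c * heatdiv t phi x.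
Proof.
move=> b1 t0; rewrite /heatdiv -RintegralZl//; last exact: heatdiv_integrable b1 t0.
by apply: eq_Rintegral => h _; rewrite dotrvZr; move: (heat _ _) (dotrv _ _) => A B; ring.
Qed.

Lemma fdivD a M L M' L' phi psi x : 0 < a -> a < 1 -> 0 <= L -> 0 <= L' ->
  bndlip M L phi -> bndlip M' L' psi ->
  fdiv a (fun x => phi x + psi x) x = fdiv a phi x + fdiv a psi x.
Proof.
move=> a0 a1 L0 L0' b1 b2; rewrite /fdiv -RintegralD//; [|exact: fdiv_integrable b1|exact: fdiv_integrable b2].
apply: eq_Rintegral => t _; have [t0|t0] := leP t 0; first by rewrite pw_neg// !mul0r addr0.
by rewrite (heatdivD _ b1 b2 t0) mulrDr.
Qed.

Lemma fdivZ a M L c phi x : 0 < a -> a < 1 -> 0 <= L -> bndlip M L phi ->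
  fdiv a (fun x => c *: phi x) x = c * fdiv a phi x.
Proof.
move=> a0 a1 L0 b1; rewrite /fdiv -RintegralZl//; last exact: fdiv_integrable b1.
apply: eq_Rintegral => t _; have [t0|t0] := leP t 0; first by rewrite pw_neg// !mul0r mulr0.
by rewrite (heatdivZ _ _ b1 t0) mulrCA.
Qed.

Variables (f : Rn -> R) (N : R).
Hypotheses (mf : measurable_fun setT f) (fN : (\int[leb]_x `|f x|%:E <= N%:E)%E).

Definition pairing (a : R) phi : R := \int[leb]_x (f x * frac_div a phi x).

Lemma fpair_integrable a M L phi : 0 < a -> a < 1 -> 0 <= L -> bndlip M L phi ->
  leb.-integrable setT (EFin \o (fun x => f x * fdiv a phi x)).
Proof.
move=> a0 a1 L0 bl; apply: (integrable_pair mf fN) => [||x]; last exact: fdiv_le bl.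
- by rewrite mulr_ge0 ?cfdiv_ge0// mulr_ge0 ?cheat_ge0// addr_ge0// (bndlip_ge0 bl).
- by apply: measurable_fdiv; case: bl.
Qed.

Lemma pairingE a M L phi : 0 < a -> a < 1 -> 0 <= L -> bndlip M L phi ->
  pairing a phi = Ka (n := n) a * fpair f a phi.
Proof.
move=> a0 a1 L0 bl; rewrite /fpair -RintegralZl//; last exact: fpair_integrable bl.
by apply: eq_Rintegral => x _; rewrite (frac_divE x a0 a1 L0 bl) mulrCA.
Qed.

Lemma pairingD a phi psi : 0 < a -> a < 1 -> Cc_infty phi -> Cc_infty psi ->
  pairing a (fun x => phi x + psi x) = pairing a phi + pairing a psi.
Proof.
move=> a0 a1 Cphi Cpsi.
have [M b1] := Cc_infty_bound Cphi; have [M' b2] := Cc_infty_bound Cpsi.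
have [L L0 l1] := Cc_infty_bndlip Cphi b1; have [L' L0' l2] := Cc_infty_bndlip Cpsi b2.
rewrite (pairingE a0 a1 (addr_ge0 L0 L0') (bndlipD l1 l2)).
rewrite (pairingE a0 a1 L0 l1) (pairingE a0 a1 L0' l2) -mulrDr; congr (_ * _).
rewrite /fpair -RintegralD//; [|exact: fpair_integrable l1|exact: fpair_integrable l2].
by apply: eq_Rintegral => x _; rewrite (fdivD x a0 a1 L0 L0' l1 l2) mulrDr.
Qed.

Lemma pairingZ a c phi : 0 < a -> a < 1 -> Cc_infty phi ->
  pairing a (fun x => c *: phi x) = c * pairing a phi.
Proof.
move=> a0 a1 Cphi; have [M b1] := Cc_infty_bound Cphi.
have [L L0 l1] := Cc_infty_bndlip Cphi b1.
rewrite (pairingE a0 a1 (mulr_ge0 (normr_ge0 c) L0) (bndlipZ c l1)).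
rewrite (pairingE a0 a1 L0 l1) mulrCA; congr (_ * _).
rewrite /fpair -RintegralZl//; last exact: fpair_integrable l1.
by apply: eq_Rintegral => x _; rewrite (fdivZ c x a0 a1 L0 l1) mulrCA.
Qed.

End pairing_linear.

Section pairing_continuous.
Context {R : realType} {n : nat}.
Local Notation Rn := 'rV[R]_n.
Local Notation leb := (@lebesgue_rV R n).
Local Notation mu := (@lebesgue_measure R).
Local Notation RT := (measurableTypeR R).
Implicit Types (phi psi : Rn -> Rn).

Lemma Ka_gt0 (a : R) : 0 < a -> a < 1 -> 0 < Ka (n := n) a.
Proof.
move=> a0 a1; rewrite /Ka /frac_mu !GammaE.
have n0 : 0 <= n%:R :> R by [].
have h1 : 0 < wint egam ((n%:R + a + 1) / 2 - 1).
  by apply: wint_gt0 (@admissible_egam R) _ => /=; lra.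
have h2 : 0 < wint egam ((1 - a) / 2 - 1) by apply: wint_gt0 (@admissible_egam R) _ => /=; lra.
have h3 : 0 < wint einv (- qexp (n := n) a - 1).
  by apply: wint_gt0 (@admissible_einv R) _ => /=; rewrite /qexp; lra.
apply: divr_gt0 => //; apply: mulr_gt0; last by rewrite exprn_gt0// sqrtr_gt0 pi_gt0.
have h4 : 0 < 2 `^ a :> R by rewrite powR_gt0.
have h5 : 0 < pi `^ (- (n%:R / 2)) :> R by rewrite powR_gt0// pi_gt0.
exact: (divr_gt0 (mulr_gt0 (mulr_gt0 h4 h5) h1) h2).
Qed.

Lemma cvg_quotient (p g h w : nat -> R) (p' g' h' w' c d : R) :
  p k @[k --> \oo] --> p' -> g k @[k --> \oo] --> g' -> h k @[k --> \oo] --> h' ->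
  w k @[k --> \oo] --> w' -> h' != 0 -> w' != 0 ->
  p k * c * g k / h k * d / w k @[k --> \oo] --> p' * c * g' / h' * d / w'.
Proof.
move=> cp cg ch cw h0 w0; apply: cvgM; last exact: cvgV.
apply: cvgM; last exact: cvg_cst; apply: cvgM; last exact: cvgV.
by apply: cvgM => //; apply: cvgM => //; exact: cvg_cst.
Qed.

Variables (al al0 : R) (b : nat -> R).
Hypotheses (al00 : 0 < al0) (al1 : al < 1).
Hypotheses (bb : forall k, al0 <= b k <= al) (cb : b k @[k --> \oo] --> al).

Let al0_le : al0 <= al.
Proof. by have /andP[h1 h2] := bb 0%N; exact: le_trans h2. Qed.

Let b_gt0 k : 0 < b k. Proof. by have /andP[h _] := bb k; exact: lt_le_trans h. Qed.
Let b_lt1 k : b k < 1. Proof. by have /andP[_ h] := bb k; exact: le_lt_trans al1. Qed.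
Let al_gt0 : 0 < al. Proof. exact: lt_le_trans al0_le. Qed.

(** Every Gamma factor is a moment [wint], continuous in its exponent as long as the orders stay
    between al0 and al, and the denominators are positive moments. *)
Lemma cvg_Ka : Ka (n := n) (b k) @[k --> \oo] --> Ka (n := n) al.
Proof.
have n0 : 0 <= n%:R :> R by [].
have h1 : Gamma ((n%:R + b k + 1) / 2) @[k --> \oo] --> Gamma ((n%:R + al + 1) / 2).
  under eq_fun do rewrite GammaE; rewrite GammaE.
  apply: (@cvg_wint _ _ _ _ _ ((n%:R + al0 + 1) / 2 - 1) ((n%:R + al + 1) / 2 - 1) (@admissible_egam R)).
  - by move: al00 => h /=; lra.
  - by move: al_gt0 => h /=; lra.
  - by move=> k; have /andP[h1 h2] := bb k; apply/andP; split; lra.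
  - apply: cvgB; last exact: cvg_cst.
    by apply: cvgM; [apply: cvgD; [apply: cvgD; [exact: cvg_cst|exact: cb]|exact: cvg_cst]|exact: cvg_cst].
have h2 : Gamma ((1 - b k) / 2) @[k --> \oo] --> Gamma ((1 - al) / 2).
  under eq_fun do rewrite GammaE; rewrite GammaE.
  apply: (@cvg_wint _ _ _ _ _ ((1 - al) / 2 - 1) ((1 - al0) / 2 - 1) (@admissible_egam R)).
  - by move: al1 => h /=; lra.
  - by move: al1 al0_le => h h' /=; lra.
  - by move=> k; have /andP[h1' h2'] := bb k; apply/andP; split; lra.
  - apply: cvgB; last exact: cvg_cst.
    by apply: cvgM; [apply: cvgB; [exact: cvg_cst|exact: cb]|exact: cvg_cst].
have h3 : wint einv (- qexp (n := n) (b k) - 1) @[k --> \oo] --> wint einv (- qexp (n := n) al - 1).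
  apply: (@cvg_wint _ _ _ _ _ (- qexp (n := n) al - 1) (- qexp (n := n) al0 - 1) (@admissible_einv R)).
  - by move: al_gt0 => h /=; rewrite /qexp; lra.
  - by move: al00 => h /=; rewrite /qexp; lra.
  - by move=> k; have /andP[h1' h2'] := bb k; rewrite /qexp; apply/andP; split; lra.
  - apply: cvgB; last exact: cvg_cst; apply: cvgN; rewrite /qexp.
    by apply: cvgM; [apply: cvgD; [apply: cvgD; [exact: cvg_cst|exact: cb]|exact: cvg_cst]|exact: cvg_cst].
have h4 : 2 `^ b k @[k --> \oo] --> 2 `^ al.
  have t2 : 0 < 2 :> R by [].
  by rewrite -(pw_pos al t2); under eq_fun do rewrite -(pw_pos _ t2); exact: cvg_pw.
have n2 : Gamma ((1 - al) / 2) != 0.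
  by rewrite GammaE gt_eqF//; apply: wint_gt0 (@admissible_egam R) _; move: al1 => h /=; lra.
have n3 : wint einv (- qexp (n := n) al - 1) != 0.
  by rewrite gt_eqF//; apply: wint_gt0 (@admissible_einv R) _; move: al_gt0 => h /=; rewrite /qexp; lra.
exact: (cvg_quotient h4 h1 h2 h3 n2 n3).
Qed.

Lemma cvg_fdiv M L phi x : 0 <= L -> bndlip M L phi ->
  fdiv (b k) phi x @[k --> \oo] --> fdiv al phi x.
Proof.
move=> L0 bl; have [mp _ _] := bl.
have al01 : al0 < 1 by exact: le_lt_trans al1.
have i0 := fdiv_integrable x al00 al01 L0 bl.
have i1 := fdiv_integrable x al_gt0 al1 L0 bl.
(* Orders in [al0, al] have weights dominated by the two extreme ones, and both extreme integrands
   are integrable. *)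
pose g t := pw (- ((al + 1) / 2)) t * `|heatdiv t phi x| + pw (- ((al0 + 1) / 2)) t * `|heatdiv t phi x|.
have mm p : measurable_fun setT (fun t : RT => pw p t * heatdiv t phi x).
  exact: measurable_fdiv_integrand.
apply: (@Rintegral_dominated _ _ RT mu _ _ g) => //.
- by move=> t; apply: cvgM; [apply: cvg_pw; apply: cvgN; apply: cvgM; [apply: cvgD; [exact: cb|exact: cvg_cst]|exact: cvg_cst]|exact: cvg_cst].
- have abs p : mu.-integrable setT (EFin \o (fun t : RT => pw p t * heatdiv t phi x)) ->
      mu.-integrable setT (EFin \o (fun t : RT => pw p t * `|heatdiv t phi x|)).
    move=> ip; have := integrable_abse ip.
    rewrite (_ : abse \o _ = EFin \o (fun t : RT => pw p t * `|heatdiv t phi x|))//.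
    by apply/funext => t /=; rewrite normrM (ger0_norm (pw_ge0 _ _)).
  exact: (integrableD measurableT (abs _ i1) (abs _ i0)).
- move=> k t; rewrite normrM (ger0_norm (pw_ge0 _ _)) /g -mulrDl ler_wpM2r//.
  by have /andP[h1 h2] := bb k; apply: pw_between; lra.
Qed.

Variables (f : Rn -> R) (N : R).
Hypotheses (mf : measurable_fun setT f) (fN : (\int[leb]_x `|f x|%:E <= N%:E)%E).

Lemma cvg_pairing phi : Cc_infty phi -> pairing f (b k) phi @[k --> \oo] --> pairing f al phi.
Proof.
move=> Cphi; have [M b1] := Cc_infty_bound Cphi.
have [L L0 l1] := Cc_infty_bndlip Cphi b1; have [mp _ _] := l1.
rewrite (pairingE mf fN al_gt0 al1 L0 l1).
under eq_fun do rewrite (pairingE mf fN (b_gt0 _) (b_lt1 _) L0 l1).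
apply: cvgM; first exact: cvg_Ka.
(* The first term of [cfdiv] increases with the order and the second decreases; each is taken at its
   worst end, for a bound uniform in k. *)
pose C := cheat (n := n) * (M + L) * ((1 - (al + 1) / 2)^-1 + (al0 / 2)^-1).
have ML : 0 <= cheat (n := n) * (M + L) by rewrite mulr_ge0 ?cheat_ge0// addr_ge0// (bndlip_ge0 l1).
have C0 : 0 <= C.
  by rewrite /C mulr_ge0// addr_ge0// invr_ge0; move: al1 al00 => h h'; lra.
have fC k x : `|fdiv (b k) phi x| <= C.
  apply: le_trans (fdiv_le x (b_gt0 k) (b_lt1 k) L0 l1) _; rewrite /C ler_wpM2l//.
  have /andP[h1 h2] := bb k; rewrite /cfdiv; apply: lerD.
    by rewrite lef_pV2 ?posrE; move: al1 => h; lra.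
  by rewrite lef_pV2 ?posrE; move: al00 => h; lra.
apply: (@Rintegral_dominated _ _ _ leb _ _ (fun x => `|f x| * C)).
- by move=> k; apply: measurable_funM => //; exact: measurable_fdiv.
- by apply: measurable_funM => //; exact: measurable_fdiv.
- by move=> x; apply: cvgM; [exact: cvg_cst|exact: cvg_fdiv l1].
- have nf : measurable_fun setT (fun x => `|f x|) by exact: measurableT_comp.
  have nfN : (\int[leb]_x `| `|f x| |%:E <= N%:E)%E by under eq_integral do rewrite normr_id.
  by apply: (integrable_pair nf nfN C0) => // x; rewrite ger0_norm.
- by move=> k x; rewrite normrM ler_wpM2l.
Qed.

End pairing_continuous.

(** * Riesz representation *)

Section eseries.
Context {R : realType}.
Local Open Scope ereal_scope.
Implicit Type u : nat -> \bar R.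

Lemma nneseries_le_bound u x : (forall k, 0 <= u k) ->
  (forall N, \sum_(0 <= k < N) u k <= x) -> \sum_(k <oo) u k <= x.
Proof. by move=> u0 h; apply: lime_le; [exact: is_cvg_nneseries|exact: nearW]. Qed.

Lemma nneseries_ge_partial u N : (forall k, 0 <= u k) ->
  \sum_(0 <= k < N) u k <= \sum_(k <oo) u k.
Proof. by move=> u0; apply: nneseries_lim_ge. Qed.

Lemma nneseries_single u : (forall k, u k.+1 = 0) -> \sum_(k <oo) u k = u 0%N.
Proof.
move=> u0; apply/cvg_lim => //; rewrite -cvg_shiftS.
rewrite (_ : [sequence _]_n = cst (u 0%N)); first exact: cvg_cst.
by rewrite funeqE => n /=; rewrite big_nat_recl//= big1 ?adde0.
Qed.

(** The enumeration is fixed before G because the same one must serve the functions, at every point,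
    and their values under the functional. *)
Lemma nneseries_pair : exists f : nat -> nat * nat, forall G : nat -> nat -> \bar R,
  (forall i j, 0 <= G i j) ->
  \sum_(m <oo) G (f m).1 (f m).2 = \sum_(i <oo) \sum_(j <oo) G i j.
Proof.
have /card_esym/ppcard_eqP[f] := card_nat2.
exists f => G G0.
rewrite !nneseries_esumT//; last by move=> i; exact: nneseries_ge0.
rewrite [RHS](_ : _ = \esum_(i in [set: nat]) \esum_(j in [set: nat]) G i j); last first.
  by apply: eq_esum => i _; rewrite nneseries_esumT.
rewrite esum_esum//.
have -> : [set: nat] `*`` (fun=> [set: nat]) = [set: nat * nat].
  by apply/seteqP; split.
by rewrite -(@reindex_esum _ _ _ setT setT f (fun k => G k.1 k.2)).
Qed.

End eseries.

Section Cc_facts.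
Context {R : realType} {n : nat}.
Local Notation Rn := 'rV[R]_n.
Implicit Types (f g h : Rn -> R).

Lemma Cc_support f g : continuous f -> Cc g -> (forall x, g x = 0 -> f x = 0) -> Cc f.
Proof.
move=> cf [_ /compactly_supportedP[r gr]] fg; split => //.
by apply/compactly_supportedP; exists r => x xr; rewrite fg// gr.
Qed.

Lemma CcD (W : normedModType R) (f g : Rn -> W) : Cc f -> Cc g -> Cc (fun x => f x + g x).
Proof.
move=> [cf /compactly_supportedP[r fr]] [cg /compactly_supportedP[s gs]].
split; first exact: contD.
apply/compactly_supportedP; exists (Num.max r s) => x; rewrite gt_max => /andP[h1 h2].
by rewrite fr// gs// addr0.
Qed.

Lemma CcZ c f : Cc f -> Cc (fun x => c * f x).
Proof.
move=> Cf; apply: Cc_support (Cf) _; first by apply: contM; [exact: cont_cst|exact: Cf.1].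
by move=> x ->; rewrite mulr0.
Qed.

Lemma CcB (W : normedModType R) (f g : Rn -> W) : Cc f -> Cc g -> Cc (fun x => f x - g x).
Proof.
move=> [cf /compactly_supportedP[r fr]] [cg /compactly_supportedP[s gs]].
split; first exact: contB.
apply/compactly_supportedP; exists (Num.max r s) => x; rewrite gt_max => /andP[h1 h2].
by rewrite fr// gs// subrr.
Qed.

Lemma CcM f g : continuous f -> Cc g -> Cc (fun x => f x * g x).
Proof.
move=> cf Cg; apply: Cc_support (Cg) _; first by apply: contM; [|exact: Cg.1].
by move=> x ->; rewrite mulr0.
Qed.

Lemma Cc0 : Cc (fun _ : Rn => 0 : R).
Proof. by split; [exact: cont_cst|apply/compactly_supportedP; exists 0]. Qed.

Lemma Cc_sum (I : Type) (r : seq I) (f : I -> Rn -> R) : (forall i, Cc (f i)) ->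
  Cc (fun x => \sum_(i <- r) f i x).
Proof.
move=> cf; elim: r => [|i r ih].
  by under eq_fun do rewrite big_nil; exact: Cc0.
by under eq_fun do rewrite big_cons; exact: CcD.
Qed.

Lemma cont_min f g : continuous f -> continuous g -> continuous (fun x => Num.min (f x) (g x)).
Proof. by move=> cf cg x; apply: (@continuous_min _ _ f g); [exact: cf|exact: cg]. Qed.

Lemma cont_max f g : continuous f -> continuous g -> continuous (fun x => Num.max (f x) (g x)).
Proof. by move=> cf cg x; apply: (@continuous_max _ _ f g); [exact: cf|exact: cg]. Qed.

Definition Ccp : set (Rn -> R) := [set f : Rn -> R | Cc f /\ forall x, 0 <= f x].

Lemma Ccp0 : Ccp (fun=> 0). Proof. by split => //; exact: Cc0. Qed.

Lemma CcpD f g : Ccp f -> Ccp g -> Ccp (fun x => f x + g x).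
Proof. by move=> [Cf f0] [Cg g0]; split => [|x]; [exact: CcD|exact: addr_ge0]. Qed.

Lemma CcpZ c f : 0 <= c -> Ccp f -> Ccp (fun x => c * f x).
Proof. by move=> c0 [Cf f0]; split => [|x]; [exact: CcZ|exact: mulr_ge0]. Qed.

Lemma CcpB f g : Ccp f -> Ccp g -> (forall x, g x <= f x) -> Ccp (fun x => f x - g x).
Proof. by move=> [Cf f0] [Cg g0] h; split => [|x]; [exact: CcB|rewrite subr_ge0]. Qed.

Lemma CcpM f g : continuous f -> (forall x, 0 <= f x) -> Ccp g -> Ccp (fun x => f x * g x).
Proof. by move=> cf f0 [Cg g0]; split => [|x]; [exact: CcM|exact: mulr_ge0]. Qed.

Lemma Ccp_sum (I : Type) (r : seq I) (f : I -> Rn -> R) : (forall i, Ccp (f i)) ->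
  Ccp (fun x => \sum_(i <- r) f i x).
Proof.
move=> Cf; split; first by apply: Cc_sum => i; have [] := Cf i.
by move=> x; apply: sumr_ge0 => i _; have [_] := Cf i.
Qed.

Lemma measurable_normr_le (r : R) : measurable [set x : Rn | `|x| <= r].
Proof.
rewrite -[X in measurable X]setCK; apply: measurableC; apply: open_measurable_rV.
have -> : ~` [set x : Rn | `|x| <= r] = [set x : Rn | r < `|x|].
  by apply/seteqP; split => x /=; rewrite ltNge => /negP.
apply: (@open_comp _ _ (fun x : Rn => `|x|) [set t | r < t]); last exact: open_gt.
by move=> x _; exact: norm_continuous.
Qed.

(** Borel sets are reached from positivity sets of functions in [Ccp]: open sets are countable
    unions of rational balls. *)
Lemma ball_Ccp (q : Rn) (r : R) : exists2 g, Ccp g & ball q r = [set x | 0 < g x].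
Proof.
exists (fun x => Num.max (r - `|q - x|) 0); last first.
  by apply/seteqP; split => x; rewrite -ball_normE /ball_/= lt_max ltxx orbF subr_gt0.
split; last by move=> x; rewrite le_max lexx orbT.
split.
  apply: cont_max; last exact: cont_cst.
  apply: contB; first exact: cont_cst.
  by apply: cont_norm; apply: contB; [exact: cont_cst|exact: cont_id].
apply/compactly_supportedP; exists (`|q| + r) => x xr; apply/max_idPr.
by have := ler_normD (x - q) q; rewrite subrK distrC; lra.
Qed.

End Cc_facts.

Section finite_measure.
Context {R : realType} d (T : measurableType d) (mu : {measure set T -> \bar R}).

Definition fin_measure (h : fin_num_fun mu) : set T -> \bar R := mu.

Variable h : fin_num_fun mu.

Let fin_measure0 : fin_measure h set0 = 0%E. Proof. exact: measure0. Qed.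

Let fin_measure_ge0 A : (0 <= fin_measure h A)%E. Proof. exact: measure_ge0. Qed.

Let fin_measure_sigma_additive : semi_sigma_additive (fin_measure h).
Proof. exact: measure_semi_sigma_additive. Qed.

HB.instance Definition _ := isMeasure.Build _ _ _ (fin_measure h)
  fin_measure0 fin_measure_ge0 fin_measure_sigma_additive.

HB.instance Definition _ := Measure_isFinite.Build _ _ _ (fin_measure h) h.

End finite_measure.

(** * The measure of a bounded positive functional *)

Section daniell.
Context {R : realType} {n : nat}.
Local Notation Rn := 'rV[R]_n.
Implicit Types (f g h phi psi : Rn -> R).
Variables (Lam : (Rn -> R) -> R) (V : R).
Hypothesis V0 : 0 <= V.
Hypothesis LamD : forall f g, Ccp f -> Ccp g -> Lam (fun x => f x + g x) = Lam f + Lam g.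
Hypothesis LamZ : forall c f, 0 <= c -> Ccp f -> Lam (fun x => c * f x) = c * Lam f.
Hypothesis Lam_ge0 : forall f, Ccp f -> 0 <= Lam f.
Hypothesis Lam_le : forall c f, Ccp f -> (forall x, f x <= c) -> Lam f <= V * c.

Lemma Lam0 : Lam (fun=> 0) = 0.
Proof.
rewrite -[RHS](mul0r (Lam (fun=> 0))) -LamZ//; last exact: Ccp0.
by congr Lam; apply/funext => x; rewrite mul0r.
Qed.

Lemma LamB f g : Ccp f -> Ccp g -> (forall x, g x <= f x) -> Lam (fun x => f x - g x) = Lam f - Lam g.
Proof.
move=> Cf Cg fg; have := LamD (CcpB Cf Cg fg) Cg.
by under eq_fun do rewrite subrK; move=> ->; rewrite addrK.
Qed.

Lemma le_Lam f g : Ccp f -> Ccp g -> (forall x, f x <= g x) -> Lam f <= Lam g.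
Proof. by move=> Cf Cg fg; rewrite -subr_ge0 -LamB//; apply: Lam_ge0; exact: CcpB. Qed.

Lemma Lam_sum (p : nat -> Rn -> R) N : (forall k, Ccp (p k)) ->
  Lam (fun x => \sum_(0 <= k < N) p k x) = \sum_(0 <= k < N) Lam (p k).
Proof.
move=> Cp; elim: N => [|N ih].
  by under eq_fun do rewrite big_nil; rewrite big_nil Lam0.
under eq_fun do rewrite big_nat_recr//=.
by rewrite big_nat_recr//= LamD// ?ih//; exact: Ccp_sum.
Qed.

(* Dini: by compactness finitely many [p k] already cover [f] up to a small
   error, and [Lam] is bounded by the sup norm. *)
Lemma Lam_dini f (p : nat -> Rn -> R) : Ccp f -> (forall k, Ccp (p k)) ->
  (forall x, (f x)%:E <= \sum_(k <oo) (p k x)%:E)%E ->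
  ((Lam f)%:E <= \sum_(k <oo) (Lam (p k))%:E)%E.
Proof.
move=> Cf Cp fp.
have p0 k x : 0 <= p k x by have [] := Cp k.
have cp k : continuous (p k) by have [[]] := Cp k.
apply/lee_addgt0Pr => e e0; have V1 : 0 < V + 1 by rewrite ltr_wpDl.
pose d := e / (V + 1); have d0 : 0 < d by exact: divr_gt0.
pose S N x := \sum_(0 <= k < N) p k x.
have CS N : Ccp (S N) by exact: Ccp_sum.
have S_homo N M x : (N <= M)%N -> S N x <= S M x.
  move=> NM; rewrite /S (big_cat_nat (n := N) (p := M))//=.
  by rewrite lerDl; apply: sumr_ge0.
have [N _ HN] : exists2 N, True & forall x, f x <= S N x + d.
  have [[cf K] f0] := Cf.
  have : \forall N \near \oo, closure [set x | f x <> 0] `<=` [set x | f x < S N x + d].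
    move/compact_near_coveringP : K => /(_ nat \oo (fun N x => f x < S N x + d) _); apply => x _.
    have [N HN] : exists N, f x < S N x + d.
      apply: contrapT => /forallNP h.
      have : (\sum_(k <oo) (p k x)%:E <= (f x - d)%:E)%E.
        apply: nneseries_le_bound => [k|N]; first by rewrite lee_fin.
        by rewrite sumEFin lee_fin lerBrDr leNgt; apply/negP; exact: h.
      by move=> /(le_trans (fp x)); rewrite lee_fin; lra.
    have near_x : \forall y \near x, f y < S N y + d.
      have c : continuous (fun y => S N y + d - f y).
        by apply: contB => //; apply: contD; [exact: (CS N).1.1|exact: cont_cst].
      have : \forall y \near x, 0 < S N y + d - f y.
        by apply: (cvgr_gt _ (c x)); rewrite subr_gt0.
      by apply: filterS => y; rewrite subr_gt0.
    near=> y M => /=; have : f y < S N y + d by near: y.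
    move/lt_le_trans; apply; rewrite lerD2r; apply: S_homo.
    by near: M; exact: nbhs_infty_ge.
  move=> [N _ HN]; exists N => // x.
  have [fx|fx] := pselect (f x = 0); first by rewrite fx addr_ge0 ?(ltW d0)//; have [_] := CS N; exact.
  by apply/ltW; apply: (HN N (leqnn N)); exact: subset_closure.
(* The excess of f over the partial sum vanishes off the support of f and is at most d, so its value
   under the functional is at most V d. *)
have Cr : Ccp (fun x => Num.max (f x - S N x) 0).
  split; last by move=> x; rewrite le_max lexx orbT.
  apply: (Cc_support _ Cf.1).
    by apply: cont_max; [apply: contB; [exact: Cf.1.1|exact: (CS N).1.1]|exact: cont_cst].
  by move=> x ->; rewrite sub0r; apply/max_idPr; rewrite oppr_le0 (CS N).2.
have h1 : Lam f <= Lam (fun x => S N x + Num.max (f x - S N x) 0).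
  apply: le_Lam => //; first exact: CcpD.
  by move=> x; rewrite -lerBlDl le_max lexx.
have h2 : Lam (fun x => Num.max (f x - S N x) 0) <= V * d.
  by apply: Lam_le => // x; rewrite ge_max lerBlDl HN ltW.
apply: (@le_trans _ _ (\sum_(0 <= k < N) (Lam (p k))%:E + e%:E)%E); last first.
  by rewrite leeD2r// nneseries_ge_partial// => k; rewrite lee_fin Lam_ge0.
rewrite sumEFin -Lam_sum// -EFinD lee_fin; apply: (le_trans h1).
rewrite LamD// lerD2l; apply: (le_trans h2).
by rewrite /d mulrA ler_pdivrMr// mulrC ler_pM2l// lerDl.
Unshelve. all: by end_near. Qed.

(* The Daniell upper integral; on indicators it is an outer measure. *)
Definition upper (u : Rn -> \bar R) : \bar R :=
  ereal_inf [set (\sum_(k <oo) (Lam (p k))%:E)%E | p in [set p : nat -> Rn -> R |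
    (forall k, Ccp (p k)) /\ forall x, (u x <= \sum_(k <oo) (p k x)%:E)%E]].

Lemma upper_lb u x : (forall p, (forall k, Ccp (p k)) ->
  (forall y, (u y <= \sum_(k <oo) (p k y)%:E)%E) -> (x <= \sum_(k <oo) (Lam (p k))%:E)%E) ->
  (x <= upper u)%E.
Proof. by move=> h; apply: le_ereal_inf_tmp => _ [p [Cp up] <-]; exact: h. Qed.

Lemma upper_ge0 u : (0 <= upper u)%E.
Proof. by apply: upper_lb => p Cp _; apply: nneseries_ge0 => k _ _; rewrite lee_fin Lam_ge0. Qed.

Lemma upper_le_sum u p : (forall k, Ccp (p k)) -> (forall y, (u y <= \sum_(k <oo) (p k y)%:E)%E) ->
  (upper u <= \sum_(k <oo) (Lam (p k))%:E)%E.
Proof. by move=> Cp up; apply: ereal_inf_lbound; exists p. Qed.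

Lemma le_upper u v : (forall x, (u x <= v x)%E) -> (upper u <= upper v)%E.
Proof.
by move=> uv; apply: upper_lb => p Cp vp; apply: upper_le_sum => // y; exact: le_trans (vp y).
Qed.

Lemma Lam_le_upper f u : Ccp f -> (forall x, ((f x)%:E <= u x)%E) -> ((Lam f)%:E <= upper u)%E.
Proof.
by move=> Cf fu; apply: upper_lb => p Cp up; apply: Lam_dini => // x; exact: le_trans (up x).
Qed.

Lemma upper_le_Lam f u : Ccp f -> (forall x, (u x <= (f x)%:E)%E) -> (upper u <= (Lam f)%:E)%E.
Proof.
move=> Cf uf; pose p (k : nat) : Rn -> R := if k is 0%N then f else fun=> 0.
have <- : (\sum_(k <oo) (Lam (p k))%:E)%E = (Lam f)%:E.
  by apply: nneseries_single => k; rewrite /p Lam0.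
apply: upper_le_sum => [[|k]//|y]; first exact: Ccp0.
by rewrite nneseries_single// /p.
Qed.

Lemma upper0 : upper (fun=> 0%E) = 0%E.
Proof.
apply/eqP; rewrite eq_le upper_ge0 andbT.
by have := upper_le_Lam Ccp0 (fun=> lexx 0%E); rewrite Lam0.
Qed.

(** As for outer measures: covers that are optimal up to e / 2^(i+1) are merged into one sequence
    along an enumeration of the pairs. *)
Lemma upper_subadd u (v : nat -> Rn -> \bar R) :
  (forall x, (u x <= \sum_(i <oo) v i x)%E) -> (forall i x, (0 <= v i x)%E) ->
  (upper u <= \sum_(i <oo) upper (v i))%E.
Proof.
move=> uv v0; have [[i ioo]|/forallNP Aoo] := pselect (exists i, upper (v i) = +oo%E).
  rewrite (eseries_pinfty _ _ ioo) ?leey// => k _.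
  by rewrite -ltNye (lt_le_trans _ (upper_ge0 _)).
apply/lee_addgt0Pr => e e0.
rewrite (le_trans _ (epsilon_trick _ _ (ltW e0)))//; last by move=> k; exact: upper_ge0.
have /choice[p Hp] i : exists p : nat -> Rn -> R, [/\ forall k, Ccp (p k),
    forall x, (v i x <= \sum_(k <oo) (p k x)%:E)%E &
    (\sum_(k <oo) (Lam (p k))%:E <= upper (v i) + (e / (2 ^ i.+1)%:R)%:E)%E].
  have fv : upper (v i) \is a fin_num.
    by rewrite ge0_fin_numE ?upper_ge0// ltey; apply/eqP; exact: Aoo.
  have ei : 0 < e / (2 ^ i.+1)%:R by rewrite divr_gt0// ltr0n expn_gt0.
  have [_ [p [Cp vp] <-] /ltW h] := lb_ereal_inf_adherent ei fv.
  by exists p.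
have [f Hf] := @nneseries_pair R.
apply: (@le_trans _ _ (\sum_(i <oo) \sum_(j <oo) (Lam (p i j))%:E)%E); last first.
  apply: lee_nneseries => [i _ _|i _]; last by have [] := Hp i.
  by apply: nneseries_ge0 => j _ _; rewrite lee_fin Lam_ge0//; have [] := Hp i.
rewrite -(Hf (fun i j => (Lam (p i j))%:E)); last first.
  by move=> i j; rewrite lee_fin Lam_ge0//; have [] := Hp i.
apply: (@upper_le_sum _ (fun m => p (f m).1 (f m).2)) => [k|y].
  by have [] := Hp (f k).1.
have p0 i j x : 0 <= p i j x by have [/(_ j)[]] := Hp i.
rewrite (Hf (fun i j => (p i j y)%:E)); last by move=> i j; rewrite lee_fin.
apply: le_trans (uv y) _; apply: lee_nneseries => [i _ _|i _]; first exact: v0.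
by have [_ + _] := Hp i; exact.
Qed.

Definition restr (u : Rn -> R) (A : set Rn) (x : Rn) : \bar R := (u x * \1_A x)%:E.

(** The functions min(1, m g) f increase to f on G = {g > 0} and vanish off G. Their increments
    cover f restricted to G, and what remains of f covers its restriction to the complement. *)
Lemma upper_split f g : Ccp f -> Ccp g ->
  (upper (restr f [set x | (0 < g x)%R]) + upper (restr f (~` [set x | (0 < g x)%R])) <= (Lam f)%:E)%E.
Proof.
move=> Cf Cg; set G := [set x | (0 < g x)%R].
have [[cf _] f0] := Cf; have [[cg _] g0] := Cg.
pose h (m : nat) x := Num.min 1 (m%:R * g x).
have ch m : continuous (h m).
  by apply: cont_min; [exact: cont_cst|apply: contM => //; exact: cont_cst].
have h0 m x : 0 <= h m x by rewrite le_min ler01 mulr_ge0.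
have h1 m x : h m x <= 1 by rewrite ge_min lexx.
have hS m x : h m x <= h m.+1 x.
  by rewrite /h le_min ge_min lexx/= ge_min ler_wpM2r ?ler_nat ?orbT.
pose q m x := h m x * f x.
have Cq m : Ccp (q m) by exact: CcpM.
have qf m x : q m x <= f x by rewrite /q ler_piMl.
have qS m x : q m x <= q m.+1 x by rewrite /q ler_wpM2r.
have q0 : q 0%N = (fun=> 0) by apply/funext => x; rewrite /q /h mul0r (min_idPr ler01) mul0r.
pose p k x := q k.+1 x - q k x.
have Cp k : Ccp (p k) by exact: CcpB.
have psum N x : (\sum_(0 <= k < N) (p k x)%:E = (q N x)%:E)%E.
  by rewrite sumEFin (telescope_sumr (fun k => q k x))// q0 subr0.
have upc : (upper (restr f (~` G)) <= (Lam f)%:E)%E.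
  apply: upper_le_Lam => // x; rewrite lee_fin ler_piMr// indicE; by case: (_ \in _).
have fin : upper (restr f (~` G)) \is a fin_num.
  by rewrite ge0_fin_numE ?upper_ge0//; apply: le_lt_trans upc _; rewrite ltry.
rewrite -leeBrDr//.
apply: (@le_trans _ _ (\sum_(k <oo) (Lam (p k))%:E)%E).
  apply: upper_le_sum => // x; rewrite /restr indicE.
  have p0 k : (0 <= (p k x)%:E)%E by rewrite lee_fin (Cp k).2.
  case: (boolP (x \in G)) => [xG|_]; last by rewrite mulr0; apply: nneseries_ge0.
  rewrite mulr1; move: xG; rewrite inE /G /= => gx.
  pose N := (Num.truncn (g x)^-1).+1.
  apply: le_trans (@nneseries_ge_partial _ _ N _) => //.
  rewrite psum lee_fin /q /h min_l ?mul1r// -ler_pdivrMr// mul1r ltW//.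
  exact: truncnS_gt.
apply: nneseries_le_bound => [k|N]; first by rewrite lee_fin Lam_ge0.
rewrite sumEFin -Lam_sum// leeBrDr// -leeBrDl//.
rewrite (_ : (fun x => _) = q N); last first.
  by apply/funext => x; have := psum N x; rewrite sumEFin => -[].
rewrite -EFinB -LamB//; apply: upper_le_Lam; first exact: CcpB.
move=> x; rewrite lee_fin indicE.
case: (boolP (x \in ~` G)) => [|_]; last by rewrite mulr0 subr_ge0.
rewrite inE /G /= => /negP; rewrite -leNgt => gx; rewrite mulr1.
rewrite /q /h.
have -> : g x = 0 by apply/le_anti; rewrite gx g0.
by rewrite mulr0 (min_idPr ler01) mul0r subr0.
Qed.

Definition daniell_outer (A : set Rn) : \bar R := upper (fun x => (\1_A x)%:E).

Let outer0 : daniell_outer set0 = 0%E.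
Proof. by rewrite /daniell_outer -upper0; congr upper; apply/funext => x; rewrite indic0. Qed.

Let outer_ge0 A : (0 <= daniell_outer A)%E. Proof. exact: upper_ge0. Qed.

Let outer_homo : {homo daniell_outer : A B / A `<=` B >-> (A <= B)%E}.
Proof.
move=> A B AB; apply: le_upper => x; rewrite lee_fin !indicE.
case: (boolP (x \in A)) => // xA.
by rewrite (_ : x \in B)//; move: xA; rewrite !inE; exact: AB.
Qed.

Let outer_subadd : sigma_subadditive daniell_outer.
Proof.
move=> A; apply: upper_subadd => [x|i x]; last by rewrite lee_fin indicE.
rewrite indicE; case: (boolP (x \in _)) => [|_]; last first.
  by apply: nneseries_ge0 => k _ _; rewrite lee_fin indicE.
rewrite inE => -[i _ Aix].
apply: le_trans (@nneseries_ge_partial _ _ i.+1 _); last by move=> k; rewrite lee_fin indicE.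
rewrite big_nat_recr//= [\1_(A i) x]indicE mem_set//; apply: lee_paddl => //.
by apply: sume_ge0 => k _; rewrite lee_fin indicE.
Qed.

Let dout : {outer_measure set Rn -> \bar R} := HB.pack daniell_outer
  (isOuterMeasure.Build R Rn daniell_outer outer0 outer_ge0 outer_homo outer_subadd).

(** Any cover of E splits term by term along {g > 0} by [upper_split], and subadditivity reassembles
    the two halves. *)
Lemma caratheodory_pos g : Ccp g -> dout.-caratheodory [set x | (0 < g x)%R].
Proof.
move=> Cg; apply: (@le_caratheodory_measurable _ _ dout) => E.
set G := [set x | _]; apply: upper_lb => p Cp Ep.
have p0 k x : 0 <= p k x by have [] := Cp k.
have H A : (dout (E `&` A) <= \sum_(k <oo) upper (restr (p k) A))%E.
  apply: upper_subadd => [x|i x]; last by rewrite lee_fin mulr_ge0// indicE.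
  rewrite indicI /= EFinM.
  rewrite [X in (_ <= X)%E](_ : _ = (\sum_(k <oo) (p k x)%:E) * (\1_A x)%:E)%E; last first.
    rewrite muleC -nneseriesZl//; last by move=> k _; rewrite lee_fin.
    by apply: eq_eseriesr => k _; rewrite muleC.
  by rewrite lee_wpmul2r// lee_fin indicE.
apply: le_trans (leeD (H G) (H (~` G))) _.
rewrite -nneseriesD => [|k _ _|k _ _]; [|exact: upper_ge0..].
by apply: lee_nneseries => [k _ _|k _]; [apply: adde_ge0; exact: upper_ge0|exact: upper_split].
Qed.

Lemma caratheodory_borel (A : set Rn) : measurable A -> dout.-cara.-measurable A.
Proof.
have ball_pos (q : Rn) (r : R) : dout.-caratheodory (ball q r).
  by have [g Cg ->] := ball_Ccp q r; exact: caratheodory_pos.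
apply: smallest_sub.
  split; first exact: measurable0.
    by move=> B mB; rewrite setTD; exact: measurableC.
  by move=> F mF; exact: bigcupT_measurable.
move=> U oU; rewrite (open_rV_bigcup oU) bigcup_mkcond.
apply: countable_bigcupT_measurable => [|[q k]]; first exact: countableP.
case: ifPn => _; last exact: measurable0.
exact: ball_pos.
Qed.

Let daniell_sigma_additive : semi_sigma_additive (daniell_outer : set Rn -> \bar R).
Proof.
move=> F mF tF mUF.
apply: (@measure_semi_sigma_additive _ _ _ (dout : {measure set (caratheodory_type dout) -> \bar R}) F) => //.
- by move=> k; exact: caratheodory_borel.
- exact: caratheodory_borel.
Qed.

Definition daniell : {measure set Rn -> \bar R} := HB.pack daniell_outer
  (isMeasure.Build _ _ _ (daniell_outer : set Rn -> \bar R) outer0 outer_ge0 daniell_sigma_additive).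

Definition bump (r : R) (x : Rn) : R := Num.max 0 (Num.min 1 (r - `|x|)).

Lemma Ccp_bump r : Ccp (bump r).
Proof.
split; last by move=> x; rewrite le_max lexx.
split.
  apply: cont_max; first exact: cont_cst.
  apply: cont_min; first exact: cont_cst.
  by apply: contB; [exact: cont_cst|apply: cont_norm; exact: cont_id].
apply/compactly_supportedP; exists r => x xr; apply/max_idPl.
by rewrite ge_min; apply/orP; right; rewrite subr_le0 ltW.
Qed.

Lemma bump_le1 r x : bump r x <= 1.
Proof. by rewrite /bump ge_max ler01 ge_min lexx. Qed.

Lemma bump_eq1 r x : `|x| <= r - 1 -> bump r x = 1.
Proof.
move=> h; rewrite /bump (_ : Num.min 1 _ = 1); first by apply/max_idPr; exact: ler01.
by apply/min_idPl; lra.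
Qed.

(** The increments of growing bumps cover the constant 1, and their partial sums are bumps, at most
    1, hence of value at most V. *)
Lemma daniell_le_V : (daniell setT <= V%:E)%E.
Proof.
pose q (k : nat) := bump k%:R.
have Cq k : Ccp (q k) by exact: Ccp_bump.
pose p k x := q k.+1 x - q k x.
have qS k x : q k x <= q k.+1 x.
  rewrite /q /bump ge_max le_max lexx/= le_max; apply/orP; right.
  by rewrite le_min ge_min lexx/= ge_min -natr1; apply/orP; right; lra.
have Cp k : Ccp (p k) by exact: CcpB.
have q0 x : q 0%N x = 0.
  apply/max_idPl; rewrite ge_min; apply/orP; right; by rewrite sub0r oppr_le0.
have psum N x : \sum_(0 <= k < N) p k x = q N x.
  by rewrite (telescope_sumr (fun k => q k x))// q0 subr0.
apply: (@le_trans _ _ (\sum_(k <oo) (Lam (p k))%:E)%E).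
  apply: upper_le_sum => // x; rewrite indicT.
  pose N := (Num.truncn (`|x| + 1)).+1.
  apply: le_trans (@nneseries_ge_partial _ _ N _); last by move=> k; rewrite lee_fin (Cp k).2.
  rewrite sumEFin psum /q bump_eq1// lerBrDr ltW//.
  exact: truncnS_gt.
apply: nneseries_le_bound => [k|N]; first by rewrite lee_fin Lam_ge0.
rewrite sumEFin -Lam_sum// lee_fin -[leRHS]mulr1; apply: Lam_le; first exact: Ccp_sum.
by move=> x; rewrite psum bump_le1.
Qed.

(** A layer-cake argument of step d: f is at most the sum of d times the indicators of {f > j d},
    and d times the indicator of {f > (j + 1) d} lies below the layer min(f, (j + 1) d) - min(f, j
    d). *)
Lemma integral_daniell_le f : Ccp f -> (\int[daniell]_x (f x)%:E <= (Lam f)%:E)%E.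
Proof.
move=> Cf; have [Cf1 f0] := Cf; have [M M0 fM] := Cc_bounded Cf1.
have mf : measurable_fun setT f by exact: measurable_continuous_rV Cf1.1.
apply/lee_addgt0Pr => e e0; have V1 : 0 < V + 1 by rewrite ltr_wpDl.
have [d d0 dV] : exists2 d : R, 0 < d & d * V <= e.
  exists (e / (V + 1)); first exact: divr_gt0.
  by rewrite mulrAC ler_pdivrMr// ler_pM2l// lerDl.
pose m (j : nat) x := Num.min (f x) (j%:R * d).
pose A (j : nat) := [set x | j%:R * d < f x].
have mA j : measurable (A j).
  apply: open_measurable_rV; apply: (@open_comp _ _ f [set t | j%:R * d < t]); last exact: open_gt.
  by move=> x _; exact: Cf1.1.
have Cm j : Ccp (m j).
  split; last by move=> x; rewrite le_min f0 mulr_ge0// ltW.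
  apply: (Cc_support _ Cf1); first by apply: cont_min; [exact: Cf1.1|exact: cont_cst].
  by move=> x fx; rewrite /m fx; apply/min_idPl; rewrite mulr_ge0// ltW.
have mS j x : m j x <= m j.+1 x.
  rewrite /m le_min ge_min lexx/= ge_min; apply/orP; right.
  by rewrite ler_pM2r// ler_nat.
have lay j : ((d%:E * daniell (A j.+1)) <= (Lam (m j.+1) - Lam (m j))%:E)%E.
  rewrite -LamB//.
  have Cl : Ccp (fun x => m j.+1 x - m j x) by exact: CcpB.
  rewrite -[X in (_ <= X%:E)%E](mulVKf (lt0r_neq0 d0)) EFinM.
  apply: lee_wpmul2l; first by rewrite lee_fin ltW.
  rewrite -LamZ ?invr_ge0 ?(ltW d0)//.
  apply: upper_le_Lam; first by apply: CcpZ => //; rewrite invr_ge0 ltW.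
  move=> x; rewrite lee_fin indicE; case: (boolP (_ \in _)) => [|_]; last first.
    by rewrite mulr_ge0// ?invr_ge0 ?(ltW d0)// subr_ge0.
  rewrite inE /A /= => xj; rewrite /m (min_idPr (ltW xj)) min_r; last first.
    by apply: le_trans (ltW xj); rewrite ler_pM2r// ler_nat.
  by rewrite -mulrBl -(natr1 j) addrAC subrr add0r mul1r mulVf// gt_eqF.
pose J := (Num.truncn (M / d)).+1.
have fJ x : f x <= J%:R * d.
  rewrite -ler_pdivrMr// ltW//; apply: le_lt_trans (truncnS_gt _).
  by rewrite ler_pM2r ?invr_gt0//; apply: le_trans (fM x); exact: ler_norm.
have bnd x : f x <= \sum_(0 <= j < J.+1) d * \1_(A j) x.
  have mle N : m N x <= \sum_(0 <= j < N) d * \1_(A j) x.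
    elim: N => [|N ih]; first by rewrite big_nil ge_min mul0r lexx orbT.
    rewrite big_nat_recr//= indicE; case: (boolP (_ \in _)) => [_|].
      rewrite mulr1; apply: (@le_trans _ _ (m N x + d)); last by rewrite lerD2r.
      rewrite /m -natr1 mulrDl mul1r addr_minl; rewrite le_min !ge_min lexx orbT andbT.
      by rewrite lerDl ltW.
    rewrite notin_setE /A /= => /negP; rewrite -leNgt => h.
    rewrite mulr0 addr0; apply: le_trans ih; rewrite /m (min_idPl h) ge_min lexx//.
  apply: le_trans (mle J.+1); rewrite le_min lexx/=; apply: le_trans (fJ x) _.
  by rewrite ler_pM2r// ler_nat.
have I x j : 0 <= d * \1_(A j) x by rewrite mulr_ge0 ?(ltW d0)// indicE.
apply: (@le_trans _ _ (\int[daniell]_x (\sum_(0 <= j < J.+1) (d * \1_(A j) x)%:E)%E)%E).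
  apply: ge0_le_integral => //.
  - by move=> x _; rewrite lee_fin.
  - exact/measurable_EFinP.
  - apply: emeasurable_sum => j; apply/measurable_EFinP.
    by apply: measurable_funM; [exact: measurable_cst|exact: measurable_indic].
  - by move=> x _; rewrite sumEFin lee_fin.
rewrite ge0_integral_sum//; last first.
  by move=> j x _; rewrite lee_fin.
  move=> j; apply/measurable_EFinP.
  by apply: measurable_funM; [exact: measurable_cst|exact: measurable_indic].
have IA j : (\int[daniell]_x (d * \1_(A j) x)%:E = d%:E * daniell (A j))%E.
  have -> := ge0_integralZ_EFin daniell (ltW d0) (measurable_indic (mA j)) (fun x => _ : 0 <= \1_(A j) x).
    by rewrite integral_indic// setIT.
  by move=> x; rewrite indicE.
under eq_bigr do rewrite IA.
(* The shift of the index leaves the set {f > 0} without a layer; it costs at most d V <= e. *)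
rewrite big_nat_recl//= addeC; apply: leeD.
  apply: (@le_trans _ _ (\sum_(0 <= j < J) (Lam (m j.+1) - Lam (m j))%:E)%E).
    by apply: lee_sum => j _; exact: lay.
  rewrite sumEFin (telescope_sumr (fun j => Lam (m j)))// lee_fin.
  apply: (@le_trans _ _ (Lam (m J))); first by rewrite lerBlDr lerDl Lam_ge0.
  by apply: le_Lam => // x; rewrite ge_min lexx.
apply: (@le_trans _ _ (d%:E * V%:E)%E).
  rewrite lee_pmul2l// ?fin_numE//; apply: le_trans daniell_le_V.
  by apply: le_measure; rewrite ?inE.
by rewrite -EFinM lee_fin.
Qed.

Lemma daniell_fin : fin_num_fun (daniell : set Rn -> \bar R).
Proof.
move=> A mA; rewrite ge0_fin_numE//; apply: le_lt_trans (ltry V).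
by apply: le_trans daniell_le_V; apply: le_measure; rewrite ?inE.
Qed.

Lemma daniell_ball_approx (e : R) : 0 < e ->
  exists k : nat, (daniell setT <= daniell [set x : Rn | (`|x| <= k%:R)%R] + e%:E)%E.
Proof.
move=> e0; pose F (k : nat) := [set x : Rn | `|x| <= k%:R].
have mF k : measurable (F k) by exact: measurable_normr_le.
have UF : \bigcup_k F k = setT.
  apply/seteqP; split => // x _; exists (Num.truncn `|x|).+1 => //.
  by rewrite /F /= ltW// truncnS_gt.
have := @nondecreasing_cvg_mu _ _ _ daniell F mF.
rewrite UF => /(_ measurableT) H.
have {}H : daniell \o F @ \oo --> daniell setT.
  by apply: H; apply/nondecreasing_seqP => k; apply/subsetPset => x /= /le_trans; apply; rewrite ler_nat.
have fT := daniell_fin measurableT.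
rewrite -(fineK fT) in H.
have /fine_cvgP[_ /cvgrPdist_lt/(_ _ e0)[N _ /(_ N (leqnn N)) HN]] := H.
exists N; rewrite -(fineK fT) -(fineK (daniell_fin (mF N))) -EFinD lee_fin.
rewrite -lerBlDl ltW//; apply: le_lt_trans HN; exact: ler_norm.
Qed.

(** The inequality just proved is applied to M chi - f, where chi is a plateau that carries almost
    all the mass; there [Lam chi] is at most the total mass, which is close to the integral of
    chi. *)
Lemma integral_daniell f : Ccp f -> (\int[daniell]_x (f x)%:E = (Lam f)%:E)%E.
Proof.
move=> Cf; apply/eqP; rewrite eq_le integral_daniell_le//=.
have [Cf1 f0] := Cf; have [M0 M00 fM0] := Cc_bounded Cf1.
have /compactly_supportedP[r0 fr0] := Cf1.2.
pose M := M0 + 1; have M1 : 0 < M by rewrite ltr_wpDl.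
apply/lee_addgt0Pr => e e0.
have [k Hk] := daniell_ball_approx (divr_gt0 e0 M1).
have [N [kN rN]] : exists N : nat, (k <= N)%N /\ r0 <= N%:R.
  exists (maxn k (Num.truncn r0).+1); split; first exact: leq_maxl.
  apply: (@le_trans _ _ (Num.truncn r0).+1%:R); first by rewrite ltW// truncnS_gt.
  by rewrite ler_nat leq_maxr.
pose chi := bump (N%:R + 1); have Cchi : Ccp chi by exact: Ccp_bump.
have chi0 x : 0 <= chi x by have [] := Cchi.
have chi1 x : `|x| <= N%:R -> chi x = 1 by move=> xN; apply: bump_eq1; rewrite addrK.
pose g x := M * chi x - f x.
have fg x : f x <= M * chi x.
  have [xN|xN] := leP `|x| N%:R.
    by rewrite chi1// mulr1 (le_trans (ler_norm _))// (le_trans (fM0 x))// lerDl.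
  by rewrite fr0 ?mulr_ge0 ?(ltW M1)//; apply: le_lt_trans xN.
have Cg : Ccp g by apply: CcpB => //; apply: CcpZ => //; exact: ltW.
have mc h : Ccp h -> measurable_fun setT h by move=> [[ch _] _]; exact: measurable_continuous_rV.
have fin h : Ccp h -> (\int[daniell]_x (h x)%:E)%E \is a fin_num.
  move=> Ch; rewrite ge0_fin_numE; last by apply: integral_ge0 => x _; rewrite lee_fin Ch.2.
  by apply: le_lt_trans (integral_daniell_le Ch) _; rewrite ltry.
have E1 : (\int[daniell]_x (g x)%:E + \int[daniell]_x (f x)%:E = M%:E * \int[daniell]_x (chi x)%:E)%E.
  rewrite -ge0_integralZ_EFin ?(ltW M1)//; last exact: mc.
  rewrite -ge0_integralD_EFin//; [|exact: mc|exact: mc|by move=> x; have [] := Cg].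
  by apply: eq_integral => x _; rewrite /g subrK.
have E2 := integral_daniell_le Cg.
have E3 : (daniell [set x : Rn | (`|x| <= k%:R)%R] <= \int[daniell]_x (chi x)%:E)%E.
  have mF := @measurable_normr_le R n k%:R.
  have <- : (\int[daniell]_x (\1_[set x : Rn | `|x| <= k%:R] x)%:E = daniell [set x : Rn | (`|x| <= k%:R)%R])%E.
    by rewrite integral_indic// setIT.
  apply: ge0_le_integral_EFin; [exact: measurable_indic|exact: mc|by move=> x; rewrite indicE|].
  move=> x; rewrite indicE; case: (boolP (_ \in _)) => [|_]; last exact: chi0.
  by rewrite inE /= => xk; rewrite chi1// (le_trans xk)// ler_nat.
have E4 : ((Lam chi)%:E <= daniell setT)%E.
  apply: Lam_le_upper => // x; rewrite lee_fin indicT; exact: bump_le1.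
have Lg : Lam g = M * Lam chi - Lam f.
  by rewrite LamB// ?LamZ ?(ltW M1)//; apply: CcpZ => //; exact: ltW.
move: E1 E2 E3 (le_trans E4 Hk); rewrite Lg.
rewrite -(fineK (fin _ Cf)) -(fineK (fin _ Cg)) -(fineK (fin _ Cchi)).
set a := fine _; set b := fine _; set c := fine _.
rewrite -EFinD -EFinM => -[E1]; rewrite !lee_fin => E2 E3 E5.
have {E3 E5} E6 : Lam chi <= c + e / M.
  by rewrite -lee_fin; apply: le_trans E5 _; rewrite EFinD; apply: leeD.
have : M * Lam chi <= M * c + e by rewrite -[e](divfK (lt0r_neq0 M1)) (mulrC (e / M)) -mulrDr ler_pM2l.
rewrite -E1 => h; lra.
Qed.

Lemma daniell_representation : exists mu : {finite_measure set Rn -> \bar R},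
  forall f, Ccp f -> (\int[mu]_x (f x)%:E = (Lam f)%:E)%E.
Proof.
by exists (fin_measure daniell_fin) => f Cf; exact: integral_daniell.
Qed.

End daniell.

Lemma eq0_le_eps {R : realType} (x C : R) : (forall e, 0 < e -> `|x| <= C * e) -> x = 0.
Proof.
move=> h; apply/eqP; rewrite -normr_eq0 eq_le normr_ge0 andbT.
apply/ler_addgt0Pr => e e0; rewrite add0r.
have C1 : 0 < `|C| + 1 by rewrite ltr_wpDl.
apply: le_trans (h _ (divr_gt0 e0 C1)) _; rewrite mulrA ler_pdivrMr// mulrC ler_pM2l//.
by apply: le_trans (ler_norm _) _; rewrite lerDl.
Qed.

Lemma integrable_bounded {R : realType} d (T : measurableType d) (mu : {finite_measure set T -> \bar R})
    (f : T -> R) (M : R) : measurable_fun setT f -> (forall x, `|f x| <= M) -> mu.-integrable setT (EFin \o f).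
Proof.
move=> mf fM; have [->|/set0P[x0 _]] := eqVneq [set: T] set0; first exact: integrable_set0.
apply: (integrable_le mf (g := fun=> M)) => //.
rewrite integral_cst// lte_mul_pinfty//; last by rewrite ltey_eq fin_num_measure.
by rewrite lee_fin (le_trans _ (fM x0)).
Qed.

Lemma integrable_Cc {R : realType} {n : nat} (mu : {finite_measure set 'rV[R]_n -> \bar R}) (f : 'rV[R]_n -> R) :
  Cc f -> mu.-integrable setT (EFin \o f).
Proof.
move=> Cf; have [M _ fM] := Cc_bounded Cf.
exact: (integrable_bounded _ (measurable_continuous_rV Cf.1) fM).
Qed.

(** * Bounded signed functionals on smooth test functions *)

Section riesz.
Context {R : realType} {n : nat}.
Local Notation Rn := 'rV[R]_n.
Implicit Types (f g h phi psi : Rn -> R).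

Lemma Cc_inftyD f g : Cc_infty f -> Cc_infty g -> Cc_infty (fun x => f x + g x).
Proof.
move=> Cf Cg; split; first exact: smoothD Cf.1 Cg.1.
exact: (CcD (Cc_infty_Cc Cf) (Cc_infty_Cc Cg)).2.
Qed.

Lemma Cc_inftyZ c f : Cc_infty f -> Cc_infty (fun x => c * f x).
Proof.
move=> Cf; split; first exact: (smoothZ c Cf.1).
exact: (CcZ c (Cc_infty_Cc Cf)).2.
Qed.

Variables (L : (Rn -> R) -> R) (V : R).
Hypothesis V0 : 0 <= V.
Hypothesis LD : forall f g, Cc_infty f -> Cc_infty g -> L (fun x => f x + g x) = L f + L g.
Hypothesis LZ : forall c f, Cc_infty f -> L (fun x => c * f x) = c * L f.
Hypothesis LB : forall c f, Cc_infty f -> (forall x, `|f x| <= c) -> `|L f| <= V * c.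

Let LBB f g c : Cc_infty f -> Cc_infty g -> (forall x, `|f x - g x| <= c) -> `|L f - L g| <= V * c.
Proof.
move=> Cf Cg fg; have Cg' := Cc_inftyZ (-1) Cg.
have <- : L (fun x => f x + -1 * g x) = L f - L g by rewrite LD// LZ// mulN1r.
by apply: LB => [|x]; [exact: Cc_inftyD|rewrite mulN1r].
Qed.

(* The bound [V] determines the extension of [L] from [Cc_infty] to [Cc]. *)
Lemma riesz_extension : exists Lb : (Rn -> R) -> R, forall f g c, Cc f -> Cc_infty g ->
  (forall x, `|f x - g x| <= c) -> `|Lb f - L g| <= V * c.
Proof.
have /choice[Lb HLb] f : exists l : R, Cc f -> forall g c, Cc_infty g ->
    (forall x, `|f x - g x| <= c) -> `|l - L g| <= V * c.
  have [Cf|nCf] := pselect (Cc f); last by exists 0.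
  (* Each smooth g within c of f confines the value to [L g - V c, L g + V c]. By the bound on L no
     left end exceeds a right end, so the supremum of the left ends lies in all these intervals. *)
  pose E := [set r | exists g c, [/\ Cc_infty g, forall x, `|f x - g x| <= c & r = L g - V * c]].
  have Eub g c : Cc_infty g -> (forall x, `|f x - g x| <= c) -> ubound E (L g + V * c).
    move=> Cg fg _ [g' [c' [Cg' fg' ->]]].
    rewrite lerBlDr -addrA -mulrDr -lerBlDl; apply: le_trans (ler_norm _) _.
    apply: LBB => // x; rewrite -(subrKA (f x)); apply: le_trans (ler_normD _ _) _.
    by rewrite addrC; apply: lerD; rewrite // distrC.
  have [M _ fM] := Cc_bounded Cf.
  have [g0 [Cg0 _ h0]] := Cc_infty_dense Cf ltr01 fM.
  have E0 : E !=set0 by exists (L g0 - V * 1); exists g0, 1.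
  exists (sup E) => _ g c Cg fg; rewrite ler_norml; apply/andP; split.
    rewrite lerBrDl; apply: ub_le_sup; first by exists (L g + V * c); exact: Eub.
    by exists g, c.
  by rewrite lerBlDl; apply: ge_sup => //; exact: Eub.
by exists Lb => f g c Cf; exact: HLb.
Qed.

Let Lb := sval (cid riesz_extension).

Let LbP f g c : Cc f -> Cc_infty g -> (forall x, `|f x - g x| <= c) -> `|Lb f - L g| <= V * c.
Proof. exact: (svalP (cid riesz_extension)). Qed.

Let LbD f g : Cc f -> Cc g -> Lb (fun x => f x + g x) = Lb f + Lb g.
Proof.
move=> Cf Cg; apply/eqP; rewrite -subr_eq0; apply/eqP/(@eq0_le_eps R _ (V * 4)) => e e0.
have [M _ fM] := Cc_bounded Cf; have [N _ gN] := Cc_bounded Cg.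
have [f' [Cf' _ hf]] := Cc_infty_dense Cf e0 fM.
have [g' [Cg' _ hg]] := Cc_infty_dense Cg e0 gN.
have h1 := LbP Cf Cf' hf; have h2 := LbP Cg Cg' hg.
have h3 : `|Lb (fun x => f x + g x) - L (fun x => f' x + g' x)| <= V * (e + e).
  apply: LbP; [exact: CcD|exact: Cc_inftyD|] => x.
  by rewrite opprD addrACA; apply: le_trans (ler_normD _ _) _; exact: lerD.
rewrite LD// in h3; move: h1 h2 h3; rewrite !ler_norml => /andP[a1 a2] /andP[b1 b2] /andP[c1 c2].
apply/andP; split; lra.
Qed.

Let LbZ c f : Cc f -> Lb (fun x => c * f x) = c * Lb f.
Proof.
move=> Cf; apply/eqP; rewrite -subr_eq0; apply/eqP/(@eq0_le_eps R _ (V * (2 * `|c|))) => e e0.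
have [M _ fM] := Cc_bounded Cf.
have [f' [Cf' _ hf]] := Cc_infty_dense Cf e0 fM.
have h1 := LbP Cf Cf' hf.
have h3 : `|Lb (fun x => c * f x) - L (fun x => c * f' x)| <= V * (`|c| * e).
  apply: LbP; [exact: CcZ|exact: Cc_inftyZ|] => x.
  by rewrite -mulrBr normrM ler_wpM2l.
rewrite LZ// in h3.
have h4 : `|c * Lb f - c * L f'| <= `|c| * (V * e) by rewrite -mulrBr normrM ler_wpM2l.
move: h3 h4; rewrite !ler_norml => /andP[a1 a2] /andP[b1 b2].
apply/andP; split; lra.
Qed.

Let LbB c f : Cc f -> (forall x, `|f x| <= c) -> `|Lb f| <= V * c.
Proof.
move=> Cf fc; apply/ler_addgt0Pr => e e0.
have V1 : 0 < V + 1 by rewrite ltr_wpDl.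
have [f' [Cf' fc' hf]] := Cc_infty_dense Cf (divr_gt0 e0 V1) fc.
have h1 := LbP Cf Cf' hf; have h2 := LB Cf' fc'.
have h3 : V * (e / (V + 1)) <= e by rewrite mulrA ler_pdivrMr// mulrC ler_pM2l// lerDl.
rewrite -(subrK (L f') (Lb f)); apply: le_trans (ler_normD _ _) _; lra.
Qed.

Let PS f := [set Lb g | g in [set g : Rn -> R | Cc g /\ forall x, 0 <= g x <= f x]].

(* The positive part of the functional [Lb] on nonnegative functions. *)
Let P f := sup (PS f).

Let PS_ub f c : (forall x, f x <= c) -> ubound (PS f) (V * c).
Proof.
move=> fc _ [g [Cg gf] <-]; apply: le_trans (ler_norm _) _; apply: LbB => // x.
by have /andP[g0 gx] := gf x; rewrite ger0_norm// (le_trans gx).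
Qed.

Let Lb0 : Lb (fun=> 0) = 0.
Proof.
rewrite -[RHS](mul0r (Lb (fun=> 0))) -LbZ; last exact: Cc0.
by congr Lb; apply/funext => x; rewrite mul0r.
Qed.

Let PS0 f : Ccp f -> PS f 0.
Proof. by move=> [_ f0]; exists (fun=> 0) => //; split => [|x]; [exact: Cc0|rewrite lexx f0]. Qed.

Let PS_hub f : Ccp f -> has_ubound (PS f).
Proof.
move=> [Cf f0]; have [M _ fM] := Cc_bounded Cf; exists (V * M); apply: PS_ub => x.
by apply: le_trans (fM x); exact: ler_norm.
Qed.

Let P_ge f g : Ccp f -> Cc g -> (forall x, 0 <= g x <= f x) -> Lb g <= P f.
Proof. by move=> Cf Cg gf; apply: ub_le_sup; [exact: PS_hub|exists g]. Qed.

Let P_le f r : Ccp f -> (forall g, Cc g -> (forall x, 0 <= g x <= f x) -> Lb g <= r) -> P f <= r.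
Proof.
move=> Cf h; apply: ge_sup; first by exists 0; exact: PS0.
by move=> _ [g [Cg gf] <-]; exact: h.
Qed.

Let P_ge0 f : Ccp f -> 0 <= P f.
Proof. by move=> Cf; apply: ub_le_sup; [exact: PS_hub|exact: PS0]. Qed.

Let P_bnd c f : Ccp f -> (forall x, f x <= c) -> P f <= V * c.
Proof. by move=> Cf fc; apply: ge_sup; [by exists 0; exact: PS0|exact: PS_ub]. Qed.

(** The Riesz decomposition: a competitor h <= f + g splits into min(h, f) <= f and a remainder <=
    g. Conversely, competitors for f and g add up. *)
Let PD f g : Ccp f -> Ccp g -> P (fun x => f x + g x) = P f + P g.
Proof.
move=> Cf Cg; have Cfg := CcpD Cf Cg; apply/le_anti/andP; split.
  apply: P_le => // h Ch hfg.
  have Cm : Cc (fun x => Num.min (h x) (f x)).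
    apply: (Cc_support _ Cf.1); first by apply: cont_min; [exact: Ch.1|exact: Cf.1.1].
    by move=> x fx; rewrite fx; apply/min_idPr; have /andP[] := hfg x.
  have -> : Lb h = Lb (fun x => Num.min (h x) (f x)) + Lb (fun x => h x - Num.min (h x) (f x)).
    by rewrite -LbD//; [congr Lb; apply/funext => x; rewrite addrC subrK|exact: CcB].
  have f0 x := Cf.2 x; have g0 x := Cg.2 x.
  apply: lerD; [apply: P_ge (Cf) Cm _|apply: P_ge (Cg) (CcB Ch Cm) _].
    by move=> x; have /andP[h0 _] := hfg x; rewrite le_min h0 f0 ge_min lexx orbT.
  move=> x; have /andP[h0 hx] := hfg x; rewrite subr_ge0 ge_min lexx/=.
  by rewrite lerBlDr addrC -lerBlDr le_min lerBlDr lerDl g0 lerBlDr.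
rewrite -lerBrDr; apply: P_le => // h1 Ch1 h1f.
rewrite lerBrDr -lerBrDl; apply: P_le => // h2 Ch2 h2g.
rewrite lerBrDl -LbD//; apply: P_ge => //; first exact: CcD.
move=> x; have /andP[a1 a2] := h1f x; have /andP[b1 b2] := h2g x.
by rewrite addr_ge0//= lerD.
Qed.

(** One inequality holds for every positive factor; used with 1/c it gives the other one. *)
Let PZ c f : 0 <= c -> Ccp f -> P (fun x => c * f x) = c * P f.
Proof.
rewrite le_eqVlt => /predU1P[<- Cf|c0 Cf].
  rewrite mul0r; apply/le_anti/andP; split; last by apply: P_ge0; apply: CcpZ.
  rewrite -[leRHS](mulr0 V); apply: P_bnd; first exact: (CcpZ (lexx 0) Cf).
  by move=> x; rewrite mul0r.
have H d h : 0 < d -> Ccp h -> d * P h <= P (fun x => d * h x).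
  move=> d0 Ch; rewrite -ler_pdivlMl//; apply: P_le => // g Cg gh.
  rewrite ler_pdivlMl// -LbZ//; apply: P_ge; [by apply: CcpZ => //; exact: ltW|exact: CcZ|].
  by move=> x; have /andP[a1 a2] := gh x; rewrite mulr_ge0 ?(ltW d0)//= ler_pM2l.
apply/le_anti; rewrite H// andbT -ler_pdivrMl//.
have ci : 0 < c^-1 by rewrite invr_gt0.
apply: le_trans (H _ _ ci (CcpZ (ltW c0) Cf)) _.
rewrite (_ : (fun x => _) = f)//; apply/funext => x.
by rewrite mulKf// gt_eqF.
Qed.

Let Q f := P f - Lb f.

Let QD f g : Ccp f -> Ccp g -> Q (fun x => f x + g x) = Q f + Q g.
Proof. by move=> Cf Cg; rewrite /Q PD// LbD ?Cf.1 ?Cg.1//; [ring|exact: Cf.1|exact: Cg.1]. Qed.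

Let QZ c f : 0 <= c -> Ccp f -> Q (fun x => c * f x) = c * Q f.
Proof. by move=> c0 Cf; rewrite /Q PZ// LbZ; [ring|exact: Cf.1]. Qed.

Let Q_ge0 f : Ccp f -> 0 <= Q f.
Proof.
move=> Cf; rewrite subr_ge0; apply: P_ge => //; first exact: Cf.1.
by move=> x; rewrite Cf.2 lexx.
Qed.

Let Q_bnd c f : Ccp f -> (forall x, f x <= c) -> Q f <= (V + V) * c.
Proof.
move=> Cf fc; have h1 := P_bnd Cf fc.
have : `|Lb f| <= V * c.
  by apply: LbB => [|x]; [exact: Cf.1|rewrite ger0_norm// Cf.2].
by rewrite ler_norml /Q => /andP[h2 _]; lra.
Qed.

(** The Jordan decomposition Lb = P - Q into positive functionals, each represented by Daniell's
    measure; f is split into its positive and negative parts, which are only continuous, hence the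
    extension to [Cc]. *)
Lemma riesz : exists mu1 mu2 : {finite_measure set Rn -> \bar R}, forall f, Cc_infty f ->
  L f = \int[mu1]_x f x - \int[mu2]_x f x.
Proof.
have [mu1 H1] := daniell_representation V0 PD PZ P_ge0 P_bnd.
have [mu2 H2] := daniell_representation (addr_ge0 V0 V0) QD QZ Q_ge0 Q_bnd.
exists mu1, mu2 => f Cf; have Cf1 := Cc_infty_Cc Cf.
have LE : Lb f = L f.
  apply/eqP; rewrite -subr_eq0; apply/eqP/(@eq0_le_eps R _ V) => e e0.
  by apply: LbP => // x; rewrite subrr normr0 ltW.
have Cp : Ccp (fun x => Num.max (f x) 0).
  split; last by move=> x; rewrite le_max lexx orbT.
  apply: (Cc_support _ Cf1); first by apply: cont_max; [exact: Cf1.1|exact: cont_cst].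
  by move=> x ->; rewrite maxxx.
have Cn : Ccp (fun x => Num.max (- f x) 0).
  split; last by move=> x; rewrite le_max lexx orbT.
  apply: (Cc_support _ Cf1); first by apply: cont_max; [apply: contN; exact: Cf1.1|exact: cont_cst].
  by move=> x ->; rewrite oppr0 maxxx.
have fE : f = (fun x => Num.max (f x) 0 + -1 * Num.max (- f x) 0).
  apply/funext => x; rewrite mulN1r; have [fx|fx] := leP 0 (f x).
    by rewrite (max_idPr _) ?subr0// oppr_le0.
  by rewrite (max_idPl _) ?opprK ?add0r// oppr_ge0 ltW.
have R1 (mu : {finite_measure set Rn -> \bar R}) :
    \int[mu]_x f x = \int[mu]_x Num.max (f x) 0 - \int[mu]_x Num.max (- f x) 0.
  rewrite -RintegralB//; [|exact: integrable_Cc Cp.1|exact: integrable_Cc Cn.1].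
  by apply: eq_Rintegral => x _; rewrite {1}fE mulN1r.
have R2 g : Ccp g -> Lb g = \int[mu1]_x g x - \int[mu2]_x g x.
  by move=> Cg; rewrite /Rintegral H1// H2//= /Q opprB addrC subrK.
rewrite -LE {1}fE LbD//; [|exact: Cp.1|by apply: CcZ; exact: Cn.1].
rewrite LbZ; last exact: Cn.1.
by rewrite (R2 _ Cp) (R2 _ Cn) !R1; ring.
Qed.

End riesz.

(** * Total variation and duality *)

Section charge_facts.
Context d (T : measurableType d) {R : realType}.
Implicit Types (nu : {charge set T -> \bar R}) (mu : {finite_measure set T -> \bar R}) (f g : T -> R).

Definition bmeas f := measurable_fun setT f /\ exists M : R, forall x, `|f x| <= M.

Lemma bmeasD f g : bmeas f -> bmeas g -> bmeas (fun x => f x + g x).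
Proof.
move=> [mf [M fM]] [mg [N gN]]; split; first exact: measurable_funD.
by exists (M + N) => x; apply: le_trans (ler_normD _ _) _; exact: lerD.
Qed.

Lemma bmeasM f g : bmeas f -> bmeas g -> bmeas (fun x => f x * g x).
Proof.
move=> [mf [M fM]] [mg [N gN]]; split; first exact: measurable_funM.
by exists (M * N) => x; rewrite normrM; apply: ler_pM.
Qed.

Lemma bmeas_cst c : bmeas (fun=> c).
Proof. by split; [exact: measurable_cst|exists `|c|]. Qed.

Lemma bmeasZ c f : bmeas f -> bmeas (fun x => c * f x).
Proof. by move=> bf; apply: bmeasM => //; exact: bmeas_cst. Qed.

Lemma bmeasB f g : bmeas f -> bmeas g -> bmeas (fun x => f x - g x).
Proof.
move=> bf bg; have := bmeasD bf (bmeasZ (-1) bg).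
by under eq_fun do rewrite mulN1r.
Qed.

Lemma bmeas_indic (A : set T) : measurable A -> bmeas (\1_A : T -> R).
Proof.
move=> mA; split; first exact: measurable_indic.
by exists 1 => x; rewrite indicE; case: (_ \in _); rewrite ?normr1 ?normr0.
Qed.

Lemma bmeas_sum (I : Type) (r : seq I) (f : I -> T -> R) : (forall i, bmeas (f i)) ->
  bmeas (fun x => \sum_(i <- r) f i x).
Proof.
move=> bf; elim: r => [|i r ih].
  by under eq_fun do rewrite big_nil; exact: bmeas_cst.
by under eq_fun do rewrite big_cons; exact: bmeasD.
Qed.

Lemma bmeas_norm f : bmeas f -> bmeas (fun x => `|f x|).
Proof.
move=> [mf [M fM]]; split; first exact: measurableT_comp.
by exists M => x; rewrite normr_id.
Qed.

Lemma bmeas_integrable mu f : bmeas f -> mu.-integrable setT (EFin \o f).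
Proof. by move=> [mf [M fM]]; exact: integrable_bounded fM. Qed.

Lemma bmeas_le mu f g : bmeas f -> bmeas g -> (forall x, f x <= g x) ->
  \int[mu]_x f x <= \int[mu]_x g x.
Proof. by move=> bf bg fg; apply: le_Rintegral => //; exact: bmeas_integrable. Qed.

Lemma bmeas_intD mu f g : bmeas f -> bmeas g ->
  \int[mu]_x (f x + g x) = \int[mu]_x f x + \int[mu]_x g x.
Proof. by move=> bf bg; rewrite RintegralD//; exact: bmeas_integrable. Qed.

Lemma bmeas_intZ mu c f : bmeas f -> \int[mu]_x (c * f x) = c * \int[mu]_x f x.
Proof. by move=> bf; rewrite RintegralZl//; exact: bmeas_integrable. Qed.

Lemma bmeas_int_sum mu (I : Type) (r : seq I) (f : I -> T -> R) : (forall i, bmeas (f i)) ->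
  \int[mu]_x (\sum_(i <- r) f i x) = \sum_(i <- r) \int[mu]_x f i x.
Proof.
move=> bf; elim: r => [|i r ih].
  under eq_Rintegral do rewrite big_nil.
  by rewrite big_nil Rintegral_cst// mul0r.
under eq_Rintegral do rewrite big_cons.
by rewrite big_cons bmeas_intD ?ih//; exact: bmeas_sum.
Qed.

Lemma Rintegral_indic mu (A : set T) : measurable A -> \int[mu]_x (\1_A x) = fine (mu A).
Proof. by move=> mA; rewrite /Rintegral integral_indic// setIT. Qed.

(** Makes the Hahn decomposition chosen inside [charge_integral] available, with the two finite
    measures it produces. *)
Lemma charge_jordan nu : exists p q : {finite_measure set T -> \bar R}, exists P N : set T,
  [/\ measurable P, measurable N, forall A, measurable A -> p A = nu (A `&` P),
  forall A, measurable A -> (q A = - nu (A `&` N))%E &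
  (forall A, measurable A -> nu A = p A - q A)%E /\
  forall g, charge_integral nu g = \int[p]_x g x - \int[q]_x g x].
Proof.
(* The decomposition is left open and is then instantiated, by [reflexivity], with the hidden
   choice. *)
have [[[P N] /= PN] E] : {h : {PN : set T * set T | hahn_decomposition nu PN.1 PN.2} |
    forall g, charge_integral nu g = \int[jordan_pos (svalP h)]_x g x - \int[jordan_neg (svalP h)]_x g x}.
  by eexists => g; reflexivity.
have [[mP _] [mN _] _ _] := PN.
exists (jordan_pos PN), (jordan_neg PN), P, N; split => //.
- by move=> A mA; apply: (etrans (jordan_posE PN A)); rewrite cjordan_posE /crestr0 mem_set.
- by move=> A mA; apply: (etrans (jordan_negE PN A)); rewrite cjordan_negE /crestr0 mem_set.
- by split => // A mA; apply: (etrans (jordan_decomp PN mA)); rewrite /cadd/= cscaleN1.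
Qed.

(** If p - q = m1 - m2 then p + m2 = q + m1 as measures, and integrals are additive in the measure:
    any decomposition computes the integral. *)
Lemma charge_integral_measures nu (m1 m2 : {finite_measure set T -> \bar R}) g :
  (forall A, measurable A -> nu A = m1 A - m2 A)%E -> bmeas g ->
  charge_integral nu g = \int[m1]_x g x - \int[m2]_x g x.
Proof.
move=> H bg; have [p [q [P [N [_ _ _ _ [K ->]]]]]] := charge_jordan nu.
have E : (\int[measure_add p m2]_x (g x)%:E = \int[measure_add q m1]_x (g x)%:E)%E.
  apply: eq_measure_integral => A mA _.
  apply: (etrans (measure_addE p m2 A)); apply: (etrans _ (esym (measure_addE q m1 A))).
  have F (mu : {finite_measure set T -> \bar R}) : mu A = (fine (mu A))%:E.
    by rewrite fineK// fin_num_measure.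
  have := H A mA; rewrite K// (F p) (F q) (F m1) (F m2) -!EFinB => -[h].
  apply: (etrans (congr2 adde (F p) (F m2))); apply: (etrans _ (esym (congr2 adde (F q) (F m1)))).
  by rewrite /adde/=; congr (_%:E); lra.
have I mu : mu.-integrable setT (EFin \o g) by exact: bmeas_integrable.
have J mu : (\int[mu]_x (g x)%:E = (\int[mu]_x g x)%:E)%E by rewrite (EFin_Rintegral (I mu)).
move: E; rewrite !integral_measure_add//; try exact: I.
rewrite (J p) (J q) (J m1) (J m2) => -[h]; lra.
Qed.

Lemma charge_integralD nu f g : bmeas f -> bmeas g ->
  charge_integral nu (fun x => f x + g x) = charge_integral nu f + charge_integral nu g.
Proof.
move=> bf bg; have [p [q [P [N [_ _ _ _ [K H]]]]]] := charge_jordan nu.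
by rewrite !H !bmeas_intD//; ring.
Qed.

Lemma charge_integralZ nu c f : bmeas f ->
  charge_integral nu (fun x => c * f x) = c * charge_integral nu f.
Proof.
move=> bf; have [p [q [P [N [_ _ _ _ [K H]]]]]] := charge_jordan nu.
by rewrite !H !bmeas_intZ//; ring.
Qed.

Lemma charge_integral_indic nu (A : set T) : measurable A ->
  charge_integral nu (\1_A) = fine (nu A).
Proof.
move=> mA; have [p [q [P [N [_ _ _ _ [K H]]]]]] := charge_jordan nu.
by rewrite H K// fineB ?fin_num_measure// !Rintegral_indic.
Qed.

(** Each Jordan part is a value of nu on a subset, hence at most mu. The crude factor 2 affects only
    error terms. *)
Lemma normr_charge_integral_le nu mu g : (forall A, measurable A -> (`|fine (nu A)|%:E <= mu A)%E) ->
  bmeas g -> `|charge_integral nu g| <= 2 * \int[mu]_x `|g x|.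
Proof.
move=> H bg; have [p [q [P [N [mP mN pE qE [_ ->]]]]]] := charge_jordan nu.
have G (r : {finite_measure set T -> \bar R}) : (forall A, measurable A -> (r A <= mu A)%E) ->
    `|\int[r]_x g x| <= \int[mu]_x `|g x|.
  move=> rmu; apply: le_trans (le_normr_Rintegral _ (bmeas_integrable r bg)) _ => //.
  have bn := bmeas_norm bg.
  rewrite -lee_fin !EFin_Rintegral//; try exact: (bmeas_integrable _ bn).
  apply: ge0_le_measure_integral => //; last by apply/measurable_EFinP; exact: bn.1.
have Gp : `|\int[p]_x g x| <= \int[mu]_x `|g x|.
  apply: G => A mA; rewrite pE//; have mAP := measurableI _ _ mA mP.
  apply: (@le_trans _ _ (mu (A `&` P))); last by apply: le_measure; rewrite ?inE//; exact: subIsetl.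
  apply: le_trans (H _ mAP); rewrite -{1}(fineK (fin_num_measure nu _ mAP)) lee_fin.
  exact: ler_norm.
have Gq : `|\int[q]_x g x| <= \int[mu]_x `|g x|.
  apply: G => A mA; rewrite qE//; have mAN := measurableI _ _ mA mN.
  apply: (@le_trans _ _ (mu (A `&` N))); last by apply: le_measure; rewrite ?inE//; exact: subIsetl.
  apply: le_trans (H _ mAN); rewrite -{1}(fineK (fin_num_measure nu _ mAN)) -EFinN lee_fin.
  by rewrite -normrN; exact: ler_norm.
by apply: le_trans (ler_normB _ _) _; rewrite mulr_natl mulr2n; exact: lerD.
Qed.

End charge_facts.

Section vcharge_facts.
Context d (T : measurableType d) {R : realType} {n : nat}.
Variable nu : vcharge T R n.
Local Notation TV := (vtotal_variation nu).
Local Notation Rn := 'rV[R]_n.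

Lemma enorm_le_TV (A : set T) : measurable A -> ((enorm (vcharge_val nu A))%:E <= TV A)%E.
Proof.
move=> mA; pose F (k : nat) : set T := if k is 0%N then A else set0.
have <- : (\sum_(k <oo) (enorm (vcharge_val nu (F k)))%:E)%E = (enorm (vcharge_val nu A))%:E.
  by apply: nneseries_single => k; rewrite /F vcharge_val0 enorm0.
apply: ereal_sup_ubound; exists F => //; split.
- by case=> [|k]; rewrite /F.
- by apply/trivIsetP => -[|i] [|j] //= _ _ _; rewrite ?setI0 ?set0I.
- by move=> t [[|k] _].
Qed.

Lemma sum_measure_le (mu : {measure set T -> \bar R}) (F : (set T)^nat) N :
  (forall k, measurable (F k)) -> trivIset setT F ->
  (\sum_(0 <= k < N) mu (F k) <= mu setT)%E.
Proof.
move=> mF tF; rewrite big_mkord -measure_bigsetU//.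
by apply: le_measure; rewrite ?inE//; exact: bigsetU_measurable.
Qed.

(** The Euclidean norm is at most the sum of the coordinates, and each coordinate is controlled by
    the two finite Jordan parts of its component. *)
Lemma TV_fin : fin_num_fun TV.
Proof.
have /choice[p /choice[q Hpq]] i : exists p q : {finite_measure set T -> \bar R},
    (forall A, measurable A -> nu i A = p A - q A)%E.
  by have [p [q [P [N [_ _ _ _ [K _]]]]]] := charge_jordan (nu i); exists p, q.
move=> A mA; rewrite ge0_fin_numE//.
apply: (@le_lt_trans _ _ (\sum_i (fine (p i setT) + fine (q i setT)))%:E); last exact: ltry.
apply: ge_ereal_sup => _ [F [mF tF _] <-].
apply: nneseries_le_bound => [k|N]; first by rewrite lee_fin enorm_ge0.
rewrite sumEFin lee_fin.
apply: (@le_trans _ _ (\sum_(0 <= k < N) \sum_i (fine (p i (F k)) + fine (q i (F k))))).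
  apply: ler_sum => k _; apply: le_trans (enorm_le_sum _) _; apply: ler_sum => i _.
  rewrite mxE Hpq// fineB ?fin_num_measure//; apply: le_trans (ler_normB _ _) _.
  by rewrite !ger0_norm// fine_ge0.
rewrite exchange_big/=; apply: ler_sum => i _; rewrite big_split/=.
have E (mu : {finite_measure set T -> \bar R}) : \sum_(0 <= k < N) fine (mu (F k)) <= fine (mu setT).
  rewrite -lee_fin fineK ?fin_num_measure// -sumEFin.
  apply: le_trans (sum_measure_le mu N mF tF); apply: lee_sum => k _.
  by rewrite fineK// fin_num_measure.
exact: lerD.
Qed.

Definition tvm : {finite_measure set T -> \bar R} := fin_measure TV_fin.

Definition vbmeas (phi : T -> Rn) := forall i, bmeas (fun x => phi x 0 i).

Lemma normr_vcharge_integral_le (phi : T -> Rn) (g : T -> R) : vbmeas phi -> bmeas g ->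
  (forall x, enorm (phi x) <= g x) -> `|vcharge_integral nu phi| <= n%:R * (2 * \int[tvm]_x g x).
Proof.
move=> bphi bg phig; apply: le_trans (ler_norm_sum _ _ _) _.
rewrite -[n in n%:R]card_ord mulr_natl -sumr_const; apply: ler_sum => i _.
apply: le_trans (normr_charge_integral_le (mu := tvm) _ (bphi i)) _.
  move=> A mA; apply: le_trans (enorm_le_TV mA); rewrite lee_fin.
  by have := normr_coord_le_enorm (vcharge_val nu A) i; rewrite mxE.
rewrite ler_pM2l//; apply: bmeas_le => //; first exact: bmeas_norm.
by move=> x; apply: le_trans (phig x); exact: normr_coord_le_enorm.
Qed.

Lemma vcharge_integralD (phi psi : T -> Rn) : vbmeas phi -> vbmeas psi ->
  vcharge_integral nu (fun x => phi x + psi x) = vcharge_integral nu phi + vcharge_integral nu psi.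
Proof.
move=> b1 b2; rewrite /vcharge_integral -big_split/=; apply: eq_bigr => i _.
by under eq_fun do rewrite mxE; exact: charge_integralD.
Qed.

Lemma vcharge_integralZ c (phi : T -> Rn) : vbmeas phi ->
  vcharge_integral nu (fun x => c *: phi x) = c * vcharge_integral nu phi.
Proof.
move=> b1; rewrite /vcharge_integral mulr_sumr; apply: eq_bigr => i _.
by under eq_fun do rewrite mxE; exact: charge_integralZ.
Qed.

Lemma vbmeasZ c (phi : T -> Rn) : vbmeas phi -> vbmeas (fun x => c *: phi x).
Proof. by move=> b1 i; under eq_fun do rewrite mxE; exact: bmeasZ. Qed.

Lemma vbmeas_scale (g : T -> R) (v : Rn) : bmeas g -> vbmeas (fun x => g x *: v).
Proof.
by move=> bg i; under eq_fun do rewrite mxE mulrC; exact: bmeasZ.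
Qed.

Lemma vbmeasB (phi psi : T -> Rn) : vbmeas phi -> vbmeas psi -> vbmeas (fun x => phi x - psi x).
Proof. by move=> b1 b2 i; under eq_fun do rewrite !mxE; exact: bmeasB. Qed.

Lemma vbmeas_sum (I : Type) (r : seq I) (phi : I -> T -> Rn) : (forall k, vbmeas (phi k)) ->
  vbmeas (fun x => \sum_(k <- r) phi k x).
Proof. by move=> b i; under eq_fun do rewrite summxE; apply: bmeas_sum => k; exact: b. Qed.

Lemma vcharge_integralB (phi psi : T -> Rn) : vbmeas phi -> vbmeas psi ->
  vcharge_integral nu (fun x => phi x - psi x) = vcharge_integral nu phi - vcharge_integral nu psi.
Proof.
move=> b1 b2; rewrite -mulN1r -vcharge_integralZ// -vcharge_integralD//; last exact: vbmeasZ.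
by congr vcharge_integral; apply/funext => x; rewrite scaleN1r.
Qed.

Lemma vcharge_integral_sum (I : Type) (r : seq I) (phi : I -> T -> Rn) : (forall k, vbmeas (phi k)) ->
  vcharge_integral nu (fun x => \sum_(k <- r) phi k x) = \sum_(k <- r) vcharge_integral nu (phi k).
Proof.
move=> b; elim: r => [|k r ih].
  rewrite big_nil; under eq_fun do rewrite big_nil.
  rewrite (_ : (fun=> 0) = (fun x : T => 0 *: (0 : Rn))); last by apply/funext => x; rewrite scale0r.
  by rewrite vcharge_integralZ ?mul0r// => i; under eq_fun do rewrite mxE; exact: bmeas_cst.
under eq_fun do rewrite big_cons; rewrite big_cons vcharge_integralD ?ih//.
exact: vbmeas_sum.
Qed.

Lemma vcharge_integral_indic (A : set T) (v : Rn) : measurable A ->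
  vcharge_integral nu (fun x => \1_A x *: v) = dotrv v (vcharge_val nu A).
Proof.
move=> mA; rewrite /vcharge_integral /dotrv; apply: eq_bigr => i _.
under eq_fun do rewrite mxE mulrC.
by rewrite charge_integralZ ?charge_integral_indic ?mxE//; exact: bmeas_indic.
Qed.

End vcharge_facts.

(** * Approximation of Borel sets by continuous functions in L^1 *)

Section Cc_L1_dense.
Context {R : realType} {n : nat}.
Local Notation Rn := 'rV[R]_n.
Variable mu : {finite_measure set Rn -> \bar R}.
Implicit Types (A B : set Rn) (f g h : Rn -> R).

Lemma Cc_bmeas g : Cc g -> bmeas g.
Proof.
move=> Cg; have [M _ gM] := Cc_bounded Cg.
by split; [exact: measurable_continuous_rV Cg.1|exists M].
Qed.

Lemma measure_setD_bigcup_small (F : (set Rn)^nat) (e : R) : (forall k, measurable (F k)) ->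
  nondecreasing_seq F -> 0 < e -> exists N, fine (mu (\bigcup_k F k `\` F N)) <= e.
Proof.
move=> mF ndF e0; have mU : measurable (\bigcup_k F k) by exact: bigcupT_measurable.
have H : mu (F k) @[k --> \oo] --> (fine (mu (\bigcup_k F k)))%:E.
  by rewrite fineK ?fin_num_measure//; exact: (@nondecreasing_cvg_mu _ _ _ mu F).
have /fine_cvgP[_ /cvgrPdist_lt/(_ _ e0)[N _ /(_ N (leqnn N)) HN]] := H.
exists N; have FU : F N `<=` \bigcup_k F k by move=> x Fx; exists N.
rewrite measureD//; last by rewrite ltey_eq fin_num_measure.
rewrite setIC (setIidl FU) fineB ?fin_num_measure//.
by apply: le_trans (ler_norm _) _; exact: ltW HN.
Qed.

(* The approximable sets form a sigma-algebra containing the balls. *)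
Definition Cc_approximable A := forall e : R, 0 < e ->
  exists2 g : Rn -> R, Cc g & \int[mu]_x `|\1_A x - g x| <= e.

Lemma Cc_approximable_tail (U A : set Rn) g (e : R) : measurable U -> measurable A -> Cc g ->
  (forall x, `|\1_U x - g x| <= \1_(U `\` A) x) -> fine (mu (U `\` A)) <= e ->
  \int[mu]_x `|\1_U x - g x| <= e.
Proof.
move=> mU mA Cg h he; have mUA := measurableD mU mA.
apply: le_trans he; rewrite -Rintegral_indic//.
apply: bmeas_le => //; last exact: bmeas_indic.
by apply: bmeas_norm; apply: bmeasB; [exact: bmeas_indic|exact: Cc_bmeas].
Qed.

(** The function min(1, N h) is exact off {h > 0} and on {N h > 1}; the set in between has small
    measure for large N. *)
Lemma Cc_approximable_pos h : Ccp h -> Cc_approximable [set x | 0 < h x].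
Proof.
move=> [Ch h0] e e0; pose F (k : nat) := [set x : Rn | 1 < k%:R * h x].
have mF k : measurable (F k).
  apply: open_measurable_rV; apply: (@open_comp _ _ (fun x => k%:R * h x) [set t | 1 < t]); last exact: open_gt.
  by move=> x _; apply: contM; [exact: cont_cst|exact: Ch.1].
have ndF : nondecreasing_seq F.
  apply/nondecreasing_seqP => k; apply/subsetPset => x /= /lt_le_trans; apply.
  by rewrite ler_wpM2r// ler_nat.
have FU : \bigcup_k F k = [set x | 0 < h x].
  apply/seteqP; split => x.
    move=> [k _]; rewrite /F /= => kh; rewrite lt_neqAle h0 andbT; apply/eqP => hx.
    by move: kh; rewrite -hx mulr0 ltNge ler01.
  move=> /= hx; exists (Num.truncn (h x)^-1).+1 => //; rewrite /F /=.
  by rewrite -ltr_pdivrMr// mul1r truncnS_gt.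
have [N HN] := measure_setD_bigcup_small mF ndF e0; rewrite FU in HN.
pose g x := Num.min 1 (N%:R * h x).
have Cg : Cc g.
  apply: (Cc_support _ Ch); first by apply: cont_min; [exact: cont_cst|apply: contM; [exact: cont_cst|exact: Ch.1]].
  by move=> x hx; rewrite /g hx mulr0 (min_idPr ler01).
exists g => //; apply: Cc_approximable_tail HN => //.
  by rewrite -FU; exact: bigcupT_measurable.
have g01 x : 0 <= g x <= 1 by rewrite /g le_min ler01 mulr_ge0//= ge_min lexx.
move=> x; rewrite !indicE; have [hx|hx] := ltP 0 (h x); last first.
  rewrite memNset/=; last by move=> /=; rewrite ltNge hx.
  have -> : g x = 0 by rewrite /g (_ : h x = 0) ?mulr0 ?(min_idPr ler01)//; apply/le_anti; rewrite hx h0.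
  by rewrite subrr normr0.
rewrite mem_set//=; have [xF|xF] := pselect (F N x).
  by rewrite /g (min_idPl (ltW xF)) subrr normr0.
rewrite mem_set; last by split.
by have /andP[g0 g1] := g01 x; rewrite ger0_norm ?subr_ge0//= lerBlDr lerDl.
Qed.

Lemma Cc_approximableT : Cc_approximable setT.
Proof.
move=> e e0; pose F (k : nat) := [set x : Rn | `|x| <= k%:R].
have mF k : measurable (F k) by exact: measurable_normr_le.
have ndF : nondecreasing_seq F.
  by apply/nondecreasing_seqP => k; apply/subsetPset => x /= /le_trans; apply; rewrite ler_nat.
have FU : \bigcup_k F k = setT.
  apply/seteqP; split => // x _; exists (Num.truncn `|x|).+1 => //.
  by rewrite /F /= ltW// truncnS_gt.
have [N HN] := measure_setD_bigcup_small mF ndF e0; rewrite FU in HN.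
have Cb := Ccp_bump (n := n) (N%:R + 1 : R).
exists (bump (N%:R + 1)); first exact: Cb.1.
apply: Cc_approximable_tail HN => //; first exact: Cb.1.
move=> x; rewrite indicT indicE; have [xF|xF] := pselect (F N x).
  by rewrite bump_eq1 ?subrr ?normr0// addrK.
rewrite mem_set//= ger0_norm; first by rewrite lerBlDr lerDl; exact: Cb.2.
by rewrite subr_ge0 bump_le1.
Qed.

(** The constant 1 has no compact support, so it is replaced by an approximation of the whole
    space. *)
Lemma Cc_approximableC A : measurable A -> Cc_approximable A -> Cc_approximable (~` A).
Proof.
move=> mA aA e e0; have e2 : 0 < e / 2 by rewrite divr_gt0.
have [g Cg gA] := aA _ e2; have [h Ch hT] := Cc_approximableT e2.
exists (fun x => h x - g x); first exact: CcB.
have b1 : bmeas (fun x => `|\1_setT x - h x|).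
  by apply: bmeas_norm; apply: bmeasB; [exact: bmeas_indic|exact: Cc_bmeas].
have b2 : bmeas (fun x => `|\1_A x - g x|).
  by apply: bmeas_norm; apply: bmeasB; [exact: bmeas_indic|exact: Cc_bmeas].
apply: (@le_trans _ _ (\int[mu]_x (`|\1_setT x - h x| + `|\1_A x - g x|))).
  apply: bmeas_le; [|exact: bmeasD|].
    by apply: bmeas_norm; apply: bmeasB; [apply: bmeas_indic; exact: measurableC|apply: bmeasB; exact: Cc_bmeas].
  move=> x; apply: le_trans (ler_normB _ _).
  have -> : \1_setT x = \1_(~` A) x + \1_A x :> R.
    by rewrite !indicE in_setC in_setT; case: (x \in A); rewrite /= ?addr0 ?add0r.
  by rewrite (_ : \1_(~` A) x - (h x - g x) = \1_(~` A) x + \1_A x - h x - (\1_A x - g x))//; ring.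
by rewrite bmeas_intD// [e]splitr lerD.
Qed.

(** The indicator of a union is a maximum, and |max(a, b) - max(c, d)| <= |a - c| + |b - d|. *)
Lemma Cc_approximableU A B : measurable A -> measurable B ->
  Cc_approximable A -> Cc_approximable B -> Cc_approximable (A `|` B).
Proof.
move=> mA mB aA aB e e0; have e2 : 0 < e / 2 by rewrite divr_gt0.
have [g Cg gA] := aA _ e2; have [h Ch hB] := aB _ e2.
have Cm : Cc (fun x => Num.max (g x) (h x)).
  have [[cg /compactly_supportedP[r gr]] [ch /compactly_supportedP[s hs]]] := (Cg, Ch).
  split; first exact: cont_max.
  apply/compactly_supportedP; exists (Num.max r s) => x; rewrite gt_max => /andP[h1 h2].
  by rewrite gr// hs// maxxx.
exists (fun x => Num.max (g x) (h x)) => //.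
have b1 : bmeas (fun x => `|\1_A x - g x|).
  by apply: bmeas_norm; apply: bmeasB; [exact: bmeas_indic|exact: Cc_bmeas].
have b2 : bmeas (fun x => `|\1_B x - h x|).
  by apply: bmeas_norm; apply: bmeasB; [exact: bmeas_indic|exact: Cc_bmeas].
apply: (@le_trans _ _ (\int[mu]_x (`|\1_A x - g x| + `|\1_B x - h x|))).
  apply: bmeas_le; [|exact: bmeasD|].
    by apply: bmeas_norm; apply: bmeasB; [apply: bmeas_indic; exact: measurableU|exact: Cc_bmeas].
  move=> x; have -> : \1_(A `|` B) x = Num.max (\1_A x) (\1_B x) :> R.
    rewrite !indicE in_setU; case: (x \in A); case: (x \in B) => /=; rewrite ?maxxx//.
      by rewrite (max_idPl ler01).
    by rewrite (max_idPr ler01).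
  move: (\1_A x) (\1_B x) (g x) (h x) => a b c d.
  have := ler_norm (a - c); have := ler_norm (b - d); have := ler_norm (- (a - c)); have := ler_norm (- (b - d)).
  rewrite !normrN => h1 h2 h3 h4; rewrite ler_norml.
  by case: (leP a b) => ?; case: (leP c d) => ?; apply/andP; split; lra.
by rewrite bmeas_intD// [e]splitr lerD.
Qed.

Lemma Cc_approximable_bigcup (F : (set Rn)^nat) : (forall k, measurable (F k)) ->
  (forall k, Cc_approximable (F k)) -> Cc_approximable (\bigcup_k F k).
Proof.
move=> mF aF e e0; have e2 : 0 < e / 2 by rewrite divr_gt0.
pose G k := \big[setU/set0]_(i < k.+1) F i.
have mG k : measurable (G k) by exact: bigsetU_measurable.
have aG k : Cc_approximable (G k).
  rewrite /G; elim: k => [|k ih]; first by rewrite big_ord_recl big_ord0 setU0; exact: aF.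
  by rewrite big_ord_recr/=; apply: Cc_approximableU => //; exact: mG.
have ndG : nondecreasing_seq G.
  by apply/nondecreasing_seqP => k; rewrite /G [X in (_ <= X)%O]big_ord_recr/=; apply/subsetPset; exact: subsetUl.
have GU : \bigcup_k G k = \bigcup_k F k by exact: bigcup_bigsetU_bigcup.
have [N HN] := measure_setD_bigcup_small mG ndG e2; rewrite GU in HN.
have mU : measurable (\bigcup_k F k) by exact: bigcupT_measurable.
have [g Cg gA] := aG N _ e2; exists g => //.
have mD : measurable (\bigcup_k F k `\` G N) by exact: measurableD.
have b1 : bmeas (fun x => `|\1_(G N) x - g x|).
  by apply: bmeas_norm; apply: bmeasB; [exact: bmeas_indic|exact: Cc_bmeas].
apply: (@le_trans _ _ (\int[mu]_x (\1_(\bigcup_k F k `\` G N) x + `|\1_(G N) x - g x|))).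
  apply: bmeas_le; [|by apply: bmeasD => //; exact: bmeas_indic|].
    by apply: bmeas_norm; apply: bmeasB; [exact: bmeas_indic|exact: Cc_bmeas].
  have GF : G N `<=` \bigcup_k F k by rewrite -GU => x Gx; exists N.
  have H x : \1_(\bigcup_k F k) x = \1_(\bigcup_k F k `\` G N) x + \1_(G N) x :> R.
    rewrite !indicE in_setD; case: (boolP (x \in G N)) => [xG|_]; last by rewrite andbT addr0.
    by rewrite mem_set ?andbF ?add0r//; apply: GF; rewrite inE in xG.
  move=> x; rewrite H -addrA; apply: le_trans (ler_normD _ _) _.
  by rewrite lerD2r ger0_norm// indicE.
rewrite bmeas_intD//; last exact: bmeas_indic.
by rewrite [e]splitr; apply: lerD => //; rewrite Rintegral_indic.
Qed.

Lemma Cc_approximable_measurable A : measurable A -> Cc_approximable A.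
Proof.
have set0_app : Cc_approximable set0.
  move=> e e0; exists (fun=> 0); first exact: Cc0.
  under eq_Rintegral do rewrite indic0 subrr normr0.
  by rewrite Rintegral_cst// mul0r ltW.
suff H : <<s @open Rn >> `<=` [set A : set Rn | measurable A /\ Cc_approximable A] by move=> /H[].
apply: smallest_sub.
  split; first by split => //; exact: measurable0.
    by move=> B [mB aB]; rewrite setTD; split; [exact: measurableC|exact: Cc_approximableC].
  move=> F HF; split; first by apply: bigcupT_measurable => k; have [] := HF k.
  by apply: Cc_approximable_bigcup => k; have [] := HF k.
move=> U oU; split; first exact: open_measurable_rV.
have ball_app (q : Rn) (r : R) : Cc_approximable (ball q r).
  by have [g Cg ->] := ball_Ccp q r; exact: Cc_approximable_pos.
(* The rational balls inside U are enumerated through [pickle], with empty sets at the other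
   indices, so that U is a union over nat. *)
pose P := [set p : 'rV[rat]_n * nat |
  ball (map_mx ratr p.1 : Rn) (p.2.+1%:R^-1) `<=` U].
pose F (m : nat) : set Rn := if @unpickle ('rV[rat]_n * nat)%type m is Some p then
  (if p \in P then ball (map_mx ratr p.1 : Rn) (p.2.+1%:R^-1) else set0) else set0.
have -> : U = \bigcup_m F m.
  rewrite {1}(open_rV_bigcup oU); apply/seteqP; split => x.
    by move=> [p Pp px]; exists (pickle p) => //; rewrite /F pickleK mem_set.
  move=> [m _]; rewrite /F; case: unpickle => // p; case: ifPn => // Pp px.
  by exists p => //; rewrite inE in Pp.
have hF m : measurable (F m) /\ Cc_approximable (F m).
  rewrite /F; case: unpickle => [p|]; last by split; [exact: measurable0|].
  case: ifPn => _; last by split; [exact: measurable0|].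
  split; last exact: ball_app.
  by apply: open_measurable_rV; exact: ball_open.
by apply: Cc_approximable_bigcup => m; have [] := hF m.
Qed.

End Cc_L1_dense.

Section unit_ball_projection.
Context {R : realType} {n : nat}.
Local Notation Rn := 'rV[R]_n.

Definition ball_proj (v : Rn) : Rn := (Num.max 1 (enorm v))^-1 *: v.

Lemma enorm_ball_proj v : enorm (ball_proj v) <= 1.
Proof.
have m0 : 0 < Num.max 1 (enorm v) by rewrite lt_max ltr01.
rewrite enormZ gtr0_norm ?invr_gt0// mulrC ler_pdivrMr// mul1r.
by rewrite le_max lexx orbT.
Qed.

(** When |u| > 1 the projection moves u by |u| - 1 <= |u| - |s| <= |u - s|. *)
Lemma enorm_ball_projB (u s : Rn) : enorm s <= 1 -> enorm (ball_proj u - s) <= 2 * enorm (u - s).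
Proof.
move=> s1; have E0 := enorm_ge0 (u - s).
have [u1|u1] := leP (enorm u) 1.
  by rewrite /ball_proj (max_idPl u1) invr1 scale1r mulr_natl mulr2n lerDl.
have -> : ball_proj u - s = (ball_proj u - u) + (u - s) by rewrite addrA subrK.
apply: le_trans (enormD _ _) _; rewrite mulr_natl mulr2n lerD2r.
have -> : ball_proj u - u = - ((1 - (enorm u)^-1) *: u).
  by rewrite /ball_proj (max_idPr (ltW u1)) scalerBl scale1r opprB.
have u0 : 0 < enorm u by exact: lt_trans u1.
rewrite enormN enormZ ger0_norm; last by rewrite subr_ge0 invf_le1// ltW.
rewrite mulrBl mul1r mulVf ?gt_eqF//.
have : enorm u <= enorm (u - s) + enorm s by rewrite -{1}(subrK s u) enormD.
lra.
Qed.

Lemma ball_proj_continuous : continuous ball_proj.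
Proof.
apply: (@cont_rV R) => j; under eq_fun do rewrite mxE.
apply: contM; last exact: cont_coord0.
move=> x; apply: (@continuousV _ _ (fun v : Rn => Num.max 1 (enorm v))).
  by rewrite gt_eqF// lt_max ltr01.
by apply: cont_max; [exact: cont_cst|exact: enorm_continuous].
Qed.

End unit_ball_projection.

(** * Total variation as a supremum over continuous test fields *)

Section total_variation_duality.
Context {R : realType} {n : nat}.
Local Notation Rn := 'rV[R]_n.
Variable nu : vcharge Rn R n.
Implicit Types (phi : Rn -> Rn).

Lemma sum_disjoint (W : nmodType) (D : (set Rn)^nat) (f : nat -> W) (x : Rn) N :
  trivIset setT D -> (forall k, ~ D k x -> f k = 0) ->
  ((forall k, (k < N)%N -> ~ D k x) /\ \sum_(k < N) f k = 0) \/
  exists2 k, (k < N)%N /\ D k x & \sum_(k < N) f k = f k.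
Proof.
move=> tD f0; have [[k [kN Dk]]|h] := pselect (exists k, (k < N)%N /\ D k x).
  right; exists k => //; rewrite (bigD1 (Ordinal kN))//= big1 ?addr0// => i ik.
  apply: f0 => Di; move/eqP: ik; apply; apply/val_inj => /=.
  by apply: (tD i k) => //; exists x.
have h' k : (k < N)%N -> ~ D k x by move=> kN Dk; apply: h; exists k.
by left; split => //; apply: big1 => k _; apply: f0; exact: h'.
Qed.

Lemma Cc_vbmeas phi : Cc phi -> vbmeas phi.
Proof. by move=> Cphi i; apply: Cc_bmeas; exact: Cc_coord. Qed.

Lemma Cc_enorm phi : Cc phi -> Cc (fun x => enorm (phi x)).
Proof.
move=> [cphi /compactly_supportedP[r phir]]; split.
  by apply: (cont_comp cphi); exact: enorm_continuous.
by apply/compactly_supportedP; exists r => x xr; rewrite phir// enorm0.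
Qed.

(** On a field constant on disjoint cells the claim is Cauchy-Schwarz on each cell. A uniformly
    close field of this kind is enough: the error is absorbed by the crude bound with its
    dimensional constant. *)
Lemma vcharge_integral_le_TV phi : Cc phi ->
  vcharge_integral nu phi <= \int[tvm nu]_x enorm (phi x).
Proof.
move=> Cphi; have [cphi /compactly_supportedP[r phir]] := Cphi.
set TT := fine (tvm nu setT).
have TT0 : 0 <= TT by rewrite fine_ge0.
apply/ler_addgt0Pr => e0 e00.
have K0 : 0 < TT + n%:R * (2 * TT) + 1 by rewrite ltr_wpDl// addr_ge0// mulr_ge0// mulr_ge0.
(* The error is e TT from comparing norms plus 2 n e TT from comparing the integrals; the 1 keeps
   the denominator positive. *)
pose e := e0 / (TT + n%:R * (2 * TT) + 1).
have e_gt0 : 0 < e by exact: divr_gt0.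
have n1 : 0 < (n%:R + 1) :> R by rewrite ltr_wpDl.
have [d d0 ud] := Cc_unif Cphi (divr_gt0 e_gt0 n1).
have {}ud x y : `|x - y| < d -> enorm (phi x - phi y) <= e.
  move=> /ud/ltW h; apply: le_trans (enorm_le_normr _) _.
  apply: (@le_trans _ _ (n%:R * (e / (n%:R + 1)))); first by rewrite ler_wpM2l.
  by rewrite mulrA ler_pdivrMr// mulrC ler_pM2l// lerDl.
have [J [w [p [Cw w0 w1 wr wp]]]] := smooth_partition (n := n) r d0.
pose N := #|J|.
(* Of the partition of unity only the cells where a weight is nonzero are kept. They are indexed by
   nat, empty from N on, so that [seqDU] can make them disjoint. *)
pose F (k : nat) : set Rn := if @insub nat (fun i => i < N)%N 'I_N k is Some i
  then [set x | w (enum_val i) x != 0] else set0.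
pose pk (k : nat) : Rn := if @insub nat (fun i => i < N)%N 'I_N k is Some i
  then p (enum_val i) else 0.
have mF k : measurable (F k).
  rewrite /F; case: insubP => [i _ _|_]; last exact: measurable0.
  apply: open_measurable_rV.
  apply: (@open_comp _ _ (w (enum_val i)) [set t | t != 0]); last exact: open_neq.
  by move=> x _; exact: (Cc_infty_Cc (Cw _)).1.
have FN k x : F k x -> (k < N)%N by rewrite /F; case: insubP.
have Fp k x : F k x -> `|x - pk k| < d.
  by rewrite /F /pk; case: insubP => // i _ _; exact: wp.
have Fcov x : `|x| <= r -> exists k, F k x.
  move=> /wr wx; have [j wj] : exists j, w j x != 0.
    apply: contrapT => /forallNP h; have : \sum_j w j x = 0.
      by apply: big1 => j _; apply/eqP/negPn/negP; exact: h.
    by move/eqP; rewrite wx oner_eq0.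
  exists (enum_rank j); rewrite /F; case: insubP => [i _ ij|]; last by rewrite ltn_ord.
  by have -> : i = enum_rank j; [exact: val_inj|rewrite /= enum_rankK].
pose D := seqDU F.
have mD k : measurable (D k) by exact: seqDU_measurable.
have tD : trivIset setT D := trivIset_seqDU F.
have DF k x : D k x -> F k x by exact: subset_seqDU.
pose s x := \sum_(k < N) \1_(D k) x *: phi (pk k).
have bs : vbmeas s.
  by apply: vbmeas_sum => k; apply: vbmeas_scale; exact: bmeas_indic.
have bphi := Cc_vbmeas Cphi.
have ind0 k x : ~ D k x -> \1_(D k) x = 0 :> R by move=> h; rewrite indicE memNset.
have ind1 k x : D k x -> \1_(D k) x = 1 :> R by move=> h; rewrite indicE mem_set.
have noD x : (forall k, (k < N)%N -> ~ D k x) -> phi x = 0.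
  move=> h; apply: phir; rewrite ltNge; apply/negP => /Fcov[k Fk].
  have : (\bigcup_k F k) x by exists k.
  by rewrite seqDU_bigcup_eq => -[l _ Dl]; exact: (h l (FN _ _ (DF _ _ Dl))).
have es x : enorm (phi x - s x) <= e.
  have h0 k : ~ D k x -> \1_(D k) x *: phi (pk k) = 0 by move=> h; rewrite ind0// scale0r.
  have [[h sx]|[k [kN Dk] sx]] := sum_disjoint N tD h0.
  - by rewrite /s sx (noD _ h) subrr enorm0 ltW.
  - by rewrite /s sx ind1// scale1r; apply: ud; exact/Fp/DF.
have cs x : \sum_(k < N) \1_(D k) x * enorm (phi (pk k)) <= enorm (phi x) + e.
  have h0 k : ~ D k x -> \1_(D k) x * enorm (phi (pk k)) = 0 by move=> h; rewrite ind0// mul0r.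
  have [[h ->]|[k [kN Dk] ->]] := sum_disjoint N tD h0.
    by rewrite addr_ge0 ?enorm_ge0// ltW.
  rewrite ind1// mul1r; have h1 := ud x (pk k) (Fp _ _ (DF _ _ Dk)).
  have := enormD (phi x) (phi (pk k) - phi x).
  by rewrite (addrC (phi x)) subrK -(opprB (phi x)) enormN => h2; lra.
have Is : vcharge_integral nu s <= \int[tvm nu]_x enorm (phi x) + e * TT.
  rewrite vcharge_integral_sum; last by move=> k; apply: vbmeas_scale; exact: bmeas_indic.
  apply: (@le_trans _ _ (\int[tvm nu]_x (\sum_(k < N) \1_(D k) x * enorm (phi (pk k))))).
    rewrite bmeas_int_sum; last first.
      by move=> k; apply: bmeasM; [exact: bmeas_indic|exact: bmeas_cst].
    apply: ler_sum => k _; rewrite vcharge_integral_indic//.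
    under eq_Rintegral do rewrite mulrC.
    rewrite bmeas_intZ ?Rintegral_indic//; last exact: bmeas_indic.
    apply: le_trans (dotrv_le _ _) _; rewrite ler_wpM2l ?enorm_ge0//.
    rewrite -lee_fin fineK; first exact: enorm_le_TV.
    exact: (fin_num_measure (tvm nu)).
  have bE := Cc_bmeas (Cc_enorm Cphi).
  apply: (@le_trans _ _ (\int[tvm nu]_x (enorm (phi x) + e))).
    apply: bmeas_le => //; last by apply: bmeasD => //; exact: bmeas_cst.
    by apply: bmeas_sum => k; apply: bmeasM; [exact: bmeas_indic|exact: bmeas_cst].
  by rewrite bmeas_intD ?Rintegral_cst//; exact: bmeas_cst.
have Id : vcharge_integral nu (fun x => phi x - s x) <= n%:R * (2 * (e * TT)).
  apply: le_trans (ler_norm _) _.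
  have h := normr_vcharge_integral_le nu (vbmeasB bphi bs) (@bmeas_cst _ _ R e) es.
  by rewrite Rintegral_cst in h.
rewrite vcharge_integralB// in Id.
have eE : e * (TT + n%:R * (2 * TT)) <= e0.
  by rewrite /e mulrAC ler_pdivrMr// ler_pM2l// lerDl.
have -> : vcharge_integral nu phi = vcharge_integral nu s + (vcharge_integral nu phi - vcharge_integral nu s).
  by rewrite addrC subrK.
apply: le_trans (lerD Is Id) _.
by move: eE; rewrite mulrDr; lra.
Qed.

(** A nearly optimal partition, cut to finitely many sets, gives a simple field of unit directions.
    Its indicators are replaced by continuous functions in L^1, and projection onto the unit ball
    restores the pointwise bound. *)
Lemma TV_le_vcharge_integral (e : R) : 0 < e -> exists phi, [/\ Cc phi, forall x, enorm (phi x) <= 1 &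
  fine (tvm nu setT) - e <= vcharge_integral nu phi].
Proof.
move=> e0; have e2 : 0 < e / 2 by rewrite divr_gt0.
have TVf : vtotal_variation nu setT \is a fin_num by exact: (fin_num_measure (tvm nu)).
have [_ [F [mF tF _] <-] HF] := ub_ereal_sup_adherent e2 TVf.
have [N HN] : exists N, fine (tvm nu setT) - e / 2 <= \sum_(k < N) enorm (vcharge_val nu (F k)).
  apply: contrapT => /forallNP h.
  suff : (\sum_(k <oo) (enorm (vcharge_val nu (F k)))%:E <= vtotal_variation nu setT - (e / 2)%:E)%E.
    by rewrite leNgt => /negP; apply.
  apply: nneseries_le_bound => [k|N]; first by rewrite lee_fin enorm_ge0.
  rewrite sumEFin big_mkord -(fineK TVf) -EFinB lee_fin.
  by have /negP := h N; rewrite -ltNge => /ltW.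
(* The direction of nu(F k); it is 0 when nu(F k) = 0, since the inverse of 0 is 0. *)
pose v k : Rn := (enorm (vcharge_val nu (F k)))^-1 *: vcharge_val nu (F k).
have dE (x : Rn) : dotrv x x = enorm x ^+ 2 by rewrite sqr_sqrtr ?dotrv_ge0.
have vE k : dotrv (v k) (vcharge_val nu (F k)) = enorm (vcharge_val nu (F k)).
  rewrite dotrvZl dE; have [->|h] := eqVneq (enorm (vcharge_val nu (F k))) 0.
    by rewrite expr0n mulr0.
  by rewrite expr2 mulrA mulVf// mul1r.
have v1 k : enorm (v k) <= 1.
  rewrite enormZ ger0_norm ?invr_ge0 ?enorm_ge0//.
  have [->|h] := eqVneq (enorm (vcharge_val nu (F k))) 0; first by rewrite mulr0 ler01.
  by rewrite mulVf.
pose s x := \sum_(k < N) \1_(F k) x *: v k.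
have bs : vbmeas s.
  by apply: vbmeas_sum => k; apply: vbmeas_scale; exact: bmeas_indic.
have s1 x : enorm (s x) <= 1.
  have h0 k : ~ F k x -> \1_(F k) x *: v k = 0 by move=> h; rewrite indicE memNset// scale0r.
  have [[h sx]|[k [kN Fk] sx]] := sum_disjoint N tF h0; rewrite /s sx; first by rewrite enorm0.
  by rewrite indicE mem_set// scale1r.
have Is : vcharge_integral nu s = \sum_(k < N) enorm (vcharge_val nu (F k)).
  rewrite vcharge_integral_sum; last by move=> k; apply: vbmeas_scale; exact: bmeas_indic.
  by apply: eq_bigr => k _; rewrite vcharge_integral_indic.
have K0 : 0 < n%:R * (4 * N%:R) + 1 :> R by rewrite ltr_wpDl// !mulr_ge0.
(* The factor 4 n N collects 2 from the projection, 2 n from the crude bound on integrals, and N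
   sets with error d each. *)
pose d := e / 2 / (n%:R * (4 * N%:R) + 1).
have d0 : 0 < d by exact: divr_gt0.
have /choice[g Hg] k : exists g : Rn -> R, Cc g /\ \int[tvm nu]_x `|\1_(F k) x - g x| <= d.
  by have [g Cg gd] := Cc_approximable_measurable (tvm nu) (mF k) d0; exists g.
pose u x := \sum_(k < N) g k x *: v k.
pose phi x := ball_proj (u x).
have cu : continuous u.
  apply: cont_sum => k; apply: (@cont_rV R) => j; under eq_fun do rewrite mxE.
  by apply: contM; [have [[]] := Hg k|exact: cont_cst].
have Cphi : Cc phi.
  split; first by apply: (cont_comp cu); exact: ball_proj_continuous.
  have /compactly_supportedP[r ur] : compactly_supported u.
    by apply: compactly_supported_sum => k; have [] := Cc_scale (v k) (Hg k).1.
  by apply/compactly_supportedP; exists r => x xr; rewrite /phi ur// /ball_proj scaler0.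
exists phi; split => //; first by move=> x; exact: enorm_ball_proj.
pose G x := \sum_(k < N) `|\1_(F k) x - g k x|.
have bG1 k : bmeas (fun x => `|\1_(F k) x - g k x|).
  by apply: bmeas_norm; apply: bmeasB; [exact: bmeas_indic|apply: Cc_bmeas; exact: (Hg k).1].
have bG : bmeas G by exact: bmeas_sum.
have us x : enorm (u x - s x) <= G x.
  rewrite /u /s -sumrB; apply: le_trans (enorm_sum _ _ _) _; apply: ler_sum => k _.
  by rewrite -scalerBl enormZ distrC ler_piMr.
have bphi := Cc_vbmeas Cphi.
have Id : `|vcharge_integral nu (fun x => phi x - s x)| <= n%:R * (2 * \int[tvm nu]_x (2 * G x)).
  apply: normr_vcharge_integral_le; [exact: vbmeasB|exact: bmeasZ|move=> x].
  by apply: le_trans (enorm_ball_projB _ (s1 x)) _; rewrite ler_pM2l.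
have IG : \int[tvm nu]_x G x <= N%:R * d.
  rewrite bmeas_int_sum// -[N in N%:R]card_ord mulr_natl -sumr_const.
  by apply: ler_sum => k _; exact: (Hg k).2.
rewrite bmeas_intZ// vcharge_integralB// in Id.
have h1 : n%:R * (2 * (2 * \int[tvm nu]_x G x)) <= e / 2.
  apply: (@le_trans _ _ (n%:R * (2 * (2 * (N%:R * d))))); first by rewrite ler_wpM2l// !ler_pM2l.
  have -> : n%:R * (2 * (2 * (N%:R * d))) = d * (n%:R * (4 * N%:R)) by ring.
  by rewrite /d mulrAC ler_pdivrMr// ler_pM2l// lerDl.
move: Id; rewrite ler_norml => /andP[Id _]; move: HN; rewrite -Is; lra.
Qed.

End total_variation_duality.

(** * The limit of the fractional gradients *)

Section representation.
Context {R : realType} {n : nat}.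
Local Notation Rn := 'rV[R]_n.
Local Notation leb := (@lebesgue_rV R n).
Implicit Types (phi psi : Rn -> Rn) (nu : vcharge Rn R n).

Lemma le_of_le_eps (x y C : R) : (forall e, 0 < e -> x <= y + C * e) -> x <= y.
Proof.
move=> h; apply/ler_addgt0Pr => e e0; have C1 : 0 < `|C| + 1 by rewrite ltr_wpDl.
apply: le_trans (h _ (divr_gt0 e0 C1)) _; rewrite lerD2l mulrA ler_pdivrMr// mulrC ler_pM2l//.
by apply: le_trans (ler_norm _) _; rewrite lerDl.
Qed.

Definition tvmass nu : R := fine (tvm nu setT).

Lemma tvmass_ge0 nu : 0 <= tvmass nu.
Proof. by rewrite fine_ge0. Qed.

(** Smooth fields already compute the mass: a nearly optimal continuous field has a smooth
    approximation with the same sup bound. *)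
Lemma TV_le_bound nu (m : R) :
  (forall phi, Cc_infty phi -> (forall x, enorm (phi x) <= 1) -> vcharge_integral nu phi <= m) ->
  tvmass nu <= m.
Proof.
move=> h; rewrite /tvmass; set TT := fine _; apply: (@le_of_le_eps _ _ (TT + 1)) => e e0.
have [phi [Cphi phi1 TVphi]] := TV_le_vcharge_integral nu e0.
have [psi [Cpsi psi1 hpsi]] := Cc_infty_dense_rV Cphi e0 phi1.
have CB := CcB Cphi (Cc_infty_Cc Cpsi).
have h1 := vcharge_integral_le_TV nu CB.
have h2 : \int[tvm nu]_x enorm (phi x - psi x) <= e * TT.
  rewrite -(Rintegral_cst (tvm nu) measurableT); apply: bmeas_le => //.
    exact: Cc_bmeas (Cc_enorm CB).
  exact: bmeas_cst.
rewrite vcharge_integralB in h1; [|exact: Cc_vbmeas|exact: Cc_vbmeas (Cc_infty_Cc Cpsi)].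
have h3 := h _ Cpsi psi1; rewrite -/TT in TVphi.
lra.
Qed.

Lemma normr_vcharge_integral_TV nu phi (c : R) : Cc phi -> (forall x, enorm (phi x) <= c) ->
  `|vcharge_integral nu phi| <= c * tvmass nu.
Proof.
move=> Cphi phic.
have K psi : Cc psi -> (forall x, enorm (psi x) <= c) -> vcharge_integral nu psi <= c * tvmass nu.
  rewrite /tvmass; move=> Cpsi psic; apply: le_trans (vcharge_integral_le_TV nu Cpsi) _.
  rewrite -(Rintegral_cst (tvm nu) measurableT); apply: bmeas_le => //.
    exact: Cc_bmeas (Cc_enorm Cpsi).
  exact: bmeas_cst.
rewrite ler_norml K// andbT lerNl -mulN1r -vcharge_integralZ; last exact: Cc_vbmeas.
apply: K.
  have [cphi /compactly_supportedP[s phis]] := Cphi; split; first exact: contZ.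
  by apply/compactly_supportedP; exists s => x xs; rewrite phis// scaler0.
by move=> x; rewrite scaleN1r enormN.
Qed.

Lemma Cc_infty_scaler (c : R) phi : Cc_infty phi -> Cc_infty (fun x => c *: phi x).
Proof.
move=> [sphi /compactly_supportedP[s phis]]; split; first exact: smoothZ.
by apply/compactly_supportedP; exists s => x xs; rewrite phis// scaler0.
Qed.

Variables (f : Rn -> R) (N : R).
Hypotheses (mf : measurable_fun setT f) (fN : (\int[leb]_x `|f x|%:E <= N%:E)%E).

Lemma frac_gradP a : (exists nu, represents_frac_grad a f nu) ->
  represents_frac_grad a f (frac_grad a f).
Proof. by move=> h; rewrite /frac_grad; case: pselect => // h'; exact: (svalP (cid h')). Qed.

Section fixed_order.
Variable a : R.
Hypotheses (a0 : 0 < a) (a1 : a < 1).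

Lemma pairing_le_TV nu phi : represents_frac_grad a f nu -> Cc_infty phi ->
  (forall x, enorm (phi x) <= 1) -> `|pairing f a phi| <= tvmass nu.
Proof.
move=> rep Cphi phi1; rewrite /pairing rep// normrN -[leRHS]mul1r.
exact: normr_vcharge_integral_TV (Cc_infty_Cc Cphi) phi1.
Qed.

Variable m : R.
Hypothesis bnd : forall phi, Cc_infty phi -> (forall x, enorm (phi x) <= 1) -> `|pairing f a phi| <= m.

Lemma pairing_le phi (c : R) : Cc_infty phi -> (forall x, enorm (phi x) <= c) ->
  `|pairing f a phi| <= m * c.
Proof.
move=> Cphi phic; apply: (@le_of_le_eps _ _ m) => e e0.
have c0 : 0 <= c by apply: le_trans (phic 0); exact: enorm_ge0.
(* Normalizing by c + e instead of c covers the case c = 0. *)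
have ce : 0 < c + e by exact: ltr_wpDl.
have Cs := Cc_infty_scaler (c + e)^-1 Cphi.
have := bnd Cs; rewrite (pairingZ mf fN _ a0 a1 Cphi) normrM gtr0_norm ?invr_gt0// => h.
rewrite -mulrDr mulrC -ler_pdivrMl// mulrC mulrC; apply: h => x.
rewrite enormZ gtr0_norm ?invr_gt0// ler_pdivrMl// mulr1.
by apply: le_trans (phic x) _; rewrite lerDl ltW.
Qed.

Let m0 : 0 <= m.
Proof.
have C0 : Cc_infty (fun _ : Rn => 0 : Rn).
  by split; [exact: smooth0|apply/compactly_supportedP; exists 0].
by apply: le_trans (bnd C0 _) => // x; rewrite enorm0 ler01.
Qed.

Lemma pairing_sum (I : Type) (r : seq I) (phi : I -> Rn -> Rn) : (forall i, Cc_infty (phi i)) ->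
  pairing f a (fun x => \sum_(i <- r) phi i x) = \sum_(i <- r) pairing f a (phi i).
Proof.
move=> Cphi; elim: r => [|i r ih].
  rewrite big_nil; have C0 : Cc_infty (fun _ : Rn => 0 : Rn).
    by split; [exact: smooth0|apply/compactly_supportedP; exists 0].
  have := pairingZ mf fN 0 a0 a1 C0; rewrite mul0r => <-; congr pairing.
  by apply/funext => x; rewrite big_nil scale0r.
rewrite big_cons -ih; have <- := pairingD mf fN a0 a1 (Cphi i) (Cc_infty_sum r Cphi).
by congr pairing; apply/funext => x; rewrite big_cons.
Qed.

(** Riesz is applied to each component u -> -pairing(u e_i), with the sign of the integration by
    parts formula; linearity reassembles the field from its coordinates. *)
Lemma frac_grad_exists : exists nu, represents_frac_grad a f nu.
Proof.
pose L i (u : Rn -> R) : R := - pairing f a (fun x => u x *: ei i).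
have /choice[mu1 /choice[mu2 H]] i : exists mu1 mu2 : {finite_measure set Rn -> \bar R},
    forall u, Cc_infty u -> L i u = \int[mu1]_x u x - \int[mu2]_x u x.
  apply: (@riesz _ _ (L i) m m0).
  - move=> u v Cu Cv; rewrite /L -opprD -(pairingD mf fN a0 a1); [|exact: Cc_infty_scale..].
    by congr (- pairing _ _ _); apply/funext => x; rewrite scalerDl.
  - move=> c u Cu; rewrite /L mulrN -(pairingZ mf fN c a0 a1); last exact: Cc_infty_scale.
    by congr (- pairing _ _ _); apply/funext => x; rewrite scalerA.
  - move=> c u Cu uc; rewrite /L normrN; apply: pairing_le; first exact: Cc_infty_scale.
    by move=> x; rewrite enormZ enorm_ei mulr1.
pose nu : vcharge Rn R n := fun i =>
  cadd (charge_of_finite_measure (mu1 i)) (cscale (-1) (charge_of_finite_measure (mu2 i))).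
exists nu => phi Cphi.
have -> : vcharge_integral nu phi = \sum_i L i (fun x => phi x 0 i).
  apply: eq_bigr => i _; have Ci := Cc_infty_coord i Cphi; rewrite H//.
  apply: charge_integral_measures; last exact: Cc_bmeas (Cc_infty_Cc Ci).
  move=> A mA; rewrite [LHS](_ : _ = mu1 i A + (-1)%:E * mu2 i A)%E//.
  by rewrite EFinN mulN1e.
rewrite sumrN opprK -/(pairing f a phi) -pairing_sum; last first.
  by move=> i; apply: Cc_infty_scale; exact: Cc_infty_coord.
by congr pairing; apply/funext => x; exact: rV_sum_ei.
Qed.

Lemma TV_frac_grad_le : tvmass (frac_grad a f) <= m.
Proof.
have rep := frac_gradP frac_grad_exists.
apply: TV_le_bound => phi Cphi phi1.
have := bnd Cphi phi1; rewrite /pairing rep// normrN; apply: le_trans; exact: ler_norm.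
Qed.

End fixed_order.

Lemma frac_variation_bound a : (frac_variation a f < +oo)%E -> exists m : R,
  forall phi, Cc_infty phi -> (forall x, enorm (phi x) <= 1) -> 0 < a -> a < 1 -> `|pairing f a phi| <= m.
Proof.
move=> fv; exists (fine (frac_variation a f)) => phi Cphi phi1 a0 a1.
have K psi : Cc_infty psi -> (forall x, enorm (psi x) <= 1) -> pairing f a psi <= fine (frac_variation a f).
  move=> Cpsi psi1.
  have h : ((pairing f a psi)%:E <= frac_variation a f)%E.
    apply: ereal_sup_ubound; exists psi => //; split => //.
    (* A bound at every point is one almost everywhere, which controls the essential supremum. *)
    rewrite unlock; case: ifP => // _; apply/ess_supP; apply: aeW => x /=.
    by rewrite lee_fin ger0_norm ?enorm_ge0.
  have ffin : frac_variation a f \is a fin_num.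
    by rewrite fin_numElt fv andbT; apply: lt_le_trans h; exact: ltNyr.
  by rewrite -lee_fin (fineK ffin).
rewrite ler_norml K// andbT lerNl -mulN1r -(pairingZ mf fN _ a0 a1 Cphi).
by apply: K => [|x]; [exact: Cc_infty_scaler|rewrite scaleN1r enormN].
Qed.

End representation.

(** A sequence that tends to al is eventually above al0, and dropping finitely many terms does not
    affect the limit. *)
Lemma cvg_at_left_seq {R : realType} (F : R -> R) (al al0 l : R) : al0 < al ->
  (forall b : nat -> R, (forall k, al0 <= b k) -> (forall k, b k < al) -> b k @[k --> \oo] --> al ->
    F (b k) @[k --> \oo] --> l) -> F x @[x --> al^'-] --> l.
Proof.
move=> al0al h; apply/cvg_at_leftP => u [ual cu].
have [N _ HN] := cvgr_gt _ cu _ al0al.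
rewrite -(@cvg_shiftn N); apply: (h (fun k => u (k + N)%N)) => //.
  by move=> k; apply: ltW; apply: HN => /=; exact: leq_addl.
by rewrite (@cvg_shiftn N _ u).
Qed.

(** * Convergence of vector measures with asymptotically bounded masses *)

Section vcharge_convergence.
Context {R : realType} {n : nat}.
Local Notation Rn := 'rV[R]_n.
Implicit Types (phi psi : Rn -> Rn).
Variables (nuk : nat -> vcharge Rn R n) (nu : vcharge Rn R n) (bd : nat -> R).
Local Notation TV := tvmass.
Hypothesis cvg_smooth : forall phi, Cc_infty phi ->
  vcharge_integral (nuk k) phi @[k --> \oo] --> vcharge_integral nu phi.
Hypothesis TV_le : forall k, TV (nuk k) <= bd k.
Hypothesis cvg_bd : bd k @[k --> \oo] --> TV nu.

(** A fixed nearly optimal smooth field bounds the masses from below in the limit; [bd] bounds them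
    from above. *)
Lemma cvg_TV : TV (nuk k) @[k --> \oo] --> TV nu.
Proof.
apply/cvgrPdist_le => e e0.
have [phi [Cphi phi1 TVphi]] : exists phi, [/\ Cc_infty phi, forall x, enorm (phi x) <= 1 &
    TV nu - e / 2 <= vcharge_integral nu phi].
  apply: contrapT => /forallNP h; have e2 : 0 < e / 2 by rewrite divr_gt0.
  have : TV nu <= TV nu - e / 2.
    apply: TV_le_bound => phi Cphi phi1; rewrite leNgt; apply/negP => /ltW h1.
    exact: (h phi).
  by move=> h1; lra.
have e2 : 0 < e / 2 by rewrite divr_gt0.
have /cvgrPdist_lt/(_ _ e2) h1 := cvg_smooth Cphi.
have /cvgrPdist_lt/(_ _ e0) h2 := cvg_bd.
near=> k.
have k1 : `|vcharge_integral nu phi - vcharge_integral (nuk k) phi| < e / 2 by near: k.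
have k2 : `|TV nu - bd k| < e by near: k.
have k3 := TV_le k.
have k4 := normr_vcharge_integral_TV (nuk k) (Cc_infty_Cc Cphi) phi1.
rewrite mul1r in k4; have k5 := le_trans (ler_norm _) k4.
move: k1 k2; rewrite !ltr_norml => /andP[k1 k1'] /andP[k2 k2'].
move: k1 k1' k2 k2' k3 k5 TVphi.
move: (vcharge_integral nu phi) (vcharge_integral (nuk k) phi) (TV nu) (TV (nuk k)) (bd k) => u v x y z *.
by rewrite ler_norml; apply/andP; split; lra.
Unshelve. all: by end_near. Qed.

Lemma cvg_vcharge_Cc phi : Cc phi ->
  vcharge_integral (nuk k) phi @[k --> \oo] --> vcharge_integral nu phi.
Proof.
move=> Cphi; apply/cvgrPdist_le => e e0.
have TVal0 : 0 <= TV nu by exact: tvmass_ge0.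
(* The three errors are d TV(nu), d (TV(nu) + 1) for the eventual mass of [nuk k], and d for the
   smooth field; they add up to e. *)
pose d := e / (2 * TV nu + 2).
have K0 : 0 < 2 * TV nu + 2 by rewrite ltr_wpDl// mulr_ge0.
have d0 : 0 < d by exact: divr_gt0.
have [M _ HM] := Cc_bounded (Cc_enorm Cphi).
have phiM x : enorm (phi x) <= M by apply: le_trans (HM x); exact: ler_norm.
have [psi [Cpsi _ hpsi]] := Cc_infty_dense_rV Cphi d0 phiM.
have Cpsi' := Cc_infty_Cc Cpsi.
have CB := CcB Cphi Cpsi'.
have D c : `|vcharge_integral c phi - vcharge_integral c psi| <= d * TV c.
  rewrite -vcharge_integralB; [|exact: Cc_vbmeas|exact: Cc_vbmeas].
  exact: normr_vcharge_integral_TV.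
have /cvgrPdist_lt/(_ _ d0) h1 := cvg_smooth Cpsi.
have /cvgrPdist_lt/(_ _ ltr01) h2 := cvg_TV.
near=> k.
have k1 : `|vcharge_integral nu psi - vcharge_integral (nuk k) psi| < d by near: k.
have k2 : `|TV nu - TV (nuk k)| < 1 by near: k.
have k3 := D nu; have k4 := D (nuk k).
have k5 : d * TV (nuk k) <= d * (TV nu + 1).
  rewrite ler_pM2l//; move: k2; rewrite ltr_norml => /andP[+ _].
  by move: (TV nu) (TV (nuk k)) => x y ?; lra.
have k6 : d * (2 * TV nu + 2) = e by rewrite /d divfK// gt_eqF.
have k7 : d * TV nu + d * (TV nu + 1) + d = e.
  by rewrite -k6; move: (TV nu) => x; ring.
move: k1 k3 k4; rewrite ltr_norml !ler_norml => /andP[k1 k1'] /andP[k3 k3'] /andP[k4 k4'].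
move: k1 k1' k3 k3' k4 k4' k5 k7; clear.
move: (d * TV nu) (d * TV (nuk k)) (d * (TV nu + 1)) (vcharge_integral nu phi) (vcharge_integral nu psi)
  (vcharge_integral (nuk k) phi) (vcharge_integral (nuk k) psi) => *.
by apply/andP; split; lra.
Unshelve. all: by end_near. Qed.

(* An almost optimal [phi] for the total mass is almost optimal for the weight
   [h] as well, since the weights [h] and [1 - h] share its defect. *)
Lemma liminf_integral_TV (h : Rn -> R) (e : R) : continuous h -> (forall x, 0 <= h x <= 1) -> 0 < e ->
  \forall k \near \oo, \int[tvm nu]_x h x - e <= \int[tvm (nuk k)]_x h x.
Proof.
move=> ch h01 e0; have e2 : 0 < e / 2 by rewrite divr_gt0.
have [phi [Cphi phi1 TVphi]] := TV_le_vcharge_integral nu e2.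
have bh : bmeas h.
  split; first exact: measurable_continuous_rV.
  by exists 1 => x; have /andP[h0 h1] := h01 x; rewrite ger0_norm.
have CM (g : Rn -> R) : continuous g -> Cc (fun x => g x *: phi x).
  have [cphi /compactly_supportedP[s phis]] := Cphi; move=> cg; split.
    apply: (@cont_rV R) => j; under eq_fun do rewrite mxE.
    by apply: contM => //; exact: cont_coord.
  by apply/compactly_supportedP; exists s => x xs; rewrite phis// scaler0.
have c1h : continuous (fun x => 1 - h x) by apply: contB => //; exact: cont_cst.
have le_h c (g : Rn -> R) : continuous g -> bmeas g -> (forall x, 0 <= g x) ->
    vcharge_integral c (fun x => g x *: phi x) <= \int[tvm c]_x g x.
  move=> cg bg g0; apply: le_trans (vcharge_integral_le_TV _ (CM _ cg)) _.
  apply: bmeas_le => //; first exact: Cc_bmeas (Cc_enorm (CM _ cg)).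
  by move=> x; rewrite enormZ ger0_norm// ler_piMr.
have b1h : bmeas (fun x => 1 - h x) by apply: bmeasB => //; exact: bmeas_cst.
have E1 : vcharge_integral nu phi = vcharge_integral nu (fun x => h x *: phi x) +
    vcharge_integral nu (fun x => (1 - h x) *: phi x).
  rewrite -vcharge_integralD; [|exact: Cc_vbmeas (CM _ ch)|exact: Cc_vbmeas (CM _ c1h)].
  by congr vcharge_integral; apply/funext => x; rewrite -scalerDl addrC subrK scale1r.
have h2 : vcharge_integral nu (fun x => (1 - h x) *: phi x) <= TV nu - \int[tvm nu]_x h x.
  apply: le_trans (le_h nu _ c1h b1h _) _.
    by move=> x; have /andP[_ ?] := h01 x; rewrite subr_ge0.
  rewrite (_ : \int[tvm nu]_x (1 - h x) = \int[tvm nu]_x (1 + -1 * h x)); last first.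
    by apply: eq_Rintegral => x _; rewrite mulN1r.
  rewrite bmeas_intD ?bmeas_intZ//; [|exact: bmeas_cst|exact: bmeasZ].
  by rewrite Rintegral_cst// mul1r mulN1r.
have /cvgrPdist_lt/(_ _ e2) h3 := cvg_vcharge_Cc (CM _ ch).
near=> k.
have k1 : `|vcharge_integral nu (fun x => h x *: phi x) -
    vcharge_integral (nuk k) (fun x => h x *: phi x)| < e / 2 by near: k.
have k2 : vcharge_integral (nuk k) (fun x => h x *: phi x) <= \int[tvm (nuk k)]_x h x.
  by apply: le_h => // x; have /andP[] := h01 x.
move: k1; rewrite ltr_norml => /andP[k1 k1'].
move: TVphi h2 k1 k1' k2; rewrite E1 -/(TV nu); clear.
move: (vcharge_integral nu (fun x => h x *: phi x)) (vcharge_integral nu (fun x => (1 - h x) *: phi x))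
  (vcharge_integral (nuk k) (fun x => h x *: phi x)) (\int[tvm nu]_x h x) (\int[tvm (nuk k)]_x h x) (TV nu) => *.
lra.
Unshelve. all: by end_near. Qed.

(** The lower bound for 1 - h, together with the convergence of the total masses, is the upper bound
    for h. *)
Lemma cvg_integral_TV01 (h : Rn -> R) : continuous h -> (forall x, 0 <= h x <= 1) ->
  \int[tvm (nuk k)]_x h x @[k --> \oo] --> \int[tvm nu]_x h x.
Proof.
move=> ch h01; apply/cvgrPdist_le => e e0; have e2 : 0 < e / 2 by rewrite divr_gt0.
have bh : bmeas h.
  split; first exact: measurable_continuous_rV.
  by exists 1 => x; have /andP[h0 h1] := h01 x; rewrite ger0_norm.
have E c : \int[tvm c]_x (1 - h x) = TV c - \int[tvm c]_x h x.
  rewrite (_ : \int[tvm c]_x (1 - h x) = \int[tvm c]_x (1 + -1 * h x)); last first.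
    by apply: eq_Rintegral => x _; rewrite mulN1r.
  rewrite bmeas_intD ?bmeas_intZ//; [|exact: bmeas_cst|exact: bmeasZ].
  by rewrite Rintegral_cst// mul1r mulN1r.
have h1 := liminf_integral_TV ch h01 e2.
have h2 : \forall k \near \oo, \int[tvm nu]_x (1 - h x) - e / 2 <= \int[tvm (nuk k)]_x (1 - h x).
  apply: liminf_integral_TV => //; first by apply: contB => //; exact: cont_cst.
  by move=> x; have /andP[? ?] := h01 x; rewrite subr_ge0 gerBl; apply/andP.
have /cvgrPdist_lt/(_ _ e2) h3 := cvg_TV.
near=> k.
have k1 : \int[tvm nu]_x h x - e / 2 <= \int[tvm (nuk k)]_x h x by near: k.
have k2 : \int[tvm nu]_x (1 - h x) - e / 2 <= \int[tvm (nuk k)]_x (1 - h x) by near: k.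
have k3 : `|TV nu - TV (nuk k)| < e / 2 by near: k.
rewrite !E in k2; move: k3; rewrite ltr_norml => /andP[k3 k3'].
move: k1 k2 k3 k3'; clear.
move: (\int[tvm nu]_x h x) (\int[tvm (nuk k)]_x h x) (TV nu) (TV (nuk k)) => *.
by rewrite ler_norml; apply/andP; split; lra.
Unshelve. all: by end_near. Qed.

(** An affine change brings g into [0, 1]. The new function is 1/2 off the support of g, hence the
    previous lemmas deal with continuous weights on the whole space. *)
Lemma cvg_integral_TV (g : Rn -> R) : Cc g ->
  \int[tvm (nuk k)]_x g x @[k --> \oo] --> \int[tvm nu]_x g x.
Proof.
move=> Cg; have [M M0 gM] := Cc_bounded Cg.
pose c := M + 1; have c0 : 0 < c by rewrite ltr_wpDl.
pose h x := (2 * c)^-1 * (g x + c).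
have ch : continuous h.
  by apply: contM; [exact: cont_cst|apply: contD; [exact: Cg.1|exact: cont_cst]].
have c2 : 0 < 2 * c by rewrite mulr_gt0.
have h01 x : 0 <= h x <= 1.
  have := gM x; rewrite ler_norml => /andP[g1 g2]; have cE : c = M + 1 by [].
  rewrite /h mulr_ge0 ?invr_ge0 ?(ltW c2)//=; last by rewrite cE; lra.
  by rewrite ler_pdivrMl// mulr1 cE; lra.
have bh : bmeas h.
  split; first exact: measurable_continuous_rV.
  by exists 1 => x; have /andP[h0 h1] := h01 x; rewrite ger0_norm.
have E a : \int[tvm a]_x g x = 2 * c * \int[tvm a]_x h x - c * TV a.
  rewrite -bmeas_intZ// -(Rintegral_cst (tvm a) measurableT) -mulN1r -bmeas_intZ; last exact: bmeas_cst.
  rewrite -bmeas_intD; [|exact: bmeasZ|by apply: bmeasZ; exact: bmeas_cst].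
  by apply: eq_Rintegral => x _; rewrite /h mulVKf ?gt_eqF// mulN1r addrK.
under eq_fun do rewrite E; rewrite E.
apply: cvgB; (apply: cvgM; first exact: cvg_cst); first exact: cvg_integral_TV01.
exact: cvg_TV.
Qed.

End vcharge_convergence.

Lemma cvg_congr {R : realType} (u v : nat -> R) (x y : R) :
  (forall k, u k = v k) -> x = y -> v k @[k --> \oo] --> y -> u k @[k --> \oo] --> x.
Proof. by move=> uv ->; rewrite (_ : u = v)//; apply/funext. Qed.

Lemma cvge_congr {R : realType} (F : set_system R) {FF : Filter F} (u : R -> \bar R) (v : R -> R) x (y : R) :
  (forall k, u k = (v k)%:E) -> x = y%:E -> v k @[k --> F] --> y -> u k @[k --> F] --> x.
Proof.
move=> uv -> vy; rewrite (_ : u = EFin \o v); last exact/funext.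
by apply/fine_cvgP; split; first exact: nearW.
Qed.

(** * The limit as the order increases to alpha *)

Section left_limit.
Context {R : realType} {n : nat}.
Local Notation Rn := 'rV[R]_n.
Local Notation leb := (@lebesgue_rV R n).
Variables (f : Rn -> R) (N al : R).
Hypotheses (mf : measurable_fun setT f) (fN : (\int[leb]_x `|f x|%:E <= N%:E)%E).
Hypotheses (al0 : 0 < al) (al1 : al < 1) (fvar : (frac_variation al f < +oo)%E).
Implicit Types (phi psi : Rn -> Rn).

Local Notation nu b := (frac_grad b f).
Local Notation TV b := (tvmass (frac_grad b f)).

Let rep_al : represents_frac_grad al f (nu al).
Proof.
have [m bnd] := frac_variation_bound mf fN fvar.
by apply: frac_gradP; apply: (frac_grad_exists mf fN al0 al1 (m := m)) => phi Cphi phi1; exact: bnd.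
Qed.

(** The error constant of [fpair_interpolation] with M = 1, the sup bound of admissible fields. In
    [bound] the error vanishes at b = al and the two factors [Ka] cancel, which leaves the mass at
    al. *)
Let err := cheat (n := n) * 1 * cfdiv al * N.
Let bound b := Ka (n := n) b * (TV al / Ka (n := n) al + err * (1 + 2 / b) * (al - b)).

(** Every translate of phi is admissible at order al, so the interpolation applies with m equal to
    the mass at al divided by [Ka al]. *)
Let pairing_bound b : 0 < b -> b < al -> forall phi, Cc_infty phi ->
  (forall x, enorm (phi x) <= 1) -> `|pairing f b phi| <= bound b.
Proof.
move=> b0 bal phi Cphi phi1; have b1 := lt_trans bal al1.
have [L L0 bl] := Cc_infty_bndlip Cphi phi1.
have Kal := Ka_gt0 (n := n) al0 al1; have Kb := Ka_gt0 (n := n) b0 b1.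
rewrite (pairingE mf fN b0 b1 L0 bl) normrM (gtr0_norm Kb) ler_pM2l//.
apply: (fpair_interpolation mf fN al0 al1 L0 bl b0 bal).
  by rewrite divr_ge0 ?(ltW Kal)// tvmass_ge0.
move=> z; have Cz := Cc_infty_shift z Cphi.
have := pairing_le_TV rep_al Cz (fun x => phi1 (x + z)).
rewrite (pairingE mf fN al0 al1 L0 (bndlip_shift z bl)) normrM (gtr0_norm Kal).
by rewrite ler_pdivlMr// (mulrC _ (Ka _)).
Qed.

Let rep b : 0 < b -> b < al -> represents_frac_grad b f (nu b).
Proof.
move=> b0 bal; apply: frac_gradP.
exact: (frac_grad_exists mf fN b0 (lt_trans bal al1) (pairing_bound b0 bal)).
Qed.

Let TV_le b : 0 < b -> b < al -> TV b <= bound b.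
Proof.
move=> b0 bal; exact: (TV_frac_grad_le mf fN b0 (lt_trans bal al1) (pairing_bound b0 bal)).
Qed.

Section sequence.
Variable b : nat -> R.
Hypotheses (b_ge : forall k, al / 2 <= b k) (b_lt : forall k, b k < al) (cb : b k @[k --> \oo] --> al).

Let al2 : 0 < al / 2. Proof. exact: divr_gt0. Qed.
Let b0 k : 0 < b k. Proof. exact: lt_le_trans (b_ge k). Qed.

Lemma cvg_vcharge_Cc_infty phi : Cc_infty phi ->
  vcharge_integral (nu (b k)) phi @[k --> \oo] --> vcharge_integral (nu al) phi.
Proof.
move=> Cphi.
have E a : represents_frac_grad a f (nu a) -> vcharge_integral (nu a) phi = - pairing f a phi.
  by move=> r; rewrite /pairing r// opprK.
apply: (cvg_congr (fun k => E _ (rep (b0 k) (b_lt k))) (E al rep_al)).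
apply: cvgN; apply: (cvg_pairing al2 al1 _ cb mf fN) => // k.
by rewrite b_ge/= ltW.
Qed.

Lemma cvg_bound : bound (b k) @[k --> \oo] --> TV al.
Proof.
have Kal := Ka_gt0 (n := n) al0 al1.
have -> : TV al = Ka (n := n) al * (TV al / Ka (n := n) al + err * (1 + 2 / al) * (al - al)).
  by rewrite subrr mulr0 addr0 mulrC divfK// gt_eqF.
have cK : Ka (n := n) (b k) @[k --> \oo] --> Ka (n := n) al.
  by apply: (cvg_Ka al2 al1 _ cb) => k; rewrite b_ge/= ltW.
apply: cvgM => //; apply: cvgD; first exact: cvg_cst.
apply: cvgM; last by apply: cvgB => //; exact: cvg_cst.
apply: cvgM; first exact: cvg_cst.
apply: cvgD; first exact: cvg_cst.
by apply: cvgM; [exact: cvg_cst|apply: cvgV => //; rewrite gt_eqF].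
Qed.

Lemma cvg_TV_seq : TV (b k) @[k --> \oo] --> TV al.
Proof. exact: (cvg_TV cvg_vcharge_Cc_infty (fun k => TV_le (b0 k) (b_lt k)) cvg_bound). Qed.

Lemma cvg_vcharge_Cc_seq phi : Cc phi ->
  vcharge_integral (nu (b k)) phi @[k --> \oo] --> vcharge_integral (nu al) phi.
Proof. exact: (cvg_vcharge_Cc cvg_vcharge_Cc_infty (fun k => TV_le (b0 k) (b_lt k)) cvg_bound). Qed.

Lemma cvg_integral_TV_seq (g : Rn -> R) : Cc g ->
  \int[tvm (nu (b k))]_x g x @[k --> \oo] --> \int[tvm (nu al)]_x g x.
Proof. exact: (cvg_integral_TV cvg_vcharge_Cc_infty (fun k => TV_le (b0 k) (b_lt k)) cvg_bound). Qed.

End sequence.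
End left_limit.

Theorem theorem5p4 (R : realType) (n : nat) (n_ge1 : (1 <= n)%N) (alpha : R)
    (alpha_gt0 : 0 < alpha) (alpha_lt1 : alpha < 1)
    (f : 'rV[R]_n -> R) (fBV : BV alpha f) :
  [/\ vweak_star_cvg alpha^'- (fun beta => frac_grad beta f)
        (frac_grad alpha f),
      weak_star_cvg alpha^'-
        (fun beta => vtotal_variation (frac_grad beta f))
        (vtotal_variation (frac_grad alpha f)) &
      vtotal_variation (frac_grad beta f) setT @[beta --> alpha^'-] -->
        vtotal_variation (frac_grad alpha f) setT].
Proof.
have [iF fvar] := fBV.
have mf : measurable_fun setT f by apply/measurable_EFinP; have /integrableP[] := iF.
have [N fN] : exists N : R, (\int[@lebesgue_rV R n]_x `|f x|%:E <= N%:E)%E.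
  have /integrableP[_ foo] := iF.
  exists (fine (\int[@lebesgue_rV R n]_x `|f x|%:E)); rewrite fineK// ge0_fin_numE//.
  by apply: integral_ge0 => x _; rewrite lee_fin.
have al2 : alpha / 2 < alpha by rewrite ltr_pdivrMr// ltr_pMr// ltr1n.
split.
- move=> phi Cphi; apply: (cvg_at_left_seq al2) => b b1 b2 cb.
  exact: (cvg_vcharge_Cc_seq mf fN alpha_gt0 alpha_lt1 fvar b1 b2 cb Cphi).
- move=> psi Cpsi; apply: (cvg_at_left_seq al2) => b b1 b2 cb.
  exact: (cvg_integral_TV_seq mf fN alpha_gt0 alpha_lt1 fvar b1 b2 cb Cpsi).
(* [frac_grad] is a finite vector measure for every b, by its default value if there is no
   representing measure, so the extended-real limit reduces to a real one. *)
have TVf b : vtotal_variation (frac_grad b f) setT = (tvmass (frac_grad b f))%:E.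
  by rewrite fineK//; exact: TV_fin.
apply: (cvge_congr TVf (TVf alpha)); apply: (cvg_at_left_seq al2) => b b1 b2 cb.
exact: (cvg_TV_seq mf fN alpha_gt0 alpha_lt1 fvar b1 b2 cb).
Qed.
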